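(* The assignment $\mathcal T\mapsto(\mathcal T,\ p_{\mathcal T}:T(\mathcal T)\to B(\mathcal L),\ i)$, sending each opfibrational layered theory $\mathcal T=(\mathcal L,E^0,E^1)$ to its syntactic opfibrational model, extends to a functor $\mathsf{OpFTh}\to\mathsf{OpFThMod}$ from the category of opfibrational layered theories to the category of models of opfibrational theories. Moreover, this functor is left adjoint to the forgetful functor $\mathsf{OpFThMod}\to\mathsf{OpFTh}$, $(\mathcal T,p,i)\mapsto\mathcal T$.
   Context: Composition is written diagrammatically: $f;g$ is first $f$, then $g$. $C^*$ is the set of finite words on $C$, $\varepsilon$ the empty word; $\mathcal Y_x$ is the fibre of a functor $p:\mathcal Y\to\mathcal X$ over $x$ (morphisms above $\mathrm{id}_x$). **Signatures.** A monoidal signature is $(C,\Sigma)$ with $C$ a set and $\Sigma:C^*\times C^*\to\mathsf{Set}$; a morphism $(C,\Sigma)\to(D,\Gamma)$ is a function $f:C\to D$ with functions $f_{a,b}:\Sigma(a,b)\to\Gamma(f^*a,f^*b)$. A layered signature $\mathcal L=(\Omega,\mathcal F,\{\mathcal M_\omega\}_{\omega\in\Omega})$ is a set $\Omega$ (layers), a function $\mathcal F:\Omega\times\Omega\to\mathsf{Set}$, and monoidal signatures $\mathcal M_\omega=(C_\omega,\Sigma_\omega)$. A morphism $F:(\Omega,\mathcal F,\mathcal M_\omega)\to(\Psi,\mathcal G,\mathcal M_\psi)$ is a function $F:\Omega\to\Psi$, functions $F_{\omega,\tau}:\mathcal F(\omega,\tau)\to\mathcal G(F\omega,F\tau)$,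 and morphisms of monoidal signatures $F^\omega:\mathcal M_\omega\to\mathcal M_{F\omega}$. **Types.** Internal types $A:\omega$ are generated by: $\varepsilon:\omega$; $a:\omega$ for $a\in C_\omega$; $f(A):\tau$ for $A:\omega$, $f\in\mathcal F(\omega,\tau)$; $AB:\omega$ for $A,B:\omega$ (a monoid in each layer with unit $\varepsilon:\omega$). Types are the free closure of internal types and $\varepsilon:\varepsilon$ under lists $T,S$ (a monoid with unit $\varepsilon:\varepsilon$). A set of 0-equations $E^0$ is a set of pairs of internal types in the same layer; it generates a type congruence (closed under $f(-)$, $AB$ and $T,S$). **Opfibrational terms**, with sorts $(T\mid S)$, $T,S$ types: - basic: $\mathrm{id}_{\varepsilon:\omega}:(\varepsilon:\omega\mid\varepsilon:\omega)$; $\mathrm{id}_{A}:(A:\omega\mid A:\omega)$ for $A\neq\varepsilon$; $\sigma:(a:\omega\mid b:\omega)$ for $\sigma\in\Sigma_\omega(a,b)$; $f[x]:(f(A):\tau\mid f(B):\tau)$ for an internal term $x:(A:\omega\mid B:\omega)$ and $f\in\mathcal F(\omega,\tau)$; $x\otimes_\omega y:(AC:\omega\mid BD:\omega)$ for internal $x:(A:\omega\mid B:\omega)$, $y:(C:\omega\mid D:\omega)$; $x;y:(T\mid U)$ for $x:(T\mid S)$, $y:(S\mid U)$; $\mathrm{id}_\varepsilon:(\varepsilon:\varepsilon\mid\varepsilon:\varepsilon)$; $x\otimes y:(T,U\mid S,W)$ for $x:(T\mid S)$, $y:(U\mid W)$. Internal terms are those generated by $\mathrm{id}_{\varepsilon:\omega}$,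 $\mathrm{id}_A$, $\sigma$, $f[-]$, $\otimes_\omega$ and composition of internal terms; - symmetry: $s_{A,B}:(A:\omega,B:\tau\mid B:\tau,A:\omega)$; - $\nabla_{f,A}:(A:\omega\mid f(A):\tau)$ for $f\in\mathcal F(\omega,\tau)$; $m_{A,B}:(A:\omega,B:\omega\mid AB:\omega)$; $u_\omega:(\varepsilon:\varepsilon\mid\varepsilon:\omega)$; $d_A:(A:\omega\mid A:\omega,A:\omega)$; $e_A:(A:\omega\mid\varepsilon:\varepsilon)$. Two terms are parallel if their sorts agree up to the type congruence. An *opfibrational layered theory* is $\mathcal T=(\mathcal L,E^0,E^1)$ with $E^1$ a set of pairs of parallel terms (there are no generating 2-cells). A morphism in $\mathsf{OpFTh}$ is a morphism of layered signatures whose evident recursive extensions to types and terms map $E^0$ and $E^1$ into the corresponding sets of equations of the codomain. **Structural equations.** $S^0$: $(AB)C=A(BC)$, $\varepsilon A=A=A\varepsilon$, $f(AB)=f(A)f(B)$, $f(\varepsilon)=\varepsilon$. $S^1_{\mathsf{opf}}$: (a) the strict monoidal category equations for $;$, $\otimes$, identity terms, $\mathrm{id}_\varepsilon$ (associativity, unitality, interchange); (b) associativity, unitality with unit $\mathrm{id}_{\varepsilon:\omega}$, and interchange for $\otimes_\omega$ and $;$ on internal terms; $\mathrm{id}_{AB}=\mathrm{id}_A\otimes_\omega\mathrm{id}_B$; (c) $f[\mathrm{id}_A]=\mathrm{id}_{f(A)}$, $f[x;y]=f[x];f[y]$, $f[x\otimes_\omega y]=f[x]\otimes_\tau f[y]$,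 $f[\mathrm{id}_{\varepsilon:\omega}]=\mathrm{id}_{\varepsilon:\tau}$; (d) the $s_{A,B}$ (extended recursively to lists of types) form a symmetry: involutive and natural with respect to all terms; (e) each $(d_A,e_A)$ is a comonoid (coassociative, counital), and, extended to lists by $d_{T,S}=(d_T\otimes d_S);(\mathrm{id}\otimes s_{T,S}\otimes\mathrm{id})$, $e_{T,S}=e_T\otimes e_S$, $d_{\varepsilon}=e_\varepsilon=\mathrm{id}_\varepsilon$, one has $x;d_S=d_T;(x\otimes x)$, $x;e_S=e_T$ for all terms $x:(T\mid S)$; (f) $(m_{A,B}\otimes\mathrm{id}_C);m_{AB,C}=(\mathrm{id}_A\otimes m_{B,C});m_{A,BC}$, $(u_\omega\otimes\mathrm{id}_A);m_{\varepsilon,A}=\mathrm{id}_A=(\mathrm{id}_A\otimes u_\omega);m_{A,\varepsilon}$, and $(x\otimes y);m_{B,D}=m_{A,C};(x\otimes_\omega y)$ for internal $x:(A:\omega\mid B:\omega)$, $y:(C:\omega\mid D:\omega)$; (g) $x;\nabla_{f,B}=\nabla_{f,A};f[x]$ for internal $x:(A:\omega\mid B:\omega)$, $m_{A,B};\nabla_{f,AB}=(\nabla_{f,A}\otimes\nabla_{f,B});m_{f(A),f(B)}$, $u_\omega;\nabla_{f,\varepsilon}=u_\tau$. **Indexed monoids.** A symmetric monoidal category $(\mathcal C,\otimes,I)$ with symmetry $\sigma$ has *uniform comonoids* if each object $x$ has a comonoid $(d_x,e_x)$, natural in $x$, with $d_I,e_I$ the canonical isomorphisms and $(d_x\otimes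 d_y);(\mathrm{id}\otimes\sigma_{xy}\otimes\mathrm{id})=d_{x\otimes y}$ (equivalently, it is cartesian monoidal). *Consistent monoids* are a choice of monoid $(m_x:x\otimes x\to x,\ u_x:I\to x)$ for each object with $m_I,u_I$ canonical, $u$ natural ($u_x;f=u_y$ for $f:x\to y$), and $(\mathrm{id}\otimes\sigma_{yx}\otimes\mathrm{id});(m_x\otimes m_y)=m_{x\otimes y}$ (structural isomorphisms left implicit). *Indexed monoids* are consistent monoids in a symmetric monoidal category with uniform comonoids. $\mathsf{IMon}$: categories with indexed monoids, and strong monoidal functors $(F,\mu)$ with $\mu_{xx};F(m_x)=m_{Fx}$. For a small category $\mathcal X$, $\mathcal F_{\mathsf{im}}(\mathcal X)$ is the free category with indexed monoids: the strict symmetric monoidal category with objects $\mathrm{Ob}(\mathcal X)^*$ and morphisms generated by the morphisms $f:a\to b$ of $\mathcal X$ (on one-letter words), symmetries, $d_a:a\to aa$, $e_a:a\to\varepsilon$, $m_a:aa\to a$, $u_a:\varepsilon\to a$, modulo: symmetric strict monoidal axioms; comonoid axioms and naturality of $d,e$ (extended to words as in (e)) for all morphisms; monoid axioms; $m_a;f=(f\otimes f);m_b$ and $u_a;f=u_b$ for $f\in\mathcal X(a,b)$; and the identities and composites of $\mathcal X$. **Im-opfibrations.** A split opfibration $p:\mathcal Y\to\mathcal X$ is a *split im-opfibration* if $\mathcal X$ has indexed monoids, $\mathcal Y$ is cartesian monoidal with chosen products, $p$ strictly preserves and reflects the chosen cartesian products (reflection: $p(a)=1$ iff $a=1$, and every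 $H$ with $p(H)=f\times g$ is of the form $F\times G$ with $p(F)=f$, $p(G)=g$), and the product of opcartesian maps is opcartesian. A morphism of split im-opfibrations $(P,Q):p\to q$ is a commutative square of functors ($P$ between total categories, $Q$ between bases) with $P$ preserving opcartesian maps and chosen liftings, $Q$ a morphism of $\mathsf{IMon}$, and both $P,Q$ strict monoidal ($P$ for the cartesian structures). For an object $x$ of the base, the *fibrewise monoidal structure* $(\otimes_x,I_x)$ on $\mathcal Y_x$ is: $a\otimes_x b$ is the codomain of the chosen opcartesian lifting of $m_x$ at $a\times b$ (with the action on morphisms of $\mathcal Y_x$ induced by the universal property), $I_x$ the codomain of the chosen lifting of $u_x$ at the terminal object $1$. **Models.** An opfibrational model of $\mathcal L$ is a split im-opfibration $p:\mathcal Y\to\mathcal F_{\mathsf{im}}(\mathcal X)$ ($\mathcal X$ a small category) with functions $i:\Omega\to\mathrm{Ob}(\mathcal X)$, $i_{\omega,\tau}:\mathcal F(\omega,\tau)\to\mathcal X(i\omega,i\tau)$, $i^\omega:C_\omega\to\mathrm{Ob}(\mathcal Y_{i\omega})$, $i^\omega_{a,b}:\Sigma_\omega(a,b)\to\mathcal Y_{i\omega}((i^\omega)^*a,(i^\omega)^*b)$, where $(i^\omega)^*$ extends $i^\omega$ to words using $\otimes_{i\omega}$. It induces an interpretation of types: $(\varepsilon:\varepsilon)\mapsto1$, $(\varepsilon:\omega)\mapsto I_{i\omega}$, $(a:\omega)\mapsto i^\omega(a)$, $f(A)\mapsto i_{\omega,\tau}(f)^*(i(A))$ ($(-)^*$ being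 reindexing), $AB\mapsto i(A)\otimes_{i\omega}i(B)$, $(T,S)\mapsto i(T)\times i(S)$; and of terms: identities to identities, $\sigma\mapsto i^\omega_{a,b}(\sigma)$, $f[x]\mapsto i_{\omega,\tau}(f)^*(i(x))$, $x\otimes_\omega y\mapsto i(x)\otimes_{i\omega}i(y)$, $\nabla_{f,A}\mapsto$ the chosen opcartesian lifting of $i_{\omega,\tau}(f)$ at $i(A)$, $m_{A,B}\mapsto$ the chosen lifting of $m_{i\omega}$ at $i(A)\times i(B)$, $u_\omega\mapsto$ the chosen lifting of $u_{i\omega}$ at $1$, $d_A,e_A,s_{A,B}\mapsto$ diagonal, map to the terminal object, and symmetry of $\mathcal Y$, $x;y\mapsto i(x);i(y)$, $x\otimes y\mapsto i(x)\times i(y)$. A *model of a theory* $\mathcal T=(\mathcal L,E^0,E^1)$ is an opfibrational model of $\mathcal L$ in which both sides of each equation in $E^0$ and $E^1$ have equal interpretation. $\mathsf{OpFThMod}$: objects are $(\mathcal T,p,i)$ with $\mathcal T$ an opfibrational theory and $(p,i)$ a model of it; a morphism $(F,P,Q):(\mathcal T,p,i)\to(\mathcal K,q,j)$ is a morphism of theories $F:\mathcal T\to\mathcal K$ and a morphism of split im-opfibrations $(P,Q):p\to q$ with $Q(i\omega)=j(F\omega)$, $Q(i_{\omega,\tau}(f))=j_{F\omega,F\tau}(F_{\omega,\tau}f)$, $P(i^\omega(a))=j^{F\omega}(F^\omega a)$, $P(i^\omega_{a,b}(\sigma))=j^{F\omega}(F^\omega_{a,b}\sigma)$ (with the evident indices).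 **Syntactic model.** $T(\mathcal T)$ has as objects types modulo the type congruence generated by $E^0\cup S^0$, and as morphisms terms modulo the congruence (closed under the basic term-forming rules) generated by $E^1\cup S^1_{\mathsf{opf}}$, sorts being read up to the type congruence. $B(\mathcal L)$ is the free category with indexed monoids generated by $(\Omega,\mathcal F)$, i.e. $\mathcal F_{\mathsf{im}}$ of the free category on the graph with vertices $\Omega$ and edges $\mathcal F(\omega,\tau)$. The functor $p_{\mathcal T}:T(\mathcal T)\to B(\mathcal L)$ sends $A:\omega$ to $\omega$, lists to words, internal terms $(A:\omega\mid B:\omega)$ to $\mathrm{id}_\omega$, $\nabla_{f,A}$ to $f$, $m_{A,B},u_\omega,d_A,e_A$ to $m_\omega,u_\omega,d_\omega,e_\omega$, $s_{A,B}$ to the symmetry, and preserves composition and $\otimes$. It is a split im-opfibration, whose chosen liftings are the terms without non-trivial internal structure (e.g. $\nabla_{f,A}$ for $f$ at $A$, $m_{A,B}$ for $m_\omega$). The interpretation functions are $i(\omega)=\omega$, $i_{\omega,\tau}(f)=f$, $i^\omega(a)=(a:\omega)$, $i^\omega_{a,b}(\sigma)=\sigma$.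
   Formalization: Restricted to theories whose E^1-equations respect the projection to B(L) and whose chosen liftings are opcartesian (otherwise p_T is ill-defined or not an opfibration); models are required to have strictly associative products, with chosen liftings closed under products. *)

(* Defs.v *)
From Stdlib Require Import List ClassicalEpsilon FunctionalExtensionality
  PropExtensionality ProofIrrelevance.
Import ListNotations.
Set Implicit Arguments.

(** Composition is diagrammatic throughout: [cmp f g] is first [f], then [g]. *)
Record category := Category {
  Obj : Type;
  Hom : Obj -> Obj -> Type;
  idc : forall x, Hom x x;
  cmp : forall x y z, Hom x y -> Hom y z -> Hom x z;
  cmp_idl : forall x y (f : Hom x y), cmp (idc x) f = f;
  cmp_idr : forall x y (f : Hom x y), cmp f (idc y) = f;
  cmp_assoc : forall x y z w (f : Hom x y) (g : Hom y z) (h : Hom z w),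
    cmp (cmp f g) h = cmp f (cmp g h) }.
Arguments idc {_} x.
Arguments cmp {_ x y z} f g.

Record functor (C D : category) := Functor {
  F_ob :> Obj C -> Obj D;
  F_hom : forall x y, Hom C x y -> Hom D (F_ob x) (F_ob y);
  F_id : forall x, F_hom x x (idc x) = idc (F_ob x);
  F_cmp : forall x y z (f : Hom C x y) (g : Hom C y z),
    F_hom x z (cmp f g) = cmp (F_hom x y f) (F_hom y z g) }.
Arguments F_hom {C D} _ {x y} _.

Definition left_adjoint (C D : category) (G : functor C D) (U : functor D C) : Prop :=
  exists (phi : forall c d, Hom D (G c) d -> Hom C c (U d))
         (psi : forall c d, Hom C c (U d) -> Hom D (G c) d),
    (forall c d (g : Hom D (G c) d), psi c d (phi c d g) = g) /\
    (forall c d (f : Hom C c (U d)), phi c d (psi c d f) = f) /\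
    (forall c c' d (h : Hom C c' c) (g : Hom D (G c) d),
       phi c' d (cmp (F_hom G h) g) = cmp h (phi c d g)) /\
    (forall c d d' (g : Hom D (G c) d) (k : Hom D d d'),
       phi c d' (cmp g k) = cmp (phi c d g) (F_hom U k)).

Definition full_sub (C : category) (P : Obj C -> Prop) : category :=
  @Category {x : Obj C | P x}
    (fun x y => Hom C (proj1_sig x) (proj1_sig y))
    (fun x => idc (proj1_sig x))
    (fun x y z f g => cmp f g)
    (fun x y f => cmp_idl C _ _ f)
    (fun x y f => cmp_idr C _ _ f)
    (fun x y z w f g h => cmp_assoc C _ _ _ _ f g h).

(** Restriction of [U : D -> C] to the full subcategories cut out by [P] on [C]
    and by its inverse image on [D]. *)
Definition full_sub_functor (C D : category) (U : functor D C) (P : Obj C -> Prop) :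
  functor (full_sub D (fun d => P (U d))) (full_sub C P) :=
  @Functor (full_sub D (fun d => P (U d))) (full_sub C P)
    (fun d => exist P (U (proj1_sig d)) (proj2_sig d))
    (fun x y f => F_hom U f)
    (fun x => F_id U (proj1_sig x))
    (fun x y z f g => F_cmp U _ _ _ f g).

(** Equivalence classes; only used with equivalence relations. *)
Definition quot (A : Type) (R : A -> A -> Prop) : Type :=
  {P : A -> Prop | exists a, P = R a}.
Definition cls (A : Type) (R : A -> A -> Prop) (a : A) : quot R :=
  exist _ (R a) (ex_intro _ a eq_refl).
Definition rep (A : Type) (R : A -> A -> Prop) (q : quot R) : A :=
  proj1_sig (constructive_indefinite_description _ (proj2_sig q)).

(** Some element satisfying [P]; [d] only witnesses that [A] is inhabited. *)
Definition the (A : Type) (d : A) (P : A -> Prop) : A := epsilon (inhabits d) P.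

(** The small categories below are strict monoidal, fibred, quotients, etc., so
    most axioms equate arrows whose end points agree only propositionally.  They
    are therefore presented with one type of arrows.  [comp f g] is a total
    function, but all axioms constrain it only when [tgt f = src g]. *)
Record cat := Cat {
  ob : Type;
  ar : Type;
  src : ar -> ob;
  tgt : ar -> ob;
  idn : ob -> ar;
  comp : ar -> ar -> ar }.
Arguments src {_} _.
Arguments tgt {_} _.
Arguments idn {_} _.
Arguments comp {_} _ _.
Notation "f ;; g" := (comp f g) (at level 51, left associativity).

Record is_cat (C : cat) : Prop := {
  cat_src_id : forall x : ob C, src (idn x) = x;
  cat_tgt_id : forall x : ob C, tgt (idn x) = x;
  cat_src_comp : forall f g : ar C, tgt f = src g -> src (f ;; g) = src f;
  cat_tgt_comp : forall f g : ar C, tgt f = src g -> tgt (f ;; g) = tgt g;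
  cat_idl : forall f : ar C, idn (src f) ;; f = f;
  cat_idr : forall f : ar C, f ;; idn (tgt f) = f;
  cat_assoc : forall f g h : ar C, tgt f = src g -> tgt g = src h ->
    (f ;; g) ;; h = f ;; (g ;; h) }.

Record sfun (C D : cat) := SFun {
  s_ob : ob C -> ob D;
  s_ar : ar C -> ar D }.
Arguments s_ob {C D} _ _.
Arguments s_ar {C D} _ _.

Record is_functor (C D : cat) (F : sfun C D) : Prop := {
  fun_src : forall f, src (s_ar F f) = s_ob F (src f);
  fun_tgt : forall f, tgt (s_ar F f) = s_ob F (tgt f);
  fun_id : forall x, s_ar F (idn x) = idn (s_ob F x);
  fun_comp : forall f g, tgt f = src g -> s_ar F (f ;; g) = s_ar F f ;; s_ar F g }.

Definition sfun_id (C : cat) : sfun C C := SFun C C (fun x => x) (fun f => f).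
Definition sfun_cmp (C D E : cat) (F : sfun C D) (G : sfun D E) : sfun C E :=
  SFun C E (fun x => s_ob G (s_ob F x)) (fun f => s_ar G (s_ar F f)).

Record mcat := MCat {
  mc_cat :> cat;
  one : ob mc_cat;
  tob : ob mc_cat -> ob mc_cat -> ob mc_cat;
  tar : ar mc_cat -> ar mc_cat -> ar mc_cat }.
Arguments one {_}.
Arguments tob {_} _ _.
Arguments tar {_} _ _.
Notation "x ** y" := (tob x y) (at level 41, right associativity).
Notation "f ## g" := (tar f g) (at level 41, right associativity).

Record is_strict_monoidal (C : mcat) : Prop := {
  mon_cat : is_cat C;
  mon_src : forall f g : ar C, src (f ## g) = src f ** src g;
  mon_tgt : forall f g : ar C, tgt (f ## g) = tgt f ** tgt g;
  mon_id : forall x y : ob C, idn x ## idn y = idn (x ** y);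
  mon_comp : forall f f' g g' : ar C, tgt f = src f' -> tgt g = src g' ->
    (f ;; f') ## (g ;; g') = (f ## g) ;; (f' ## g');
  mon_assoc_ob : forall x y z : ob C, (x ** y) ** z = x ** (y ** z);
  mon_assoc_ar : forall f g h : ar C, (f ## g) ## h = f ## (g ## h);
  mon_unitl_ob : forall x : ob C, one ** x = x;
  mon_unitr_ob : forall x : ob C, x ** one = x;
  mon_unitl_ar : forall f : ar C, idn one ## f = f;
  mon_unitr_ar : forall f : ar C, f ## idn one = f }.

Record strict_monoidal_functor (C D : mcat) (F : sfun C D) : Prop := {
  smf_fun : is_functor F;
  smf_one : s_ob F one = one;
  smf_ob : forall x y, s_ob F (x ** y) = s_ob F x ** s_ob F y;
  smf_ar : forall f g, s_ar F (f ## g) = s_ar F f ## s_ar F g }.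

Definition bang (C : mcat) (x : ob C) : ar C :=
  the (idn x) (fun h => src h = x /\ tgt h = one).
Definition pr1 (C : mcat) (x y : ob C) : ar C := idn x ## bang C y.
Definition pr2 (C : mcat) (x y : ob C) : ar C := bang C x ## idn y.
Definition is_pairing (C : mcat) (f g h : ar C) : Prop :=
  src h = src f /\ tgt h = tgt f ** tgt g /\
  h ;; pr1 C (tgt f) (tgt g) = f /\ h ;; pr2 C (tgt f) (tgt g) = g.

(** The monoidal unit is terminal and the tensor, with the projections induced by
    the maps to the unit, is the chosen product. *)
Record is_cartesian (C : mcat) : Prop := {
  cart_mon : is_strict_monoidal C;
  cart_one : forall x : ob C, exists! h : ar C, src h = x /\ tgt h = one;
  cart_prod : forall f g : ar C, src f = src g -> exists! h : ar C, is_pairing C f g h }.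

Definition pairing (C : mcat) (f g : ar C) : ar C := the f (is_pairing C f g).
Definition diag (C : mcat) (x : ob C) : ar C := pairing C (idn x) (idn x).
Definition swap (C : mcat) (x y : ob C) : ar C := pairing C (pr2 C x y) (pr1 C x y).

Record imcat := IMCat {
  im_mcat :> mcat;
  sym : ob im_mcat -> ob im_mcat -> ar im_mcat;
  dup : ob im_mcat -> ar im_mcat;
  del : ob im_mcat -> ar im_mcat;
  mul : ob im_mcat -> ar im_mcat;
  unt : ob im_mcat -> ar im_mcat }.
Arguments sym {_} _ _.
Arguments dup {_} _.
Arguments del {_} _.
Arguments mul {_} _.
Arguments unt {_} _.

Record is_symmetric (C : imcat) : Prop := {
  symm_mon : is_strict_monoidal C;
  symm_src : forall x y : ob C, src (sym x y) = x ** y;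
  symm_tgt : forall x y : ob C, tgt (sym x y) = y ** x;
  symm_inv : forall x y : ob C, sym x y ;; sym y x = idn (x ** y);
  symm_nat : forall f g : ar C,
    (f ## g) ;; sym (tgt f) (tgt g) = sym (src f) (src g) ;; (g ## f);
  symm_hex : forall x y z : ob C,
    sym x (y ** z) = (sym x y ## idn z) ;; (idn y ## sym x z) }.

Record has_uniform_comonoids (C : imcat) : Prop := {
  dup_src : forall x : ob C, src (dup x) = x;
  dup_tgt : forall x : ob C, tgt (dup x) = x ** x;
  del_src : forall x : ob C, src (del x) = x;
  del_tgt : forall x : ob C, tgt (del x) = one;
  dup_assoc : forall x : ob C, dup x ;; (dup x ## idn x) = dup x ;; (idn x ## dup x);
  dup_unitl : forall x : ob C, dup x ;; (del x ## idn x) = idn x;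
  dup_unitr : forall x : ob C, dup x ;; (idn x ## del x) = idn x;
  dup_nat : forall f : ar C, f ;; dup (tgt f) = dup (src f) ;; (f ## f);
  del_nat : forall f : ar C, f ;; del (tgt f) = del (src f);
  dup_one : dup (@one C) = idn one;
  del_one : del (@one C) = idn one;
  dup_tensor : forall x y : ob C,
    (dup x ## dup y) ;; (idn x ## sym x y ## idn y) = dup (x ** y) }.

Record has_consistent_monoids (C : imcat) : Prop := {
  mul_src : forall x : ob C, src (mul x) = x ** x;
  mul_tgt : forall x : ob C, tgt (mul x) = x;
  unt_src : forall x : ob C, src (unt x) = one;
  unt_tgt : forall x : ob C, tgt (unt x) = x;
  mul_assoc : forall x : ob C, (mul x ## idn x) ;; mul x = (idn x ## mul x) ;; mul x;
  mul_unitl : forall x : ob C, (unt x ## idn x) ;; mul x = idn x;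
  mul_unitr : forall x : ob C, (idn x ## unt x) ;; mul x = idn x;
  mul_one : mul (@one C) = idn one;
  unt_one : unt (@one C) = idn one;
  unt_nat : forall f : ar C, unt (src f) ;; f = unt (tgt f);
  mul_tensor : forall x y : ob C,
    (idn x ## sym y x ## idn y) ;; (mul x ## mul y) = mul (x ** y) }.

Record has_indexed_monoids (C : imcat) : Prop := {
  im_symmetric : is_symmetric C;
  im_comonoids : has_uniform_comonoids C;
  im_monoids : has_consistent_monoids C }.

(** A morphism of [IMon] that is strict monoidal; comonoids, symmetries and units of
    monoids are then preserved automatically. *)
Record imon_functor (C D : imcat) (F : sfun C D) : Prop := {
  imf_mon : @strict_monoidal_functor C D F;
  imf_mul : forall x, s_ar F (mul x) = mul (s_ob F x) }.

(** [fim X] is the free category with indexed monoids on [X]: words in [ob X], and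
    classes of well-sorted expressions [fim_raw] modulo [fim_eq].  The operations [fw_*]
    extend the generating symmetries, comonoids and monoids from letters to words. *)
Inductive fim_raw (X : cat) : Type :=
| fr_gen (f : ar X)
| fr_id (a : ob X)
| fr_eps
| fr_comp (x y : fim_raw X)
| fr_ten (x y : fim_raw X)
| fr_sym (a b : ob X)
| fr_dup (a : ob X)
| fr_del (a : ob X)
| fr_mul (a : ob X)
| fr_unt (a : ob X).
Arguments fr_gen {X} f.
Arguments fr_id {X} a.
Arguments fr_eps {X}.
Arguments fr_sym {X} a b.
Arguments fr_dup {X} a.
Arguments fr_del {X} a.
Arguments fr_mul {X} a.
Arguments fr_unt {X} a.
Notation "x ;f y" := (fr_comp x y) (at level 51, left associativity).
Notation "x *f y" := (fr_ten x y) (at level 41, right associativity).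

Inductive fim_sort (X : cat) : fim_raw X -> list (ob X) -> list (ob X) -> Prop :=
| fs_gen f : fim_sort (fr_gen f) [src f] [tgt f]
| fs_id a : fim_sort (fr_id a) [a] [a]
| fs_eps : fim_sort fr_eps [] []
| fs_comp x y w v u :
    fim_sort x w v -> fim_sort y v u -> fim_sort (x ;f y) w u
| fs_ten x y w v w' v' :
    fim_sort x w v -> fim_sort y w' v' -> fim_sort (x *f y) (w ++ w') (v ++ v')
| fs_sym a b : fim_sort (fr_sym a b) [a; b] [b; a]
| fs_dup a : fim_sort (fr_dup a) [a] [a; a]
| fs_del a : fim_sort (fr_del a) [a] []
| fs_mul a : fim_sort (fr_mul a) [a; a] [a]
| fs_unt a : fim_sort (fr_unt a) [] [a].

Section WordOperations.
Variable X : cat.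
Implicit Types (a : ob X) (w v : list (ob X)).

Fixpoint fw_id w : fim_raw X :=
  match w with [] => fr_eps | a :: w' => fr_id a *f fw_id w' end.

Fixpoint fw_sym1 a v : fim_raw X :=
  match v with
  | [] => fr_id a
  | b :: v' => (fr_sym a b *f fw_id v') ;f (fr_id b *f fw_sym1 a v')
  end.

Fixpoint fw_sym w v : fim_raw X :=
  match w with
  | [] => fw_id v
  | a :: w' => (fr_id a *f fw_sym w' v) ;f (fw_sym1 a v *f fw_id w')
  end.

Fixpoint fw_dup w : fim_raw X :=
  match w with
  | [] => fr_eps
  | a :: w' => (fr_dup a *f fw_dup w') ;f (fr_id a *f fw_sym1 a w' *f fw_id w')
  end.

Fixpoint fw_del w : fim_raw X :=
  match w with [] => fr_eps | a :: w' => fr_del a *f fw_del w' end.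

Fixpoint fw_mul w : fim_raw X :=
  match w with
  | [] => fr_eps
  | a :: w' => (fr_id a *f fw_sym w' [a] *f fw_id w') ;f (fr_mul a *f fw_mul w')
  end.

Fixpoint fw_unt w : fim_raw X :=
  match w with [] => fr_eps | a :: w' => fr_unt a *f fw_unt w' end.

Lemma fs_cast (x : fim_raw X) w v w' v' :
  fim_sort x w v -> w = w' -> v = v' -> fim_sort x w' v'.
Proof. intros H -> ->; exact H. Qed.

Lemma fw_id_sort w : fim_sort (fw_id w) w w.
Proof. induction w as [|a w IH]; [apply fs_eps|]. exact (fs_ten (fs_id _ a) IH). Qed.

Lemma fw_sym1_sort a v : fim_sort (fw_sym1 a v) (a :: v) (v ++ [a]).
Proof.
induction v as [|b v IH]; [apply fs_id|].
apply fs_comp with (v := b :: a :: v).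
- exact (fs_ten (fs_sym _ a b) (fw_id_sort v)).
- exact (fs_ten (fs_id _ b) IH).
Qed.

Lemma fw_sym_sort w v : fim_sort (fw_sym w v) (w ++ v) (v ++ w).
Proof.
induction w as [|a w IH]; simpl.
- rewrite app_nil_r. apply fw_id_sort.
- apply fs_comp with (v := a :: v ++ w).
  + exact (fs_ten (fs_id _ a) IH).
  + apply (fs_cast (fs_ten (fw_sym1_sort a v) (fw_id_sort w))); [reflexivity|].
    rewrite <- app_assoc; reflexivity.
Qed.

Lemma fw_dup_sort w : fim_sort (fw_dup w) w (w ++ w).
Proof.
induction w as [|a w IH]; [apply fs_eps|].
apply fs_comp with (v := a :: a :: w ++ w).
- exact (fs_ten (fs_dup _ a) IH).
- apply (fs_cast (fs_ten (fs_id _ a) (fs_ten (fw_sym1_sort a w) (fw_id_sort w))));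
    [reflexivity|]. simpl. rewrite <- app_assoc; reflexivity.
Qed.

Lemma fw_del_sort w : fim_sort (fw_del w) w [].
Proof. induction w as [|a w IH]; [apply fs_eps|]. exact (fs_ten (fs_del _ a) IH). Qed.

Lemma fw_mul_sort w : fim_sort (fw_mul w) (w ++ w) w.
Proof.
induction w as [|a w IH]; [apply fs_eps|].
apply fs_comp with (v := a :: a :: w ++ w).
- apply (fs_cast (fs_ten (fs_id _ a) (fs_ten (fw_sym_sort w [a]) (fw_id_sort w))));
    [|reflexivity]. simpl. rewrite <- app_assoc; reflexivity.
- exact (fs_ten (fs_mul _ a) IH).
Qed.

Lemma fw_unt_sort w : fim_sort (fw_unt w) [] w.
Proof. induction w as [|a w IH]; [apply fs_eps|]. exact (fs_ten (fs_unt _ a) IH). Qed.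

End WordOperations.

Inductive fim_eq (X : cat) : fim_raw X -> fim_raw X -> Prop :=
| fe_refl x w v : fim_sort x w v -> fim_eq x x
| fe_symm x y : fim_eq x y -> fim_eq y x
| fe_trans x y z : fim_eq x y -> fim_eq y z -> fim_eq x z
| fe_comp x x' y y' w v u : fim_sort x w v -> fim_sort y v u ->
    fim_eq x x' -> fim_eq y y' -> fim_eq (x ;f y) (x' ;f y')
| fe_ten x x' y y' : fim_eq x x' -> fim_eq y y' -> fim_eq (x *f y) (x' *f y')
| fe_assoc x y z w v u t : fim_sort x w v -> fim_sort y v u -> fim_sort z u t ->
    fim_eq ((x ;f y) ;f z) (x ;f (y ;f z))
| fe_idl x w v : fim_sort x w v -> fim_eq (fw_id X w ;f x) x
| fe_idr x w v : fim_sort x w v -> fim_eq (x ;f fw_id X v) x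
| fe_tassoc x y z w v w' v' w'' v'' :
    fim_sort x w v -> fim_sort y w' v' -> fim_sort z w'' v'' ->
    fim_eq ((x *f y) *f z) (x *f (y *f z))
| fe_tunitl x w v : fim_sort x w v -> fim_eq (fr_eps *f x) x
| fe_tunitr x w v : fim_sort x w v -> fim_eq (x *f fr_eps) x
| fe_interchange x y x' y' w v u w' v' u' :
    fim_sort x w v -> fim_sort y v u -> fim_sort x' w' v' -> fim_sort y' v' u' ->
    fim_eq ((x ;f y) *f (x' ;f y')) ((x *f x') ;f (y *f y'))
| fe_sym_inv a b : fim_eq (fr_sym a b ;f fr_sym b a) (fw_id X [a; b])
| fe_sym_nat x y w v w' v' : fim_sort x w v -> fim_sort y w' v' ->
    fim_eq ((x *f y) ;f fw_sym X v v') (fw_sym X w w' ;f (y *f x))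
| fe_dup_assoc a : fim_eq (fr_dup a ;f (fr_dup a *f fr_id a))
                          (fr_dup a ;f (fr_id a *f fr_dup a))
| fe_dup_unitl a : fim_eq (fr_dup a ;f (fr_del a *f fr_id a)) (fr_id a)
| fe_dup_unitr a : fim_eq (fr_dup a ;f (fr_id a *f fr_del a)) (fr_id a)
| fe_dup_nat x w v : fim_sort x w v ->
    fim_eq (x ;f fw_dup X v) (fw_dup X w ;f (x *f x))
| fe_del_nat x w v : fim_sort x w v -> fim_eq (x ;f fw_del X v) (fw_del X w)
| fe_mul_assoc a : fim_eq ((fr_mul a *f fr_id a) ;f fr_mul a)
                          ((fr_id a *f fr_mul a) ;f fr_mul a)
| fe_mul_unitl a : fim_eq ((fr_unt a *f fr_id a) ;f fr_mul a) (fr_id a)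
| fe_mul_unitr a : fim_eq ((fr_id a *f fr_unt a) ;f fr_mul a) (fr_id a)
| fe_mul_nat f : fim_eq (fr_mul (src f) ;f fr_gen f)
                        ((fr_gen f *f fr_gen f) ;f fr_mul (tgt f))
| fe_unt_nat f : fim_eq (fr_unt (src f) ;f fr_gen f) (fr_unt (tgt f))
| fe_gen_id a : fim_eq (fr_gen (idn a)) (fr_id a)
| fe_gen_comp f g : tgt f = src g -> fim_eq (fr_gen (f ;; g)) (fr_gen f ;f fr_gen g).

Record fim_term (X : cat) := FimTerm {
  ft_src : list (ob X);
  ft_tgt : list (ob X);
  ft_raw : fim_raw X;
  ft_ok : fim_sort ft_raw ft_src ft_tgt }.
Arguments ft_src {X} _.
Arguments ft_tgt {X} _.
Arguments ft_raw {X} _.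

Definition fim_term_eq (X : cat) (s t : fim_term X) : Prop :=
  ft_src s = ft_src t /\ ft_tgt s = ft_tgt t /\ fim_eq (ft_raw s) (ft_raw t).

Definition fim_ar (X : cat) : Type := quot (@fim_term_eq X).

Definition fim_mk (X : cat) (x : fim_raw X) (w v : list (ob X)) (H : fim_sort x w v) :
  fim_ar X := cls (@fim_term_eq X) (FimTerm H).

Definition fim_cat (X : cat) : cat := {|
  ob := list (ob X);
  ar := fim_ar X;
  src := fun h => ft_src (rep h);
  tgt := fun h => ft_tgt (rep h);
  idn := fun w => fim_mk (fw_id_sort X w);
  comp := fun h k => the h (fun l => exists s t r,
    h = cls _ s /\ k = cls _ t /\ l = cls _ r /\ ft_raw r = ft_raw s ;f ft_raw t) |}.

Definition fim_mcat (X : cat) : mcat := {|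
  mc_cat := fim_cat X;
  one := @nil (ob X);
  tob := fun w v => w ++ v;
  tar := fun h k : fim_ar X => fim_mk (fs_ten (ft_ok (rep h)) (ft_ok (rep k))) |}.

Definition fim (X : cat) : imcat := {|
  im_mcat := fim_mcat X;
  sym := fun w v => fim_mk (fw_sym_sort X w v);
  dup := fun w => fim_mk (fw_dup_sort X w);
  del := fun w => fim_mk (fw_del_sort X w);
  mul := fun w => fim_mk (fw_mul_sort X w);
  unt := fun w => fim_mk (fw_unt_sort X w) |}.

Definition fim_ob (X : cat) (a : ob X) : ob (fim X) := [a].
Definition fim_gen (X : cat) (f : ar X) : ar (fim X) := fim_mk (fs_gen X f).

Record mon_sig := MonSig {
  col : Type;
  gen : list col -> list col -> Type }.

Record mon_sig_mor (S S' : mon_sig) := MonSigMor {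
  mm_col : col S -> col S';
  mm_gen : forall a b, gen S a b -> gen S' (map mm_col a) (map mm_col b) }.

Arguments mm_gen {S S'} _ {a b} _.

Record lsig := LSig {
  layer : Type;
  fgen : layer -> layer -> Type;
  msig : layer -> mon_sig }.

Record lsig_mor (L L' : lsig) := LSigMor {
  lm_layer : layer L -> layer L';
  lm_fgen : forall o t, fgen L o t -> fgen L' (lm_layer o) (lm_layer t);
  lm_msig : forall o, mon_sig_mor (msig L o) (msig L' (lm_layer o)) }.
Arguments lm_layer {L L'} _ _.
Arguments lm_fgen {L L'} _ {o t} _.
Arguments lm_msig {L L'} _ _.

Definition cast_gen (S : mon_sig) (a a' b b' : list (col S)) (ea : a = a') (eb : b = b')
  (s : gen S a b) : gen S a' b' :=
  match ea in _ = x, eb in _ = y return gen S x y with eq_refl, eq_refl => s end.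

Definition mon_sig_id (S : mon_sig) : mon_sig_mor S S :=
  MonSigMor S S (fun c => c)
    (fun a b s => cast_gen S (eq_sym (map_id a)) (eq_sym (map_id b)) s).

Definition mon_sig_cmp (S S' S'' : mon_sig) (F : mon_sig_mor S S') (G : mon_sig_mor S' S'') :
  mon_sig_mor S S'' :=
  MonSigMor S S'' (fun c => mm_col G (mm_col F c))
    (fun a b s => cast_gen S'' (map_map (mm_col F) (mm_col G) a)
                               (map_map (mm_col F) (mm_col G) b)
                               (mm_gen G (mm_gen F s))).

Definition lsig_id (L : lsig) : lsig_mor L L :=
  LSigMor L L (fun o => o) (fun o t f => f) (fun o => mon_sig_id (msig L o)).

Definition lsig_cmp (L L' L'' : lsig) (F : lsig_mor L L') (G : lsig_mor L' L'') :
  lsig_mor L L'' :=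
  LSigMor L L'' (fun o => lm_layer G (lm_layer F o))
    (fun o t f => lm_fgen G (lm_fgen F f))
    (fun o => mon_sig_cmp (lm_msig F o) (lm_msig G (lm_layer F o))).

Inductive ity (L : lsig) : layer L -> Type :=
| iunit o : ity L o
| icol o (a : col (msig L o)) : ity L o
| iapp o t (f : fgen L o t) (A : ity L o) : ity L t
| iten o (A B : ity L o) : ity L o.
Arguments iunit {L} o.
Arguments icol {L} o a.
Arguments iapp {L o t} f A.
Arguments iten {L o} A B.

Definition ty (L : lsig) : Type := list {o : layer L & ity L o}.

Definition sg (L : lsig) (o : layer L) (A : ity L o) : ty L := [existT (ity L) o A].

(** A word of colours as an internal type; the trailing unit is absorbed by the
    structural 0-equations. *)
Definition iword (L : lsig) (o : layer L) (a : list (col (msig L o))) : ity L o :=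
  fold_right (fun c A => iten (icol o c) A) (iunit o) a.

Fixpoint map_ity (L L' : lsig) (F : lsig_mor L L') (o : layer L) (A : ity L o) :
  ity L' (lm_layer F o) :=
  match A in ity _ o return ity L' (lm_layer F o) with
  | iunit o => iunit (lm_layer F o)
  | icol o a => icol (lm_layer F o) (mm_col (lm_msig F o) a)
  | iapp f A => iapp (lm_fgen F f) (map_ity F A)
  | iten A B => iten (map_ity F A) (map_ity F B)
  end.

Definition rel0 (L : lsig) : Type := forall o, ity L o -> ity L o -> Prop.

(** The congruence on internal types generated by the 0-equations [E0] together
    with the structural 0-equations. *)
Inductive ieq (L : lsig) (E0 : rel0 L) : forall o, ity L o -> ity L o -> Prop :=
| ie_refl o (A : ity L o) : ieq E0 A A
| ie_sym o (A B : ity L o) : ieq E0 A B -> ieq E0 B A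
| ie_trans o (A B C : ity L o) : ieq E0 A B -> ieq E0 B C -> ieq E0 A C
| ie_app o t (f : fgen L o t) A B : ieq E0 A B -> ieq E0 (iapp f A) (iapp f B)
| ie_ten o (A A' B B' : ity L o) :
    ieq E0 A A' -> ieq E0 B B' -> ieq E0 (iten A B) (iten A' B')
| ie_E0 o (A B : ity L o) : E0 o A B -> ieq E0 A B
| ie_assoc o (A B C : ity L o) : ieq E0 (iten (iten A B) C) (iten A (iten B C))
| ie_unitl o (A : ity L o) : ieq E0 (iten (iunit o) A) A
| ie_unitr o (A : ity L o) : ieq E0 (iten A (iunit o)) A
| ie_app_ten o t (f : fgen L o t) A B :
    ieq E0 (iapp f (iten A B)) (iten (iapp f A) (iapp f B))
| ie_app_unit o t (f : fgen L o t) : ieq E0 (iapp f (iunit o)) (iunit t).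

Inductive sieq (L : lsig) (E0 : rel0 L) :
  {o : layer L & ity L o} -> {o : layer L & ity L o} -> Prop :=
| sieq_intro o (A B : ity L o) :
    ieq E0 A B -> sieq E0 (existT _ o A) (existT _ o B).

Definition teq (L : lsig) (E0 : rel0 L) : ty L -> ty L -> Prop := Forall2 (sieq E0).

(** Raw opfibrational terms.  [tid (iunit o)] is the identity of the unit of layer
    [o], [teps] that of the empty list of types; [tapp] and [titen] are sorted only on
    internal terms. *)
Inductive tm (L : lsig) : Type :=
| tid o (A : ity L o)
| tgen o (a b : list (col (msig L o))) (s : gen (msig L o) a b)
| tapp o t (f : fgen L o t) (x : tm L)
| titen (o : layer L) (x y : tm L)
| tcomp (x y : tm L)
| teps
| tten (x y : tm L)
| tsym o t (A : ity L o) (B : ity L t)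
| tnab o t (f : fgen L o t) (A : ity L o)
| tmul o (A B : ity L o)
| tunt (o : layer L)
| tdup o (A : ity L o)
| tdel o (A : ity L o).
Arguments tid {L o} A.
Arguments tgen {L} o {a b} s.
Arguments tapp {L o t} f x.
Arguments teps {L}.
Arguments tsym {L o t} A B.
Arguments tnab {L o t} f A.
Arguments tmul {L o} A B.
Arguments tunt {L} o.
Arguments tdup {L o} A.
Arguments tdel {L o} A.
Notation "x ;t y" := (tcomp x y) (at level 51, left associativity).
Notation "x *t y" := (tten x y) (at level 41, right associativity).

Fixpoint map_tm (L L' : lsig) (F : lsig_mor L L') (x : tm L) : tm L' :=
  match x with
  | tid A => tid (map_ity F A)
  | tgen o s => tgen (lm_layer F o) (mm_gen (lm_msig F o) s)
  | tapp f x => tapp (lm_fgen F f) (map_tm F x)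
  | titen o x y => titen (lm_layer F o) (map_tm F x) (map_tm F y)
  | x ;t y => map_tm F x ;t map_tm F y
  | teps => teps
  | x *t y => map_tm F x *t map_tm F y
  | tsym A B => tsym (map_ity F A) (map_ity F B)
  | tnab f A => tnab (lm_fgen F f) (map_ity F A)
  | tmul A B => tmul (map_ity F A) (map_ity F B)
  | tunt o => tunt (lm_layer F o)
  | tdup A => tdup (map_ity F A)
  | tdel A => tdel (map_ity F A)
  end.

(** [iterm E0 x A B]: [x] is an internal term of sort [(A : o | B : o)]; sorts are
    read up to the type congruence. *)
Inductive iterm (L : lsig) (E0 : rel0 L) :
  forall o, tm L -> ity L o -> ity L o -> Prop :=
| it_id o (A : ity L o) : iterm E0 (tid A) A A
| it_gen o a b (s : gen (msig L o) a b) :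
    iterm E0 (tgen o s) (iword L o a) (iword L o b)
| it_app o t (f : fgen L o t) x A B :
    iterm E0 x A B -> iterm E0 (tapp f x) (iapp f A) (iapp f B)
| it_ten o x y (A B C D : ity L o) :
    iterm E0 x A B -> iterm E0 y C D -> iterm E0 (titen o x y) (iten A C) (iten B D)
| it_comp o x y (A B C : ity L o) :
    iterm E0 x A B -> iterm E0 y B C -> iterm E0 (x ;t y) A C
| it_conv o x (A A' B B' : ity L o) :
    ieq E0 A A' -> ieq E0 B B' -> iterm E0 x A B -> iterm E0 x A' B'.

(** [term E0 x T S]: [x] is a term of sort [(T | S)]. *)
Inductive term (L : lsig) (E0 : rel0 L) : tm L -> ty L -> ty L -> Prop :=
| tm_int o x (A B : ity L o) : iterm E0 x A B -> term E0 x (sg A) (sg B)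
| tm_comp x y T S U : term E0 x T S -> term E0 y S U -> term E0 (x ;t y) T U
| tm_eps : term E0 teps [] []
| tm_ten x y T S U W :
    term E0 x T S -> term E0 y U W -> term E0 (x *t y) (T ++ U) (S ++ W)
| tm_sym o t (A : ity L o) (B : ity L t) :
    term E0 (tsym A B) (sg A ++ sg B) (sg B ++ sg A)
| tm_nab o t (f : fgen L o t) A : term E0 (tnab f A) (sg A) (sg (iapp f A))
| tm_mul o (A B : ity L o) : term E0 (tmul A B) (sg A ++ sg B) (sg (iten A B))
| tm_unt o : term E0 (tunt o) [] (sg (iunit o))
| tm_dup o (A : ity L o) : term E0 (tdup A) (sg A) (sg A ++ sg A)
| tm_del o (A : ity L o) : term E0 (tdel A) (sg A) []
| tm_conv x T T' S S' :
    teq E0 T T' -> teq E0 S S' -> term E0 x T S -> term E0 x T' S'.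

Section ListOperations.
Variable L : lsig.
Implicit Types (A : {o : layer L & ity L o}) (T S : ty L).

Fixpoint tid_l T : tm L :=
  match T with [] => teps | A :: T' => tid (projT2 A) *t tid_l T' end.

Fixpoint tsym1_l A S : tm L :=
  match S with
  | [] => tid (projT2 A)
  | B :: S' => (tsym (projT2 A) (projT2 B) *t tid_l S') ;t
               (tid (projT2 B) *t tsym1_l A S')
  end.

Fixpoint tsym_l T S : tm L :=
  match T with
  | [] => tid_l S
  | A :: T' => (tid (projT2 A) *t tsym_l T' S) ;t (tsym1_l A S *t tid_l T')
  end.

Fixpoint tdup_l T : tm L :=
  match T with
  | [] => teps
  | A :: T' => (tdup (projT2 A) *t tdup_l T') ;t
               (tid (projT2 A) *t tsym1_l A T' *t tid_l T')
  end.

Fixpoint tdel_l T : tm L :=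
  match T with [] => teps | A :: T' => tdel (projT2 A) *t tdel_l T' end.

Lemma tid_l_sort (E0 : rel0 L) T : term E0 (tid_l T) T T.
Proof.
induction T as [|[o A] T IH]; [apply tm_eps|].
exact (tm_ten (tm_int (it_id E0 A)) IH).
Qed.

End ListOperations.

Definition rel1 (L : lsig) : Type := tm L -> tm L -> Prop.

(** The congruence on terms generated by the 1-equations [E1] together with the
    structural 1-equations.  That [id_A] (and likewise [d_A], [m_{A,B}], ...) depends
    on [A] only up to the type congruence follows, because the hypotheses
    [term E0 x T S] allow [T] and [S] to be any representatives of the sort. *)
Inductive tmeq (L : lsig) (E0 : rel0 L) (E1 : rel1 L) : tm L -> tm L -> Prop :=
| te_refl x T S : term E0 x T S -> tmeq E0 E1 x x
| te_symm x y : tmeq E0 E1 x y -> tmeq E0 E1 y x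
| te_trans x y z : tmeq E0 E1 x y -> tmeq E0 E1 y z -> tmeq E0 E1 x z
| te_comp x x' y y' T S U : term E0 x T S -> term E0 y S U ->
    tmeq E0 E1 x x' -> tmeq E0 E1 y y' -> tmeq E0 E1 (x ;t y) (x' ;t y')
| te_ten x x' y y' : tmeq E0 E1 x x' -> tmeq E0 E1 y y' ->
    tmeq E0 E1 (x *t y) (x' *t y')
| te_app o t (f : fgen L o t) x x' (A B : ity L o) : iterm E0 x A B -> iterm E0 x' A B ->
    tmeq E0 E1 x x' -> tmeq E0 E1 (tapp f x) (tapp f x')
| te_iten o x x' y y' (A B C D : ity L o) :
    iterm E0 x A B -> iterm E0 x' A B -> iterm E0 y C D -> iterm E0 y' C D ->
    tmeq E0 E1 x x' -> tmeq E0 E1 y y' -> tmeq E0 E1 (titen o x y) (titen o x' y')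
| te_E1 x y : E1 x y -> tmeq E0 E1 x y
| te_assoc x y z T S U V : term E0 x T S -> term E0 y S U -> term E0 z U V ->
    tmeq E0 E1 ((x ;t y) ;t z) (x ;t (y ;t z))
| te_idl x T S : term E0 x T S -> tmeq E0 E1 (tid_l T ;t x) x
| te_idr x T S : term E0 x T S -> tmeq E0 E1 (x ;t tid_l S) x
| te_tassoc x y z T S T' S' T'' S'' :
    term E0 x T S -> term E0 y T' S' -> term E0 z T'' S'' ->
    tmeq E0 E1 ((x *t y) *t z) (x *t (y *t z))
| te_tunitl x T S : term E0 x T S -> tmeq E0 E1 (teps *t x) x
| te_tunitr x T S : term E0 x T S -> tmeq E0 E1 (x *t teps) x
| te_interchange x y x' y' T S U T' S' U' :
    term E0 x T S -> term E0 y S U -> term E0 x' T' S' -> term E0 y' S' U' ->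
    tmeq E0 E1 ((x ;t y) *t (x' ;t y')) ((x *t x') ;t (y *t y'))
| te_iassoc o x y z (A B A' B' A'' B'' : ity L o) :
    iterm E0 x A B -> iterm E0 y A' B' -> iterm E0 z A'' B'' ->
    tmeq E0 E1 (titen o (titen o x y) z) (titen o x (titen o y z))
| te_iunitl o x (A B : ity L o) : iterm E0 x A B ->
    tmeq E0 E1 (titen o (tid (iunit o)) x) x
| te_iunitr o x (A B : ity L o) : iterm E0 x A B ->
    tmeq E0 E1 (titen o x (tid (iunit o))) x
| te_iinterchange o x y x' y' (A B C A' B' C' : ity L o) :
    iterm E0 x A B -> iterm E0 y B C -> iterm E0 x' A' B' -> iterm E0 y' B' C' ->
    tmeq E0 E1 (titen o (x ;t y) (x' ;t y')) (titen o x x' ;t titen o y y')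
| te_id_ten o (A B : ity L o) :
    tmeq E0 E1 (tid (iten A B)) (titen o (tid A) (tid B))
| te_app_id o t (f : fgen L o t) A : tmeq E0 E1 (tapp f (tid A)) (tid (iapp f A))
| te_app_comp o t (f : fgen L o t) x y (A B C : ity L o) :
    iterm E0 x A B -> iterm E0 y B C ->
    tmeq E0 E1 (tapp f (x ;t y)) (tapp f x ;t tapp f y)
| te_app_ten o t (f : fgen L o t) x y (A B C D : ity L o) :
    iterm E0 x A B -> iterm E0 y C D ->
    tmeq E0 E1 (tapp f (titen o x y)) (titen t (tapp f x) (tapp f y))
| te_app_unit o t (f : fgen L o t) :
    tmeq E0 E1 (tapp f (tid (iunit o))) (tid (iunit t))
| te_sym_inv T S : tmeq E0 E1 (tsym_l T S ;t tsym_l S T) (tid_l (T ++ S))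
| te_sym_nat x y T S T' S' : term E0 x T S -> term E0 y T' S' ->
    tmeq E0 E1 ((x *t y) ;t tsym_l S S') (tsym_l T T' ;t (y *t x))
| te_dup_assoc o (A : ity L o) :
    tmeq E0 E1 (tdup A ;t (tdup A *t tid A)) (tdup A ;t (tid A *t tdup A))
| te_dup_unitl o (A : ity L o) : tmeq E0 E1 (tdup A ;t (tdel A *t tid A)) (tid A)
| te_dup_unitr o (A : ity L o) : tmeq E0 E1 (tdup A ;t (tid A *t tdel A)) (tid A)
| te_dup_nat x T S : term E0 x T S ->
    tmeq E0 E1 (x ;t tdup_l S) (tdup_l T ;t (x *t x))
| te_del_nat x T S : term E0 x T S -> tmeq E0 E1 (x ;t tdel_l S) (tdel_l T)
| te_mul_assoc o (A B C : ity L o) :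
    tmeq E0 E1 ((tmul A B *t tid C) ;t tmul (iten A B) C)
               ((tid A *t tmul B C) ;t tmul A (iten B C))
| te_mul_unitl o (A : ity L o) :
    tmeq E0 E1 ((tunt o *t tid A) ;t tmul (iunit o) A) (tid A)
| te_mul_unitr o (A : ity L o) :
    tmeq E0 E1 ((tid A *t tunt o) ;t tmul A (iunit o)) (tid A)
| te_mul_nat o x y (A B C D : ity L o) : iterm E0 x A B -> iterm E0 y C D ->
    tmeq E0 E1 ((x *t y) ;t tmul B D) (tmul A C ;t titen o x y)
| te_nab_nat o t (f : fgen L o t) x A B : iterm E0 x A B ->
    tmeq E0 E1 (x ;t tnab f B) (tnab f A ;t tapp f x)
| te_nab_mul o t (f : fgen L o t) A B :
    tmeq E0 E1 (tmul A B ;t tnab f (iten A B))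
               ((tnab f A *t tnab f B) ;t tmul (iapp f A) (iapp f B))
| te_nab_unt o t (f : fgen L o t) :
    tmeq E0 E1 (tunt o ;t tnab f (iunit o)) (tunt t).

Record theory := Theory {
  th_sig : lsig;
  th_E0 : rel0 th_sig;
  th_E1 : rel1 th_sig;
  th_parallel : forall x y, th_E1 x y ->
    exists T S, term th_E0 x T S /\ term th_E0 y T S }.

Definition preserves_equations (T K : theory) (F : lsig_mor (th_sig T) (th_sig K)) : Prop :=
  (forall o (A B : ity (th_sig T) o), th_E0 T A B -> th_E0 K (map_ity F A) (map_ity F B)) /\
  (forall x y, th_E1 T x y -> th_E1 K (map_tm F x) (map_tm F y)).

Definition theory_mor (T K : theory) : Type :=
  {F : lsig_mor (th_sig T) (th_sig K) | preserves_equations T K F}.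

Lemma cast_gen_irr (S : mon_sig) (a a' b b' : list (col S)) (ea ea' : a = a')
  (eb eb' : b = b') (s : gen S a b) : cast_gen S ea eb s = cast_gen S ea' eb' s.
Proof.
rewrite (proof_irrelevance _ ea' ea), (proof_irrelevance _ eb' eb); reflexivity.
Qed.

Lemma cast_gen_refl (S : mon_sig) (a b : list (col S)) (ea : a = a) (eb : b = b)
  (s : gen S a b) : cast_gen S ea eb s = s.
Proof. exact (cast_gen_irr S ea eq_refl eb eq_refl s). Qed.

Lemma cast_gen_cast (S : mon_sig) (a a' a'' b b' b'' : list (col S)) (ea : a = a')
  (eb : b = b') (ea' : a' = a'') (eb' : b' = b'') (s : gen S a b) :
  cast_gen S ea' eb' (cast_gen S ea eb s)
  = cast_gen S (eq_trans ea ea') (eq_trans eb eb') s.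
Proof. subst; reflexivity. Qed.

Lemma mm_gen_cast (S S' : mon_sig) (F : mon_sig_mor S S') (a a' b b' : list (col S))
  (ea : a = a') (eb : b = b') (s : gen S a b) :
  mm_gen F (cast_gen S ea eb s)
  = cast_gen S' (f_equal (map (mm_col F)) ea) (f_equal (map (mm_col F)) eb) (mm_gen F s).
Proof. subst; reflexivity. Qed.

Lemma mon_sig_mor_ext (S S' : mon_sig) (c : col S -> col S')
  (g g' : forall a b, gen S a b -> gen S' (map c a) (map c b)) :
  (forall a b s, g a b s = g' a b s) -> MonSigMor S S' c g = MonSigMor S S' c g'.
Proof.
intros H; f_equal.
apply functional_extensionality_dep; intros a.
apply functional_extensionality_dep; intros b.
apply functional_extensionality_dep; intros s; apply H.
Qed.

Lemma mon_sig_idl (S S' : mon_sig) (F : mon_sig_mor S S') :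
  mon_sig_cmp (mon_sig_id S) F = F.
Proof.
destruct F as [c g]; apply mon_sig_mor_ext; intros a b s; simpl.
rewrite (mm_gen_cast (MonSigMor S S' c g)), cast_gen_cast. apply cast_gen_refl.
Qed.

Lemma mon_sig_idr (S S' : mon_sig) (F : mon_sig_mor S S') :
  mon_sig_cmp F (mon_sig_id S') = F.
Proof.
destruct F as [c g]; apply mon_sig_mor_ext; intros a b s; simpl.
rewrite cast_gen_cast. apply cast_gen_refl.
Qed.

Lemma mon_sig_assoc (S S' S'' S''' : mon_sig) (F : mon_sig_mor S S')
  (G : mon_sig_mor S' S'') (H : mon_sig_mor S'' S''') :
  mon_sig_cmp (mon_sig_cmp F G) H = mon_sig_cmp F (mon_sig_cmp G H).
Proof.
apply mon_sig_mor_ext; intros a b s; simpl.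
rewrite mm_gen_cast, !cast_gen_cast. apply cast_gen_irr.
Qed.

Lemma lsig_idl (L L' : lsig) (F : lsig_mor L L') : lsig_cmp (lsig_id L) F = F.
Proof.
destruct F as [l f m]; unfold lsig_cmp; simpl; f_equal.
apply functional_extensionality_dep; intros o; apply mon_sig_idl.
Qed.

Lemma lsig_idr (L L' : lsig) (F : lsig_mor L L') : lsig_cmp F (lsig_id L') = F.
Proof.
destruct F as [l f m]; unfold lsig_cmp; simpl; f_equal.
apply functional_extensionality_dep; intros o; apply mon_sig_idr.
Qed.

Lemma lsig_assoc (L L' L'' L''' : lsig) (F : lsig_mor L L') (G : lsig_mor L' L'')
  (H : lsig_mor L'' L''') : lsig_cmp (lsig_cmp F G) H = lsig_cmp F (lsig_cmp G H).
Proof.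
unfold lsig_cmp; simpl; f_equal.
apply functional_extensionality_dep; intros o; apply mon_sig_assoc.
Qed.

Lemma map_ity_id (L : lsig) (o : layer L) (A : ity L o) : map_ity (lsig_id L) A = A.
Proof. induction A; simpl; congruence. Qed.

Lemma map_ity_cmp (L L' L'' : lsig) (F : lsig_mor L L') (G : lsig_mor L' L'')
  (o : layer L) (A : ity L o) : map_ity (lsig_cmp F G) A = map_ity G (map_ity F A).
Proof. induction A; simpl; f_equal; assumption. Qed.

Lemma tgen_cast (L : lsig) (o : layer L) (a a' b b' : list (col (msig L o)))
  (ea : a = a') (eb : b = b') (s : gen (msig L o) a b) :
  tgen o (cast_gen (msig L o) ea eb s) = tgen o s.
Proof. subst; reflexivity. Qed.

Lemma map_tm_id (L : lsig) (x : tm L) : map_tm (lsig_id L) x = x.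
Proof.
induction x; simpl; rewrite ?map_ity_id; try congruence.
apply (@tgen_cast L o).
Qed.

Lemma map_tm_cmp (L L' L'' : lsig) (F : lsig_mor L L') (G : lsig_mor L' L'') (x : tm L) :
  map_tm (lsig_cmp F G) x = map_tm G (map_tm F x).
Proof.
induction x; simpl; rewrite ?map_ity_cmp; try congruence.
apply (@tgen_cast L'' (lm_layer G (lm_layer F o))).
Qed.

Lemma preserves_id (T : theory) : preserves_equations T T (lsig_id (th_sig T)).
Proof.
split; [intros o A B|intros x y]; rewrite ?map_ity_id, ?map_tm_id; trivial.
Qed.

Lemma preserves_cmp (T K M : theory) (F : theory_mor T K) (G : theory_mor K M) :
  preserves_equations T M (lsig_cmp (proj1_sig F) (proj1_sig G)).
Proof.
destruct F as [F [F0 F1]], G as [G [G0 G1]]; simpl.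
split.
- intros o A B H; rewrite !map_ity_cmp. exact (G0 _ _ _ (F0 _ _ _ H)).
- intros x y H; rewrite !map_tm_cmp. exact (G1 _ _ (F1 _ _ H)).
Qed.

Lemma sig_ext (A : Type) (P : A -> Prop) (x y : {a : A | P a}) :
  proj1_sig x = proj1_sig y -> x = y.
Proof. intros H; apply eq_sig_hprop; [intros; apply proof_irrelevance|exact H]. Qed.

Definition theory_id (T : theory) : theory_mor T T := exist _ _ (preserves_id T).
Definition theory_cmp (T K M : theory) (F : theory_mor T K) (G : theory_mor K M) :
  theory_mor T M := exist _ _ (preserves_cmp F G).

Lemma theory_idl (T K : theory) (F : theory_mor T K) : theory_cmp (theory_id T) F = F.
Proof. apply sig_ext, lsig_idl. Qed.
Lemma theory_idr (T K : theory) (F : theory_mor T K) : theory_cmp F (theory_id K) = F.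
Proof. apply sig_ext, lsig_idr. Qed.
Lemma theory_assoc (T K M N : theory) (F : theory_mor T K) (G : theory_mor K M)
  (H : theory_mor M N) :
  theory_cmp (theory_cmp F G) H = theory_cmp F (theory_cmp G H).
Proof. apply sig_ext, lsig_assoc. Qed.

Definition OpFTh : category :=
  @Category theory theory_mor theory_id theory_cmp theory_idl theory_idr theory_assoc.

Record opfib (Y B : cat) := OpFib {
  proj :> sfun Y B;
  lift : ar B -> ob Y -> ar Y }.
Arguments lift {Y B} _ _ _.

Definition opcartesian (Y B : cat) (p : sfun Y B) (h : ar Y) : Prop :=
  forall (k : ar Y) (g : ar B),
    src k = src h -> src g = tgt (s_ar p h) -> s_ar p k = s_ar p h ;; g ->
    exists! l : ar Y, src l = tgt h /\ tgt l = tgt k /\ s_ar p l = g /\ h ;; l = k.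

(** [lift p f y] is the chosen lifting of [f] at [y]; it is only meaningful when
    [y] lies over the source of [f]. *)
Record is_split_opfib (Y B : cat) (p : opfib Y B) : Prop := {
  so_fun : is_functor p;
  so_src : forall f y, s_ob p y = src f -> src (lift p f y) = y;
  so_proj : forall f y, s_ob p y = src f -> s_ar p (lift p f y) = f;
  so_opcart : forall f y, s_ob p y = src f -> opcartesian p (lift p f y);
  so_id : forall y, lift p (idn (s_ob p y)) y = idn y;
  so_comp : forall f g y, s_ob p y = src f -> tgt f = src g ->
    lift p (f ;; g) y = lift p f y ;; lift p g (tgt (lift p f y)) }.

(** The base is strict monoidal, which covers all bases [fim X] of models; its
    chosen cartesian products are its tensor products.
    [io_lift_tensor] is the split form of [io_opcart_tensor]: the product of chosen
    liftings is the chosen lifting.  Without it the fibrewise products need not be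
    strictly associative, so that types would have no well-defined interpretation. *)
Record is_split_im_opfib (Y : mcat) (B : imcat) (p : opfib Y B) : Prop := {
  io_total : is_cartesian Y;
  io_base_cat : is_cat B;
  io_base : has_indexed_monoids B;
  io_split : is_split_opfib p;
  io_preserves : @strict_monoidal_functor Y B p;
  io_reflects_one : forall a, s_ob p a = one <-> a = one;
  io_reflects : forall (h : ar Y) (f g : ar B), s_ar p h = f ## g ->
    exists h1 h2 : ar Y, h = h1 ## h2 /\ s_ar p h1 = f /\ s_ar p h2 = g;
  io_opcart_tensor : forall h k : ar Y,
    opcartesian p h -> opcartesian p k -> opcartesian p (h ## k);
  io_lift_tensor : forall f g y z, s_ob p y = src f -> s_ob p z = src g ->
    lift p (f ## g) (y ** z) = lift p f y ## lift p g z }.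

Record im_opfib_mor (Y Y' : mcat) (B B' : imcat) (p : opfib Y B) (p' : opfib Y' B')
  (P : sfun Y Y') (Q : sfun B B') : Prop := {
  iom_total : @strict_monoidal_functor Y Y' P;
  iom_base : @imon_functor B B' Q;
  iom_square_ob : forall y, s_ob p' (s_ob P y) = s_ob Q (s_ob p y);
  iom_square_ar : forall h, s_ar p' (s_ar P h) = s_ar Q (s_ar p h);
  iom_opcart : forall h, opcartesian p h -> opcartesian p' (s_ar P h);
  iom_lift : forall f y, s_ob p y = src f ->
    s_ar P (lift p f y) = lift p' (s_ar Q f) (s_ob P y) }.

(** [reindex_ob p f y] needs [y] over [src f]; [reindex_ar p f h] needs [h] over
    [idn (src f)], and is then the arrow over [idn (tgt f)] given by the universal
    property of the chosen liftings. *)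
Definition reindex_ob (Y B : cat) (p : opfib Y B) (f : ar B) (y : ob Y) : ob Y :=
  tgt (lift p f y).
Definition reindex_ar (Y B : cat) (p : opfib Y B) (f : ar B) (h : ar Y) : ar Y :=
  the h (fun k =>
    src k = reindex_ob p f (src h) /\ tgt k = reindex_ob p f (tgt h) /\
    s_ar p k = idn (tgt f) /\ lift p f (src h) ;; k = h ;; lift p f (tgt h)).

Definition fib_unit (Y : mcat) (B : imcat) (p : opfib Y B) (x : ob B) : ob Y :=
  reindex_ob p (unt x) one.
Definition fib_ob (Y : mcat) (B : imcat) (p : opfib Y B) (x : ob B) (a b : ob Y) : ob Y :=
  reindex_ob p (mul x) (a ** b).
Definition fib_ar (Y : mcat) (B : imcat) (p : opfib Y B) (x : ob B) (h k : ar Y) : ar Y :=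
  reindex_ar p (mul x) (h ## k).

Arguments is_split_im_opfib {Y B} p.
Arguments im_opfib_mor {Y Y' B B'} p p' P Q.
Arguments fib_unit {Y B} p x.
Arguments fib_ob {Y B} p x a b.
Arguments fib_ar {Y B} p x h k.

Record model (L : lsig) := Model {
  m_base : cat;
  m_total : mcat;
  m_opfib :> opfib m_total (fim m_base);
  m_layer : layer L -> ob m_base;
  m_fgen : forall o t, fgen L o t -> ar m_base;
  m_col : forall o, col (msig L o) -> ob m_total;
  m_gen : forall o a b, gen (msig L o) a b -> ar m_total }.
Arguments m_layer {L} _ _.
Arguments m_fgen {L} _ {o t} _.
Arguments m_col {L} _ {o} _.
Arguments m_gen {L} _ {o a b} _.

Definition m_ob (L : lsig) (M : model L) (o : layer L) : ob (fim (m_base M)) :=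
  fim_ob (m_base M) (m_layer M o).
Definition m_ar (L : lsig) (M : model L) o t (f : fgen L o t) : ar (fim (m_base M)) :=
  fim_gen (m_base M) (m_fgen M f).
Arguments m_ob {L} M o.
Arguments m_ar {L} M {o t} f.

Section Interpretation.
Variables (L : lsig) (M : model L).

Definition m_word (o : layer L) (a : list (col (msig L o))) : ob (m_total M) :=
  fold_right (fun c y => fib_ob M (m_ob M o) (m_col M c) y) (fib_unit M (m_ob M o)) a.

Fixpoint int_ity (o : layer L) (A : ity L o) : ob (m_total M) :=
  match A with
  | iunit o => fib_unit M (m_ob M o)
  | icol o a => m_col M a
  | iapp f A => reindex_ob M (m_ar M f) (int_ity A)
  | @iten _ o A B => fib_ob M (m_ob M o) (int_ity A) (int_ity B)
  end.

Fixpoint int_tm (x : tm L) : ar (m_total M) :=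
  match x with
  | tid A => idn (int_ity A)
  | tgen o s => m_gen M s
  | tapp f x => reindex_ar M (m_ar M f) (int_tm x)
  | titen o x y => fib_ar M (m_ob M o) (int_tm x) (int_tm y)
  | x ;t y => int_tm x ;; int_tm y
  | teps => idn one
  | x *t y => int_tm x ## int_tm y
  | tsym A B => swap (m_total M) (int_ity A) (int_ity B)
  | tnab f A => lift M (m_ar M f) (int_ity A)
  | @tmul _ o A B => lift M (mul (m_ob M o)) (int_ity A ** int_ity B)
  | tunt o => lift M (unt (m_ob M o)) one
  | tdup A => diag (m_total M) (int_ity A)
  | tdel A => bang (m_total M) (int_ity A)
  end.

Record is_opf_model : Prop := {
  om_base : is_cat (m_base M);
  om_opfib : is_split_im_opfib M;
  om_fgen_src : forall o t (f : fgen L o t), src (m_fgen M f) = m_layer M o;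
  om_fgen_tgt : forall o t (f : fgen L o t), tgt (m_fgen M f) = m_layer M t;
  om_col : forall o (a : col (msig L o)), s_ob M (m_col M a) = m_ob M o;
  om_gen_src : forall o a b (s : gen (msig L o) a b), src (m_gen M s) = m_word o a;
  om_gen_tgt : forall o a b (s : gen (msig L o) a b), tgt (m_gen M s) = m_word o b;
  om_gen : forall o a b (s : gen (msig L o) a b), s_ar M (m_gen M s) = idn (m_ob M o) }.

End Interpretation.

Record is_model (T : theory) (M : model (th_sig T)) : Prop := {
  mod_opf : is_opf_model M;
  mod_E0 : forall o (A B : ity (th_sig T) o), th_E0 T A B -> int_ity M A = int_ity M B;
  mod_E1 : forall x y, th_E1 T x y -> int_tm M x = int_tm M y }.

Record theory_model := TheoryModel {
  tm_theory : theory;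
  tm_model :> model (th_sig tm_theory);
  tm_ok : is_model tm_theory tm_model }.

Record model_mor_data (M N : theory_model) := ModelMorData {
  mo_theory : theory_mor (tm_theory M) (tm_theory N);
  mo_total : sfun (m_total M) (m_total N);
  mo_base : sfun (fim (m_base M)) (fim (m_base N)) }.
Arguments mo_theory {M N} _.
Arguments mo_total {M N} _.
Arguments mo_base {M N} _.

Record is_model_mor (M N : theory_model) (H : model_mor_data M N) : Prop := {
  mo_opfib : im_opfib_mor M N (mo_total H) (mo_base H);
  mo_layer : forall o,
    s_ob (mo_base H) (m_ob M o) = m_ob N (lm_layer (proj1_sig (mo_theory H)) o);
  mo_fgen : forall o t (f : fgen _ o t),
    s_ar (mo_base H) (m_ar M f) = m_ar N (lm_fgen (proj1_sig (mo_theory H)) f);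
  mo_col : forall o (a : col (msig _ o)),
    s_ob (mo_total H) (m_col M a)
    = m_col N (mm_col (lm_msig (proj1_sig (mo_theory H)) o) a);
  mo_gen : forall o a b (s : gen (msig _ o) a b),
    s_ar (mo_total H) (m_gen M s)
    = m_gen N (mm_gen (lm_msig (proj1_sig (mo_theory H)) o) s) }.

Definition model_mor (M N : theory_model) : Type :=
  {H : model_mor_data M N | is_model_mor H}.

Definition model_mor_id_data (M : theory_model) : model_mor_data M M :=
  ModelMorData M M (theory_id (tm_theory M))
    (sfun_id (m_total M)) (sfun_id (fim (m_base M))).

Definition model_mor_cmp_data (M N K : theory_model) (H : model_mor_data M N)
  (H' : model_mor_data N K) : model_mor_data M K :=
  ModelMorData M K (theory_cmp (mo_theory H) (mo_theory H'))
    (sfun_cmp (mo_total H) (mo_total H')) (sfun_cmp (mo_base H) (mo_base H')).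

Lemma m_gen_cast (L : lsig) (M : model L) (o : layer L) (a a' b b' : list (col (msig L o)))
  (ea : a = a') (eb : b = b') (s : gen (msig L o) a b) :
  m_gen M (cast_gen (msig L o) ea eb s) = m_gen M s.
Proof. subst; reflexivity. Qed.

Lemma is_functor_id (C : cat) : is_functor (sfun_id C).
Proof. split; reflexivity. Qed.

Lemma is_functor_cmp (C D E : cat) (F : sfun C D) (G : sfun D E) :
  is_functor F -> is_functor G -> is_functor (sfun_cmp F G).
Proof.
intros [F1 F2 F3 F4] [G1 G2 G3 G4]; split; simpl; intros.
- rewrite G1, F1; reflexivity.
- rewrite G2, F2; reflexivity.
- rewrite F3, G3; reflexivity.
- rewrite F4, G4; [reflexivity| |assumption]. rewrite F1, F2; congruence.
Qed.

Lemma smf_id (C : mcat) : @strict_monoidal_functor C C (sfun_id C).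
Proof. split; try reflexivity. apply is_functor_id. Qed.

Lemma smf_cmp (C D E : mcat) (F : sfun C D) (G : sfun D E) :
  strict_monoidal_functor C D F -> strict_monoidal_functor D E G ->
  strict_monoidal_functor C E (sfun_cmp F G).
Proof.
intros [F1 F2 F3 F4] [G1 G2 G3 G4]; split; simpl; intros.
- apply is_functor_cmp; assumption.
- congruence.
- congruence.
- congruence.
Qed.

Lemma model_mor_id_ok (M : theory_model) : is_model_mor (model_mor_id_data M).
Proof.
split; try reflexivity.
- split; try reflexivity; trivial.
  + apply smf_id.
  + split; [apply smf_id|reflexivity].
- intros o a b s; simpl. symmetry.
  apply (@m_gen_cast (th_sig (tm_theory M)) M o).
Qed.

Lemma model_mor_cmp_ok (M N K : theory_model) (H : model_mor M N) (H' : model_mor N K) :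
  is_model_mor (model_mor_cmp_data (proj1_sig H) (proj1_sig H')).
Proof.
destruct H as [H [[a1 [a2 a2'] a3 a4 a5 a6] a7 a8 a9 a10]].
destruct H' as [H' [[b1 [b2 b2'] b3 b4 b5 b6] b7 b8 b9 b10]].
simpl; split.
- split; simpl.
  + exact (smf_cmp a1 b1).
  + split; [exact (smf_cmp a2 b2)|]. intros x.
    exact (eq_trans (f_equal (s_ar (mo_base H')) (a2' x)) (b2' _)).
  + intros; rewrite b3, a3; reflexivity.
  + intros; rewrite b4, a4; reflexivity.
  + intros; apply b5, a5; assumption.
  + intros f y Hy. rewrite a6, b6; trivial.
    refine (eq_trans (a3 y) (eq_trans (f_equal _ Hy) _)).
    destruct a2 as [[c1 _ _ _] _ _ _]. symmetry; apply c1.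
- intros o; simpl. rewrite a7, b7; reflexivity.
- intros o t f; simpl. rewrite a8, b8; reflexivity.
- intros o a; simpl. rewrite a9, b9; reflexivity.
- intros o a b s; simpl. rewrite a10, b10. symmetry.
  apply (@m_gen_cast (th_sig (tm_theory K)) K
           (lm_layer (proj1_sig (mo_theory H')) (lm_layer (proj1_sig (mo_theory H)) o))).
Qed.

Lemma model_mor_ext (M N : theory_model) (H H' : model_mor M N) :
  mo_theory (proj1_sig H) = mo_theory (proj1_sig H') ->
  mo_total (proj1_sig H) = mo_total (proj1_sig H') ->
  mo_base (proj1_sig H) = mo_base (proj1_sig H') -> H = H'.
Proof.
destruct H as [[F P Q] h], H' as [[F' P' Q'] h']; simpl; intros -> -> ->.
apply sig_ext; reflexivity.
Qed.

Lemma sfun_idl (C D : cat) (F : sfun C D) : sfun_cmp (sfun_id C) F = F.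
Proof. destruct F; reflexivity. Qed.
Lemma sfun_idr (C D : cat) (F : sfun C D) : sfun_cmp F (sfun_id D) = F.
Proof. destruct F; reflexivity. Qed.

Definition model_mor_id (M : theory_model) : model_mor M M :=
  exist _ _ (model_mor_id_ok M).
Definition model_mor_cmp (M N K : theory_model) (H : model_mor M N) (H' : model_mor N K) :
  model_mor M K := exist _ _ (model_mor_cmp_ok H H').

Lemma model_mor_idl (M N : theory_model) (H : model_mor M N) :
  model_mor_cmp (model_mor_id M) H = H.
Proof. apply model_mor_ext; [apply theory_idl|apply sfun_idl|apply sfun_idl]. Qed.
Lemma model_mor_idr (M N : theory_model) (H : model_mor M N) :
  model_mor_cmp H (model_mor_id N) = H.
Proof. apply model_mor_ext; [apply theory_idr|apply sfun_idr|apply sfun_idr]. Qed.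
Lemma model_mor_assoc (M N K J : theory_model) (H : model_mor M N) (H' : model_mor N K)
  (H'' : model_mor K J) :
  model_mor_cmp (model_mor_cmp H H') H'' = model_mor_cmp H (model_mor_cmp H' H'').
Proof. apply model_mor_ext; [apply theory_assoc|reflexivity|reflexivity]. Qed.

Definition OpFThMod : category :=
  @Category theory_model model_mor model_mor_id model_mor_cmp
    model_mor_idl model_mor_idr model_mor_assoc.

Definition forget : functor OpFThMod OpFTh :=
  @Functor OpFThMod OpFTh tm_theory (fun M N H => mo_theory (proj1_sig H))
    (fun M => eq_refl) (fun M N K H H' => eq_refl).

Inductive path (L : lsig) : layer L -> layer L -> Type :=
| pnil o : path L o o
| pcons o t r (f : fgen L o t) (p : path L t r) : path L o r.
Arguments pnil {L} o.
Arguments pcons {L o t r} f p.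

Fixpoint papp (L : lsig) (o t r : layer L) (p : path L o t) : path L t r -> path L o r :=
  match p in path _ o t return path L t r -> path L o r with
  | pnil o => fun q => q
  | pcons f p => fun q => pcons f (papp p q)
  end.

Record path_ar (L : lsig) := PathAr {
  pa_src : layer L;
  pa_tgt : layer L;
  pa_path : path L pa_src pa_tgt }.

Definition free_cat (L : lsig) : cat := {|
  ob := layer L;
  ar := path_ar L;
  src := @pa_src L;
  tgt := @pa_tgt L;
  idn := fun o => PathAr (pnil o);
  comp := fun p q => the p (fun r => exists o t s (x : path L o t) (y : path L t s),
    p = PathAr x /\ q = PathAr y /\ r = PathAr (papp x y)) |}.

Definition edge (L : lsig) o t (f : fgen L o t) : ar (free_cat L) :=
  PathAr (pcons f (pnil t)).
Arguments edge {L o t} f.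

Definition syn_base (L : lsig) : imcat := fim (free_cat L).

Record sterm (T : theory) := STerm {
  st_src : ty (th_sig T);
  st_tgt : ty (th_sig T);
  st_raw : tm (th_sig T);
  st_ok : term (th_E0 T) st_raw st_src st_tgt }.
Arguments st_src {T} _.
Arguments st_tgt {T} _.
Arguments st_raw {T} _.

Definition sterm_eq (T : theory) (x y : sterm T) : Prop :=
  teq (th_E0 T) (st_src x) (st_src y) /\ teq (th_E0 T) (st_tgt x) (st_tgt y) /\
  tmeq (th_E0 T) (th_E1 T) (st_raw x) (st_raw y).

Definition syn_ob (T : theory) : Type := quot (teq (th_E0 T)).
Definition syn_ar (T : theory) : Type := quot (@sterm_eq T).

Definition syn_ty (T : theory) (U : ty (th_sig T)) : syn_ob T := cls (teq (th_E0 T)) U.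
Definition syn_mk (T : theory) (x : tm (th_sig T)) (U V : ty (th_sig T))
  (H : term (th_E0 T) x U V) : syn_ar T := cls (@sterm_eq T) (STerm T H).

Definition syn_cat (T : theory) : cat := {|
  ob := syn_ob T;
  ar := syn_ar T;
  src := fun h => syn_ty T (st_src (rep h));
  tgt := fun h => syn_ty T (st_tgt (rep h));
  idn := fun A => syn_mk T (tid_l_sort (th_E0 T) (rep A));
  comp := fun h k => the h (fun l => exists x y z,
    h = cls _ x /\ k = cls _ y /\ l = cls _ z /\ st_raw z = st_raw x ;t st_raw y) |}.

Definition syn_mcat (T : theory) : mcat := {|
  mc_cat := syn_cat T;
  one := syn_ty T [];
  tob := fun A B : syn_ob T => syn_ty T (rep A ++ rep B);
  tar := fun h k : syn_ar T => syn_mk T (tm_ten (st_ok (rep h)) (st_ok (rep k))) |}.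

Definition ty_layers (L : lsig) (U : ty L) : list (layer L) := map (@projT1 _ _) U.

Fixpoint tm_proj (L : lsig) (x : tm L) : fim_raw (free_cat L) :=
  match x with
  | @tid _ o A => @fr_id (free_cat L) o
  | tgen o s => @fr_id (free_cat L) o
  | @tapp _ o t f x => @fr_id (free_cat L) t
  | titen o x y => @fr_id (free_cat L) o
  | x ;t y => tm_proj x ;f tm_proj y
  | teps => fr_eps
  | x *t y => tm_proj x *f tm_proj y
  | @tsym _ o t A B => @fr_sym (free_cat L) o t
  | tnab f A => fr_gen (edge f)
  | @tmul _ o A B => @fr_mul (free_cat L) o
  | tunt o => @fr_unt (free_cat L) o
  | @tdup _ o A => @fr_dup (free_cat L) o
  | @tdel _ o A => @fr_del (free_cat L) o
  end.

(** [path_lift p A B x]: [x : (A | B)] is the composite of the [nabla]s along [p]. *)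
Inductive path_lift (L : lsig) :
  forall o t, path L o t -> ity L o -> ity L t -> tm L -> Prop :=
| pl_nil o (A : ity L o) : path_lift (pnil o) A A (tid A)
| pl_cons o t r (f : fgen L o t) (p : path L t r) A B x :
    path_lift p (iapp f A) B x -> path_lift (pcons f p) A B (tnab f A ;t x).

(** [is_lift h U V x]: [x : (U | V)] is the term without non-trivial internal
    structure that lifts [h] at [U]. *)
Inductive is_lift (L : lsig) : fim_raw (free_cat L) -> ty L -> ty L -> tm L -> Prop :=
| il_gen o t (p : path L o t) A B x :
    path_lift p A B x ->
    is_lift (@fr_gen (free_cat L) (PathAr p)) (sg A) (sg B) x
| il_id o (A : ity L o) : is_lift (@fr_id (free_cat L) o) (sg A) (sg A) (tid A)
| il_eps : is_lift (@fr_eps (free_cat L)) [] [] teps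
| il_comp h k U V W x y : is_lift h U V x -> is_lift k V W y ->
    is_lift (h ;f k) U W (x ;t y)
| il_ten h k U V U' V' x y : is_lift h U V x -> is_lift k U' V' y ->
    is_lift (h *f k) (U ++ U') (V ++ V') (x *t y)
| il_sym o t (A : ity L o) (B : ity L t) :
    is_lift (@fr_sym (free_cat L) o t) (sg A ++ sg B) (sg B ++ sg A) (tsym A B)
| il_dup o (A : ity L o) :
    is_lift (@fr_dup (free_cat L) o) (sg A) (sg A ++ sg A) (tdup A)
| il_del o (A : ity L o) : is_lift (@fr_del (free_cat L) o) (sg A) [] (tdel A)
| il_mul o (A B : ity L o) :
    is_lift (@fr_mul (free_cat L) o) (sg A ++ sg B) (sg (iten A B)) (tmul A B)
| il_unt (o : layer L) :
    is_lift (@fr_unt (free_cat L) o) [] (sg (iunit o)) (tunt o).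

Definition syn_proj (T : theory) : sfun (syn_cat T) (syn_base (th_sig T)) :=
  SFun (syn_cat T) (syn_base (th_sig T))
    (fun A : syn_ob T => ty_layers (rep A))
    (fun h : syn_ar T =>
       the (@idn (syn_base (th_sig T)) (ty_layers (st_src (rep h))))
         (fun k => exists r, k = cls _ r /\ ft_raw r = tm_proj (st_raw (rep h)))).

Definition syn_lift (T : theory) (h : ar (syn_base (th_sig T))) (A : syn_ob T) : syn_ar T :=
  the (@idn (syn_cat T) A)
    (fun k => exists r x, h = cls _ r /\ k = cls _ x /\ A = syn_ty T (st_src x) /\
       is_lift (ft_raw r) (st_src x) (st_tgt x) (st_raw x)).

Definition syn_opfib (T : theory) : opfib (syn_mcat T) (syn_base (th_sig T)) :=
  @OpFib (syn_mcat T) (syn_base (th_sig T)) (syn_proj T) (@syn_lift T).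

Definition syn_model (T : theory) : model (th_sig T) :=
  @Model (th_sig T) (free_cat (th_sig T)) (syn_mcat T) (syn_opfib T)
    (fun o => o)
    (fun o t f => edge f)
    (fun o a => syn_ty T (sg (icol o a)))
    (fun o a b s => syn_mk T (tm_int (it_gen (th_E0 T) o a b s))).

(** The 1-equations of a theory are coherent when the syntactic projection is well
    defined on classes of terms and the chosen liftings are opcartesian.  Both can fail:
    if [E1] equates [nabla_{f,A}] with [nabla_{g,A}] for parallel [f] and [g], there is
    no projection to the free base category, and if it equates [m_{A,B};x] with
    [m_{A,B};y], then [m_{A,B}] need not be opcartesian.  *)
Record coherent (T : theory) : Prop := {
  coh_proj : forall x y, th_E1 T x y -> fim_eq (tm_proj x) (tm_proj y);
  coh_lift : forall h A, s_ob (syn_opfib T) A = src h ->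
    opcartesian (syn_opfib T) (lift (syn_opfib T) h A) }.

Definition internal_equations (T : theory) : Prop :=
  forall x y, th_E1 T x y ->
    exists o (A B : ity (th_sig T) o), iterm (th_E0 T) x A B /\ iterm (th_E0 T) y A B.

(* Main.v *)
(** Every term factors as a lifting (built from [nabla], [m], [u], [d], [e] and
    symmetries only) followed by a tensor of internal terms, and the lifting is determined
    by its source and its projection to the base.  Hence the liftings are opcartesian as
    soon as they can be cancelled on the left of vertical arrows.  For theories with
    internal equations this holds because a term [x] acts on lists of internal terms into
    its source, with [nabla_f] acting as [f[-]] and [m] as the internal tensor, and a
    vertical arrow is recovered from this action at the identities.

    In a model the chosen liftings of symmetries, diagonals and maps to the terminal object
    are forced by the compatibility of liftings with products, and the fibrewise monoidal structures are
    strict and preserved by reindexing; this validates all structural equations.  The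
    interpretation is therefore a functor on the syntactic category, and the only one that
    extends the given data.  For a morphism [F : T -> K] and a model of [K], applying this
    to the model of [T] obtained by restriction along [F] gives the unique morphism of
    models above [F], which is the adjunction. *)

Require Import Defs.
From Stdlib Require Import List ClassicalEpsilon FunctionalExtensionality
  PropExtensionality ProofIrrelevance Morphisms.
Import ListNotations.
Set Implicit Arguments.

(** Many equations that present the base and the terms mention only letters and generators, whereas
    the axioms to be verified range over all words and arrows. The bridge is Fox's characterization:
    natural comonoids make the tensor a cartesian product, so symmetries, duplications and deletions
    are fixed by universal properties, and equations between structural maps may be checked on
    tuples of generalized elements. Hexagons, comonoid laws and monoid laws on words then follow
    from naturality and the laws on letters. The obstacle with liftings is that [is_lift] speaks of
    representatives. It is matched with a recursive function on raw base expressions, and invariance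
    of that function under [fim_eq] means finding above each equation of the base an equation of
    terms. Sorts are unique up to congruence, which allows a class to be named by its raw term
    alone. A morphism out of a syntactic model is determined by its theory component. Functoriality
    and the laws of the adjunction are therefore compared on theories only, even though the
    transposes are obtained by choice. *)

(** * Quotients and choice *)

Section Quotients.
Variables (A : Type) (R : A -> A -> Prop).

Lemma quot_surj (q : quot R) : exists a, q = cls R a.
Proof.
destruct q as [P [a ->]]; exists a. apply sig_ext; reflexivity.
Qed.

Lemma cls_rep (q : quot R) : cls R (rep q) = q.
Proof.
unfold rep. destruct (constructive_indefinite_description _ _) as [a e]; simpl.
apply sig_ext; simpl; symmetry; exact e.
Qed.

(** A class is the predicate that it defines, so extensionality turns equivalence into equality. *)
Lemma cls_eq (HR : Equivalence R) a b : R a b -> cls R a = cls R b.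
Proof.
intros H; apply sig_ext; simpl.
apply functional_extensionality; intros c; apply propositional_extensionality.
split; intros H'; [rewrite <- H|rewrite H]; assumption.
Qed.

Lemma cls_inj (HR : Equivalence R) a b : cls R a = cls R b -> R a b.
Proof.
intros H. apply (f_equal (@proj1_sig _ _)) in H; simpl in H. rewrite H. reflexivity.
Qed.

Lemma rep_cls (HR : Equivalence R) a : R (rep (cls R a)) a.
Proof. apply (cls_inj HR), cls_rep. Qed.
End Quotients.

Lemma the_spec (A : Type) (d : A) (P : A -> Prop) : (exists a, P a) -> P (the d P).
Proof. intros H; unfold the; apply epsilon_spec; exact H. Qed.

Lemma the_eq (A : Type) (d : A) (P : A -> Prop) a :
  P a -> (forall b, P b -> b = a) -> the d P = a.
Proof. intros Ha H; apply H, the_spec; exists a; exact Ha. Qed.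

(** * Cartesian strict monoidal categories *)

Existing Class is_cat.
Existing Class is_strict_monoidal.
Existing Class is_cartesian.
Global Existing Instance mon_cat.
Global Existing Instance cart_mon.
Arguments cat_src_id {C _}.
Arguments cat_tgt_id {C _}.
Arguments cat_src_comp {C _}.
Arguments cat_tgt_comp {C _}.
Arguments cat_idl {C _}.
Arguments cat_idr {C _}.
Arguments cat_assoc {C _}.
Arguments mon_src {C _}.
Arguments mon_tgt {C _}.
Arguments mon_id {C _}.
Arguments mon_comp {C _}.
Arguments mon_assoc_ob {C _}.
Arguments mon_assoc_ar {C _}.
Arguments mon_unitl_ob {C _}.
Arguments mon_unitr_ob {C _}.
Arguments mon_unitl_ar {C _}.
Arguments mon_unitr_ar {C _}.

Lemma cat_idl' C (H : is_cat C) x (f : ar C) : src f = x -> idn x ;; f = f.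
Proof. intros <-; apply cat_idl. Qed.
Lemma cat_idr' C (H : is_cat C) x (f : ar C) : tgt f = x -> f ;; idn x = f.
Proof. intros <-; apply cat_idr. Qed.
Arguments cat_idl' {C _} _ _ _.
Arguments cat_idr' {C _} _ _ _.

Lemma bang_spec C (H : is_cartesian C) x : src (bang C x) = x /\ tgt (bang C x) = one.
Proof.
apply (the_spec (idn x) (fun h => src h = x /\ tgt h = one)).
destruct (cart_one H x) as [h [e _]]; exists h; exact e. Qed.
Lemma bang_src C (H : is_cartesian C) x : src (bang C x) = x.
Proof. apply bang_spec, H. Qed.
Lemma bang_tgt C (H : is_cartesian C) x : tgt (bang C x) = one.
Proof. apply bang_spec, H. Qed.
Lemma bang_uniq C (H : is_cartesian C) x (h : ar C) : src h = x -> tgt h = one -> h = bang C x.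
Proof.
intros h1 h2. destruct (cart_one H x) as [k [_ e]].
rewrite <- (e h), <- (e (bang C x)); auto using bang_spec.
Qed.
Arguments bang_src {C _}.
Arguments bang_tgt {C _}.
Arguments bang_uniq {C _}.

Lemma pairing_spec C (H : is_cartesian C) (f g : ar C) :
  src f = src g -> is_pairing C f g (pairing C f g).
Proof.
intros e; apply (the_spec f (is_pairing C f g)). destruct (cart_prod H f g e) as [h [e' _]]; exists h; exact e'.
Qed.
Lemma pairing_src C (H : is_cartesian C) (f g : ar C) :
  src f = src g -> src (pairing C f g) = src f.
Proof. intros e; apply (pairing_spec H f g e). Qed.
Lemma pairing_tgt C (H : is_cartesian C) (f g : ar C) :
  src f = src g -> tgt (pairing C f g) = tgt f ** tgt g.
Proof. intros e; apply (pairing_spec H f g e). Qed.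
Lemma pairing_uniq C (H : is_cartesian C) (f g h : ar C) :
  src f = src g -> is_pairing C f g h -> h = pairing C f g.
Proof.
intros e e'. destruct (cart_prod H f g e) as [k [_ u]].
rewrite <- (u h), <- (u (pairing C f g)); auto using pairing_spec.
Qed.
Arguments pairing_src {C _}.
Arguments pairing_tgt {C _}.

Ltac hyps_st := repeat match goal with
  | H : src ?f = _ |- context [src ?f] => rewrite H
  | H : tgt ?f = _ |- context [tgt ?f] => rewrite H end.

(** Composition is a total function, so every use of a category axiom leaves equations between end
    points. [so] computes both sides, calling itself for the end points of composites and pairings,
    and closes the goal up to strict associativity and units. *)
Ltac so := intros; unfold pr1, pr2; hyps_st;
  repeat first
   [ rewrite cat_src_id | rewrite cat_tgt_id
   | rewrite mon_src | rewrite mon_tgt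
   | rewrite bang_src | rewrite bang_tgt
   | rewrite cat_src_comp by so | rewrite cat_tgt_comp by so
   | rewrite pairing_src by so | rewrite pairing_tgt by so];
  hyps_st;
  rewrite ?mon_assoc_ob, ?mon_unitl_ob, ?mon_unitr_ob;
  first [reflexivity | assumption | congruence].

Section Cartesian.
Variables (C : mcat) (HC : is_cartesian C).
Implicit Types (f g h k : ar C) (x y z : ob C).
Local Notation "<< f , g >>" := (pairing C f g).

Lemma bang_nat f : f ;; bang C (tgt f) = bang C (src f).
Proof. apply bang_uniq; so. Qed.

Lemma bang_one : bang C one = idn one.
Proof. symmetry; apply bang_uniq; so. Qed.

Lemma pr1_src x y : src (pr1 C x y) = x ** y. Proof. so. Qed.
Lemma pr2_src x y : src (pr2 C x y) = x ** y. Proof. so. Qed.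
Lemma pr1_tgt x y : tgt (pr1 C x y) = x. Proof. so. Qed.
Lemma pr2_tgt x y : tgt (pr2 C x y) = y. Proof. so. Qed.

Lemma pairing_pr1 f g x y : src f = src g -> x = tgt f -> y = tgt g ->
  <<f, g>> ;; pr1 C x y = f.
Proof. intros e -> ->; apply (pairing_spec HC f g e). Qed.
Lemma pairing_pr2 f g x y : src f = src g -> x = tgt f -> y = tgt g ->
  <<f, g>> ;; pr2 C x y = g.
Proof. intros e -> ->; apply (pairing_spec HC f g e). Qed.

Lemma pairing_ext f g h : src f = src g -> src h = src f -> tgt h = tgt f ** tgt g ->
  h ;; pr1 C (tgt f) (tgt g) = f -> h ;; pr2 C (tgt f) (tgt g) = g -> h = <<f, g>>.
Proof. intros; apply (pairing_uniq HC); [assumption|split; auto]. Qed.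

(** The second factor is absorbed by naturality of the map to the unit. *)
Lemma ten_pr1 h k : (h ## k) ;; pr1 C (tgt h) (tgt k) = pr1 C (src h) (src k) ;; h.
Proof.
unfold pr1. rewrite <- mon_comp by so. rewrite bang_nat, cat_idr.
rewrite <- (mon_unitr_ar h) at 3. rewrite <- mon_comp by so.
rewrite cat_idl, cat_idr' by so. reflexivity.
Qed.
Lemma ten_pr2 h k : (h ## k) ;; pr2 C (tgt h) (tgt k) = pr2 C (src h) (src k) ;; k.
Proof.
unfold pr2. rewrite <- mon_comp by so. rewrite bang_nat, cat_idr.
rewrite <- (mon_unitl_ar k) at 3. rewrite <- mon_comp by so.
rewrite cat_idl, cat_idr' by so. reflexivity.
Qed.

Lemma pairing_ten f g h k : src f = src g -> tgt f = src h -> tgt g = src k ->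
  <<f, g>> ;; (h ## k) = <<f ;; h, g ;; k>>.
Proof.
intros e1 e2 e3. apply pairing_ext; try so.
- replace (tgt (f ;; h)) with (tgt h) by so. replace (tgt (g ;; k)) with (tgt k) by so.
  rewrite cat_assoc by so. rewrite ten_pr1. rewrite <- cat_assoc by so.
  rewrite pairing_pr1 by so. reflexivity.
- replace (tgt (f ;; h)) with (tgt h) by so. replace (tgt (g ;; k)) with (tgt k) by so.
  rewrite cat_assoc by so. rewrite ten_pr2. rewrite <- cat_assoc by so.
  rewrite pairing_pr2 by so. reflexivity.
Qed.

Lemma comp_pairing k f g : src f = src g -> tgt k = src f ->
  k ;; <<f, g>> = <<k ;; f, k ;; g>>.
Proof.
intros e1 e2. apply pairing_ext; try so.
- replace (tgt (k ;; f)) with (tgt f) by so. replace (tgt (k ;; g)) with (tgt g) by so.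
  rewrite cat_assoc by so. rewrite pairing_pr1 by so. reflexivity.
- replace (tgt (k ;; f)) with (tgt f) by so. replace (tgt (k ;; g)) with (tgt g) by so.
  rewrite cat_assoc by so. rewrite pairing_pr2 by so. reflexivity.
Qed.

Lemma pairing_unitr f g : src f = src g -> tgt g = one -> <<f, g>> = f.
Proof.
intros e1 e2; symmetry; apply pairing_ext; try so.
- unfold pr1. rewrite e2, bang_one, mon_unitr_ar. apply cat_idr.
- unfold pr2. rewrite e2, mon_unitr_ar, bang_nat. symmetry; apply bang_uniq; so.
Qed.
Lemma pairing_unitl f g : src f = src g -> tgt f = one -> <<f, g>> = g.
Proof.
intros e1 e2; symmetry; apply pairing_ext; try so.
- unfold pr1. rewrite e2, mon_unitl_ar, bang_nat. symmetry; apply bang_uniq; so.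
- unfold pr2. rewrite e2, bang_one, mon_unitl_ar. apply cat_idr.
Qed.

Lemma pairing_id x y : <<pr1 C x y, pr2 C x y>> = idn (x ** y).
Proof.
symmetry; apply pairing_ext; try so; rewrite ?pr1_tgt, ?pr2_tgt; apply cat_idl'; so.
Qed.

Lemma pr_decomp h x y : tgt h = x ** y -> h = <<h ;; pr1 C x y, h ;; pr2 C x y>>.
Proof.
intros e. rewrite <- comp_pairing by so. rewrite pairing_id. rewrite cat_idr'; so.
Qed.

Lemma pairing_assoc f g h : src f = src g -> src g = src h ->
  <<<<f, g>>, h>> = <<f, <<g, h>>>>.
Proof.
intros e1 e2.
(* Since the product is strictly associative, a triple product has two sets of iterated projections,
   one for each bracketing; [p1], [p2] and [p3] say that they coincide. *)
assert (p1 : forall x y z, pr1 C (x ** y) z ;; pr1 C x y = pr1 C x (y ** z)).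
{ intros. unfold pr1. rewrite <- (mon_unitr_ar (idn x ## bang C y)).
  rewrite <- mon_id, !mon_assoc_ar. rewrite <- !mon_comp by so.
  rewrite !cat_idl', cat_idr' by so. f_equal. apply bang_uniq; so. }
assert (p2 : forall x y z, pr1 C (x ** y) z ;; pr2 C x y = pr2 C x (y ** z) ;; pr1 C y z).
{ intros. unfold pr1, pr2. rewrite <- mon_id, !mon_assoc_ar.
  transitivity (bang C x ## idn y ## bang C z).
  - rewrite <- (mon_unitr_ar (bang C x ## idn y)). rewrite !mon_assoc_ar.
    rewrite <- !mon_comp by so. rewrite !cat_idl', cat_idr' by so. reflexivity.
  - rewrite <- (mon_unitl_ar (idn y ## bang C z)) at 2.
    rewrite <- !mon_comp by so. rewrite !cat_idl', cat_idr' by so. reflexivity. }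
assert (p3 : forall x y z, pr2 C (x ** y) z = pr2 C x (y ** z) ;; pr2 C y z).
{ intros. unfold pr2. rewrite <- (mon_unitl_ar (bang C y ## idn z)).
  rewrite <- mon_id, <- mon_comp, <- mon_comp by so.
  rewrite cat_idl', cat_idr', cat_idl' by so. rewrite <- mon_assoc_ar. f_equal.
  symmetry; apply bang_uniq; so. }
symmetry. apply pairing_ext; try so; rewrite ?(pairing_tgt f g), ?(pairing_tgt g h) by so.
- rewrite (pr_decomp (<<f, <<g, h>>>> ;; _) (tgt f) (tgt g)) by so.
  rewrite !cat_assoc by so. rewrite p1, p2.
  rewrite pairing_pr1 by so. f_equal.
  rewrite <- cat_assoc, pairing_pr2, pairing_pr1 by so. reflexivity.
- rewrite p3. rewrite <- cat_assoc, !pairing_pr2 by so. reflexivity.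
Qed.

Lemma swap_src x y : src (swap C x y) = x ** y. Proof. unfold swap. so. Qed.
Lemma swap_tgt x y : tgt (swap C x y) = y ** x. Proof. unfold swap. so. Qed.
Lemma diag_src x : src (diag C x) = x. Proof. unfold diag. so. Qed.
Lemma diag_tgt x : tgt (diag C x) = x ** x. Proof. unfold diag. so. Qed.

Lemma pairing_swap f g x y : src f = src g -> tgt f = x -> tgt g = y ->
  <<f, g>> ;; swap C x y = <<g, f>>.
Proof.
intros e1 e2 e3; unfold swap. rewrite comp_pairing by so.
rewrite pairing_pr1, pairing_pr2 by so. reflexivity.
Qed.

Lemma comp_diag f x : tgt f = x -> f ;; diag C x = <<f, f>>.
Proof. intros e; unfold diag. rewrite comp_pairing by so. rewrite cat_idr'; so. Qed.

Lemma comp_bang f x : tgt f = x -> f ;; bang C x = bang C (src f).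
Proof. intros <-; apply bang_nat. Qed.

(** The instance at the identity already gives the conclusion; quantifying over all [f] lets later
    proofs compute with [f] as a generalized element of [x]. *)
Lemma element_ext1 h k x : src h = x -> src k = x ->
  (forall f, tgt f = x -> f ;; h = f ;; k) -> h = k.
Proof.
intros <- e H. rewrite <- (cat_idl h), <- (cat_idl k), e. apply H; so.
Qed.
Lemma element_ext2 h k x y : src h = x ** y -> src k = x ** y ->
  (forall f g, src f = src g -> tgt f = x -> tgt g = y -> <<f, g>> ;; h = <<f, g>> ;; k) ->
  h = k.
Proof.
intros e1 e2 H. apply (element_ext1 h k e1 e2). intros f e.
rewrite (pr_decomp f x y e). apply H; so.
Qed.
Lemma element_ext3 h k x y z : src h = x ** y ** z -> src k = x ** y ** z ->
  (forall f g g', src f = src g -> src g = src g' -> tgt f = x -> tgt g = y -> tgt g' = z ->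
    <<f, <<g, g'>>>> ;; h = <<f, <<g, g'>>>> ;; k) -> h = k.
Proof.
intros e1 e2 H. apply (element_ext2 h k e1 e2). intros f g e3 e4 e5.
rewrite (pr_decomp g y z e5). apply H; so.
Qed.
End Cartesian.
Arguments bang_nat {C _}.
Arguments bang_one {C _}.
Arguments pr1_src {C _}.
Arguments pr2_src {C _}.
Arguments pr1_tgt {C _}.
Arguments pr2_tgt {C _}.
Arguments pairing_pr1 {C _}.
Arguments pairing_pr2 {C _}.
Arguments pairing_ext {C _}.
Arguments ten_pr1 {C _}.
Arguments ten_pr2 {C _}.
Arguments pairing_ten {C _}.
Arguments comp_pairing {C _}.
Arguments pairing_unitr {C _}.
Arguments pairing_unitl {C _}.
Arguments pairing_id {C _}.
Arguments pr_decomp {C _}.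
Arguments pairing_assoc {C _}.
Arguments swap_src {C _}.
Arguments swap_tgt {C _}.
Arguments diag_src {C _}.
Arguments diag_tgt {C _}.
Arguments pairing_swap {C _}.
Arguments comp_diag {C _}.
Arguments comp_bang {C _}.
Arguments element_ext1 {C _}.
Arguments element_ext2 {C _}.
Arguments element_ext3 {C _}.

Ltac so ::= intros; unfold pr1, pr2; hyps_st;
  repeat first
   [ rewrite cat_src_id | rewrite cat_tgt_id
   | rewrite mon_src | rewrite mon_tgt
   | rewrite bang_src | rewrite bang_tgt
   | rewrite swap_src  | rewrite swap_tgt
   | rewrite diag_src  | rewrite diag_tgt
   | rewrite cat_src_comp by so | rewrite cat_tgt_comp by so
   | rewrite pairing_src by so | rewrite pairing_tgt by so];
  hyps_st;
  rewrite ?mon_assoc_ob, ?mon_unitl_ob, ?mon_unitr_ob;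
  first [reflexivity | assumption | congruence].

(** Pushes a tuple of elements through a composite of structural maps, so that an equation between
    such maps becomes an equality of tuples. *)
Ltac elt := repeat first
  [ rewrite <- cat_assoc by so
  | rewrite comp_diag by so
  | rewrite comp_bang by so
  | rewrite pairing_swap by so
  | rewrite pairing_ten by so
  | rewrite cat_idr' by so | rewrite cat_idl' by so ].

Section CartesianStructure.
Variables (C : mcat) (HC : is_cartesian C).
Implicit Types (f g h k : ar C) (x y z : ob C).
Local Notation "<< f , g >>" := (pairing C f g).

Lemma swap_inv x y : swap C x y ;; swap C y x = idn (x ** y).
Proof.
apply (element_ext2) with (x := x) (y := y); [so..|]; intros.
elt. reflexivity.
Qed.

Lemma swap_nat f g : (f ## g) ;; swap C (tgt f) (tgt g) = swap C (src f) (src g) ;; (g ## f).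
Proof.
apply (element_ext2) with (x := src f) (y := src g); [so..|]; intros a b e1 e2 e3.
elt. reflexivity.
Qed.

Lemma swap_hex x y z :
  swap C x (y ** z) = (swap C x y ## idn z) ;; (idn y ## swap C x z).
Proof.
apply (element_ext3) with (x := x) (y := y) (z := z); [so..|]; intros a b c ? ? ? ? ?.
(* Both sides permute the same three elements; only the bracketing has to be moved between the two
   swaps. *)
rewrite pairing_swap by so. rewrite <- (pairing_assoc a b c) by so.
elt. rewrite !pairing_assoc by so. elt. reflexivity.
Qed.

Lemma swap_hex' x y z :
  swap C (x ** y) z = (idn x ## swap C y z) ;; (swap C x z ## idn y).
Proof.
apply (element_ext3) with (x := x) (y := y) (z := z); [so..|]; intros a b c ? ? ? ? ?.
elt. rewrite (pairing_swap b c) by so. rewrite <- !(pairing_assoc a) by so.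
elt. rewrite pairing_assoc by so. reflexivity.
Qed.

Lemma swap_onel x : swap C one x = idn x.
Proof.
unfold swap. rewrite pairing_unitr by so. unfold pr2. rewrite bang_one.
apply mon_unitl_ar.
Qed.
Lemma swap_oner x : swap C x one = idn x.
Proof.
unfold swap. rewrite pairing_unitl by so. unfold pr1. rewrite bang_one.
apply mon_unitr_ar.
Qed.

Lemma bang_tensor x y : bang C (x ** y) = bang C x ## bang C y.
Proof. symmetry; apply bang_uniq; so. Qed.

Lemma diag_one : diag C one = idn one.
Proof. unfold diag. rewrite pairing_unitr; so. Qed.

Lemma diag_assoc x : diag C x ;; (diag C x ## idn x) = diag C x ;; (idn x ## diag C x).
Proof.
apply element_ext1 with (x := x); [so|so|]; intros; elt.
apply pairing_assoc; so.
Qed.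

Lemma diag_unitl x : diag C x ;; (bang C x ## idn x) = idn x.
Proof.
apply (element_ext1) with (x := x); [so|so|]; intros; elt.
apply pairing_unitl; so.
Qed.

Lemma diag_unitr x : diag C x ;; (idn x ## bang C x) = idn x.
Proof.
apply (element_ext1) with (x := x); [so|so|]; intros; elt.
apply pairing_unitr; so.
Qed.

Lemma diag_nat f : f ;; diag C (tgt f) = diag C (src f) ;; (f ## f).
Proof.
apply (element_ext1) with (x := src f); [so|so|]; intros; elt.
reflexivity.
Qed.

Lemma diag_tensor x y :
  diag C (x ** y) = (diag C x ## diag C y) ;; (idn x ## swap C x y ## idn y).
Proof.
apply (element_ext2) with (x := x) (y := y); [so..|]; intros. elt.
rewrite !(pairing_assoc) by so. elt. rewrite <- (pairing_assoc f g g) by so. elt.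
rewrite !(pairing_assoc) by so. reflexivity.
Qed.
End CartesianStructure.
Arguments swap_inv {C _}.
Arguments swap_nat {C _}.
Arguments swap_hex {C _}.
Arguments swap_hex' {C _}.
Arguments swap_hex {C _}.
Arguments swap_hex' {C _}.
Arguments swap_onel {C _}.
Arguments swap_oner {C _}.
Arguments bang_tensor {C _}.
Arguments diag_one {C _}.
Arguments diag_assoc {C _}.
Arguments diag_unitl {C _}.
Arguments diag_unitr {C _}.
Arguments diag_nat {C _}.
Arguments diag_tensor {C _}.

Lemma cartesian_symmetric (C : imcat) (HC : is_cartesian C) :
  (forall x y : ob C, sym x y = swap C x y) -> is_symmetric C.
Proof.
intros e; split; intros; rewrite ?e; first [exact _|so|idtac].
- apply swap_inv.
- apply swap_nat.
- apply swap_hex.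
Qed.

Lemma cartesian_comonoids (C : imcat) (HC : is_cartesian C) :
  (forall x y : ob C, sym x y = swap C x y) -> (forall x : ob C, dup x = diag C x) ->
  (forall x : ob C, del x = bang C x) -> has_uniform_comonoids C.
Proof.
intros e e' e''; split; intros; rewrite ?e, ?e', ?e''; first [so|idtac].
- apply diag_assoc.
- apply diag_unitl.
- apply diag_unitr.
- apply diag_nat.
- apply bang_nat.
- apply diag_one.
- apply bang_one.
- symmetry; apply diag_tensor.
Qed.

(** Fox's criterion, in the form that the presentations of [fim] and of terms allow:
    only symmetries of letters with words, and counitality on letters, enter. *)
Section CartesianOfComonoids.
Variables (C : mcat) (HC : is_strict_monoidal C) (letter : ob C -> Prop)
  (sy : ob C -> ob C -> ar C) (du de : ob C -> ar C).
Hypotheses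
  (ind : forall P : ob C -> Prop, P one -> (forall a w, letter a -> P w -> P (a ** w)) ->
    forall w, P w)
  (sy_src : forall x y, src (sy x y) = x ** y) (sy_tgt : forall x y, tgt (sy x y) = y ** x)
  (sy_nat : forall f g, (f ## g) ;; sy (tgt f) (tgt g) = sy (src f) (src g) ;; (g ## f))
  (sy_onel : forall x, sy one x = idn x) (sy_oner : forall x, sy x one = idn x)
  (du_src : forall x, src (du x) = x) (du_tgt : forall x, tgt (du x) = x ** x)
  (du_nat : forall f, f ;; du (tgt f) = du (src f) ;; (f ## f))
  (du_one : du one = idn one)
  (du_cons : forall a w, letter a ->
    du (a ** w) = (du a ## du w) ;; (idn a ## sy a w ## idn w))
  (de_src : forall x, src (de x) = x) (de_tgt : forall x, tgt (de x) = one)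
  (de_nat : forall f, f ;; de (tgt f) = de (src f))
  (de_one : de one = idn one)
  (counitl : forall a, letter a -> du a ;; (de a ## idn a) = idn a)
  (counitr : forall a, letter a -> du a ;; (idn a ## de a) = idn a).

Local Ltac so' := intros; hyps_st;
  repeat first
   [ rewrite cat_src_id | rewrite cat_tgt_id
   | rewrite mon_src | rewrite mon_tgt
   | rewrite sy_src | rewrite sy_tgt | rewrite du_src | rewrite du_tgt
   | rewrite de_src | rewrite de_tgt
   | rewrite cat_src_comp by so' | rewrite cat_tgt_comp by so' ];
  hyps_st;
  rewrite ?mon_assoc_ob, ?mon_unitl_ob, ?mon_unitr_ob;
  first [reflexivity | assumption | congruence].

(** Naturality of [de] at [h] together with [de one = idn one] makes the unit terminal. *)
Lemma de_uniq h : tgt h = one -> h = de (src h).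
Proof. intros e. rewrite <- de_nat, e, de_one. rewrite cat_idr'; so'. Qed.

Lemma de_bang x : bang C x = de x.
Proof.
apply the_eq; [split; so'|]. intros h [e1 e2]. rewrite (de_uniq h e2), e1. reflexivity.
Qed.

Lemma de_tensor x y : de (x ** y) = de x ## de y.
Proof. rewrite (de_uniq (de x ## de y)) by so'. f_equal. so'. Qed.

(** This joint counit law is the form that uniqueness of pairings needs; setting one factor to the
    unit recovers each counit law on words. The induction treats [x = one] first, by induction on
    [y], because [du_cons] peels letters only from the left. *)
Lemma du_counit x y :
  du (x ** y) ;; ((idn x ## de y) ## (de x ## idn y)) = idn (x ** y).
Proof.
revert x y. apply (ind (fun x => forall y, _)).
- intros y. rewrite mon_unitl_ob, de_one, !mon_unitl_ar. revert y. apply ind.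
  + rewrite du_one, de_one, mon_unitl_ar. apply cat_idr'; so'.
  + intros a w Ha IH. rewrite du_cons by assumption.
    replace (de (a ** w) ## idn (a ** w)) with (de a ## (de w ## idn a) ## idn w)
      by (rewrite de_tensor, <- mon_id, !mon_assoc_ar; reflexivity).
    rewrite cat_assoc by so'. rewrite <- mon_comp by so'.
    rewrite <- (mon_comp (sy a w)) by so'.
    (* Deleting [w] on one side of the symmetry turns it into a symmetry with the unit, which is an
       identity. *)
    pose proof (sy_nat (idn a) (de w)) as n. rewrite cat_src_id, cat_tgt_id, de_src, de_tgt in n.
    rewrite sy_oner in n. rewrite (cat_idr' a) in n by so'. rewrite <- n.
    rewrite !cat_idl' by so'.
    replace (de a ## (idn a ## de w) ## idn w) with ((de a ## idn a) ## (de w ## idn w))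
      by (rewrite !mon_assoc_ar; reflexivity).
    rewrite <- mon_comp by so'. rewrite counitl, IH by assumption. apply mon_id.
- intros a w Ha IH y. rewrite mon_assoc_ob, du_cons by assumption.
  transitivity (((du a ;; (idn a ## de a)) ## (du (w ** y) ;; ((idn w ## de y) ## (de w ## idn y))))).
  2: { rewrite counitr, IH, mon_id, ?mon_assoc_ob by assumption. reflexivity. }
  rewrite mon_comp by so'. rewrite !cat_assoc by so'. f_equal.
  (* Here the letter is deleted instead, which again trivializes its symmetry with the remaining
     word. *)
  pose proof (sy_nat (de a) (idn w ## de y)) as n.
  replace (tgt (de a)) with (@one C) in n by so'. rewrite sy_onel in n.
  rewrite cat_idr' in n by so'.
  replace (src (de a)) with a in n by so'.
  replace (src (idn w ## de y)) with (w ** y) in n by so'.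
  rewrite de_tensor, <- (mon_id a w).
  replace (((idn a ## idn w) ## de y) ## (de a ## de w) ## idn y)
    with (idn a ## ((idn w ## de y) ## de a) ## (de w ## idn y))
    by (rewrite !mon_assoc_ar; reflexivity).
  rewrite <- mon_comp by so'. rewrite <- (mon_comp (sy a (w ** y))) by so'.
  rewrite <- n, !cat_idl' by so'. rewrite !mon_assoc_ar. reflexivity.
Qed.

Lemma du_counitr x : du x ;; (idn x ## de x) = idn x.
Proof.
pose proof (du_counit x one) as H. rewrite de_one, !mon_unitr_ar, mon_unitr_ob in H.
exact H.
Qed.

Lemma du_counitl x : du x ;; (de x ## idn x) = idn x.
Proof.
pose proof (du_counit one x) as H. rewrite de_one, !mon_unitl_ar, mon_unitl_ob in H.
exact H.
Qed.

Lemma pairing_of_du f g : src f = src g -> is_pairing C f g (du (src f) ;; (f ## g)).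
Proof.
intros e. split; [so'|]. split; [so'|]. unfold pr1, pr2. rewrite !de_bang.
rewrite !cat_assoc by so'. rewrite <- !mon_comp by so'. rewrite !de_nat, !cat_idr. split.
- rewrite <- (cat_idl f) at 2. rewrite <- (cat_idr' one (de (src g))) by so'.
  rewrite mon_comp by so'. rewrite mon_unitr_ar.
  rewrite <- e. rewrite <- cat_assoc by so'. rewrite du_counitr. apply cat_idl.
- rewrite <- (cat_idl g). rewrite <- (cat_idr' one (de (src f))) by so'.
  rewrite mon_comp by so'. rewrite mon_unitl_ar.
  rewrite <- e. rewrite <- cat_assoc by so'. rewrite du_counitl. reflexivity.
Qed.

(** Naturality of [du] at [h] moves the duplication behind [h], where [du_counit] on the product
    [tgt f ** tgt g] removes it. *)
Lemma pairing_of_du_uniq f g h :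
  src f = src g -> is_pairing C f g h -> h = du (src f) ;; (f ## g).
Proof.
intros e [e1 [e2 [e3 e4]]]. rewrite <- e3, <- e4 at 2.
unfold pr1, pr2. rewrite !de_bang.
rewrite mon_comp by so'. rewrite <- e1, <- cat_assoc by so'.
rewrite <- du_nat. rewrite e2, cat_assoc by so'. rewrite du_counit.
symmetry. apply cat_idr'; so'.
Qed.

Lemma comonoids_cartesian : is_cartesian C.
Proof.
split; [exact HC| |].
- intros x. exists (de x). split; [split; so'|]. intros h [<- e]. symmetry; apply de_uniq, e.
- intros f g e. exists (du (src f) ;; (f ## g)). split; [apply pairing_of_du, e|].
  intros h Hh. symmetry; apply pairing_of_du_uniq; assumption.
Qed.

Lemma diag_of_comonoids x : diag C x = du x.
Proof.
unfold diag. symmetry. apply (pairing_uniq comonoids_cartesian); [reflexivity|].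
pose proof (pairing_of_du (idn x) (idn x) eq_refl) as H.
rewrite mon_id, cat_src_id, (cat_idr' (x ** x)) in H by so'. exact H.
Qed.

(** Composing with a projection deletes one factor, and naturality reduces the symmetry to one with
    the unit. *)
Lemma swap_of_comonoids x y : swap C x y = sy x y.
Proof.
unfold swap. symmetry. apply (pairing_uniq comonoids_cartesian); [unfold pr1, pr2; rewrite !de_bang; so'|].
unfold pr1, pr2. rewrite !de_bang.
split; [so'|]. split; [so'|]. unfold pr1, pr2. rewrite !de_bang.
rewrite !mon_tgt, !cat_tgt_id, !de_tgt, mon_unitl_ob, mon_unitr_ob. split.
- pose proof (sy_nat (de x) (idn y)) as n. rewrite !de_src, !de_tgt, cat_src_id, cat_tgt_id in n.
  rewrite <- n, sy_onel. apply cat_idr'; so'.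
- pose proof (sy_nat (idn x) (de y)) as n. rewrite !de_src, !de_tgt, cat_src_id, cat_tgt_id in n.
  rewrite <- n, sy_oner. apply cat_idr'; so'.
Qed.

Lemma cartesian_of_comonoids : is_cartesian C /\
  (forall x y, swap C x y = sy x y) /\ (forall x, diag C x = du x).
Proof.
exact (conj comonoids_cartesian (conj swap_of_comonoids diag_of_comonoids)).
Qed.
End CartesianOfComonoids.

(** * Monoid laws on words from monoid laws on letters *)

Section MonoidWords.
Variables (C : mcat) (HC : is_cartesian C) (letter : ob C -> Prop)
  (mu un : ob C -> ar C).
Hypotheses
  (ind : forall P : ob C -> Prop, P one -> (forall a w, letter a -> P w -> P (a ** w)) ->
    forall w, P w)
  (mu_src : forall x, src (mu x) = x ** x) (mu_tgt : forall x, tgt (mu x) = x)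
  (un_src : forall x, src (un x) = one) (un_tgt : forall x, tgt (un x) = x)
  (mu_one : mu one = idn one) (un_one : un one = idn one)
  (mu_cons : forall a w, letter a ->
    mu (a ** w) = (idn a ## swap C w a ## idn w) ;; (mu a ## mu w))
  (un_cons : forall a w, letter a -> un (a ** w) = un a ## un w)
  (mu_assoc : forall a, letter a ->
    (mu a ## idn a) ;; mu a = (idn a ## mu a) ;; mu a)
  (mu_unitl : forall a, letter a -> (un a ## idn a) ;; mu a = idn a)
  (mu_unitr : forall a, letter a -> (idn a ## un a) ;; mu a = idn a).
Local Notation "<< f , g >>" := (pairing C f g).

Local Ltac so' := intros; unfold pr1, pr2; hyps_st;
  repeat first
   [ rewrite cat_src_id | rewrite cat_tgt_id
   | rewrite mon_src | rewrite mon_tgt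
   | rewrite bang_src | rewrite bang_tgt
   | rewrite mu_src | rewrite mu_tgt | rewrite un_src | rewrite un_tgt
   | rewrite swap_src | rewrite swap_tgt
   | rewrite diag_src | rewrite diag_tgt
   | rewrite cat_src_comp by so' | rewrite cat_tgt_comp by so'
   | rewrite pairing_src by so' | rewrite pairing_tgt by so'];
  hyps_st;
  rewrite ?mon_assoc_ob, ?mon_unitl_ob, ?mon_unitr_ob;
  first [reflexivity | assumption | congruence].

Lemma mu_pairing_letter a w f f' g g' : letter a ->
  src f = src f' -> src f' = src g -> src g = src g' ->
  tgt f = a -> tgt f' = w -> tgt g = a -> tgt g' = w ->
  <<<<f, f'>>, <<g, g'>>>> ;; mu (a ** w) = <<<<f, g>> ;; mu a, <<f', g'>> ;; mu w>>.
Proof.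
intros. rewrite mu_cons by assumption. rewrite <- cat_assoc by so'.
rewrite pairing_assoc by so'. rewrite pairing_ten by so'. rewrite (cat_idr' a f) by so'.
rewrite <- (pairing_assoc f' g g') by so'. rewrite (pairing_ten <<f', g>> g') by so'.
rewrite pairing_swap by so'. rewrite (cat_idr' w g') by so'.
rewrite (pairing_assoc g f' g') by so'. rewrite <- (pairing_assoc f g) by so'.
apply pairing_ten; so'.
Qed.

(** On elements the shuffle hidden in the multiplication of a word disappears and multiplication is
    componentwise. Peeling one letter off [w] is the recursion that defines [mu]. *)
Lemma mu_pairing w v f f' g g' :
  src f = src f' -> src f' = src g -> src g = src g' ->
  tgt f = w -> tgt f' = v -> tgt g = w -> tgt g' = v ->
  <<<<f, f'>>, <<g, g'>>>> ;; mu (w ** v) = <<<<f, g>> ;; mu w, <<f', g'>> ;; mu v>>.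
Proof.
revert w f f' g g'. refine (ind (fun w => forall f f' g g', _) _ _).
- intros f f' g g'; intros. rewrite !(pairing_unitl f), !(pairing_unitl g), mon_unitl_ob by so'.
  symmetry; apply pairing_unitl; so'.
- intros a w Ha IH f f' g g' e1 e2 e3 e4 e5 e6 e7.
  rewrite (pr_decomp f a w e4), (pr_decomp g a w e6).
  rewrite (pairing_assoc _ _ f'), (pairing_assoc _ _ g') by so'. rewrite mon_assoc_ob.
  rewrite mu_pairing_letter by first [assumption|so'].
  rewrite (mu_pairing_letter (a := a) (w := w)) by first [assumption|so']. rewrite IH by so'.
  rewrite pairing_assoc by so'. reflexivity.
Qed.

Lemma un_tensor w v : un (w ** v) = un w ## un v.
Proof.
revert w. apply ind.
- rewrite un_one, mon_unitl_ob, mon_unitl_ar. reflexivity.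
- intros a w Ha IH. rewrite mon_assoc_ob, (un_cons (w ** v)), (un_cons w), IH, mon_assoc_ar by assumption.
  reflexivity.
Qed.

Lemma un_pairing w v f : tgt f = one -> f ;; un (w ** v) = <<f ;; un w, f ;; un v>>.
Proof.
intros e. rewrite un_tensor, <- (pairing_unitl f f) at 1 by so'. apply pairing_ten; so'.
Qed.

(** By [mu_pairing] the law splits into a law for the first letter and the same law for the
    remaining word. *)
Lemma mu_elt_assoc w f g h :
  src f = src g -> src g = src h -> tgt f = w -> tgt g = w -> tgt h = w ->
  <<<<f, g>> ;; mu w, h>> ;; mu w = <<f, <<g, h>> ;; mu w>> ;; mu w.
Proof.
revert w f g h. refine (ind (fun w => forall f g h, _) _ _).
- intros f g h; intros. rewrite mu_one. rewrite (pairing_unitl f g), (pairing_unitl g h) by so'.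
  rewrite (cat_idr' one g), (cat_idr' one h) by so'. rewrite !pairing_unitl by so'. reflexivity.
- intros a w Ha IH f g h e1 e2 e3 e4 e5.
  rewrite (pr_decomp f a w e3), (pr_decomp g a w e4), (pr_decomp h a w e5).
  rewrite (mu_pairing (w := a) (v := w) (f ;; _)) by so'.
  rewrite (mu_pairing (w := a) (v := w) (g ;; _)) by so'.
  rewrite !(mu_pairing (w := a) (v := w)) by so'. rewrite IH by so'. f_equal.
  (* What remains is the letter: associativity of [mu a] evaluated at three elements. *)
  assert (K : forall f g h : ar C,
    src f = src g -> src g = src h -> tgt f = a -> tgt g = a -> tgt h = a ->
    <<<<f, g>> ;; mu a, h>> ;; mu a = <<f, <<g, h>> ;; mu a>> ;; mu a).
  { clear f g h e1 e2 e3 e4 e5. intros f g h; intros.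
    transitivity (<<<<f, g>>, h>> ;; ((mu a ## idn a) ;; mu a)).
    - rewrite <- cat_assoc by so'. rewrite pairing_ten by so'. rewrite (cat_idr' a h) by so'.
      reflexivity.
    - rewrite mu_assoc, pairing_assoc, <- cat_assoc by first [assumption|so'].
      rewrite pairing_ten by so'. rewrite (cat_idr' a f) by so'. reflexivity. }
  apply K; so'.
Qed.

Lemma mu_elt_unitl w f g : src f = src g -> tgt f = one -> tgt g = w ->
  <<f ;; un w, g>> ;; mu w = g.
Proof.
revert w f g. refine (ind (fun w => forall f g, _) _ _).
- intros f g; intros. rewrite mu_one, cat_idr' by so'. apply pairing_unitl; so'.
- intros a w Ha IH f g e1 e2 e3.
  rewrite un_pairing by so'. rewrite (pr_decomp g a w e3) at 1.
  rewrite mu_pairing by so'. rewrite IH by so'.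
  rewrite (pr_decomp g a w e3) at 3. f_equal.
  rewrite <- (pairing_unitl f (g ;; pr1 C a w)) at 2 by so'.
  transitivity (<<f, g ;; pr1 C a w>> ;; ((un a ## idn a) ;; mu a)).
  + rewrite <- cat_assoc by so'. rewrite pairing_ten by so'.
    rewrite (cat_idr' a) by so'. reflexivity.
  + rewrite mu_unitl by assumption. apply cat_idr'. so'.
Qed.

Lemma mu_elt_unitr w f g : src f = src g -> tgt f = one -> tgt g = w ->
  <<g, f ;; un w>> ;; mu w = g.
Proof.
revert w f g. refine (ind (fun w => forall f g, _) _ _).
- intros f g; intros. rewrite mu_one, cat_idr' by so'. apply pairing_unitr; so'.
- intros a w Ha IH f g e1 e2 e3.
  rewrite un_pairing by so'. rewrite (pr_decomp g a w e3) at 1.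
  rewrite mu_pairing by so'. rewrite IH by so'.
  rewrite (pr_decomp g a w e3) at 3. f_equal.
  rewrite <- (pairing_unitr (g ;; pr1 C a w) f) at 2 by so'.
  transitivity (<<g ;; pr1 C a w, f>> ;; ((idn a ## un a) ;; mu a)).
  + rewrite <- cat_assoc by so'. rewrite pairing_ten by so'.
    rewrite (cat_idr' a (g ;; pr1 C a w)) by so'. reflexivity.
  + rewrite mu_unitr by assumption. apply cat_idr'. so'.
Qed.

Lemma monoid_words :
  (forall w, (mu w ## idn w) ;; mu w = (idn w ## mu w) ;; mu w) /\
  (forall w, (un w ## idn w) ;; mu w = idn w) /\
  (forall w, (idn w ## un w) ;; mu w = idn w) /\
  (forall w v, (idn w ## swap C v w ## idn v) ;; (mu w ## mu v) = mu (w ** v)) /\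
  (forall w v, un (w ** v) = un w ## un v).
Proof.
split; [|split; [|split; [|split; [|exact un_tensor]]]].
- intros w. apply element_ext3 with (x := w) (y := w) (z := w); [so'|so'|].
  intros f g h; intros. rewrite <- !cat_assoc by so'.
  rewrite (pairing_ten f <<g, h>> (idn w)) by so'.
  rewrite <- (pairing_assoc f g h), (pairing_ten <<f, g>> h) by so'.
  rewrite (cat_idr' w f), (cat_idr' w h) by so'. apply mu_elt_assoc; so'.
- intros w. apply element_ext1 with (x := w); [so'|so'|]. intros f e.
  rewrite <- (pairing_unitl (bang C (src f)) f) by so'.
  rewrite <- cat_assoc, pairing_ten by so'. rewrite !(cat_idr' w) by so'.
  rewrite mu_elt_unitl by so'. symmetry; apply pairing_unitl; so'.
- intros w. apply element_ext1 with (x := w); [so'|so'|]. intros f e.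
  rewrite <- (pairing_unitr f (bang C (src f))) by so'.
  rewrite <- cat_assoc, pairing_ten by so'. rewrite !(cat_idr' w) by so'.
  rewrite mu_elt_unitr by so'. symmetry; apply pairing_unitr; so'.
- intros w v. apply element_ext2 with (x := w ** v) (y := w ** v); [so'|so'|].
  intros f g e1 e2 e3. rewrite (pr_decomp f w v e2), (pr_decomp g w v e3).
  set (f1 := f ;; pr1 C w v). set (f2 := f ;; pr2 C w v).
  set (g1 := g ;; pr1 C w v). set (g2 := g ;; pr2 C w v).
  assert (src f1 = src f) by (unfold f1; so'). assert (tgt f1 = w) by (unfold f1; so').
  assert (src f2 = src f) by (unfold f2; so'). assert (tgt f2 = v) by (unfold f2; so').
  assert (src g1 = src f) by (unfold g1; so'). assert (tgt g1 = w) by (unfold g1; so').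
  assert (src g2 = src f) by (unfold g2; so'). assert (tgt g2 = v) by (unfold g2; so').
  rewrite mu_pairing by so'. rewrite <- cat_assoc by so'.
  rewrite pairing_assoc, pairing_ten by so'. rewrite (cat_idr' w f1) by so'.
  rewrite <- (pairing_assoc f2 g1 g2), (pairing_ten <<f2, g1>> g2) by so'.
  rewrite pairing_swap, (cat_idr' v g2) by so'. rewrite pairing_assoc by so'.
  rewrite <- (pairing_assoc f1 g1) by so'. apply pairing_ten; so'.
Qed.
End MonoidWords.

(** * Strict monoidal functors preserve the cartesian structure *)

Section PreserveCartesian.
Variables (C D : mcat) (HC : is_cartesian C) (HD : is_cartesian D) (F : sfun C D)
  (HF : @strict_monoidal_functor C D F).

(** Only one arrow leads from an object to the unit. Projections are tensors of identities with such
    arrows, which is why pairings, swaps and diagonals are preserved as well. *)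
Lemma preserves_bang x : s_ar F (bang C x) = bang D (s_ob F x).
Proof.
destruct HF as [[F1 F2 F3 F4] F5 F6 F7].
apply bang_uniq; [rewrite F1, bang_src|rewrite F2, bang_tgt]; trivial.
Qed.

Lemma preserves_pairing f g : src f = src g ->
  s_ar F (pairing C f g) = pairing D (s_ar F f) (s_ar F g).
Proof.
intros e. pose proof HF as [[F1 F2 F3 F4] F5 F6 F7].
destruct (pairing_spec HC f g e) as [e1 [e2 [e3 e4]]].
apply (pairing_uniq HD); [congruence|].
split; [congruence|]. split; [congruence|].
unfold pr1, pr2 in *. rewrite !F2.
rewrite <- !F3, <- !preserves_bang, <- !F7.
rewrite <- !F4 by so. rewrite e3, e4. split; reflexivity.
Qed.

Lemma preserves_swap x y : s_ar F (swap C x y) = swap D (s_ob F x) (s_ob F y).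
Proof.
pose proof HF as [[F1 F2 F3 F4] F5 F6 F7].
unfold swap, pr1, pr2. rewrite preserves_pairing by so.
rewrite !F7, !F3, !preserves_bang. reflexivity.
Qed.

Lemma preserves_diag x : s_ar F (diag C x) = diag D (s_ob F x).
Proof.
pose proof HF as [[F1 F2 F3 F4] F5 F6 F7].
unfold diag. rewrite preserves_pairing by so. rewrite !F3. reflexivity.
Qed.
End PreserveCartesian.

(** Every generator carries its end points, so a raw expression has at most one sort and its class
    may be named without mentioning the sort. *)
Lemma fim_sort_det (X : cat) (x : fim_raw X) w v : fim_sort x w v ->
  forall w' v', fim_sort x w' v' -> w = w' /\ v = v'.
Proof.
induction 1; intros w0 v0 H'; inversion H'; subst; auto.
- match goal with H : fim_sort x _ ?u, H' : fim_sort y ?u _ |- _ =>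
    destruct (IHfim_sort1 _ _ H), (IHfim_sort2 _ _ H') end; auto.
- match goal with H : fim_sort x ?a ?u, H' : fim_sort y ?u' ?b, K : fim_sort x w v |- _ =>
    idtac end.
  edestruct IHfim_sort1; [eassumption|]; edestruct IHfim_sort2; [eassumption|].
  subst; auto.
Qed.

Lemma fim_term_equiv (X : cat) : Equivalence (@fim_term_eq X).
Proof.
split.
- intros [w v x H]; repeat split. exact (fe_refl H).
- intros [w v x H] [w' v' x' H'] [e1 [e2 e3]]; repeat split; simpl in *; auto using fe_symm.
- intros [w v x H] [w' v' x' H'] [w'' v'' x'' H''] [e1 [e2 e3]] [e4 [e5 e6]];
    repeat split; simpl in *; try congruence. exact (fe_trans e3 e6).
Qed.

(** * The free category with indexed monoids *)

Section Fim.
Variable X : cat.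
Implicit Types (x y z : fim_raw X) (w v u : list (ob X)).
Local Notation equ := (fim_term_equiv X).

(** The sorting proof is hidden behind choice, so that equations between classes can be rewritten by
    raw expressions alone. Ill-sorted expressions get a meaningless value. *)
Definition fcl x : ar (fim X) :=
  the (fim_mk (fs_eps X)) (fun h => exists w v (H : fim_sort x w v), h = fim_mk H).

Lemma fim_mk_eq x y w v w' v' (H : fim_sort x w v) (H' : fim_sort y w' v') :
  w = w' -> v = v' -> fim_eq x y -> fim_mk H = fim_mk H'.
Proof. intros. apply (cls_eq equ). repeat split; assumption. Qed.

Lemma fcl_mk x w v (H : fim_sort x w v) : fcl x = fim_mk H.
Proof.
apply the_eq; [exists w, v, H; reflexivity|].
intros h [w' [v' [H' ->]]]. destruct (fim_sort_det H H'); subst.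
apply fim_mk_eq; auto. exact (fe_refl H').
Qed.

Lemma fcl_surj (h : ar (fim X)) : exists x, fim_sort x (src h) (tgt h) /\ h = fcl x.
Proof.
exists (ft_raw (rep h)). split; [exact (ft_ok (rep h))|].
rewrite (fcl_mk (ft_ok (rep h))). rewrite <- (cls_rep h) at 1.
destruct (rep h); reflexivity.
Qed.

Lemma fcl_eq x y : fim_eq x y -> forall w v, fim_sort x w v -> fim_sort y w v -> fcl x = fcl y.
Proof.
intros e w v H H'. rewrite (fcl_mk H), (fcl_mk H'). apply fim_mk_eq; auto.
Qed.

Lemma fcl_inj x y w v w' v' : fim_sort x w v -> fim_sort y w' v' -> fcl x = fcl y -> fim_eq x y.
Proof.
intros H H' e. rewrite (fcl_mk H), (fcl_mk H') in e. apply (cls_inj equ) in e. apply e.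
Qed.

Lemma fcl_src x w v : fim_sort x w v -> src (fcl x) = w.
Proof. intros H. rewrite (fcl_mk H). exact (proj1 (rep_cls equ (FimTerm H))). Qed.

Lemma fcl_tgt x w v : fim_sort x w v -> tgt (fcl x) = v.
Proof. intros H. rewrite (fcl_mk H). exact (proj1 (proj2 (rep_cls equ (FimTerm H)))). Qed.

Lemma fcl_id w : fcl (fw_id X w) = @idn (fim X) w.
Proof. apply fcl_mk. Qed.

(** Composition in [fim] chooses among the composites of all representatives; the congruence rule
    shows that these form a single class. *)
Lemma fcl_comp x y w v u : fim_sort x w v -> fim_sort y v u ->
  fcl (x ;f y) = fcl x ;; fcl y.
Proof.
intros H H'. symmetry. apply the_eq.
- exists (FimTerm H), (FimTerm H'), (FimTerm (fs_comp H H')).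
  split; [exact (fcl_mk H)|]. split; [exact (fcl_mk H')|].
  split; [exact (fcl_mk (fs_comp H H'))|reflexivity].
- intros h [[w1 v1 x1 H1] [[w2 v2 y2 H2] [[w3 v3 z3 H3] [e1 [e2 [-> e4]]]]]]; simpl in e4.
  rewrite (fcl_mk H) in e1. apply (cls_inj equ) in e1. destruct e1 as [e1 [e1' e1'']].
  rewrite (fcl_mk H') in e2. apply (cls_inj equ) in e2. destruct e2 as [e2 [e2' e2'']].
  simpl in *; subst. destruct (fim_sort_det H3 (fs_comp H1 H2)); subst.
  rewrite (fcl_mk (fs_comp H H')). apply fim_mk_eq; auto.
  apply (fe_comp H1 H2); apply fe_symm; assumption.
Qed.

Lemma fcl_ten x y w v w' v' : fim_sort x w v -> fim_sort y w' v' ->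
  fcl (x *f y) = fcl x ## fcl y.
Proof.
intros H H'. rewrite (fcl_mk (fs_ten H H')). apply fim_mk_eq.
- rewrite <- (fcl_src H), <- (fcl_src H'); reflexivity.
- rewrite <- (fcl_tgt H), <- (fcl_tgt H'); reflexivity.
- rewrite (fcl_mk H), (fcl_mk H').
  apply fe_ten; apply fe_symm, (rep_cls equ (FimTerm _)).
Qed.

Instance fim_is_cat : is_cat (fim X).
Proof.
split.
- intros w. rewrite <- fcl_id. exact (fcl_src (fw_id_sort X w)).
- intros w. rewrite <- fcl_id. exact (fcl_tgt (fw_id_sort X w)).
- intros f g e. destruct (fcl_surj f) as [x [H ->]], (fcl_surj g) as [y [H' ->]].
  rewrite <- e in H'. rewrite <- (fcl_comp H H'). rewrite (fcl_src (fs_comp H H')). reflexivity.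
- intros f g e. destruct (fcl_surj f) as [x [H ->]], (fcl_surj g) as [y [H' ->]].
  rewrite <- e in H'. rewrite <- (fcl_comp H H'). rewrite (fcl_tgt (fs_comp H H')). reflexivity.
- intros f. destruct (fcl_surj f) as [x [H e]]. rewrite e at 2 3.
  rewrite <- fcl_id, <- (fcl_comp (fw_id_sort X _) H).
  exact (fcl_eq (fe_idl H) (fs_comp (fw_id_sort X _) H) H).
- intros f. destruct (fcl_surj f) as [x [H e]]. rewrite e at 1 3.
  rewrite <- fcl_id, <- (fcl_comp H (fw_id_sort X _)).
  exact (fcl_eq (fe_idr H) (fs_comp H (fw_id_sort X _)) H).
- intros f g h e e'. destruct (fcl_surj f) as [x [H Ex]], (fcl_surj g) as [y [H' Ey]],
    (fcl_surj h) as [z [H'' Ez]].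
  rewrite <- e in H'; rewrite <- e' in H''. rewrite Ex, Ey, Ez.
  rewrite <- (fcl_comp H H'), <- (fcl_comp H' H''), <- (fcl_comp (fs_comp H H') H''),
    <- (fcl_comp H (fs_comp H' H'')).
  exact (fcl_eq (fe_assoc H H' H'') (fs_comp (fs_comp H H') H'') (fs_comp H (fs_comp H' H''))).
Qed.

Instance fim_is_monoidal : is_strict_monoidal (fim X).
Proof.
split.
- exact fim_is_cat.
- intros f g. destruct (fcl_surj f) as [x [H Ex]], (fcl_surj g) as [y [H' Ey]].
  rewrite Ex, Ey at 1. rewrite <- (fcl_ten H H'). exact (fcl_src (fs_ten H H')).
- intros f g. destruct (fcl_surj f) as [x [H Ex]], (fcl_surj g) as [y [H' Ey]].
  rewrite Ex, Ey at 1. rewrite <- (fcl_ten H H'). exact (fcl_tgt (fs_ten H H')).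
- intros w v. induction w as [|a w IH].
  + rewrite <- !fcl_id. rewrite <- (fcl_ten (fw_id_sort X []) (fw_id_sort X v)).
    exact (fcl_eq (fe_tunitl (fw_id_sort X v)) (fs_ten (fs_eps X) (fw_id_sort X v))
      (fw_id_sort X v)).
  + rewrite <- !fcl_id in *.
    rewrite <- (fcl_ten (fw_id_sort X w) (fw_id_sort X v)) in IH.
    rewrite <- (fcl_ten (fw_id_sort X (a :: w)) (fw_id_sort X v)).
    pose proof (fs_ten (fs_id X a) (fs_ten (fw_id_sort X w) (fw_id_sort X v))) as K.
    transitivity (fcl (fr_id a *f (fw_id X w *f fw_id X v))).
    * exact (fcl_eq (fe_tassoc (fs_id X a) (fw_id_sort X w) (fw_id_sort X v))
        (fs_ten (fw_id_sort X (a :: w)) (fw_id_sort X v)) K).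
    * rewrite (fcl_ten (fs_id X a) (fs_ten (fw_id_sort X w) (fw_id_sort X v))).
      rewrite IH. symmetry. exact (fcl_ten (fs_id X a) (fw_id_sort X (w ++ v))).
- intros f f' g g' e e'.
  destruct (fcl_surj f) as [x [H Ex]], (fcl_surj f') as [x' [H' Ex']],
    (fcl_surj g) as [y [K Ey]], (fcl_surj g') as [y' [K' Ey']].
  rewrite <- e in H'; rewrite <- e' in K'. rewrite Ex, Ex', Ey, Ey'.
  rewrite <- (fcl_comp H H'), <- (fcl_comp K K'), <- (fcl_ten (fs_comp H H') (fs_comp K K')).
  rewrite <- (fcl_ten H K), <- (fcl_ten H' K'), <- (fcl_comp (fs_ten H K) (fs_ten H' K')).
  exact (fcl_eq (fe_interchange H H' K K') (fs_ten (fs_comp H H') (fs_comp K K'))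
    (fs_comp (fs_ten H K) (fs_ten H' K'))).
- intros. symmetry; apply app_assoc.
- intros f g h. destruct (fcl_surj f) as [x [H Ex]], (fcl_surj g) as [y [H' Ey]],
    (fcl_surj h) as [z [H'' Ez]].
  rewrite Ex, Ey, Ez. rewrite <- (fcl_ten H H'), <- (fcl_ten H' H''),
    <- (fcl_ten (fs_ten H H') H''), <- (fcl_ten H (fs_ten H' H'')).
  refine (fcl_eq (fe_tassoc H H' H'') (fs_ten (fs_ten H H') H'') _).
  rewrite <- !app_assoc. exact (fs_ten H (fs_ten H' H'')).
- reflexivity.
- intros; apply app_nil_r.
- intros f. destruct (fcl_surj f) as [x [H ->]]. change (idn one) with (@idn (fim X) []).
  rewrite <- fcl_id, <- (fcl_ten (fw_id_sort X []) H).
  exact (fcl_eq (fe_tunitl H) (fs_ten (fs_eps X) H) H).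
- intros f. destruct (fcl_surj f) as [x [H ->]]. change (idn one) with (@idn (fim X) []).
  rewrite <- fcl_id, <- (fcl_ten H (fw_id_sort X [])).
  refine (fcl_eq (fe_tunitr H) _ H). rewrite <- (app_nil_r (src (fcl x))), <- (app_nil_r (tgt (fcl x))).
  exact (fs_ten H (fs_eps X)).
Qed.

Definition fo (a : ob X) : ob (fim X) := [a].

Lemma fim_sym_cl (w v : ob (fim X)) : sym w v = fcl (fw_sym X w v).
Proof. symmetry; apply fcl_mk. Qed.
Lemma fim_dup_cl (w : ob (fim X)) : dup w = fcl (fw_dup X w).
Proof. symmetry; apply fcl_mk. Qed.
Lemma fim_del_cl (w : ob (fim X)) : del w = fcl (fw_del X w).
Proof. symmetry; apply fcl_mk. Qed.
Lemma fim_mul_cl (w : ob (fim X)) : mul w = fcl (fw_mul X w).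
Proof. symmetry; apply fcl_mk. Qed.
Lemma fim_unt_cl (w : ob (fim X)) : unt w = fcl (fw_unt X w).
Proof. symmetry; apply fcl_mk. Qed.
(** The identity of a one-letter word is built as [fr_id a *f fr_eps]; the unit law removes the
    trailing [fr_eps]. *)
Lemma fcl_id1 a : fcl (fr_id a) = idn (fo a).
Proof.
unfold fo. rewrite <- fcl_id. symmetry.
exact (fcl_eq (fe_tunitr (fs_id X a)) (fs_ten (fs_id X a) (fs_eps X)) (fs_id X a)).
Qed.

Lemma fim_sym_src (w v : ob (fim X)) : src (sym w v) = w ** v.
Proof. rewrite fim_sym_cl. exact (fcl_src (fw_sym_sort X w v)). Qed.
Lemma fim_sym_tgt (w v : ob (fim X)) : tgt (sym w v) = v ** w.
Proof. rewrite fim_sym_cl. exact (fcl_tgt (fw_sym_sort X w v)). Qed.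
Lemma fim_dup_src (w : ob (fim X)) : src (dup w) = w.
Proof. rewrite fim_dup_cl. exact (fcl_src (fw_dup_sort X w)). Qed.
Lemma fim_dup_tgt (w : ob (fim X)) : tgt (dup w) = w ** w.
Proof. rewrite fim_dup_cl. exact (fcl_tgt (fw_dup_sort X w)). Qed.
Lemma fim_del_src (w : ob (fim X)) : src (del w) = w.
Proof. rewrite fim_del_cl. exact (fcl_src (fw_del_sort X w)). Qed.
Lemma fim_del_tgt (w : ob (fim X)) : tgt (del w) = one.
Proof. rewrite fim_del_cl. exact (fcl_tgt (fw_del_sort X w)). Qed.
Lemma fim_mul_src (w : ob (fim X)) : src (mul w) = w ** w.
Proof. rewrite fim_mul_cl. exact (fcl_src (fw_mul_sort X w)). Qed.
Lemma fim_mul_tgt (w : ob (fim X)) : tgt (mul w) = w.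
Proof. rewrite fim_mul_cl. exact (fcl_tgt (fw_mul_sort X w)). Qed.
Lemma fim_unt_src (w : ob (fim X)) : src (unt w) = one.
Proof. rewrite fim_unt_cl. exact (fcl_src (fw_unt_sort X w)). Qed.
Lemma fim_unt_tgt (w : ob (fim X)) : tgt (unt w) = w.
Proof. rewrite fim_unt_cl. exact (fcl_tgt (fw_unt_sort X w)). Qed.

Lemma fcl_sym1 a v : fcl (fw_sym1 X a v) = sym (fo a) v.
Proof.
assert (K : fim_sort (fr_id a) [a] ([a] ++ [])) by exact (fs_id X a).
rewrite fim_sym_cl; unfold fo; simpl fw_sym.
rewrite (fcl_comp (fs_ten (fs_id X a) (fw_id_sort X v)) (fs_cast (fs_ten (fw_sym1_sort X a v) (fs_eps X)) (app_nil_r (a :: v)) eq_refl)).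
rewrite (fcl_ten (fs_id X a) (fw_id_sort X v)), (fcl_ten (fw_sym1_sort X a v) (fs_eps X)).
change (@fr_eps X) with (fw_id X []). rewrite !fcl_id, fcl_id1, (mon_unitr_ar (C := fim X)), (mon_id (C := fim X)).
symmetry. apply (cat_idl' (C := fim X)). exact (fcl_src (fw_sym1_sort X a v)).
Qed.

Lemma fim_sym_onel (w : ob (fim X)) : sym one w = idn w.
Proof. rewrite fim_sym_cl; apply fcl_id. Qed.
Lemma fim_sym_oner (w : ob (fim X)) : sym w one = idn w.
Proof.
induction w as [|a w IH]; [apply fim_sym_onel|].
rewrite fim_sym_cl in *; simpl fw_sym.
rewrite (fcl_comp (fs_ten (fs_id X a) (fw_sym_sort X w [])) (fs_ten (fs_id X a) (fw_id_sort X w))).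
rewrite (fcl_ten (fs_id X a) (fw_sym_sort X w [])).
rewrite (fcl_ten (fs_id X a) (fw_id_sort X w)).
change (fw_sym X w []) with (fw_sym X w (@one (fim X))). rewrite IH, fcl_id, fcl_id1.
rewrite (mon_id (C := fim X)). apply (cat_idl' (C := fim X)).
apply (cat_src_id (C := fim X)).
Qed.

Lemma fim_sym_nat (f g : ar (fim X)) :
  (f ## g) ;; sym (tgt f) (tgt g) = sym (src f) (src g) ;; (g ## f).
Proof.
destruct (fcl_surj f) as [x [H Ex]], (fcl_surj g) as [y [H' Ey]].
rewrite !fim_sym_cl.
revert H H'. generalize (src f) (tgt f) (src g) (tgt g). intros w v w' v' H H'.
rewrite Ex, Ey, <- (fcl_ten H H'), <- (fcl_ten H' H).
rewrite <- (fcl_comp (fs_ten H H') (fw_sym_sort X _ _)).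
rewrite <- (fcl_comp (fw_sym_sort X _ _) (fs_ten H' H)).
exact (fcl_eq (fe_sym_nat H H') (fs_comp (fs_ten H H') (fw_sym_sort X _ _))
  (fs_comp (fw_sym_sort X _ _) (fs_ten H' H))).
Qed.

Lemma fim_dup_nat (f : ar (fim X)) : f ;; dup (tgt f) = dup (src f) ;; (f ## f).
Proof.
destruct (fcl_surj f) as [x [H Ex]]. rewrite !fim_dup_cl.
revert H. generalize (src f) (tgt f). intros w v H.
rewrite Ex, <- (fcl_ten H H).
rewrite <- (fcl_comp H (fw_dup_sort X _)), <- (fcl_comp (fw_dup_sort X _) (fs_ten H H)).
exact (fcl_eq (fe_dup_nat H) (fs_comp H (fw_dup_sort X _)) (fs_comp (fw_dup_sort X _) (fs_ten H H))).
Qed.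

Lemma fim_del_nat (f : ar (fim X)) : f ;; del (tgt f) = del (src f).
Proof.
destruct (fcl_surj f) as [x [H Ex]]. rewrite !fim_del_cl.
revert H. generalize (src f) (tgt f). intros w v H.
rewrite Ex, <- (fcl_comp H (fw_del_sort X _)).
exact (fcl_eq (fe_del_nat H) (fs_comp H (fw_del_sort X _)) (fw_del_sort X _)).
Qed.

Lemma fim_dup_cons a (w : ob (fim X)) :
  dup (fo a ** w) = (fcl (fr_dup a) ## dup w) ;; (idn (fo a) ## sym (fo a) w ## idn w).
Proof.
rewrite !fim_dup_cl. unfold fo at 1. simpl fw_dup.
pose proof (fs_ten (fs_id X a) (fs_ten (fw_sym1_sort X a w) (fw_id_sort X w))) as K.
rewrite (fcl_comp (v := a :: a :: w ++ w) (fs_ten (fs_dup X a) (fw_dup_sort X w))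
   K).
rewrite (fcl_ten (fs_dup X a) (fw_dup_sort X w)).
rewrite (fcl_ten (fs_id X a) (fs_ten (fw_sym1_sort X a w) (fw_id_sort X w))).
rewrite (fcl_ten (fw_sym1_sort X a w) (fw_id_sort X w)).
rewrite fcl_sym1, fcl_id, fcl_id1. reflexivity.
Qed.

Lemma fcl_dup a : fcl (fr_dup a) = dup (fo a).
Proof.
pose proof (fim_dup_cons a (@one (fim X))) as H.
rewrite !(mon_unitr_ob (C := fim X) (fo a)) in H. rewrite H.
rewrite fim_sym_oner, (mon_unitr_ar (C := fim X)), (mon_id (C := fim X)).
rewrite fim_dup_cl. change (fcl (fw_dup X (@one (fim X)))) with (fcl (fw_id X [])). rewrite fcl_id.
change (@idn (fim X) []) with (@idn (fim X) one). rewrite (mon_unitr_ar (C := fim X)).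
symmetry; apply (cat_idr' (C := fim X)). exact (fcl_tgt (fs_dup X a)).
Qed.

Lemma fcl_del a : fcl (fr_del a) = del (fo a).
Proof.
rewrite fim_del_cl. symmetry.
exact (fcl_eq (fe_tunitr (fs_del X a)) (fs_ten (fs_del X a) (fs_eps X)) (fs_del X a)).
Qed.

Lemma fim_ind (P : ob (fim X) -> Prop) :
  P one -> (forall a w, (exists c, a = fo c) -> P w -> P (a ** w)) -> forall w, P w.
Proof.
intros H H' w; induction w as [|a w IH]; [exact H|].
apply (H' (fo a)); [exists a; reflexivity|exact IH].
Qed.

Lemma fim_del_one : del (@one (fim X)) = idn one.
Proof. rewrite fim_del_cl. apply (fcl_id []). Qed.
Lemma fim_dup_one : dup (@one (fim X)) = idn one.
Proof. rewrite fim_dup_cl. apply (fcl_id []). Qed.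

Lemma fim_dup_cons' (a w : ob (fim X)) : (exists c, a = fo c) ->
  dup (a ** w) = (dup a ## dup w) ;; (idn a ## sym a w ## idn w).
Proof. intros [c ->]. rewrite fim_dup_cons, fcl_dup. reflexivity. Qed.

Lemma fim_counitl (a : ob (fim X)) : (exists c, a = fo c) ->
  dup a ;; (del a ## idn a) = idn a.
Proof.
intros [c ->]. rewrite <- fcl_dup, <- fcl_del, <- fcl_id1.
pose proof (fs_ten (fs_del X c) (fs_id X c)) as K.
rewrite <- (fcl_ten (fs_del X c) (fs_id X c)), <- (fcl_comp (fs_dup X c) K).
exact (fcl_eq (fe_dup_unitl X c) (fs_comp (fs_dup X c) K) (fs_id X c)).
Qed.

Lemma fim_counitr (a : ob (fim X)) : (exists c, a = fo c) ->
  dup a ;; (idn a ## del a) = idn a.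
Proof.
intros [c ->]. rewrite <- fcl_dup, <- fcl_del, <- fcl_id1.
pose proof (fs_ten (fs_id X c) (fs_del X c)) as K.
rewrite <- (fcl_ten (fs_id X c) (fs_del X c)), <- (fcl_comp (fs_dup X c) K).
exact (fcl_eq (fe_dup_unitr X c) (fs_comp (fs_dup X c) K) (fs_id X c)).
Qed.

(** From here on the symmetries, duplications and deletions of words are the canonical maps of a
    cartesian category, so their remaining axioms come from universal properties instead of
    inductions on words. *)
Lemma fim_cartesian_structure : is_cartesian (fim X) /\
  (forall w v : ob (fim X), swap (fim X) w v = sym w v) /\
  (forall w : ob (fim X), diag (fim X) w = dup w).
Proof.
apply cartesian_of_comonoids with (letter := fun a => exists c, a = fo c)
  (sy := @sym (fim X)) (du := @dup (fim X)) (de := @del (fim X)).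
- exact fim_is_monoidal.
- exact fim_ind.
- exact fim_sym_src.
- exact fim_sym_tgt.
- exact fim_sym_nat.
- exact fim_sym_onel.
- exact fim_sym_oner.
- exact fim_dup_src.
- exact fim_dup_tgt.
- exact fim_dup_nat.
- exact fim_dup_one.
- exact fim_dup_cons'.
- exact fim_del_src.
- exact fim_del_tgt.
- exact fim_del_nat.
- exact fim_del_one.
- exact fim_counitl.
- exact fim_counitr.
Qed.

Global Instance fim_cartesian : is_cartesian (fim X).
Proof. apply fim_cartesian_structure. Qed.
Lemma fim_sym_swap (w v : ob (fim X)) : sym w v = swap (fim X) w v.
Proof. symmetry; apply fim_cartesian_structure. Qed.
Lemma fim_dup_diag (w : ob (fim X)) : dup w = diag (fim X) w.
Proof. symmetry; apply fim_cartesian_structure. Qed.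
Lemma fim_del_bang (w : ob (fim X)) : del w = bang (fim X) w.
Proof. apply bang_uniq; [apply fim_del_src|apply fim_del_tgt]. Qed.

Lemma fcl_mul_cons a (w : ob (fim X)) : mul (fo a ** w) =
  (idn (fo a) ## swap (fim X) w (fo a) ## idn w) ;; (fcl (fr_mul a) ## mul w).
Proof.
rewrite <- fim_sym_swap, !fim_mul_cl, fim_sym_cl. unfold fo at 1. simpl fw_mul.
assert (K : fim_sort (fr_id a *f fw_sym X w [a] *f fw_id X w)
  ((a :: w) ++ a :: w) (a :: a :: w ++ w)).
{ refine (fs_cast (fs_ten (fs_id X a) (fs_ten (fw_sym_sort X w [a]) (fw_id_sort X w))) _ eq_refl).
  simpl; rewrite <- app_assoc; reflexivity. }
rewrite (fcl_comp K (fs_ten (fs_mul X a) (fw_mul_sort X w))).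
rewrite (fcl_ten (fs_mul X a) (fw_mul_sort X w)).
rewrite (fcl_ten (fs_id X a) (fs_ten (fw_sym_sort X w [a]) (fw_id_sort X w))).
rewrite (fcl_ten (fw_sym_sort X w [a]) (fw_id_sort X w)).
rewrite fcl_id, fcl_id1. reflexivity.
Qed.

Lemma fim_mul_one : mul (@one (fim X)) = idn one.
Proof. rewrite fim_mul_cl. apply (fcl_id []). Qed.
Lemma fim_unt_one : unt (@one (fim X)) = idn one.
Proof. rewrite fim_unt_cl. apply (fcl_id []). Qed.

Lemma fcl_mul a : fcl (fr_mul a) = mul (fo a).
Proof.
pose proof (fcl_mul_cons a (@one (fim X))) as H.
rewrite !(mon_unitr_ob (C := fim X) (fo a)) in H. rewrite H.
rewrite swap_onel. rewrite (mon_unitr_ar (C := fim X)), (mon_id (C := fim X)), fim_mul_one,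
  (mon_unitr_ar (C := fim X)).
symmetry; apply (cat_idl' (C := fim X)). exact (fcl_src (fs_mul X a)).
Qed.

Lemma fcl_unt a : fcl (fr_unt a) = unt (fo a).
Proof.
rewrite fim_unt_cl. symmetry.
exact (fcl_eq (fe_tunitr (fs_unt X a)) (fs_ten (fs_unt X a) (fs_eps X)) (fs_unt X a)).
Qed.

Lemma fim_unt_cons a (w : ob (fim X)) : unt (fo a ** w) = unt (fo a) ## unt w.
Proof.
rewrite <- fcl_unt, !fim_unt_cl. exact (fcl_ten (fs_unt X a) (fw_unt_sort X w)).
Qed.

Lemma fcl_sym a b : fcl (fr_sym a b) = sym (fo a) (fo b).
Proof.
rewrite <- fcl_sym1. unfold fo. simpl fw_sym1.
rewrite (fcl_comp (fs_ten (fs_sym X a b) (fs_eps X)) (fs_ten (fs_id X b) (fs_id X a))).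
rewrite (fcl_ten (fs_sym X a b) (fs_eps X)), (fcl_ten (fs_id X b) (fs_id X a)).
change (@fr_eps X) with (fw_id X []). rewrite fcl_id, !fcl_id1.
change (@idn (fim X) []) with (@idn (fim X) one).
rewrite (mon_unitr_ar (C := fim X)), (mon_id (C := fim X)).
symmetry; apply (cat_idr' (C := fim X)). exact (fcl_tgt (fs_sym X a b)).
Qed.

Lemma mul_letter_assoc a : (mul (fo a) ## idn (fo a)) ;; mul (fo a)
  = (idn (fo a) ## mul (fo a)) ;; mul (fo a).
Proof.
rewrite <- fcl_mul, <- fcl_id1.
pose proof (fs_ten (fs_mul X a) (fs_id X a)) as K.
pose proof (fs_ten (fs_id X a) (fs_mul X a)) as K'.
rewrite <- (fcl_ten (fs_mul X a) (fs_id X a)), <- (fcl_ten (fs_id X a) (fs_mul X a)).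
rewrite <- (fcl_comp K (fs_mul X a)), <- (fcl_comp K' (fs_mul X a)).
exact (fcl_eq (fe_mul_assoc X a) (fs_comp K (fs_mul X a)) (fs_comp K' (fs_mul X a))).
Qed.

Lemma mul_letter_unitl a : (unt (fo a) ## idn (fo a)) ;; mul (fo a) = idn (fo a).
Proof.
rewrite <- fcl_mul, <- fcl_unt, <- fcl_id1.
pose proof (fs_ten (fs_unt X a) (fs_id X a)) as K.
rewrite <- (fcl_ten (fs_unt X a) (fs_id X a)), <- (fcl_comp K (fs_mul X a)).
exact (fcl_eq (fe_mul_unitl X a) (fs_comp K (fs_mul X a)) (fs_id X a)).
Qed.

Lemma mul_letter_unitr a : (idn (fo a) ## unt (fo a)) ;; mul (fo a) = idn (fo a).
Proof.
rewrite <- fcl_mul, <- fcl_unt, <- fcl_id1.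
pose proof (fs_ten (fs_id X a) (fs_unt X a)) as K.
rewrite <- (fcl_ten (fs_id X a) (fs_unt X a)), <- (fcl_comp K (fs_mul X a)).
exact (fcl_eq (fe_mul_unitr X a) (fs_comp K (fs_mul X a)) (fs_id X a)).
Qed.

Lemma fim_mul_cons (a w : ob (fim X)) : (exists c, a = fo c) -> mul (a ** w) =
  (idn a ## swap (fim X) w a ## idn w) ;; (mul a ## mul w).
Proof. intros [c ->]. rewrite <- fcl_mul. apply fcl_mul_cons. Qed.

Lemma fim_unt_cons' (a w : ob (fim X)) : (exists c, a = fo c) -> unt (a ** w) = unt a ## unt w.
Proof. intros [c ->]. apply fim_unt_cons. Qed.

Lemma fim_monoid_words :
  (forall w : ob (fim X), (mul w ## idn w) ;; mul w = (idn w ## mul w) ;; mul w) /\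
  (forall w : ob (fim X), (unt w ## idn w) ;; mul w = idn w) /\
  (forall w : ob (fim X), (idn w ## unt w) ;; mul w = idn w) /\
  (forall w v : ob (fim X),
    (idn w ## swap (fim X) v w ## idn v) ;; (mul w ## mul v) = mul (w ** v)) /\
  (forall w v : ob (fim X), unt (w ** v) = unt w ## unt v).
Proof.
apply monoid_words with (letter := fun a => exists c, a = fo c).
- exact _.
- exact fim_ind.
- exact fim_mul_src.
- exact fim_mul_tgt.
- exact fim_unt_src.
- exact fim_unt_tgt.
- exact fim_mul_one.
- exact fim_unt_one.
- exact fim_mul_cons.
- exact fim_unt_cons'.
- intros a [c ->]; apply mul_letter_assoc.
- intros a [c ->]; apply mul_letter_unitl.
- intros a [c ->]; apply mul_letter_unitr.
Qed.

Lemma fim_gen_cl (f : ar X) : fim_gen X f = fcl (fr_gen f).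
Proof. symmetry; apply fcl_mk. Qed.

Lemma fim_gen_mul (f : ar X) : mul (fo (src f)) ;; fim_gen X f =
  (fim_gen X f ## fim_gen X f) ;; mul (fo (tgt f)).
Proof.
rewrite fim_gen_cl, <- !fcl_mul, <- (fcl_ten (fs_gen X f) (fs_gen X f)).
pose proof (fs_ten (fs_gen X f) (fs_gen X f)) as K.
rewrite <- (fcl_comp (fs_mul X _) (fs_gen X f)), <- (fcl_comp K (fs_mul X _)).
exact (fcl_eq (fe_mul_nat X f) (fs_comp (fs_mul X _) (fs_gen X f)) (fs_comp K (fs_mul X _))).
Qed.

Lemma fim_gen_unt (f : ar X) : unt (fo (src f)) ;; fim_gen X f = unt (fo (tgt f)).
Proof.
rewrite fim_gen_cl, <- !fcl_unt, <- (fcl_comp (fs_unt X _) (fs_gen X f)).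
exact (fcl_eq (fe_unt_nat X f) (fs_comp (fs_unt X _) (fs_gen X f)) (fs_unt X _)).
Qed.
End Fim.

(** * Naturality and uniqueness of the units of monoids *)

Section UnitNaturality.
Variables (C : imcat) (HC : is_cartesian C).
Hypotheses (mu_src : forall x : ob C, src (mul x) = x ** x)
  (mu_tgt : forall x : ob C, tgt (mul x) = x)
  (un_src : forall x : ob C, src (unt x) = one) (un_tgt : forall x : ob C, tgt (unt x) = x)
  (un_one : unt (@one C) = idn one)
  (un_tensor : forall x y : ob C, unt (x ** y) = unt x ## unt y)
  (mu_unitl : forall x : ob C, (unt x ## idn x) ;; mul x = idn x)
  (mu_unitr : forall x : ob C, (idn x ## unt x) ;; mul x = idn x).

Local Ltac so' := intros; unfold pr1, pr2; hyps_st;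
  repeat first
   [ rewrite cat_src_id | rewrite cat_tgt_id
   | rewrite mon_src | rewrite mon_tgt
   | rewrite bang_src | rewrite bang_tgt
   | rewrite mu_src | rewrite mu_tgt | rewrite un_src | rewrite un_tgt
   | rewrite swap_src | rewrite swap_tgt
   | rewrite diag_src | rewrite diag_tgt
   | rewrite cat_src_comp by so' | rewrite cat_tgt_comp by so'
   | rewrite pairing_src by so' | rewrite pairing_tgt by so'];
  hyps_st;
  rewrite ?mon_assoc_ob, ?mon_unitl_ob, ?mon_unitr_ob;
  first [reflexivity | assumption | congruence].

(** The presentation of [fim] imposes this equation on the generators coming from [X] only. The
    lemmas below show that the arrows satisfying it contain all structural maps and are closed under
    composition and tensor. *)
Definition unt_natural (f : ar C) : Prop := unt (src f) ;; f = unt (tgt f).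

Lemma unt_natural_id (x : ob C) : unt_natural (idn x).
Proof. unfold unt_natural. rewrite cat_src_id, cat_tgt_id. apply cat_idr'; so'. Qed.
Lemma unt_natural_comp (f g : ar C) : tgt f = src g ->
  unt_natural f -> unt_natural g -> unt_natural (f ;; g).
Proof.
unfold unt_natural; intros e Hf Hg.
rewrite cat_src_comp, cat_tgt_comp, <- cat_assoc, Hf, e by so'. exact Hg.
Qed.
Lemma unt_natural_ten (f g : ar C) : unt_natural f -> unt_natural g -> unt_natural (f ## g).
Proof.
unfold unt_natural; intros Hf Hg. rewrite mon_src, mon_tgt, !un_tensor.
rewrite <- mon_comp, Hf, Hg by so'. reflexivity.
Qed.
Lemma unt_natural_swap (x y : ob C) : unt_natural (swap C x y).
Proof.
unfold unt_natural. rewrite swap_src, swap_tgt, !un_tensor.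
pose proof (swap_nat (unt x) (unt y)) as n. rewrite !un_src, !un_tgt, swap_onel in n.
rewrite n. apply cat_idl'; so'.
Qed.
Lemma unt_natural_diag (x : ob C) : unt_natural (diag C x).
Proof.
unfold unt_natural. rewrite diag_src, diag_tgt, !un_tensor.
pose proof (diag_nat (unt x)) as n. rewrite un_src, un_tgt, diag_one in n.
rewrite n. apply cat_idl'; so'.
Qed.
Lemma unt_natural_bang (x : ob C) : unt_natural (bang C x).
Proof.
unfold unt_natural. rewrite bang_src, bang_tgt, un_one, comp_bang, un_src by so'.
apply bang_one.
Qed.
Lemma unt_natural_unt (x : ob C) : unt_natural (unt x).
Proof. unfold unt_natural. rewrite un_src, un_tgt, un_one. apply cat_idl'; so'. Qed.
(** By the left unit law the product of two units is a unit. *)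
Lemma unt_natural_mul (x : ob C) : unt_natural (mul x).
Proof.
unfold unt_natural. rewrite mu_src, mu_tgt, un_tensor.
rewrite <- (cat_idl' one (unt x)) at 1 by so'. rewrite <- (cat_idr' x (unt x)) at 2 by so'.
rewrite mon_comp, cat_assoc, mu_unitl, mon_unitl_ar by so'. apply cat_idr'; so'.
Qed.

(** A left unit equals a right unit: both are equal to [(u ## unt x) ;; mul x]. *)
Lemma unt_uniq (x : ob C) (u : ar C) : src u = one -> tgt u = x ->
  (u ## idn x) ;; mul x = idn x -> u = unt x.
Proof.
intros e1 e2 e3. transitivity ((u ## unt x) ;; mul x).
- rewrite <- (cat_idr' x u) at 2 by so'. rewrite <- (cat_idl' one (unt x)) by so'.
  rewrite mon_comp, cat_assoc, mu_unitr, mon_unitr_ar by so'. symmetry; apply cat_idr'; so'.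
- rewrite <- (cat_idl' one u) by so'. rewrite <- (cat_idr' x (unt x)) at 1 by so'.
  rewrite mon_comp, cat_assoc, e3, mon_unitl_ar by so'. apply cat_idr'; so'.
Qed.
End UnitNaturality.

Lemma fim_unt_nat (X : cat) (f : ar (fim X)) : unt (src f) ;; f = unt (tgt f).
Proof.
destruct (fim_monoid_words X) as [_ [H1 [H2 [_ H3]]]].
change (unt_natural (fim X) f). destruct (fcl_surj f) as [x [H ->]].
revert H. generalize (src (fcl x)) (tgt (fcl x)). intros w v H.
induction H.
- unfold unt_natural. rewrite (fcl_src (fs_gen X f)), (fcl_tgt (fs_gen X f)), <- fim_gen_cl.
  exact (fim_gen_unt X f).
- rewrite fcl_id1. apply unt_natural_id; auto using fim_unt_tgt with typeclass_instances.
- change (@fr_eps X) with (fw_id X []). rewrite fcl_id.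
  apply unt_natural_id; auto using fim_unt_tgt with typeclass_instances.
- rewrite (fcl_comp H H0). apply unt_natural_comp; auto using fim_unt_tgt with typeclass_instances.
  rewrite (fcl_src H0), (fcl_tgt H); reflexivity.
- rewrite (fcl_ten H H0). apply unt_natural_ten; auto using fim_unt_src, fim_unt_tgt with typeclass_instances.
- rewrite fcl_sym, fim_sym_swap. apply unt_natural_swap; auto using fim_unt_src, fim_unt_tgt with typeclass_instances.
- rewrite fcl_dup, fim_dup_diag. apply unt_natural_diag; auto using fim_unt_src, fim_unt_tgt with typeclass_instances.
- rewrite fcl_del, fim_del_bang. apply unt_natural_bang; auto using fim_unt_src, fim_unt_tgt, fim_unt_one with typeclass_instances.
- rewrite fcl_mul. apply unt_natural_mul; auto using fim_mul_src, fim_mul_tgt, fim_unt_src, fim_unt_tgt with typeclass_instances.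
- rewrite fcl_unt. apply unt_natural_unt; auto using fim_unt_src, fim_unt_tgt, fim_unt_one with typeclass_instances.
Qed.

Lemma fim_indexed_monoids (X : cat) : has_indexed_monoids (fim X).
Proof.
destruct (fim_monoid_words X) as [H0 [H1 [H2 [H3 H4]]]]. split.
- apply cartesian_symmetric; [exact _|apply fim_sym_swap].
- apply cartesian_comonoids; [exact _|apply fim_sym_swap|apply fim_dup_diag|apply fim_del_bang].
- split; auto using fim_mul_src, fim_mul_tgt, fim_unt_src, fim_unt_tgt, fim_mul_one,
    fim_unt_one, fim_unt_nat.
  intros. rewrite fim_sym_swap. apply H3.
Qed.

(** * Universal property of the free category with indexed monoids *)

Section FimFree.
Variables (X : cat) (D : imcat) (HC : is_cartesian D) (HD : has_indexed_monoids D)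
  (D_sym : forall x y : ob D, sym x y = swap D x y)
  (go : ob X -> ob D) (g : ar X -> ar D)
  (g_src : forall f, src (g f) = go (src f)) (g_tgt : forall f, tgt (g f) = go (tgt f))
  (g_id : forall a, g (idn a) = idn (go a))
  (g_comp : forall f f', tgt f = src f' -> g (f ;; f') = g f ;; g f')
  (g_mul : forall f, mul (go (src f)) ;; g f = (g f ## g f) ;; mul (go (tgt f))).

Let mu_src := mul_src (im_monoids HD).
Let mu_tgt := mul_tgt (im_monoids HD).
Let un_src := unt_src (im_monoids HD).
Let un_tgt := unt_tgt (im_monoids HD).

Local Ltac so' := intros; unfold pr1, pr2; hyps_st;
  repeat first
   [ rewrite cat_src_id | rewrite cat_tgt_id
   | rewrite mon_src | rewrite mon_tgt
   | rewrite bang_src | rewrite bang_tgt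
   | rewrite mu_src | rewrite mu_tgt | rewrite un_src | rewrite un_tgt
   | rewrite g_src | rewrite g_tgt
   | rewrite swap_src | rewrite swap_tgt
   | rewrite diag_src | rewrite diag_tgt
   | rewrite cat_src_comp by so' | rewrite cat_tgt_comp by so'
   | rewrite pairing_src by so' | rewrite pairing_tgt by so'];
  hyps_st;
  rewrite ?mon_assoc_ob, ?mon_unitl_ob, ?mon_unitr_ob;
  first [reflexivity | assumption | congruence].

Fixpoint free_ob (w : list (ob X)) : ob D :=
  match w with [] => one | a :: w => go a ** free_ob w end.

Fixpoint free_raw (x : fim_raw X) : ar D :=
  match x with
  | fr_gen f => g f
  | fr_id a => idn (go a)
  | fr_eps => idn one
  | x ;f y => free_raw x ;; free_raw y
  | x *f y => free_raw x ## free_raw y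
  | fr_sym a b => swap D (go a) (go b)
  | fr_dup a => diag D (go a)
  | fr_del a => bang D (go a)
  | fr_mul a => mul (go a)
  | fr_unt a => unt (go a)
  end.

Lemma free_ob_app w v : free_ob (w ++ v) = free_ob w ** free_ob v.
Proof.
induction w as [|a w IH]; simpl; [symmetry; apply mon_unitl_ob|].
rewrite IH, mon_assoc_ob. reflexivity.
Qed.

Lemma free_sort x w v : fim_sort x w v ->
  src (free_raw x) = free_ob w /\ tgt (free_raw x) = free_ob v.
Proof.
induction 1; simpl free_ob; simpl free_raw; try (split; so').
- destruct IHfim_sort1, IHfim_sort2. split; so'.
- destruct IHfim_sort1, IHfim_sort2. rewrite !free_ob_app. split; so'.
Qed.

Lemma free_raw_id w : free_raw (fw_id X w) = idn (free_ob w).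
Proof. induction w as [|a w IH]; simpl; [reflexivity|]. rewrite IH. apply mon_id. Qed.

Lemma free_raw_sym1 a v : free_raw (fw_sym1 X a v) = swap D (go a) (free_ob v).
Proof.
induction v as [|b v IH]; simpl; [symmetry; apply swap_oner|].
rewrite IH, free_raw_id. symmetry; apply swap_hex.
Qed.

Lemma free_raw_sym w v : free_raw (fw_sym X w v) = swap D (free_ob w) (free_ob v).
Proof.
induction w as [|a w IH]; simpl.
- rewrite free_raw_id. symmetry; apply swap_onel.
- rewrite IH, free_raw_id, free_raw_sym1. symmetry; apply swap_hex'.
Qed.

Lemma free_raw_dup w : free_raw (fw_dup X w) = diag D (free_ob w).
Proof.
induction w as [|a w IH]; simpl; [symmetry; apply diag_one|].
rewrite IH, free_raw_id, free_raw_sym1. symmetry; apply diag_tensor.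
Qed.

Lemma free_raw_del w : free_raw (fw_del X w) = bang D (free_ob w).
Proof.
induction w as [|a w IH]; simpl; [symmetry; apply bang_one|].
rewrite IH. symmetry; apply bang_tensor.
Qed.

Lemma free_raw_mul w : free_raw (fw_mul X w) = mul (free_ob w).
Proof.
induction w as [|a w IH]; simpl; [symmetry; apply (mul_one (im_monoids HD))|].
rewrite IH, free_raw_id, free_raw_sym. simpl. rewrite mon_unitr_ob, <- D_sym.
apply (mul_tensor (im_monoids HD)).
Qed.

Local Ltac sorts := repeat match goal with
  | H : fim_sort _ _ _ |- _ => apply free_sort in H; destruct H end.

Lemma free_raw_eq x y : fim_eq x y -> free_raw x = free_raw y.
Proof.
induction 1; simpl free_raw; rewrite ?free_raw_id, ?free_raw_sym, ?free_raw_dup, ?free_raw_del;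
  sorts; try congruence.
- apply cat_assoc; so'.
- apply cat_idl'; so'.
- apply cat_idr'; so'.
- apply mon_assoc_ar.
- apply mon_unitl_ar.
- apply mon_unitr_ar.
- apply mon_comp; so'.
- simpl. rewrite mon_unitr_ar, mon_id. apply swap_inv.
- rewrite <- H, <- H1, <- H0, <- H2. apply swap_nat.
- apply diag_assoc.
- apply diag_unitl.
- apply diag_unitr.
- rewrite <- H, <- H0. apply diag_nat.
- rewrite <- H, <- H0. apply bang_nat.
- apply (mul_assoc (im_monoids HD)).
- apply (mul_unitl (im_monoids HD)).
- apply (mul_unitr (im_monoids HD)).
(* In the target, units are natural for all arrows, in particular for the images of generators. *)
- rewrite <- g_src, <- g_tgt. apply (unt_nat (im_monoids HD)).
- apply g_comp; assumption.
Qed.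

Definition free_functor : sfun (fim X) D :=
  SFun (fim X) D free_ob (fun h : ar (fim X) => free_raw (ft_raw (rep h))).

Lemma free_functor_cl x w v : fim_sort x w v -> s_ar free_functor (fcl x) = free_raw x.
Proof.
intros H. simpl. apply free_raw_eq. rewrite (fcl_mk H).
exact (proj2 (proj2 (rep_cls (fim_term_equiv X) (FimTerm H)))).
Qed.

Lemma free_functor_ok : imon_functor (fim X) D free_functor.
Proof.
split; [split; [split| | | ]|].
- intros f. destruct (fcl_surj f) as [x [H Ex]]. rewrite Ex at 1.
  rewrite (free_functor_cl H). apply (free_sort H).
- intros f. destruct (fcl_surj f) as [x [H Ex]]. rewrite Ex at 1.
  rewrite (free_functor_cl H). apply (free_sort H).
- intros w. rewrite <- fcl_id, (free_functor_cl (fw_id_sort X w)). apply free_raw_id.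
- intros f f' e. destruct (fcl_surj f) as [x [H Ex]], (fcl_surj f') as [y [H' Ey]].
  rewrite <- e in H'. rewrite Ex, Ey, <- (fcl_comp H H').
  rewrite (free_functor_cl (fs_comp H H')), (free_functor_cl H), (free_functor_cl H'). reflexivity.
- reflexivity.
- apply free_ob_app.
- intros f f'. destruct (fcl_surj f) as [x [H Ex]], (fcl_surj f') as [y [H' Ey]].
  rewrite Ex, Ey, <- (fcl_ten H H').
  rewrite (free_functor_cl (fs_ten H H')), (free_functor_cl H), (free_functor_cl H'). reflexivity.
- intros w. rewrite fim_mul_cl, (free_functor_cl (fw_mul_sort X w)). apply free_raw_mul.
Qed.

(** A strict monoidal functor has no freedom on the cartesian generators, and preservation of
    multiplications is part of [imon_functor]; only the units call for an argument. *)
Lemma free_functor_uniq (Q : sfun (fim X) D) : imon_functor (fim X) D Q ->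
  (forall a, s_ob Q (fo X a) = go a) -> (forall f, s_ar Q (fim_gen X f) = g f) ->
  Q = free_functor.
Proof.
intros HQ Ho Hg. pose proof HQ as [HQm Qmul]. pose proof HQm as [[F1 F2 F3 F4] F5 F6 F7].
assert (eo : forall w, s_ob Q w = free_ob w).
{ induction w as [|a w IH]; [exact F5|]. simpl.
  rewrite <- Ho, <- IH. apply (F6 (fo X a)). }
assert (ea : forall x w v, fim_sort x w v -> s_ar Q (fcl x) = free_raw x).
{ intros x w v H; induction H; simpl free_raw.
  - rewrite <- fim_gen_cl. apply Hg.
  - rewrite fcl_id1, F3, Ho. reflexivity.
  - change (@fr_eps X) with (fw_id X []). rewrite fcl_id, F3. f_equal. exact F5.
  - rewrite (fcl_comp H H0), F4, IHfim_sort1, IHfim_sort2; [reflexivity|].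
    rewrite (fcl_tgt H), (fcl_src H0). reflexivity.
  - rewrite (fcl_ten H H0). rewrite F7, IHfim_sort1, IHfim_sort2. reflexivity.
  - rewrite fcl_sym, fim_sym_swap, (preserves_swap _ _ HQm), !Ho. reflexivity.
  - rewrite fcl_dup, fim_dup_diag, (preserves_diag _ _ HQm), !Ho. reflexivity.
  - rewrite fcl_del, fim_del_bang, (preserves_bang _ _ HQm), !Ho. reflexivity.
  - rewrite fcl_mul, Qmul, Ho. reflexivity.
  (* The image of a unit is a left unit for the multiplication that it is sent to, hence it is the
     chosen unit there. *)
  - rewrite fcl_unt. apply unt_uniq;
      [exact HC|exact mu_src|exact un_src|exact un_tgt
      |exact (mul_unitr (im_monoids HD))| | | ].
    + rewrite F1, fim_unt_src. exact F5.
    + rewrite F2, fim_unt_tgt. apply Ho.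
    + rewrite <- Ho, <- F3, <- F7, <- Qmul, <- F4.
      * f_equal. exact (proj1 (proj2 (fim_monoid_words X)) (fo X a)).
      * rewrite fim_mul_src, (mon_tgt (C := fim X)), fim_unt_tgt, (cat_tgt_id (C := fim X)).
        reflexivity. }
destruct Q as [Qo Qa]. unfold free_functor. simpl in *.
assert (E : Qo = free_ob) by (apply functional_extensionality; exact eo). subst Qo.
f_equal. apply functional_extensionality. intros h.
destruct (fcl_surj h) as [x [H Ex]]. rewrite Ex at 1. rewrite (ea _ _ _ H).
symmetry. rewrite Ex. exact (free_functor_cl H).
Qed.
End FimFree.

Ltac tr := match goal with
  | H : ?R ?a ?b, K : ?R ?b ?c |- ?R ?a ?c => exact (transitivity H K)
  | H : ?R ?b ?a, K : ?R ?b ?c |- ?R ?a ?c => exact (transitivity (symmetry H) K)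
  | H : ?R ?a ?b, K : ?R ?c ?b |- ?R ?a ?c => exact (transitivity H (symmetry K))
  end.

(** * The syntactic category *)

Section Sorts.
Variables (L : lsig) (E0 : rel0 L).

Lemma sieq_inv (x : {o : layer L & ity L o}) y : sieq E0 x y ->
  exists e : projT1 x = projT1 y,
    ieq E0 (eq_rect _ (ity L) (projT2 x) _ e) (projT2 y).
Proof. intros [o A B H]. exists eq_refl. exact H. Qed.

(** The equality of layers extracted by [sieq_inv] is a loop, which proof irrelevance identifies
    with [eq_refl], so that the transport vanishes. *)
Lemma sieq_inj o (A B : ity L o) : sieq E0 (existT _ o A) (existT _ o B) -> ieq E0 A B.
Proof.
intros H; apply sieq_inv in H; simpl in H. destruct H as [e H].
rewrite (proof_irrelevance _ e eq_refl) in H. exact H.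
Qed.

Global Instance sieq_equiv : Equivalence (sieq E0).
Proof.
split.
- intros [o A]; constructor; apply ie_refl.
- intros x y H; destruct H as [o A B H]; constructor; apply ie_sym, H.
- intros [o A] [t B] [r C] H K. apply sieq_inv in H, K; simpl in *.
  destruct H as [e H], K as [e' K]. subst. simpl in *.
  constructor. exact (ie_trans H K).
Qed.

Global Instance teq_equiv : Equivalence (teq E0).
Proof.
split.
- intros T; induction T; constructor; [reflexivity|assumption].
- intros T S H; induction H; constructor; [symmetry|]; assumption.
- intros T S U H; revert U; induction H; intros U K; inversion K; subst; constructor.
  + etransitivity; eassumption.
  + apply IHForall2; assumption.
Qed.

Lemma teq_app T T' S S' : teq E0 T T' -> teq E0 S S' -> teq E0 (T ++ S) (T' ++ S').
Proof. apply Forall2_app. Qed.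

Lemma teq_sg o (A B : ity L o) : ieq E0 A B -> teq E0 (sg A) (sg B).
Proof. intros H; constructor; [constructor; exact H|constructor]. Qed.

Lemma teq_sg_sieq o (A : ity L o) t (B : ity L t) :
  teq E0 (sg A) (sg B) -> sieq E0 (existT _ o A) (existT _ t B).
Proof. intros H; inversion H; subst; assumption. Qed.

Lemma sieq_teq_sg o (A : ity L o) t (B : ity L t) :
  sieq E0 (existT _ o A) (existT _ t B) -> teq E0 (sg A) (sg B).
Proof. intros H; constructor; [exact H|constructor]. Qed.

Lemma teq_sg_ieq o (A B : ity L o) : teq E0 (sg A) (sg B) -> ieq E0 A B.
Proof. intros H; apply sieq_inj, teq_sg_sieq, H. Qed.

Lemma teq_layers T S : teq E0 T S -> ty_layers T = ty_layers S.
Proof.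
induction 1 as [|A B T S H _ IH]; [reflexivity|].
simpl; rewrite IH. destruct H; reflexivity.
Qed.

Lemma tm_cast x T S T' S' : term E0 x T S -> T = T' -> S = S' -> term E0 x T' S'.
Proof. intros H -> ->; exact H. Qed.
Local Notation ex A := (existT (ity L) _ A).

(** Inversion of sorts, by recursion on [x]: the conversion rule and the dependent
    indices of [iterm] defeat [inversion]. *)
Definition iterm_inv (x : tm L) o (A B : ity L o) : Prop :=
  match x with
  | tid C => sieq E0 (ex C) (ex A) /\ sieq E0 (ex C) (ex B)
  | @tgen _ t a b s => sieq E0 (ex (iword L t a)) (ex A) /\ sieq E0 (ex (iword L t b)) (ex B)
  | tapp f y => exists C D, iterm E0 y C D /\
      sieq E0 (ex (iapp f C)) (ex A) /\ sieq E0 (ex (iapp f D)) (ex B)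
  | titen t y z => exists C D C' D' : ity L t, iterm E0 y C D /\ iterm E0 z C' D' /\
      sieq E0 (ex (iten C C')) (ex A) /\ sieq E0 (ex (iten D D')) (ex B)
  | y ;t z => exists C, iterm E0 y A C /\ iterm E0 z C B
  | _ => False
  end.

Lemma iterm_iinv x o (A B : ity L o) : iterm E0 x A B -> iterm_inv x A B.
Proof.
induction 1; simpl.
- split; reflexivity.
- split; reflexivity.
- exists A, B. repeat apply conj; [assumption|reflexivity|reflexivity].
- exists A, B, C, D. repeat apply conj; try assumption; reflexivity.
- exists B. split; assumption.
- assert (e1 : sieq E0 (ex A) (ex A')) by (constructor; assumption).
  assert (e2 : sieq E0 (ex B) (ex B')) by (constructor; assumption).
  destruct x; simpl in *; try contradiction.
  + destruct IHiterm; split; tr.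
  + destruct IHiterm; split; tr.
  + destruct IHiterm as [C [D [? [? ?]]]]; exists C, D; repeat apply conj; try assumption; tr.
  + destruct IHiterm as [C [D [C' [D' [? [? [? ?]]]]]]]; exists C, D, C', D';
      repeat apply conj; try assumption; tr.
  + destruct IHiterm as [C [? ?]]; exists C; split.
    * apply it_conv with (3 := H2); [assumption|apply ie_refl].
    * apply it_conv with (3 := H3); [apply ie_refl|assumption].
Qed.

(** The leaves of a raw term carry their types, and the layer of an internal tensor is recorded too;
    only the type congruence is left undetermined. *)
Lemma iterm_det x : forall o (A B : ity L o) o' (A' B' : ity L o'),
  iterm E0 x A B -> iterm E0 x A' B' -> sieq E0 (ex A) (ex A') /\ sieq E0 (ex B) (ex B').
Proof.
induction x; intros o1 A1 B1 o2 A2 B2 H1 H2; apply iterm_iinv in H1, H2;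
  simpl in *; try contradiction.
- destruct H1, H2; split; tr.
- destruct H1, H2; split; tr.
- destruct H1 as [C [D [H1 [? ?]]]], H2 as [C' [D' [H2 [? ?]]]].
  destruct (IHx _ _ _ _ _ _ H1 H2) as [e1 e2]. apply sieq_inj in e1, e2.
  assert (sieq E0 (ex (iapp f C)) (ex (iapp f C'))) by (constructor; apply ie_app, e1).
  assert (sieq E0 (ex (iapp f D)) (ex (iapp f D'))) by (constructor; apply ie_app, e2).
  split.
  + transitivity (ex (iapp f C)); [symmetry; assumption|]. tr.
  + transitivity (ex (iapp f D)); [symmetry; assumption|]. tr.
- destruct H1 as [C1 [D1 [C1' [D1' [H1 [K1 [? ?]]]]]]], H2 as [C2 [D2 [C2' [D2' [H2 [K2 [? ?]]]]]]].
  destruct (IHx1 _ _ _ _ _ _ H1 H2) as [e1 e2]. apply sieq_inj in e1, e2.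
  destruct (IHx2 _ _ _ _ _ _ K1 K2) as [e3 e4]. apply sieq_inj in e3, e4.
  assert (sieq E0 (ex (iten C1 C1')) (ex (iten C2 C2'))) by (constructor; apply ie_ten; assumption).
  assert (sieq E0 (ex (iten D1 D1')) (ex (iten D2 D2'))) by (constructor; apply ie_ten; assumption).
  split.
  + transitivity (ex (iten C1 C1')); [symmetry; assumption|]. tr.
  + transitivity (ex (iten D1 D1')); [symmetry; assumption|]. tr.
- destruct H1 as [C [H1 K1]], H2 as [C' [H2 K2]]. split.
  + apply (IHx1 _ _ _ _ _ _ H1 H2).
  + apply (IHx2 _ _ _ _ _ _ K1 K2).
Qed.

Definition term_inv (x : tm L) (T S : ty L) : Prop :=
  match x with
  | tid _ | tgen _ _ | tapp _ _ | titen _ _ _ =>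
      exists o (A B : ity L o), iterm E0 x A B /\ teq E0 (sg A) T /\ teq E0 (sg B) S
  | y ;t z => exists U, term E0 y T U /\ term E0 z U S
  | teps => teq E0 [] T /\ teq E0 [] S
  | y *t z => exists T1 S1 T2 S2, term E0 y T1 S1 /\ term E0 z T2 S2 /\
      teq E0 (T1 ++ T2) T /\ teq E0 (S1 ++ S2) S
  | tsym A B => teq E0 (sg A ++ sg B) T /\ teq E0 (sg B ++ sg A) S
  | tnab f A => teq E0 (sg A) T /\ teq E0 (sg (iapp f A)) S
  | tmul A B => teq E0 (sg A ++ sg B) T /\ teq E0 (sg (iten A B)) S
  | tunt o => teq E0 [] T /\ teq E0 (sg (iunit o)) S
  | tdup A => teq E0 (sg A) T /\ teq E0 (sg A ++ sg A) S
  | tdel A => teq E0 (sg A) T /\ teq E0 [] S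
  end.

Lemma term_tinv x T S : term E0 x T S -> term_inv x T S.
Proof.
induction 1; simpl; try (split; reflexivity).
- pose proof (iterm_iinv H) as K. destruct x; simpl in *; try contradiction;
    try (exists o, A, B; repeat apply conj; [assumption|reflexivity|reflexivity]).
  (* A composite of internal terms is inverted as a composite of terms through the one-letter list
     on its intermediate internal type. *)
  destruct K as [C [K1 K2]]. exists (sg C). split; apply tm_int; assumption.
- exists S. split; assumption.
- exists T, S, U, W. repeat apply conj; try assumption; reflexivity.
- assert (int : forall x, (exists o (A B : ity L o), iterm E0 x A B /\ teq E0 (sg A) T /\ teq E0 (sg B) S) ->
    exists o (A B : ity L o), iterm E0 x A B /\ teq E0 (sg A) T' /\ teq E0 (sg B) S').
  { intros y [o [A [B [? [? ?]]]]]. exists o, A, B. repeat apply conj; try assumption; tr. }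
  destruct x; simpl in *; try (destruct IHterm; split; tr); try (apply int; assumption).
  + destruct IHterm as [U [K1 K2]].
    exists U. split; [apply tm_conv with (3 := K1)|apply tm_conv with (3 := K2)];
      first [assumption|reflexivity].
  + destruct IHterm as [T1 [S1 [T2 [S2 [? [? [? ?]]]]]]].
    exists T1, S1, T2, S2; repeat apply conj; try assumption; tr.
Qed.

Lemma term_det : forall x T S T' S', term E0 x T S -> term E0 x T' S' ->
  teq E0 T T' /\ teq E0 S S'.
Proof.
assert (tr : forall T U S, teq E0 T U -> teq E0 T S -> teq E0 U S).
{ intros T U S e e'. rewrite <- e. exact e'. }
assert (int : forall x T S T' S',
  (exists o (A B : ity L o), iterm E0 x A B /\ teq E0 (sg A) T /\ teq E0 (sg B) S) ->
  (exists o (A B : ity L o), iterm E0 x A B /\ teq E0 (sg A) T' /\ teq E0 (sg B) S') ->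
  teq E0 T T' /\ teq E0 S S').
{ intros x T S T' S' [o [A [B [H [e1 e2]]]]] [o' [A' [B' [H' [e1' e2']]]]].
  destruct (iterm_det H H') as [e e']. apply sieq_teq_sg in e, e'.
  rewrite <- e1, <- e2, <- e1', <- e2'. split; assumption. }
intros x; induction x; intros T S T' S' H H'; apply term_tinv in H, H'; simpl in *;
  try (destruct H, H'; split; eapply tr; eassumption);
  try (eapply int; eassumption).
- destruct H as [U [H K]], H' as [U' [H' K']]. split.
  + exact (proj1 (IHx1 _ _ _ _ H H')).
  + exact (proj2 (IHx2 _ _ _ _ K K')).
- destruct H as [T1 [S1 [T2 [S2 [H [K [e1 e2]]]]]]], H' as [T1' [S1' [T2' [S2' [H' [K' [e1' e2']]]]]]].
  destruct (IHx1 _ _ _ _ H H') as [a1 a2], (IHx2 _ _ _ _ K K') as [b1 b2].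
  rewrite <- e1, <- e2, <- e1', <- e2'. split; apply teq_app; assumption.
Qed.

Lemma tsym1_l_sort (A : {o : layer L & ity L o}) S :
  term E0 (tsym1_l A S) (A :: S) (S ++ [A]).
Proof.
destruct A as [o A]. induction S as [|[t B] S IH]; simpl.
- apply tm_int, it_id.
- apply tm_comp with (S := (ex B) :: (ex A) :: S).
  + exact (tm_ten (tm_sym E0 A B) (tid_l_sort E0 S)).
  + exact (tm_ten (tm_int (it_id E0 B)) IH).
Qed.

Lemma tsym_l_sort T S : term E0 (tsym_l T S) (T ++ S) (S ++ T).
Proof.
induction T as [|[o A] T IH]; simpl.
- rewrite app_nil_r. apply tid_l_sort.
- apply tm_comp with (S := (ex A) :: S ++ T).
  + exact (tm_ten (tm_int (it_id E0 A)) IH).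
  + apply (tm_cast (tm_ten (tsym1_l_sort (ex A) S) (tid_l_sort E0 T))); [reflexivity|].
    rewrite <- app_assoc; reflexivity.
Qed.

Lemma tdup_l_sort T : term E0 (tdup_l T) T (T ++ T).
Proof.
induction T as [|[o A] T IH]; simpl; [apply tm_eps|].
apply tm_comp with (S := (ex A) :: (ex A) :: T ++ T).
- exact (tm_ten (tm_dup E0 A) IH).
- apply (tm_cast (tm_ten (tm_int (it_id E0 A)) (tm_ten (tsym1_l_sort (ex A) T) (tid_l_sort E0 T))));
    [reflexivity|]. simpl. rewrite <- app_assoc; reflexivity.
Qed.

Lemma tdel_l_sort T : term E0 (tdel_l T) T [].
Proof. induction T as [|[o A] T IH]; [apply tm_eps|]. exact (tm_ten (tm_del E0 A) IH). Qed.

Lemma tm_id o (A : ity L o) : term E0 (tid A) (sg A) (sg A).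
Proof. apply tm_int, it_id. Qed.

Variable E1 : rel1 L.
Hypothesis E1_parallel : forall x y, E1 x y -> exists T S, term E0 x T S /\ term E0 y T S.

Lemma iterm_conv' x o (A A' B B' : ity L o) : iterm E0 x A' B' -> ieq E0 A' A -> ieq E0 B' B ->
  iterm E0 x A B.
Proof. intros H e e'; exact (it_conv e e' H). Qed.

(** This is where the structural 0-equations are needed: the two sides of the associativity and unit
    laws, and of the laws for [f[-]] and [nabla], may have sorts that agree only up to the type
    congruence. *)
Lemma tmeq_sort : forall x y, tmeq E0 E1 x y -> exists T S, term E0 x T S /\ term E0 y T S.
Proof.
assert (two : forall x y T S, term E0 x T S -> term E0 y T S ->
  exists T S, term E0 x T S /\ term E0 y T S) by (intros; eexists; eexists; split; eassumption).
assert (itwo : forall x y o (A B : ity L o), iterm E0 x A B -> iterm E0 y A B ->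
  exists T S, term E0 x T S /\ term E0 y T S).
{ intros x0 y0 o A B H1 H2; exists (sg A), (sg B); split; apply tm_int; assumption. }
intros x y; induction 1.
- exact (two _ _ _ _ H H).
- destruct IHtmeq as [T [S [? ?]]]. exists T, S; split; assumption.
- destruct IHtmeq1 as [T [S [H1 K1]]], IHtmeq2 as [T' [S' [H2 K2]]].
  exists T, S; split; [assumption|]. destruct (term_det K1 H2) as [e1 e2].
  apply tm_conv with (3 := K2); symmetry; assumption.
- destruct IHtmeq1 as [T1 [S1 [H3 K1]]], IHtmeq2 as [T2 [S2 [H4 K2]]].
  destruct (term_det H H3), (term_det H0 H4). exists T, U. split.
  + exact (tm_comp H H0).
  + apply tm_comp with S; [apply tm_conv with (3 := K1)|apply tm_conv with (3 := K2)];
      symmetry; assumption.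
- destruct IHtmeq1 as [T1 [S1 [H3 K1]]], IHtmeq2 as [T2 [S2 [H4 K2]]].
  eapply two; apply tm_ten; eassumption.
- exact (itwo _ _ _ _ _ (it_app _ f H) (it_app _ f H0)).
- exact (itwo _ _ _ _ _ (it_ten H H1) (it_ten H0 H2)).
- apply E1_parallel; assumption.
- exact (two _ _ _ _ (tm_comp (tm_comp H H0) H1) (tm_comp H (tm_comp H0 H1))).
- exact (two _ _ _ _ (tm_comp (tid_l_sort E0 T) H) H).
- exact (two _ _ _ _ (tm_comp H (tid_l_sort E0 S)) H).
- refine (two _ _ _ _ (tm_ten (tm_ten H H0) H1) _). rewrite <- !app_assoc.
  exact (tm_ten H (tm_ten H0 H1)).
- exact (two _ _ _ _ (tm_ten (tm_eps E0) H) H).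
- refine (two _ _ _ _ (tm_ten H (tm_eps E0)) _). rewrite !app_nil_r. exact H.
- exact (two _ _ _ _ (tm_ten (tm_comp H H0) (tm_comp H1 H2))
    (tm_comp (tm_ten H H1) (tm_ten H0 H2))).
- refine (itwo _ _ _ _ _ (it_ten (it_ten H H0) H1)
    (iterm_conv' (it_ten H (it_ten H0 H1)) _ _)); apply ie_sym, ie_assoc.
- refine (itwo _ _ _ _ _ (it_ten (it_id E0 (iunit o)) H) (iterm_conv' H _ _));
    apply ie_sym, ie_unitl.
- refine (itwo _ _ _ _ _ (it_ten H (it_id E0 (iunit o))) (iterm_conv' H _ _));
    apply ie_sym, ie_unitr.
- exact (itwo _ _ _ _ _ (it_ten (it_comp H H0) (it_comp H1 H2))
    (it_comp (it_ten H H1) (it_ten H0 H2))).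
- exact (itwo _ _ _ _ _ (it_id E0 (iten A B)) (it_ten (it_id E0 A) (it_id E0 B))).
- exact (itwo _ _ _ _ _ (it_app _ f (it_id E0 A)) (it_id E0 (iapp f A))).
- exact (itwo _ _ _ _ _ (it_app _ f (it_comp H H0)) (it_comp (it_app _ f H) (it_app _ f H0))).
- refine (itwo _ _ _ _ _ (it_app _ f (it_ten H H0))
    (iterm_conv' (it_ten (it_app _ f H) (it_app _ f H0)) _ _)); apply ie_sym, ie_app_ten.
- refine (itwo _ _ _ _ _ (it_app _ f (it_id E0 (iunit o)))
    (iterm_conv' (it_id E0 (iunit t)) _ _)); apply ie_sym, ie_app_unit.
- exact (two _ _ _ _ (tm_comp (tsym_l_sort T S) (tsym_l_sort S T)) (tid_l_sort E0 (T ++ S))).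
- exact (two _ _ _ _ (tm_comp (tm_ten H H0) (tsym_l_sort S S'))
    (tm_comp (tsym_l_sort T T') (tm_ten H0 H))).
- exact (two _ _ _ _ (tm_comp (tm_dup E0 A) (tm_ten (tm_dup E0 A) (tm_id A)))
    (tm_comp (tm_dup E0 A) (tm_ten (tm_id A) (tm_dup E0 A)))).
- exact (two _ _ _ _ (tm_comp (tm_dup E0 A) (tm_ten (tm_del E0 A) (tm_id A))) (tm_id A)).
- exact (two _ _ _ _ (tm_comp (tm_dup E0 A) (tm_ten (tm_id A) (tm_del E0 A))) (tm_id A)).
- exact (two _ _ _ _ (tm_comp H (tdup_l_sort S)) (tm_comp (tdup_l_sort T) (tm_ten H H))).
- exact (two _ _ _ _ (tm_comp H (tdel_l_sort S)) (tdel_l_sort T)).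
- refine (two _ _ _ _ (tm_comp (tm_ten (tm_mul E0 A B) (tm_id C)) (tm_mul E0 (iten A B) C))
    (tm_conv _ _ (tm_comp (tm_ten (tm_id A) (tm_mul E0 B C)) (tm_mul E0 A (iten B C))))).
  + reflexivity.
  + apply teq_sg, ie_sym, ie_assoc.
- refine (two _ _ _ _ (tm_comp (tm_ten (tm_unt E0 o) (tm_id A)) (tm_mul E0 (iunit o) A))
    (tm_conv _ _ (tm_id A))).
  + reflexivity.
  + apply teq_sg, ie_sym, ie_unitl.
- refine (two _ _ _ _ (tm_comp (tm_ten (tm_id A) (tm_unt E0 o)) (tm_mul E0 A (iunit o)))
    (tm_conv _ _ (tm_id A))).
  + reflexivity.
  + apply teq_sg, ie_sym, ie_unitr.
- exact (two _ _ _ _ (tm_comp (tm_ten (tm_int H) (tm_int H0)) (tm_mul E0 B D))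
    (tm_comp (tm_mul E0 A C) (tm_int (it_ten H H0)))).
- exact (two _ _ _ _ (tm_comp (tm_int H) (tm_nab E0 _ f B))
    (tm_comp (tm_nab E0 _ f A) (tm_int (it_app _ f H)))).
- refine (two _ _ _ _ (tm_comp (tm_mul E0 A B) (tm_nab E0 _ f (iten A B)))
    (tm_conv _ _ (tm_comp (tm_ten (tm_nab E0 _ f A) (tm_nab E0 _ f B))
      (tm_mul E0 (iapp f A) (iapp f B))))).
  + reflexivity.
  + apply teq_sg, ie_sym, ie_app_ten.
- refine (two _ _ _ _ (tm_comp (tm_unt E0 o) (tm_nab E0 _ f (iunit o)))
    (tm_conv _ _ (tm_unt E0 t))).
  + reflexivity.
  + apply teq_sg, ie_sym, ie_app_unit.
Qed.
End Sorts.

(** * Types and terms as a cartesian category *)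

Section Syntactic.
Variable T : theory.
Local Notation L := (th_sig T).
Local Notation E0 := (th_E0 T).
Local Notation E1 := (th_E1 T).
Local Notation term := (term E0).
Local Notation iterm := (iterm E0).
Local Notation tmeq := (tmeq E0 E1).
Local Notation Y := (syn_mcat T).
Implicit Types (x y z : tm (th_sig T)) (U V W : ty (th_sig T)) (h k : ar (syn_mcat T)).

Definition sty U : ob Y := syn_ty T U.

Lemma sterm_equiv : Equivalence (@sterm_eq T).
Proof.
split.
- intros [U V x H]; split; [reflexivity|]; split; [reflexivity|]. exact (te_refl _ H).
- intros [U V x H] [U' V' x' H'] [e1 [e2 e3]]; repeat apply conj; simpl in *;
    [symmetry; assumption..|apply te_symm; assumption].
- intros [U V x H] [U' V' x' H'] [U'' V'' x'' H''] [e1 [e2 e3]] [e4 [e5 e6]];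
    repeat apply conj; simpl in *; [etransitivity; eassumption..|exact (te_trans e3 e6)].
Qed.
Local Notation equ := sterm_equiv.

Lemma sty_eq U V : teq E0 U V -> sty U = sty V.
Proof. apply (cls_eq (teq_equiv E0)). Qed.
Lemma sty_inj U V : sty U = sty V -> teq E0 U V.
Proof. apply (cls_inj (teq_equiv E0)). Qed.
Lemma sty_surj (A : ob Y) : exists U, A = sty U.
Proof. apply quot_surj. Qed.
Lemma sty_rep U : teq E0 (rep (sty U)) U.
Proof. apply (rep_cls (teq_equiv E0)). Qed.
Lemma sty_one : @one Y = sty [].
Proof. reflexivity. Qed.
Lemma sty_app U V : sty U ** sty V = sty (U ++ V).
Proof. apply sty_eq, teq_app; apply sty_rep. Qed.

Definition scl x : ar Y :=
  the (syn_mk T (tm_eps E0)) (fun h => exists U V (H : term x U V), h = syn_mk T H).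

Lemma syn_mk_eq x y U V U' V' (H : term x U V) (H' : term y U' V') :
  teq E0 U U' -> teq E0 V V' -> tmeq x y -> syn_mk T H = syn_mk T H'.
Proof. intros. apply (cls_eq equ). repeat apply conj; assumption. Qed.

Lemma scl_mk x U V (H : term x U V) : scl x = syn_mk T H.
Proof.
apply the_eq; [exists U, V, H; reflexivity|].
intros h [U' [V' [H' ->]]]. destruct (term_det H H').
apply syn_mk_eq; [symmetry; assumption..|exact (te_refl _ H')].
Qed.

Lemma scl_src x U V : term x U V -> src (scl x) = sty U.
Proof. intros H. rewrite (scl_mk H). apply sty_eq, (rep_cls equ (STerm T H)). Qed.
Lemma scl_tgt x U V : term x U V -> tgt (scl x) = sty V.
Proof. intros H. rewrite (scl_mk H). apply sty_eq, (rep_cls equ (STerm T H)). Qed.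

Lemma scl_surj h U V : src h = sty U -> tgt h = sty V -> exists x, term x U V /\ h = scl x.
Proof.
intros e1 e2. exists (st_raw (rep h)).
assert (H : term (st_raw (rep h)) U V).
{ apply tm_conv with (3 := st_ok (rep h)); apply sty_inj; assumption. }
split; [exact H|]. rewrite (scl_mk (st_ok (rep h))), <- (cls_rep h) at 1.
destruct (rep h); reflexivity.
Qed.

Arguments scl_surj : clear implicits.
Arguments scl_surj h {U V}.

Lemma scl_surj' h : exists x U V, term x U V /\ h = scl x /\ src h = sty U /\ tgt h = sty V.
Proof.
destruct (sty_surj (src h)) as [U e1], (sty_surj (tgt h)) as [V e2].
destruct (scl_surj h e1 e2) as [x [H e]]. exists x, U, V. auto.
Qed.

Lemma scl_eq x y U V U' V' : tmeq x y -> term x U V -> term y U' V' -> scl x = scl y.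
Proof.
intros e H H'. rewrite (scl_mk H), (scl_mk H').
destruct (tmeq_sort (th_parallel T) e) as [U0 [V0 [K K']]].
destruct (term_det H K), (term_det H' K'). apply syn_mk_eq; [tr|tr|exact e].
Qed.

Lemma scl_tmeq x y : tmeq x y -> scl x = scl y.
Proof.
intros e. destruct (tmeq_sort (th_parallel T) e) as [U0 [V0 [K K']]].
exact (scl_eq e K K').
Qed.

Lemma scl_inj x y U V U' V' : term x U V -> term y U' V' -> scl x = scl y -> tmeq x y.
Proof.
intros H H' e. rewrite (scl_mk H), (scl_mk H') in e. apply (cls_inj equ) in e. apply e.
Qed.

(** By conversion [tid_l U ;t tid_l V] is well sorted, and the two unit laws reduce it to either
    factor. Identities therefore depend on types only up to congruence. *)
Lemma tid_l_tmeq U V : teq E0 U V -> tmeq (tid_l U) (tid_l V).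
Proof.
intros e. assert (H : term (tid_l V) U V).
{ apply tm_conv with (3 := tid_l_sort E0 V); [symmetry; exact e|reflexivity]. }
assert (H' : term (tid_l U) U V).
{ apply tm_conv with (3 := tid_l_sort E0 U); [reflexivity|exact e]. }
exact (te_trans (te_symm (te_idr E1 H')) (te_idl E1 H)).
Qed.

Lemma scl_id U : scl (tid_l U) = idn (sty U).
Proof.
rewrite (scl_mk (tid_l_sort E0 U)).
apply syn_mk_eq; [symmetry; apply sty_rep..|]. apply tid_l_tmeq. symmetry; apply sty_rep.
Qed.

Lemma scl_comp x y U V W : term x U V -> term y V W -> scl (x ;t y) = scl x ;; scl y.
Proof.
intros H H'. symmetry. apply the_eq.
- exists (STerm T H), (STerm T H'), (STerm T (tm_comp H H')).
  split; [exact (scl_mk H)|]. split; [exact (scl_mk H')|].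
  split; [exact (scl_mk (tm_comp H H'))|reflexivity].
- intros h [[U1 V1 x1 H1] [[U2 V2 x2 H2] [[U3 V3 z3 H3] [e1 [e2 [-> e4]]]]]]; simpl in e4.
  rewrite (scl_mk H) in e1. apply (cls_inj equ) in e1. destruct e1 as [e1 [e1' e1'']].
  rewrite (scl_mk H') in e2. apply (cls_inj equ) in e2. destruct e2 as [e2 [e2' e2'']].
  simpl in *; subst z3.
  assert (K1 : term x1 U V) by (apply tm_conv with (3 := H1); symmetry; assumption).
  assert (K2 : term x2 V W) by (apply tm_conv with (3 := H2); symmetry; assumption).
  destruct (term_det H3 (tm_comp K1 K2)) as [e5 e6].
  rewrite (scl_mk (tm_comp H H')). apply syn_mk_eq; [assumption..|].
  apply (te_comp K1 K2); apply te_symm; assumption.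
Qed.

Lemma scl_ten x y U V U' V' : term x U V -> term y U' V' -> scl (x *t y) = scl x ## scl y.
Proof.
intros H H'. rewrite (scl_mk (tm_ten H H')). apply syn_mk_eq.
- apply teq_app; symmetry; apply sty_inj; [exact (scl_src H)|exact (scl_src H')].
- apply teq_app; symmetry; apply sty_inj; [exact (scl_tgt H)|exact (scl_tgt H')].
- rewrite (scl_mk H), (scl_mk H').
  apply te_ten; apply te_symm, (rep_cls equ (STerm T _)).
Qed.

Instance syn_is_cat : is_cat Y.
Proof.
split.
- intros A. destruct (sty_surj A) as [U ->]. rewrite <- scl_id. exact (scl_src (tid_l_sort E0 U)).
- intros A. destruct (sty_surj A) as [U ->]. rewrite <- scl_id. exact (scl_tgt (tid_l_sort E0 U)).
- intros f g e. destruct (scl_surj' f) as [x [U [V [H [Ex [e1 e2]]]]]].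
  destruct (sty_surj (tgt g)) as [W e3].
  destruct (scl_surj g (eq_trans (eq_sym e) e2) e3) as [y [H' Ey]].
  rewrite e1, Ex, Ey, <- (scl_comp H H'). exact (scl_src (tm_comp H H')).
- intros f g e. destruct (scl_surj' f) as [x [U [V [H [Ex [e1 e2]]]]]].
  destruct (sty_surj (tgt g)) as [W e3].
  destruct (scl_surj g (eq_trans (eq_sym e) e2) e3) as [y [H' Ey]].
  rewrite e3, Ex, Ey, <- (scl_comp H H'). exact (scl_tgt (tm_comp H H')).
- intros f. destruct (scl_surj' f) as [x [U [V [H [Ex [e1 e2]]]]]].
  rewrite e1, Ex, <- scl_id, <- (scl_comp (tid_l_sort E0 U) H).
  exact (scl_tmeq (te_idl E1 H)).
- intros f. destruct (scl_surj' f) as [x [U [V [H [Ex [e1 e2]]]]]].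
  rewrite e2, Ex, <- scl_id, <- (scl_comp H (tid_l_sort E0 V)).
  exact (scl_tmeq (te_idr E1 H)).
- intros f g h e e'. destruct (scl_surj' f) as [x [U [V [H [Ex [e1 e2]]]]]].
  destruct (sty_surj (tgt g)) as [W e3].
  destruct (scl_surj g (eq_trans (eq_sym e) e2) e3) as [y [H' Ey]].
  destruct (sty_surj (tgt h)) as [S e4].
  destruct (scl_surj h (eq_trans (eq_sym e') e3) e4) as [z [H'' Ez]].
  rewrite Ex, Ey, Ez. rewrite <- (scl_comp H H'), <- (scl_comp H' H''),
    <- (scl_comp (tm_comp H H') H''), <- (scl_comp H (tm_comp H' H'')).
  exact (scl_tmeq (te_assoc E1 H H' H'')).
Qed.

Global Instance syn_is_monoidal : is_strict_monoidal Y.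
Proof.
split.
- exact syn_is_cat.
- intros f g. destruct (scl_surj' f) as [x [U [V [H [Ex [e1 e2]]]]]].
  destruct (scl_surj' g) as [y [U' [V' [H' [Ey [e3 e4]]]]]].
  rewrite e1, e3, Ex, Ey, sty_app, <- (scl_ten H H'). exact (scl_src (tm_ten H H')).
- intros f g. destruct (scl_surj' f) as [x [U [V [H [Ex [e1 e2]]]]]].
  destruct (scl_surj' g) as [y [U' [V' [H' [Ey [e3 e4]]]]]].
  rewrite e2, e4, Ex, Ey, sty_app, <- (scl_ten H H'). exact (scl_tgt (tm_ten H H')).
- intros A B. destruct (sty_surj A) as [U ->], (sty_surj B) as [V ->].
  rewrite sty_app, <- !scl_id, <- (scl_ten (tid_l_sort E0 U) (tid_l_sort E0 V)).
  pose proof (tid_l_sort E0) as I. induction U as [|[o A] U IH]; simpl.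
  + exact (scl_tmeq (te_tunitl E1 (I V))).
  + rewrite (scl_tmeq (te_tassoc E1 (tm_id E0 A) (I U) (I V))).
    rewrite (scl_ten (tm_id E0 A) (tm_ten (I U) (I V))), IH.
    symmetry. exact (scl_ten (tm_id E0 A) (I (U ++ V))).
- intros f f' g g' e e'.
  destruct (scl_surj' f) as [x [U [V [H [Ex [e1 e2]]]]]].
  destruct (sty_surj (tgt f')) as [W e3].
  destruct (scl_surj f' (eq_trans (eq_sym e) e2) e3) as [x' [H' Ex']].
  destruct (scl_surj' g) as [y [U' [V' [K [Ey [e1' e2']]]]]].
  destruct (sty_surj (tgt g')) as [W' e3'].
  destruct (scl_surj g' (eq_trans (eq_sym e') e2') e3') as [y' [K' Ey']].
  rewrite Ex, Ex', Ey, Ey'.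
  rewrite <- (scl_comp H H'), <- (scl_comp K K'), <- (scl_ten (tm_comp H H') (tm_comp K K')).
  rewrite <- (scl_ten H K), <- (scl_ten H' K'), <- (scl_comp (tm_ten H K) (tm_ten H' K')).
  exact (scl_tmeq (te_interchange E1 H H' K K')).
- intros A B C. destruct (sty_surj A) as [U ->], (sty_surj B) as [V ->], (sty_surj C) as [W ->].
  rewrite !sty_app, app_assoc. reflexivity.
- intros f g h. destruct (scl_surj' f) as [x [U [V [H [Ex _]]]]].
  destruct (scl_surj' g) as [y [U' [V' [H' [Ey _]]]]].
  destruct (scl_surj' h) as [z [U'' [V'' [H'' [Ez _]]]]].
  rewrite Ex, Ey, Ez. rewrite <- (scl_ten H H'), <- (scl_ten H' H''),
    <- (scl_ten (tm_ten H H') H''), <- (scl_ten H (tm_ten H' H'')).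
  exact (scl_tmeq (te_tassoc E1 H H' H'')).
- intros A. destruct (sty_surj A) as [U ->]. rewrite sty_one, sty_app. reflexivity.
- intros A. destruct (sty_surj A) as [U ->]. rewrite sty_one, sty_app, app_nil_r. reflexivity.
- intros f. destruct (scl_surj' f) as [x [U [V [H [Ex _]]]]].
  rewrite Ex, sty_one, <- scl_id, <- (scl_ten (tid_l_sort E0 []) H). exact (scl_tmeq (te_tunitl E1 H)).
- intros f. destruct (scl_surj' f) as [x [U [V [H [Ex _]]]]].
  rewrite Ex, sty_one, <- scl_id, <- (scl_ten H (tid_l_sort E0 [])). exact (scl_tmeq (te_tunitr E1 H)).
Qed.

Definition ssym (A B : ob Y) : ar Y := scl (tsym_l (rep A) (rep B)).
Definition sdup (A : ob Y) : ar Y := scl (tdup_l (rep A)).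
Definition sdel (A : ob Y) : ar Y := scl (tdel_l (rep A)).

(** Independence of the representatives comes from naturality of the symmetry against identities,
    read as terms from one representative to another. *)
Lemma ssym_sty U V : ssym (sty U) (sty V) = scl (tsym_l U V).
Proof.
unfold ssym. assert (eU := sty_rep U). assert (eV := sty_rep V).
set (U' := rep (sty U)) in *. set (V' := rep (sty V)) in *.
pose proof (tid_l_sort E0) as I. pose proof (tsym_l_sort E0) as S.
assert (HU : term (tid_l U) U' U) by (apply tm_conv with (3 := I U); [symmetry; exact eU|reflexivity]).
assert (HV : term (tid_l V) V' V) by (apply tm_conv with (3 := I V); [symmetry; exact eV|reflexivity]).
pose proof (scl_tmeq (te_sym_nat E1 HU HV)) as n.
rewrite (scl_comp (tm_ten HU HV) (S U V)), (scl_comp (S U' V') (tm_ten HV HU)) in n.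
rewrite (scl_ten HU HV), (scl_ten HV HU), !scl_id, !mon_id, !sty_app in n.
rewrite cat_idl', cat_idr' in n.
- symmetry; exact n.
- rewrite (scl_tgt (S U' V')). apply sty_eq, teq_app; assumption.
- exact (scl_src (S U V)).
Qed.

Lemma sdup_sty U : sdup (sty U) = scl (tdup_l U).
Proof.
unfold sdup. assert (eU := sty_rep U). set (U' := rep (sty U)) in *.
pose proof (tid_l_sort E0) as I. pose proof (tdup_l_sort E0) as S.
assert (HU : term (tid_l U) U' U) by (apply tm_conv with (3 := I U); [symmetry; exact eU|reflexivity]).
pose proof (scl_tmeq (te_dup_nat E1 HU)) as n.
rewrite (scl_comp HU (S U)), (scl_comp (S U') (tm_ten HU HU)) in n.
rewrite (scl_ten HU HU), !scl_id, !mon_id, !sty_app in n.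
rewrite cat_idl', cat_idr' in n.
- symmetry; exact n.
- rewrite (scl_tgt (S U')). apply sty_eq, teq_app; assumption.
- exact (scl_src (S U)).
Qed.

Lemma sdel_sty U : sdel (sty U) = scl (tdel_l U).
Proof.
unfold sdel. assert (eU := sty_rep U). set (U' := rep (sty U)) in *.
pose proof (tid_l_sort E0) as I. pose proof (tdel_l_sort E0) as S.
assert (HU : term (tid_l U) U' U) by (apply tm_conv with (3 := I U); [symmetry; exact eU|reflexivity]).
pose proof (scl_tmeq (te_del_nat E1 HU)) as n.
rewrite (scl_comp HU (S U)), scl_id, cat_idl' in n.
- symmetry; exact n.
- exact (scl_src (S U)).
Qed.

Definition slet o (A : ity L o) : ob Y := sty (sg A).

Lemma scl_id1 o (A : ity L o) : scl (tid A) = idn (slet A).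
Proof.
unfold slet. rewrite <- scl_id. symmetry. exact (scl_tmeq (te_tunitr E1 (tm_id E0 A))).
Qed.

Lemma sty_cons o (A : ity L o) U : sty (existT (ity L) o A :: U) = slet A ** sty U.
Proof. symmetry; exact (sty_app (sg A) U). Qed.

Lemma syn_ind (P : ob Y -> Prop) :
  P one -> (forall A B, (exists o (a : ity L o), A = slet a) -> P B -> P (A ** B)) ->
  forall A, P A.
Proof.
intros H K A. destruct (sty_surj A) as [U ->].
induction U as [|[o a] U IH]; [exact H|]. rewrite sty_cons. apply K; [|exact IH].
exists o, a; reflexivity.
Qed.

Lemma scl_sym1 o (A : ity L o) U :
  scl (tsym1_l (existT (ity L) o A) U) = scl (tsym_l (sg A) U).
Proof.
simpl tsym_l. pose proof (tid_l_sort E0) as I. pose proof (tsym1_l_sort E0 (existT (ity L) o A) U) as S.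
assert (K : term (tid A *t tid_l U) (sg A ++ U) (existT (ity L) o A :: U)).
{ exact (tm_ten (tm_id E0 A) (I U)). }
assert (K' : term (tsym1_l (existT (ity L) o A) U *t teps) (existT (ity L) o A :: U) (U ++ [existT (ity L) o A])).
{ apply (tm_cast (tm_ten S (tm_eps E0))); apply app_nil_r. }
rewrite (scl_comp K K'), (scl_ten (tm_id E0 A) (I U)), (scl_ten S (tm_eps E0)).
rewrite (scl_id [] : scl teps = _), <- sty_one, mon_unitr_ar, scl_id, scl_id1, mon_id.
symmetry. apply cat_idl'. rewrite (scl_src S). apply sty_cons.
Qed.

Lemma sdup_cons o (A : ity L o) (B : ob Y) : sdup (slet A ** B)
  = (scl (tdup A) ## sdup B) ;; (idn (slet A) ## ssym (slet A) B ## idn B).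
Proof.
destruct (sty_surj B) as [U ->]. rewrite <- sty_cons, !sdup_sty.
unfold slet at 2. rewrite ssym_sty. simpl tdup_l.
pose proof (tm_ten (tm_id E0 A) (tm_ten (tsym1_l_sort E0 (existT (ity L) o A) U) (tid_l_sort E0 U))) as K.
assert (K' : term (tdup A *t tdup_l U) (existT (ity L) o A :: U) (sg A ++ (existT (ity L) o A :: U) ++ U)).
{ exact (tm_ten (tm_dup E0 A) (tdup_l_sort E0 U)). }
rewrite (scl_comp K' K), (scl_ten (tm_dup E0 A) (tdup_l_sort E0 U)).
rewrite (scl_ten (tm_id E0 A) (tm_ten (tsym1_l_sort E0 (existT (ity L) o A) U) (tid_l_sort E0 U))).
rewrite (scl_ten (tsym1_l_sort E0 (existT (ity L) o A) U) (tid_l_sort E0 U)).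
rewrite scl_id, scl_id1, scl_sym1. reflexivity.
Qed.

Lemma ssym_src (A B : ob Y) : src (ssym A B) = A ** B.
Proof.
destruct (sty_surj A) as [U ->], (sty_surj B) as [V ->].
rewrite ssym_sty, sty_app. exact (scl_src (tsym_l_sort E0 U V)).
Qed.
Lemma ssym_tgt (A B : ob Y) : tgt (ssym A B) = B ** A.
Proof.
destruct (sty_surj A) as [U ->], (sty_surj B) as [V ->].
rewrite ssym_sty, sty_app. exact (scl_tgt (tsym_l_sort E0 U V)).
Qed.
Lemma ssym_onel (A : ob Y) : ssym one A = idn A.
Proof. destruct (sty_surj A) as [U ->]. rewrite sty_one, ssym_sty. apply scl_id. Qed.
Lemma ssym_nil U : scl (tsym_l U []) = idn (sty U).
Proof.
induction U as [|[o A] U IH]; [apply (scl_id [])|]. simpl tsym_l.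
pose proof (tid_l_sort E0) as I. pose proof (tsym_l_sort E0 U []) as S. rewrite app_nil_r in S.
rewrite (scl_comp (tm_ten (tm_id E0 A) S) (tm_ten (tm_id E0 A) (I U))).
rewrite (scl_ten (tm_id E0 A) S), (scl_ten (tm_id E0 A) (I U)), IH, scl_id, scl_id1, mon_id.
rewrite sty_cons. apply cat_idl', cat_src_id.
Qed.
Lemma ssym_oner (A : ob Y) : ssym A one = idn A.
Proof. destruct (sty_surj A) as [U ->]. rewrite sty_one, ssym_sty. apply ssym_nil. Qed.
Lemma ssym_nat h k : (h ## k) ;; ssym (tgt h) (tgt k) = ssym (src h) (src k) ;; (k ## h).
Proof.
destruct (scl_surj' h) as [x [U [V [H [Ex [e1 e2]]]]]].
destruct (scl_surj' k) as [y [U' [V' [H' [Ey [e3 e4]]]]]].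
rewrite e1, e2, e3, e4, !ssym_sty, Ex, Ey, <- (scl_ten H H'), <- (scl_ten H' H).
pose proof (tsym_l_sort E0) as S.
rewrite <- (scl_comp (tm_ten H H') (S V V')), <- (scl_comp (S U U') (tm_ten H' H)).
exact (scl_tmeq (te_sym_nat E1 H H')).
Qed.
Lemma sdup_src (A : ob Y) : src (sdup A) = A.
Proof. destruct (sty_surj A) as [U ->]. rewrite sdup_sty. exact (scl_src (tdup_l_sort E0 U)). Qed.
Lemma sdup_tgt (A : ob Y) : tgt (sdup A) = A ** A.
Proof.
destruct (sty_surj A) as [U ->]. rewrite sdup_sty, sty_app. exact (scl_tgt (tdup_l_sort E0 U)).
Qed.
Lemma sdup_nat h : h ;; sdup (tgt h) = sdup (src h) ;; (h ## h).
Proof.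
destruct (scl_surj' h) as [x [U [V [H [Ex [e1 e2]]]]]].
pose proof (tdup_l_sort E0) as S. rewrite e1, e2, !sdup_sty, Ex, <- (scl_ten H H).
rewrite <- (scl_comp H (S V)), <- (scl_comp (S U) (tm_ten H H)).
exact (scl_tmeq (te_dup_nat E1 H)).
Qed.
Lemma sdup_one : sdup one = idn one.
Proof. rewrite sty_one, sdup_sty. apply (scl_id []). Qed.
Lemma sdel_src (A : ob Y) : src (sdel A) = A.
Proof. destruct (sty_surj A) as [U ->]. rewrite sdel_sty. exact (scl_src (tdel_l_sort E0 U)). Qed.
Lemma sdel_tgt (A : ob Y) : tgt (sdel A) = one.
Proof. destruct (sty_surj A) as [U ->]. rewrite sdel_sty. exact (scl_tgt (tdel_l_sort E0 U)). Qed.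
Lemma sdel_nat h : h ;; sdel (tgt h) = sdel (src h).
Proof.
destruct (scl_surj' h) as [x [U [V [H [Ex [e1 e2]]]]]].
pose proof (tdel_l_sort E0) as S. rewrite e1, e2, !sdel_sty, Ex, <- (scl_comp H (S V)).
exact (scl_tmeq (te_del_nat E1 H)).
Qed.
Lemma sdel_one : sdel one = idn one.
Proof. rewrite sty_one, sdel_sty. apply (scl_id []). Qed.

Lemma scl_dup o (A : ity L o) : scl (tdup A) = sdup (slet A).
Proof.
pose proof (sdup_cons A one) as H. rewrite !mon_unitr_ob in H. rewrite H.
rewrite ssym_oner, sdup_one, !mon_unitr_ar, mon_id.
symmetry; apply cat_idr'. rewrite (scl_tgt (tm_dup E0 A)). symmetry; apply sty_app.
Qed.
Lemma scl_del o (A : ity L o) : scl (tdel A) = sdel (slet A).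
Proof.
unfold slet. rewrite sdel_sty. symmetry. exact (scl_tmeq (te_tunitr E1 (tm_del E0 A))).
Qed.

(** Fox's criterion with internal types as letters. Counitality is an equation for each internal
    type and naturality is imposed for all terms, which are the two ingredients it asks for. *)
Lemma syn_cartesian_structure : is_cartesian Y /\
  (forall A B, swap Y A B = ssym A B) /\ (forall A, diag Y A = sdup A).
Proof.
apply cartesian_of_comonoids with (letter := fun A => exists o (a : ity L o), A = slet a)
  (sy := ssym) (du := sdup) (de := sdel);
  [exact _|exact syn_ind|exact ssym_src|exact ssym_tgt|exact ssym_nat|exact ssym_onel
  |exact ssym_oner|exact sdup_src|exact sdup_tgt|exact sdup_nat|exact sdup_one|
  |exact sdel_src|exact sdel_tgt|exact sdel_nat|exact sdel_one| | ].
- intros A B [o [a ->]]. rewrite <- scl_dup. apply sdup_cons.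
- intros A [o [a ->]]. rewrite <- scl_dup, <- scl_del, <- scl_id1.
  pose proof (tm_ten (tm_del E0 a) (tm_id E0 a)) as K.
  rewrite <- (scl_ten (tm_del E0 a) (tm_id E0 a)), <- (scl_comp (tm_dup E0 a) K).
  exact (scl_tmeq (te_dup_unitl E0 E1 a)).
- intros A [o [a ->]]. rewrite <- scl_dup, <- scl_del, <- scl_id1.
  pose proof (tm_ten (tm_id E0 a) (tm_del E0 a)) as K.
  rewrite <- (scl_ten (tm_id E0 a) (tm_del E0 a)), <- (scl_comp (tm_dup E0 a) K).
  exact (scl_tmeq (te_dup_unitr E0 E1 a)).
Qed.

Global Instance syn_cartesian : is_cartesian Y.
Proof. apply syn_cartesian_structure. Qed.

Lemma swap_sty U V : swap Y (sty U) (sty V) = scl (tsym_l U V).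
Proof. rewrite <- ssym_sty. apply syn_cartesian_structure. Qed.
Lemma swap_slet o (A : ity L o) t (B : ity L t) : swap Y (slet A) (slet B) = scl (tsym A B).
Proof.
unfold slet. rewrite swap_sty, <- scl_sym1. simpl tsym1_l.
rewrite (scl_comp (tm_ten (tm_sym E0 A B) (tm_eps E0)) (tm_ten (tm_id E0 B) (tm_id E0 A))).
rewrite (scl_ten (tm_sym E0 A B) (tm_eps E0)), (scl_ten (tm_id E0 B) (tm_id E0 A)).
rewrite (scl_id [] : scl teps = _), <- sty_one, mon_unitr_ar, !scl_id1, mon_id.
apply cat_idr'. rewrite (scl_tgt (tm_sym E0 A B)). symmetry; apply sty_app.
Qed.
Lemma diag_slet o (A : ity L o) : diag Y (slet A) = scl (tdup A).
Proof. rewrite scl_dup. apply syn_cartesian_structure. Qed.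
Lemma bang_slet o (A : ity L o) : bang Y (slet A) = scl (tdel A).
Proof.
symmetry. apply bang_uniq; [exact (scl_src (tm_del E0 A))|exact (scl_tgt (tm_del E0 A))].
Qed.
End Syntactic.
Arguments syn_mk_eq {T x y U V U' V'}.
Arguments scl_mk {T x U V}.
Arguments scl_src {T x U V}.
Arguments scl_tgt {T x U V}.
Arguments scl_surj {T} h {U V}.
Arguments scl_surj' {T}.
Arguments scl_eq {T x y U V U' V'}.
Arguments scl_tmeq {T x y}.
Arguments scl_inj {T x y U V U' V'}.
Arguments tid_l_tmeq {T U V}.
Arguments scl_comp {T x y U V W}.
Arguments scl_ten {T x y U V U' V'}.
Arguments sty_eq {T U V}.
Arguments sty_inj {T U V}.
Arguments sty_surj {T}.

(** The category laws of [X] enter through [fe_gen_id] and [fe_gen_comp], where the end points of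
    identities and composites of [X] must be known. *)
Lemma fim_eq_sort (X : cat) (HX : is_cat X) (x y : fim_raw X) : fim_eq x y ->
  exists w v, fim_sort x w v /\ fim_sort y w v.
Proof.
assert (two : forall (x y : fim_raw X) w v, fim_sort x w v -> fim_sort y w v ->
  exists w v, fim_sort x w v /\ fim_sort y w v) by (intros; eexists; eexists; split; eassumption).
intros H; induction H.
- exact (two _ _ _ _ H H).
- destruct IHfim_eq as [w [v [? ?]]]. exists w, v; split; assumption.
- destruct IHfim_eq1 as [w [v [H1 K1]]], IHfim_eq2 as [w' [v' [H2 K2]]].
  destruct (fim_sort_det K1 H2); subst. exact (two _ _ _ _ H1 K2).
- destruct IHfim_eq1 as [w1 [v1 [H3 K1]]], IHfim_eq2 as [w2 [v2 [H4 K2]]].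
  destruct (fim_sort_det H H3), (fim_sort_det H0 H4); subst.
  exact (two _ _ _ _ (fs_comp H H0) (fs_comp K1 K2)).
- destruct IHfim_eq1 as [w1 [v1 [H3 K1]]], IHfim_eq2 as [w2 [v2 [H4 K2]]].
  exact (two _ _ _ _ (fs_ten H3 H4) (fs_ten K1 K2)).
- exact (two _ _ _ _ (fs_comp (fs_comp H H0) H1) (fs_comp H (fs_comp H0 H1))).
- exact (two _ _ _ _ (fs_comp (fw_id_sort X w) H) H).
- exact (two _ _ _ _ (fs_comp H (fw_id_sort X v)) H).
- refine (two _ _ _ _ (fs_ten (fs_ten H H0) H1) _). rewrite <- !app_assoc.
  exact (fs_ten H (fs_ten H0 H1)).
- exact (two _ _ _ _ (fs_ten (fs_eps X) H) H).
- refine (two _ _ _ _ (fs_ten H (fs_eps X)) _). rewrite !app_nil_r. exact H.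
- exact (two _ _ _ _ (fs_ten (fs_comp H H0) (fs_comp H1 H2))
    (fs_comp (fs_ten H H1) (fs_ten H0 H2))).
- exact (two _ _ _ _ (fs_comp (fs_sym X a b) (fs_sym X b a)) (fw_id_sort X [a; b])).
- exact (two _ _ _ _ (fs_comp (fs_ten H H0) (fw_sym_sort X v v'))
    (fs_comp (fw_sym_sort X w w') (fs_ten H0 H))).
- exact (two _ _ _ _ (fs_comp (fs_dup X a) (fs_ten (fs_dup X a) (fs_id X a)))
    (fs_comp (fs_dup X a) (fs_ten (fs_id X a) (fs_dup X a)))).
- exact (two _ _ _ _ (fs_comp (fs_dup X a) (fs_ten (fs_del X a) (fs_id X a))) (fs_id X a)).
- exact (two _ _ _ _ (fs_comp (fs_dup X a) (fs_ten (fs_id X a) (fs_del X a))) (fs_id X a)).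
- exact (two _ _ _ _ (fs_comp H (fw_dup_sort X v)) (fs_comp (fw_dup_sort X w) (fs_ten H H))).
- exact (two _ _ _ _ (fs_comp H (fw_del_sort X v)) (fw_del_sort X w)).
- exact (two _ _ _ _ (fs_comp (fs_ten (fs_mul X a) (fs_id X a)) (fs_mul X a))
    (fs_comp (fs_ten (fs_id X a) (fs_mul X a)) (fs_mul X a))).
- exact (two _ _ _ _ (fs_comp (fs_ten (fs_unt X a) (fs_id X a)) (fs_mul X a)) (fs_id X a)).
- exact (two _ _ _ _ (fs_comp (fs_ten (fs_id X a) (fs_unt X a)) (fs_mul X a)) (fs_id X a)).
- exact (two _ _ _ _ (fs_comp (fs_mul X _) (fs_gen X f))
    (fs_comp (fs_ten (fs_gen X f) (fs_gen X f)) (fs_mul X _))).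
- exact (two _ _ _ _ (fs_comp (fs_unt X _) (fs_gen X f)) (fs_unt X _)).
- pose proof (fs_gen X (idn a)) as K. rewrite cat_src_id, cat_tgt_id in K.
  exact (two _ _ _ _ K (fs_id X a)).
- pose proof (fs_gen X (f ;; g)) as K. rewrite cat_src_comp, cat_tgt_comp in K by assumption.
  pose proof (fs_gen X g) as K'. rewrite <- H in K'.
  exact (two _ _ _ _ K (fs_comp (fs_gen X f) K')).
Qed.

(** * The syntactic projection and its liftings *)

Section FreeCategory.
Variable L : lsig.

Lemma papp_nil o t (p : path L o t) : papp p (pnil t) = p.
Proof. induction p; simpl; congruence. Qed.
Lemma papp_assoc o t r s (p : path L o t) (q : path L t r) (q' : path L r s) :
  papp (papp p q) q' = papp p (papp q q').
Proof. induction p; simpl; [reflexivity|]. rewrite IHp. reflexivity. Qed.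

Lemma papp_cons o t r s (f : fgen L o t) (p : path L t r) (q : path L r s) :
  papp (pcons f p) q = pcons f (papp p q).
Proof. reflexivity. Qed.

(** The record is repacked as a sigma type over the pair of end points, where proof irrelevance
    gives injectivity of the second component. *)
Lemma PathAr_inj o t (p q : path L o t) : PathAr p = PathAr q -> p = q.
Proof.
intros e.
pose proof (f_equal (fun r => existT (fun u => path L (fst u) (snd u)) (pa_src r, pa_tgt r) (pa_path r)) e)
  as e'. simpl in e'. exact (inj_pair2 _ _ _ _ _ e').
Qed.

Lemma free_comp o t r (p : path L o t) (q : path L t r) :
  @comp (free_cat L) (PathAr p) (PathAr q) = PathAr (papp p q).
Proof.
apply the_eq; [exists o, t, r, p, q; auto|].
intros b [o' [t' [r' [p' [q' [e1 [e2 ->]]]]]]].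
assert (o = o') by exact (f_equal (@pa_src _) e1).
assert (t = t') by exact (f_equal (@pa_tgt _) e1).
assert (r = r') by exact (f_equal (@pa_tgt _) e2). subst.
apply PathAr_inj in e1, e2. subst; reflexivity.
Qed.

Global Instance free_is_cat : is_cat (free_cat L).
Proof.
split; try reflexivity.
- intros [o t p] [t' r q] e; simpl in e; subst t'. rewrite free_comp; reflexivity.
- intros [o t p] [t' r q] e; simpl in e; subst t'. rewrite free_comp; reflexivity.
- intros [o t p]. simpl idn. rewrite free_comp; reflexivity.
- intros [o t p]. simpl idn. simpl tgt. rewrite free_comp, papp_nil; reflexivity.
- intros [o t p] [t' r q] [r' s q'] e e'; simpl in e, e'; subst t' r'.
  rewrite !free_comp, papp_assoc. reflexivity.
Qed.
End FreeCategory.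

(** * The projection of terms to the base *)

Section Projection.
Variable T : theory.
Local Notation L := (th_sig T).
Local Notation E0 := (th_E0 T).
Local Notation E1 := (th_E1 T).
Local Notation term := (term E0).
Local Notation iterm := (iterm E0).
Local Notation tmeq := (tmeq E0 E1).
Local Notation Y := (syn_mcat T).
Local Notation X := (free_cat L).
Local Notation Bs := (fim X).
Local Notation ex A := (existT (ity L) _ A).
Implicit Types (x y z : tm (th_sig T)) (U V W : ty (th_sig T)) (h k : ar (syn_mcat T)).

Lemma tm_proj_id U : tm_proj (tid_l U) = fw_id X (ty_layers U).
Proof. induction U as [|[o A] U IH]; simpl; [reflexivity|]. rewrite IH; reflexivity. Qed.
Lemma tm_proj_sym1 o (A : ity L o) U : tm_proj (tsym1_l (ex A) U) = fw_sym1 X o (ty_layers U).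
Proof.
induction U as [|[t C] U IH]; simpl; [reflexivity|]. simpl in IH.
rewrite tm_proj_id. f_equal. f_equal. exact IH.
Qed.
Lemma tm_proj_sym U V : tm_proj (tsym_l U V) = fw_sym X (ty_layers U) (ty_layers V).
Proof.
induction U as [|[o A] U IH]; simpl; [apply tm_proj_id|].
rewrite IH, tm_proj_id. f_equal. f_equal. apply tm_proj_sym1.
Qed.
Lemma tm_proj_dup U : tm_proj (tdup_l U) = fw_dup X (ty_layers U).
Proof.
induction U as [|[o A] U IH]; simpl; [reflexivity|].
rewrite IH, tm_proj_id. f_equal. f_equal. f_equal. apply tm_proj_sym1.
Qed.
Lemma tm_proj_del U : tm_proj (tdel_l U) = fw_del X (ty_layers U).
Proof. induction U as [|[o A] U IH]; simpl; [reflexivity|]. rewrite IH; reflexivity. Qed.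

Lemma layers_app U V : ty_layers (U ++ V) = ty_layers U ++ ty_layers V.
Proof. apply map_app. Qed.

Lemma iterm_proj_sort x o (A C : ity L o) : iterm x A C -> fim_sort (tm_proj x) [o : ob X] [o : ob X].
Proof.
induction 1; simpl; try apply fs_id; try assumption.
exact (fs_comp IHiterm1 IHiterm2).
Qed.

Lemma term_proj_sort x U V : term x U V -> fim_sort (tm_proj x) (ty_layers U) (ty_layers V).
Proof.
induction 1; simpl tm_proj.
- exact (iterm_proj_sort H).
- exact (fs_comp IHterm1 IHterm2).
- apply fs_eps.
- rewrite !layers_app. exact (fs_ten IHterm1 IHterm2).
- exact (fs_sym X o t).
- exact (fs_gen X (edge f)).
- exact (fs_mul X o).
- exact (fs_unt X o).
- exact (fs_dup X o).
- exact (fs_del X o).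
- apply teq_layers in H, H0. rewrite <- H, <- H0. exact IHterm.
Qed.

Definition pcl x : ar Bs := fcl (tm_proj x).

Lemma pcl_comp x y U V W : term x U V -> term y V W -> pcl (x ;t y) = pcl x ;; pcl y.
Proof. intros H K. exact (fcl_comp (term_proj_sort H) (term_proj_sort K)). Qed.
Lemma pcl_ten x y U V U' V' : term x U V -> term y U' V' -> pcl (x *t y) = pcl x ## pcl y.
Proof. intros H K. exact (fcl_ten (term_proj_sort H) (term_proj_sort K)). Qed.
Lemma pcl_src x U V : term x U V -> src (pcl x) = ty_layers U.
Proof. intros H. exact (fcl_src (term_proj_sort H)). Qed.
Lemma pcl_tgt x U V : term x U V -> tgt (pcl x) = ty_layers V.
Proof. intros H. exact (fcl_tgt (term_proj_sort H)). Qed.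
Lemma pcl_iterm x o (A C : ity L o) : iterm x A C -> pcl x = idn (fo X o).
Proof.
induction 1; try exact (fcl_id1 X _); try assumption.
rewrite (pcl_comp (tm_int H) (tm_int H0)), IHiterm1, IHiterm2.
apply (cat_idl' (C := Bs)). apply (cat_src_id (C := Bs)).
Qed.
Lemma pcl_id U : pcl (tid_l U) = @idn Bs (ty_layers U).
Proof. unfold pcl. rewrite tm_proj_id. apply fcl_id. Qed.
Lemma pcl_sym U V : pcl (tsym_l U V) = sym (i := Bs) (ty_layers U) (ty_layers V).
Proof. unfold pcl. rewrite tm_proj_sym. symmetry; apply fim_sym_cl. Qed.
Lemma pcl_dup U : pcl (tdup_l U) = dup (i := Bs) (ty_layers U).
Proof. unfold pcl. rewrite tm_proj_dup. symmetry; apply fim_dup_cl. Qed.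
Lemma pcl_del U : pcl (tdel_l U) = del (i := Bs) (ty_layers U).
Proof. unfold pcl. rewrite tm_proj_del. symmetry; apply fim_del_cl. Qed.

Hypothesis Hproj : forall x y, E1 x y -> fim_eq (tm_proj x) (tm_proj y).

(** Equations on internal terms project to equations between identities, and every other structural
    equation projects to one that holds in the free base. The pairs in [E1] are covered by
    [Hproj]. *)
Lemma pcl_eq x y : tmeq x y -> pcl x = pcl y.
Proof.
intros e; induction e.
- reflexivity.
- symmetry; assumption.
- congruence.
- destruct (tmeq_sort (th_parallel T) e1) as [U1 [V1 [H1 K1]]].
  destruct (tmeq_sort (th_parallel T) e2) as [U2 [V2 [H2 K2]]].
  destruct (term_det H H1) as [a1 a2], (term_det H0 H2) as [b1 b2].
  assert (K3 : term x' T0 S) by (apply tm_conv with (3 := K1); symmetry; assumption).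
  assert (K4 : term y' S U) by (apply tm_conv with (3 := K2); symmetry; assumption).
  rewrite (pcl_comp H H0), (pcl_comp K3 K4). congruence.
- destruct (tmeq_sort (th_parallel T) e1) as [U1 [V1 [H1 K1]]].
  destruct (tmeq_sort (th_parallel T) e2) as [U2 [V2 [H2 K2]]].
  rewrite (pcl_ten H1 H2), (pcl_ten K1 K2). congruence.
- reflexivity.
- reflexivity.
- destruct (th_parallel T _ _ H) as [U [V [K K']]].
  exact (fcl_eq (Hproj _ _ H) (term_proj_sort K) (term_proj_sort K')).
- rewrite (pcl_comp (tm_comp H H0) H1), (pcl_comp H H0), (pcl_comp H (tm_comp H0 H1)),
    (pcl_comp H0 H1). apply (cat_assoc (C := Bs)).
  + rewrite (pcl_tgt H), (pcl_src H0); reflexivity.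
  + rewrite (pcl_tgt H0), (pcl_src H1); reflexivity.
- rewrite (pcl_comp (tid_l_sort E0 T0) H), pcl_id. apply (cat_idl' (C := Bs)). exact (pcl_src H).
- rewrite (pcl_comp H (tid_l_sort E0 S)), pcl_id. apply (cat_idr' (C := Bs)). exact (pcl_tgt H).
- rewrite (pcl_ten (tm_ten H H0) H1), (pcl_ten H H0), (pcl_ten H (tm_ten H0 H1)),
    (pcl_ten H0 H1). apply (mon_assoc_ar (C := Bs)).
- rewrite (pcl_ten (tm_eps E0) H), (pcl_id [] : pcl teps = _). apply (mon_unitl_ar (C := Bs)).
- rewrite (pcl_ten H (tm_eps E0)), (pcl_id [] : pcl teps = _). apply (mon_unitr_ar (C := Bs)).
- rewrite (pcl_ten (tm_comp H H0) (tm_comp H1 H2)), (pcl_comp H H0), (pcl_comp H1 H2).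
  rewrite (pcl_comp (tm_ten H H1) (tm_ten H0 H2)), (pcl_ten H H1), (pcl_ten H0 H2).
  apply (mon_comp (C := Bs)).
  + rewrite (pcl_tgt H), (pcl_src H0); reflexivity.
  + rewrite (pcl_tgt H1), (pcl_src H2); reflexivity.
- reflexivity.
- symmetry. rewrite (pcl_iterm H). symmetry. exact (fcl_id1 X _).
- symmetry. rewrite (pcl_iterm H). symmetry. exact (fcl_id1 X _).
- rewrite (pcl_iterm (it_ten (it_comp H H0) (it_comp H1 H2))).
  symmetry. exact (pcl_iterm (it_comp (it_ten H H1) (it_ten H0 H2))).
- reflexivity.
- reflexivity.
- rewrite (pcl_iterm (it_app _ f (it_comp H H0))).
  symmetry. exact (pcl_iterm (it_comp (it_app _ f H) (it_app _ f H0))).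
- reflexivity.
- reflexivity.
- rewrite (pcl_comp (tsym_l_sort E0 T0 S) (tsym_l_sort E0 S T0)), !pcl_sym, pcl_id.
  rewrite layers_app. apply (symm_inv (im_symmetric (fim_indexed_monoids X))).
- rewrite (pcl_comp (tm_ten H H0) (tsym_l_sort E0 S S')),
    (pcl_comp (tsym_l_sort E0 T0 T') (tm_ten H0 H)), (pcl_ten H H0), (pcl_ten H0 H), !pcl_sym.
  rewrite <- (pcl_src H), <- (pcl_src H0), <- (pcl_tgt H), <- (pcl_tgt H0).
  apply fim_sym_nat.
- exact (fcl_eq (fe_dup_assoc X o)
    (fs_comp (fs_dup X o) (fs_ten (fs_dup X o) (fs_id X o)))
    (fs_comp (fs_dup X o) (fs_ten (fs_id X o) (fs_dup X o)))).
- exact (fcl_eq (fe_dup_unitl X o)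
    (fs_comp (fs_dup X o) (fs_ten (fs_del X o) (fs_id X o))) (fs_id X o)).
- exact (fcl_eq (fe_dup_unitr X o)
    (fs_comp (fs_dup X o) (fs_ten (fs_id X o) (fs_del X o))) (fs_id X o)).
- rewrite (pcl_comp H (tdup_l_sort E0 S)), (pcl_comp (tdup_l_sort E0 T0) (tm_ten H H)),
    (pcl_ten H H), !pcl_dup, <- (pcl_src H), <- (pcl_tgt H). apply fim_dup_nat.
- rewrite (pcl_comp H (tdel_l_sort E0 S)), !pcl_del, <- (pcl_src H), <- (pcl_tgt H).
  apply fim_del_nat.
- exact (fcl_eq (fe_mul_assoc X o)
    (fs_comp (fs_ten (fs_mul X o) (fs_id X o)) (fs_mul X o))
    (fs_comp (fs_ten (fs_id X o) (fs_mul X o)) (fs_mul X o))).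
- exact (fcl_eq (fe_mul_unitl X o)
    (fs_comp (fs_ten (fs_unt X o) (fs_id X o)) (fs_mul X o)) (fs_id X o)).
- exact (fcl_eq (fe_mul_unitr X o)
    (fs_comp (fs_ten (fs_id X o) (fs_unt X o)) (fs_mul X o)) (fs_id X o)).
- rewrite (pcl_comp (tm_ten (tm_int H) (tm_int H0)) (tm_mul E0 B D)),
    (pcl_ten (tm_int H) (tm_int H0)), (pcl_comp (tm_mul E0 A C) (tm_int (it_ten H H0))).
  rewrite (pcl_iterm H), (pcl_iterm H0), (pcl_iterm (it_ten H H0)), (mon_id (C := Bs)).
  transitivity (pcl (tmul B D)).
  + apply (cat_idl' (C := Bs)). exact (pcl_src (tm_mul E0 B D)).
  + symmetry. apply (cat_idr' (C := Bs)). exact (pcl_tgt (tm_mul E0 A C)).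
- rewrite (pcl_comp (tm_int H) (tm_nab E0 _ f B)), (pcl_comp (tm_nab E0 _ f A) (tm_int (it_app _ f H))).
  rewrite (pcl_iterm H), (pcl_iterm (it_app _ f H)).
  transitivity (pcl (tnab f B)).
  + apply (cat_idl' (C := Bs)). exact (pcl_src (tm_nab E0 _ f B)).
  + symmetry. apply (cat_idr' (C := Bs)). exact (pcl_tgt (tm_nab E0 _ f A)).
- exact (fcl_eq (fe_mul_nat X (edge f))
    (fs_comp (fs_mul X o) (fs_gen X (edge f)))
    (fs_comp (fs_ten (fs_gen X (edge f)) (fs_gen X (edge f))) (fs_mul X t))).
- exact (fcl_eq (fe_unt_nat X (edge f))
    (fs_comp (fs_unt X o) (fs_gen X (edge f))) (fs_unt X t)).
Qed.

Definition lay (A : ob Y) : ob Bs := @s_ob Y Bs (syn_proj T) A.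

Lemma lay_sty U : lay (sty T U) = ty_layers U.
Proof. apply (teq_layers (sty_rep T U)). Qed.

(** The projection is computed on a chosen representative, which is equal to [x] as a term and so by
    [pcl_eq] has the same image. *)
Lemma syn_proj_scl x U V : term x U V -> @s_ar Y Bs (syn_proj T) (scl T x) = pcl x.
Proof.
intros H. pose proof (st_ok (rep (scl T x))) as K.
assert (e : pcl (st_raw (rep (scl T x))) = pcl x).
{ apply pcl_eq. apply (scl_inj K H). rewrite (scl_mk (st_ok (rep (scl T x)))).
  transitivity (cls (@sterm_eq T) (rep (scl T x))); [|apply cls_rep].
  clear K. destruct (rep (scl T x)); reflexivity. }
rewrite <- e. simpl. apply the_eq.
- exists (FimTerm (term_proj_sort K)). split; [|reflexivity].
  exact (fcl_mk (term_proj_sort K)).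
- intros b [[w v r Hr] [-> e']]. simpl in e'. subst r. symmetry. exact (fcl_mk Hr).
Qed.
End Projection.
Arguments pcl_comp {T x y U V W}.
Arguments pcl_ten {T x y U V U' V'}.
Arguments pcl_src {T x U V}.
Arguments pcl_tgt {T x U V}.
Arguments pcl_iterm {T x o A C}.
Arguments term_proj_sort {T x U V}.
Arguments iterm_proj_sort {T x o A C}.
Arguments pcl_eq {T} Hproj {x y}.
Arguments syn_proj_scl {T} Hproj {x U V}.

(** * Chosen liftings and their independence of representatives *)

Section Lifting.
Variable T : theory.
Local Notation L := (th_sig T).
Local Notation E0 := (th_E0 T).
Local Notation E1 := (th_E1 T).
Local Notation term := (term E0).
Local Notation iterm := (iterm E0).
Local Notation tmeq := (tmeq E0 E1).
Local Notation Y := (syn_mcat T).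
Local Notation X := (free_cat L).
Local Notation Bs := (fim X).
Local Notation scl := (scl T).
Local Notation sty := (sty T).
Local Notation lay := (lay (T := T)).
Implicit Types (x y z : tm (th_sig T)) (U V W : ty (th_sig T)) (h k : ar (syn_mcat T))
  (A B C : ob (syn_mcat T)) (r : fim_raw (free_cat (th_sig T)))
  (w v : list (ob (free_cat (th_sig T)))).

Lemma lay_ten A B : lay (A ** B) = lay A ++ lay B.
Proof.
destruct (sty_surj A) as [U ->], (sty_surj B) as [V ->].
rewrite sty_app, !lay_sty. apply layers_app.
Qed.
Lemma lay_one : lay (@one Y) = [].
Proof. exact (lay_sty T []). Qed.
Lemma lay_slet o (a : ity L o) : lay (slet T a) = [o : ob X].
Proof. apply lay_sty. Qed.
Lemma lay_nil A : lay A = [] -> A = one.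
Proof.
destruct (sty_surj A) as [U ->]. rewrite lay_sty. destruct U; [reflexivity|discriminate].
Qed.
Lemma lay_letter A o : lay A = [o : ob X] -> exists a : ity L o, A = slet T a.
Proof.
destruct (sty_surj A) as [U ->]. rewrite lay_sty.
destruct U as [|[t a] [|b U]]; try discriminate. intros e; injection e as <-.
exists a; reflexivity.
Qed.
Lemma lay_split A w v : lay A = w ++ v ->
  exists B C, A = B ** C /\ lay B = w /\ lay C = v.
Proof.
destruct (sty_surj A) as [U ->]. rewrite lay_sty. intros e.
apply map_eq_app in e. destruct e as [U1 [U2 [-> [e1 e2]]]].
exists (sty U1), (sty U2). rewrite sty_app, !lay_sty. auto.
Qed.

(** Congruent lists of types are congruent entry by entry, so cutting a representative after [n]
    entries does not depend on the representative. *)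
Definition split_l n A : ob Y := sty (firstn n (rep A)).
Definition split_r n A : ob Y := sty (skipn n (rep A)).

Lemma split_ten A B n : length (lay A) = n ->
  split_l n (A ** B) = A /\ split_r n (A ** B) = B.
Proof.
destruct (sty_surj A) as [U ->], (sty_surj B) as [V ->]. rewrite sty_app, lay_sty.
unfold ty_layers. rewrite length_map. intros <-.
pose proof (Forall2_app_inv_r U V (sty_rep T (U ++ V))) as [U' [V' [H [H' e]]]].
unfold split_l, split_r. rewrite e.
rewrite <- (Forall2_length H), firstn_app, skipn_app, PeanoNat.Nat.sub_diag, firstn_all, skipn_all.
simpl. rewrite app_nil_r. split; apply sty_eq; assumption.
Qed.

Definition nabla_ar o t (f : fgen L o t) A : ar Y :=
  the (idn A) (fun h => exists a : ity L o, A = slet T a /\ h = scl (tnab f a)).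
Definition mult_ar o A B : ar Y :=
  the (idn A) (fun h => exists a b : ity L o, A = slet T a /\ B = slet T b /\ h = scl (tmul a b)).

Arguments nabla_ar {o t} f A.

Lemma slet_inj o (a b : ity L o) : slet T a = slet T b -> ieq E0 a b.
Proof. intros e. apply sty_inj in e. apply teq_sg_ieq, e. Qed.
Lemma slet_eq o (a b : ity L o) : ieq E0 a b -> slet T a = slet T b.
Proof. intros e. apply sty_eq, teq_sg, e. Qed.

(** If [a] and [b] are congruent, [tid a] also has sort [(a | b)]; naturality of [nabla] at this
    identity compares the two candidates. *)
Lemma nabla_slet o t (f : fgen L o t) (a : ity L o) : nabla_ar f (slet T a) = scl (tnab f a).
Proof.
apply the_eq; [exists a; auto|]. intros h [b [e ->]]. apply slet_inj in e.
assert (H : iterm (tid a) a b) by exact (it_conv (ie_refl E0 a) e (it_id E0 a)).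
pose proof (scl_tmeq (te_nab_nat E1 _ f H)) as n.
rewrite (scl_comp (tm_int H) (tm_nab E0 _ f b)) in n.
rewrite (scl_comp (tm_nab E0 _ f a) (tm_int (it_app _ f H))) in n.
rewrite (scl_tmeq (te_app_id E0 E1 _ f a)), !scl_id1, cat_idl', cat_idr' in n.
- exact n.
- exact (scl_tgt (tm_nab E0 _ f a)).
- rewrite (scl_src (tm_nab E0 _ f b)). symmetry; apply slet_eq, e.
Qed.

(** As for [nabla]: naturality of [m] at a pair of identities between congruent types. *)
Lemma mult_slet o (a b : ity L o) : mult_ar o (slet T a) (slet T b) = scl (tmul a b).
Proof.
apply the_eq; [exists a, b; auto|]. intros h [a' [b' [e [e' ->]]]]. apply slet_inj in e, e'.
assert (H : iterm (tid a) a a') by exact (it_conv (ie_refl E0 a) e (it_id E0 a)).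
assert (H' : iterm (tid b) b b') by exact (it_conv (ie_refl E0 b) e' (it_id E0 b)).
pose proof (scl_tmeq (te_mul_nat E1 H H')) as n.
rewrite (scl_comp (tm_ten (tm_int H) (tm_int H')) (tm_mul E0 a' b')) in n.
rewrite (scl_comp (tm_mul E0 a b) (tm_int (it_ten H H'))) in n.
rewrite <- (scl_tmeq (te_id_ten E0 E1 a b)), (scl_ten (tm_int H) (tm_int H')) in n.
rewrite !scl_id1, mon_id, cat_idl', cat_idr' in n.
- exact n.
- exact (scl_tgt (tm_mul E0 a b)).
- rewrite (scl_src (tm_mul E0 a' b')). rewrite (slet_eq e), (slet_eq e').
  symmetry; exact (sty_app T (sg a') (sg b')).
Qed.

Fixpoint nabla_path o t (p : path L o t) A : ar Y :=
  match p with
  | pnil o => idn A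
  | pcons f p => nabla_ar f A ;; nabla_path p (tgt (nabla_ar f A))
  end.

(** Tells where to cut the source type when a tensor is lifted; on well-sorted expressions it is the
    length of the source word. *)
Fixpoint arity (r : fim_raw X) : nat :=
  match r with
  | fr_gen _ | fr_id _ | fr_dup _ | fr_del _ => 1
  | fr_eps | fr_unt _ => 0
  | r1 ;f r2 => arity r1
  | r1 *f r2 => arity r1 + arity r2
  | fr_sym _ _ | fr_mul _ => 2
  end.

Lemma arity_sort r w v : fim_sort r w v -> arity r = length w.
Proof.
induction 1; try reflexivity; try assumption.
rewrite length_app, <- IHfim_sort1, <- IHfim_sort2. reflexivity.
Qed.

(** The chosen lifting at [A], by recursion on a representative [r] of the arrow; it is
    only meaningful when [A] lies over the source of [r]. *)
Fixpoint lift_ar (r : fim_raw X) A : ar Y :=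
  match r with
  | fr_gen f => nabla_path (pa_path f) A
  | fr_id _ | fr_eps => idn A
  | r1 ;f r2 => lift_ar r1 A ;; lift_ar r2 (tgt (lift_ar r1 A))
  | r1 *f r2 => lift_ar r1 (split_l (arity r1) A) ## lift_ar r2 (split_r (arity r1) A)
  | fr_sym _ _ => swap Y (split_l 1 A) (split_r 1 A)
  | fr_dup _ => diag Y A
  | fr_del _ => bang Y A
  | @fr_mul _ o => mult_ar o (split_l 1 A) (split_r 1 A)
  | @fr_unt _ o => scl (tunt o)
  end.

Lemma nabla_path_nil o A : nabla_path (pnil o) A = idn A.
Proof. reflexivity. Qed.
Lemma nabla_path_cons o t s (f : fgen L o t) (p : path L t s) A :
  nabla_path (pcons f p) A = nabla_ar f A ;; nabla_path p (tgt (nabla_ar f A)).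
Proof. reflexivity. Qed.
Lemma lift_ar_gen f A : lift_ar (@fr_gen X f) A = nabla_path (pa_path f) A.
Proof. reflexivity. Qed.
Lemma lift_ar_id1 o A : lift_ar (@fr_id X o) A = idn A.
Proof. reflexivity. Qed.
Lemma lift_ar_tenE r1 r2 A : lift_ar (r1 *f r2) A =
  lift_ar r1 (split_l (arity r1) A) ## lift_ar r2 (split_r (arity r1) A).
Proof. reflexivity. Qed.
Lemma lift_ar_comp r1 r2 A : lift_ar (r1 ;f r2) A = lift_ar r1 A ;; lift_ar r2 (tgt (lift_ar r1 A)).
Proof. reflexivity. Qed.
Lemma lift_ar_symE o t A : lift_ar (@fr_sym X o t) A = swap Y (split_l 1 A) (split_r 1 A).
Proof. reflexivity. Qed.
Lemma lift_ar_dup1 o A : lift_ar (@fr_dup X o) A = diag Y A.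
Proof. reflexivity. Qed.
Lemma lift_ar_del1 o A : lift_ar (@fr_del X o) A = bang Y A.
Proof. reflexivity. Qed.
Lemma lift_ar_mulE o A : lift_ar (@fr_mul X o) A = mult_ar o (split_l 1 A) (split_r 1 A).
Proof. reflexivity. Qed.
Lemma lift_ar_unt o A : lift_ar (@fr_unt X o) A = scl (tunt o).
Proof. reflexivity. Qed.

Lemma path_lift_term o t (p : path L o t) a b x : path_lift p a b x ->
  term x (sg a) (sg b) /\ scl x = nabla_path p (slet T a).
Proof.
induction 1; rewrite ?nabla_path_nil, ?nabla_path_cons.
- split; [apply tm_id|]. apply scl_id1.
- destruct IHpath_lift as [H1 H2]. split; [exact (tm_comp (tm_nab E0 _ f A) H1)|].
  rewrite (scl_comp (tm_nab E0 _ f A) H1), H2, nabla_slet, (scl_tgt (tm_nab E0 _ f A)).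
  reflexivity.
Qed.

Lemma path_lift_ex o t (p : path L o t) : forall a : ity L o, exists b x, path_lift p a b x.
Proof.
induction p as [o|o t r f p IH]; intros a.
- exists a, (tid a). apply pl_nil.
- destruct (IH (iapp f a)) as [b [x H]]. exists b, (tnab f a ;t x). exact (pl_cons H).
Qed.

(** [is_lift] manipulates lists of raw types and [lift_ar] their classes. Their agreement shows that
    the class of the lifted term depends on [U] only up to congruence. *)
Lemma is_lift_term r U V x : is_lift r U V x ->
  term x U V /\ fim_sort r (ty_layers U) (ty_layers V) /\ scl x = lift_ar r (sty U).
Proof.
assert (S1 : forall o (a : ity L o) B, split_l 1 (slet T a ** B) = slet T a /\
  split_r 1 (slet T a ** B) = B).
{ intros o a B. apply split_ten. rewrite lay_slet. reflexivity. }
induction 1; rewrite ?lift_ar_gen, ?lift_ar_id1, ?lift_ar_tenE, ?lift_ar_comp, ?lift_ar_symE,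
  ?lift_ar_dup1, ?lift_ar_del1, ?lift_ar_mulE, ?lift_ar_unt.
- destruct (path_lift_term H) as [H1 H2]. split; [exact H1|]. split; [exact (fs_gen X _)|exact H2].
- split; [apply tm_id|]. split; [exact (fs_id X o)|apply scl_id1].
- split; [apply tm_eps|]. split; [apply fs_eps|apply (scl_id T [])].
- destruct IHis_lift1 as [H1 [H2 H3]], IHis_lift2 as [H4 [H5 H6]].
  split; [exact (tm_comp H1 H4)|]. split; [exact (fs_comp H2 H5)|].
  rewrite (scl_comp H1 H4), <- H3, (scl_tgt H1), H6. reflexivity.
- destruct IHis_lift1 as [H1 [H2 H3]], IHis_lift2 as [H4 [H5 H6]].
  split; [exact (tm_ten H1 H4)|]. rewrite !layers_app. split; [exact (fs_ten H2 H5)|].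
  rewrite (scl_ten H1 H4), <- sty_app.
  destruct (split_ten (sty U) (sty U') (n := arity h)) as [-> ->].
  + rewrite lay_sty. symmetry; exact (arity_sort H2).
  + congruence.
- split; [apply tm_sym|]. split; [exact (fs_sym X o t)|].
  rewrite <- sty_app. destruct (S1 o A (sty (sg B))) as [e1 e2]. unfold slet in e1, e2.
  rewrite e1, e2. symmetry; apply swap_slet.
- split; [apply tm_dup|]. split; [exact (fs_dup X o)|]. symmetry; apply diag_slet.
- split; [apply tm_del|]. split; [exact (fs_del X o)|]. symmetry; apply bang_slet.
- split; [apply tm_mul|]. split; [exact (fs_mul X o)|].
  rewrite <- sty_app. destruct (S1 o A (sty (sg B))) as [e1 e2]. unfold slet in e1, e2.
  rewrite e1, e2. symmetry; apply mult_slet.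
- split; [apply tm_unt|]. split; [exact (fs_unt X o)|]. reflexivity.
Qed.

Lemma is_lift_ex r w v : fim_sort r w v -> forall U, ty_layers U = w ->
  exists V x, is_lift r U V x /\ ty_layers V = v.
Proof.
assert (inv1 : forall U o, ty_layers U = [o : ob X] -> exists a : ity L o, U = sg a).
{ intros [|[t a] [|b U]] o; try discriminate. intros e; injection e as <-.
  exists a; reflexivity. }
assert (inv2 : forall U o t, ty_layers U = [o : ob X; t : ob X] ->
  exists (a : ity L o) (b : ity L t), U = sg a ++ sg b).
{ intros [|[o1 a] [|[t1 b] [|c U]]] o t; try discriminate. intros e; injection e as <- <-.
  exists a, b; reflexivity. }
induction 1; intros U e.
- destruct f as [o t p]. destruct (inv1 _ _ e) as [A ->].
  destruct (path_lift_ex p A) as [B [x H]]. exists (sg B), x. split; [exact (il_gen H)|reflexivity].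
- destruct (inv1 _ _ e) as [A ->]. exists (sg A), (tid A). split; [apply il_id|reflexivity].
- destruct U; [|discriminate]. exists [], teps. split; [apply il_eps|reflexivity].
- destruct (IHfim_sort1 U e) as [V1 [x1 [H1 e1]]].
  destruct (IHfim_sort2 V1 e1) as [V2 [x2 [H2 e2]]].
  exists V2, (x1 ;t x2). split; [exact (il_comp H1 H2)|exact e2].
- apply map_eq_app in e. destruct e as [U1 [U2 [-> [e1 e2]]]].
  destruct (IHfim_sort1 U1 e1) as [V1 [x1 [H1 e3]]].
  destruct (IHfim_sort2 U2 e2) as [V2 [x2 [H2 e4]]].
  exists (V1 ++ V2), (x1 *t x2). split; [exact (il_ten H1 H2)|].
  rewrite layers_app, e3, e4. reflexivity.
- destruct (inv2 _ _ _ e) as [A [B ->]]. exists (sg B ++ sg A), (tsym A B).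
  split; [apply il_sym|reflexivity].
- destruct (inv1 _ _ e) as [A ->]. exists (sg A ++ sg A), (tdup A). split; [apply il_dup|reflexivity].
- destruct (inv1 _ _ e) as [A ->]. exists [], (tdel A). split; [apply il_del|reflexivity].
- destruct (inv2 _ _ _ e) as [A [B ->]]. exists (sg (iten A B)), (tmul A B).
  split; [apply il_mul|reflexivity].
- destruct U; [|discriminate]. exists (sg (iunit a)), (tunt a).
  split; [apply il_unt|reflexivity].
Qed.

Lemma lift_ar_sort r w v A : fim_sort r w v -> lay A = w ->
  src (lift_ar r A) = A /\ lay (tgt (lift_ar r A)) = v.
Proof.
intros H. destruct (sty_surj A) as [U ->]. rewrite lay_sty. intros e.
destruct (is_lift_ex H U e) as [V [x [H1 <-]]].
destruct (is_lift_term H1) as [H2 [_ <-]].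
rewrite (scl_src H2), (scl_tgt H2), lay_sty. auto.
Qed.

Lemma lift_ar_ten r1 r2 w v A B : fim_sort r1 w v -> lay A = w ->
  lift_ar (r1 *f r2) (A ** B) = lift_ar r1 A ## lift_ar r2 B.
Proof.
intros H e. rewrite lift_ar_tenE. destruct (split_ten A B (n := arity r1)) as [-> ->]; [|reflexivity].
rewrite e. symmetry; exact (arity_sort H).
Qed.

Lemma lift_ar_sym o t A B : lay A = [o : ob X] -> lift_ar (@fr_sym X o t) (A ** B) = swap Y A B.
Proof.
intros e. rewrite lift_ar_symE. destruct (split_ten A B (n := 1)) as [-> ->]; [|reflexivity].
rewrite e; reflexivity.
Qed.

Lemma lift_ar_mul o (a b : ity L o) : lift_ar (@fr_mul X o) (slet T a ** slet T b) = scl (tmul a b).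
Proof.
rewrite lift_ar_mulE. destruct (split_ten (slet T a) (slet T b) (n := 1)) as [-> ->]; [|apply mult_slet].
rewrite lay_slet; reflexivity.
Qed.

Lemma lift_ar_id w : forall A, lay A = w -> lift_ar (fw_id X w) A = idn A.
Proof.
induction w as [|o w IH]; intros A e; [reflexivity|].
destruct (lay_split A [o] w e) as [B [C [-> [e1 e2]]]]. simpl fw_id.
rewrite (lift_ar_ten _ B C (fs_id X o) e1), (IH C e2). apply mon_id.
Qed.

Lemma lift_ar_sym1 o v : forall A B, lay A = [o : ob X] -> lay B = v ->
  lift_ar (fw_sym1 X o v) (A ** B) = swap Y A B.
Proof.
induction v as [|t v IH]; intros A B e e'.
- apply lay_nil in e'. subst B. rewrite swap_oner, mon_unitr_ob. reflexivity.
- destruct (lay_split B [t] v e') as [B1 [B2 [-> [e1 e2]]]]. simpl fw_sym1.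
  rewrite lift_ar_comp, <- mon_assoc_ob.
  rewrite (lift_ar_ten _ (A ** B1) B2 (fs_sym X o t)) by (rewrite lay_ten, e, e1; reflexivity).
  rewrite lift_ar_sym, lift_ar_id by assumption.
  rewrite mon_tgt, swap_tgt, cat_tgt_id, mon_assoc_ob.
  rewrite (lift_ar_ten _ B1 _ (fs_id X t) e1), IH by assumption.
  symmetry; apply swap_hex.
Qed.

Lemma lift_ar_swap w v : forall A B, lay A = w -> lay B = v ->
  lift_ar (fw_sym X w v) (A ** B) = swap Y A B.
Proof.
induction w as [|o w IH]; intros A B e e'.
- apply lay_nil in e. subst A. simpl fw_sym. rewrite swap_onel, mon_unitl_ob.
  apply lift_ar_id, e'.
- destruct (lay_split A [o] w e) as [A1 [A2 [-> [e1 e2]]]]. simpl fw_sym.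
  rewrite lift_ar_comp, mon_assoc_ob.
  rewrite (lift_ar_ten _ A1 (A2 ** B) (fs_id X o) e1), IH by assumption. rewrite lift_ar_id1.
  rewrite mon_tgt, swap_tgt, cat_tgt_id, <- mon_assoc_ob.
  rewrite (lift_ar_ten _ (A1 ** B) A2 (fw_sym1_sort X o v)) by (rewrite lay_ten, e1, e'; reflexivity).
  rewrite lift_ar_sym1, lift_ar_id by assumption.
  symmetry; apply swap_hex'.
Qed.

Lemma lift_ar_dup w : forall A, lay A = w -> lift_ar (fw_dup X w) A = diag Y A.
Proof.
induction w as [|o w IH]; intros A e.
- apply lay_nil in e. subst A. symmetry; apply diag_one.
- destruct (lay_split A [o] w e) as [A1 [A2 [-> [e1 e2]]]]. simpl fw_dup.
  rewrite lift_ar_comp, (lift_ar_ten _ A1 A2 (fs_dup X o) e1), IH by assumption.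
  rewrite lift_ar_dup1, mon_tgt, !diag_tgt, mon_assoc_ob.
  rewrite (lift_ar_ten _ A1 _ (fs_id X o) e1), <- (mon_assoc_ob A1 A2).
  rewrite (lift_ar_ten _ (A1 ** A2) A2 (fw_sym1_sort X o w)) by (rewrite lay_ten, e1, e2; reflexivity).
  rewrite lift_ar_sym1, lift_ar_id by assumption. symmetry; apply diag_tensor.
Qed.

Lemma lift_ar_del w : forall A, lay A = w -> lift_ar (fw_del X w) A = bang Y A.
Proof.
induction w as [|o w IH]; intros A e.
- apply lay_nil in e. subst A. symmetry; apply bang_one.
- destruct (lay_split A [o] w e) as [A1 [A2 [-> [e1 e2]]]]. simpl fw_del.
  rewrite (lift_ar_ten _ A1 A2 (fs_del X o) e1), IH by assumption.
  symmetry; apply bang_tensor.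
Qed.

Lemma nabla_path_sort o t (p : path L o t) (a : ity L o) :
  exists b : ity L t, src (nabla_path p (slet T a)) = slet T a /\ tgt (nabla_path p (slet T a)) = slet T b.
Proof.
destruct (path_lift_ex p a) as [b [x H]]. destruct (path_lift_term H) as [H1 H2].
exists b. rewrite <- H2, (scl_src H1), (scl_tgt H1). auto.
Qed.

Lemma nabla_path_app o t s (p : path L o t) (q : path L t s) : forall a : ity L o,
  nabla_path (papp p q) (slet T a) = nabla_path p (slet T a) ;; nabla_path q (tgt (nabla_path p (slet T a))).
Proof.
induction p as [o|o t u f p IH]; intros a; rewrite ?papp_cons, ?nabla_path_cons, ?nabla_path_nil.
- rewrite cat_tgt_id. symmetry; apply cat_idl'.
  destruct (nabla_path_sort q a) as [b [e _]]; exact e.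
- rewrite nabla_slet, (scl_tgt (tm_nab E0 _ f a)). change (sty (sg (iapp f a))) with (slet T (iapp f a)).
  rewrite IH. destruct (nabla_path_sort p (iapp f a)) as [b [e1 e2]].
  assert (e3 : tgt (scl (tnab f a)) = slet T (iapp f a)) by exact (scl_tgt (tm_nab E0 _ f a)).
  destruct (nabla_path_sort q b) as [c [e4 _]].
  rewrite (cat_tgt_comp (scl (tnab f a))) by congruence.
  rewrite e2, cat_assoc by congruence. reflexivity.
Qed.

Lemma tmul_src o (a b : ity L o) : src (scl (tmul a b)) = slet T a ** slet T b.
Proof. rewrite (scl_src (tm_mul E0 a b)). symmetry; exact (sty_app T (sg a) (sg b)). Qed.
Lemma tmul_tgt o (a b : ity L o) : tgt (scl (tmul a b)) = slet T (iten a b).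
Proof. exact (scl_tgt (tm_mul E0 a b)). Qed.
Lemma tnab_src o t (f : fgen L o t) (a : ity L o) : src (scl (tnab f a)) = slet T a.
Proof. exact (scl_src (tm_nab E0 _ f a)). Qed.
Lemma tnab_tgt o t (f : fgen L o t) (a : ity L o) : tgt (scl (tnab f a)) = slet T (iapp f a).
Proof. exact (scl_tgt (tm_nab E0 _ f a)). Qed.

(** Iterates, edge by edge, the compatibility of [nabla] with [m]; at each edge the congruence
    [f(AB) = f(A)f(B)] identifies the intermediate types. *)
Lemma nabla_path_mult o t (p : path L o t) : forall a b : ity L o,
  scl (tmul a b) ;; nabla_path p (slet T (iten a b)) =
  (nabla_path p (slet T a) ## nabla_path p (slet T b)) ;;
  mult_ar t (tgt (nabla_path p (slet T a))) (tgt (nabla_path p (slet T b))).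
Proof.
induction p as [o|o t r f p IH]; intros a b; rewrite ?nabla_path_cons, ?nabla_path_nil.
- rewrite mon_id, !cat_tgt_id, mult_slet, cat_idl', cat_idr'; [reflexivity|..].
  + apply tmul_tgt.
  + apply tmul_src.
- rewrite !nabla_slet, !tnab_tgt.
  assert (e : slet T (iapp f (iten a b)) = slet T (iten (iapp f a) (iapp f b)))
    by apply slet_eq, ie_app_ten.
  destruct (nabla_path_sort p (iten (iapp f a) (iapp f b))) as [c [c1 c2]].
  destruct (nabla_path_sort p (iapp f a)) as [c' [c1' c2']].
  destruct (nabla_path_sort p (iapp f b)) as [c'' [c1'' c2'']].
  rewrite e, <- cat_assoc; rewrite ?tnab_tgt, ?tnab_src, ?tmul_src, ?tmul_tgt, ?c1; auto.
  pose proof (scl_tmeq (te_nab_mul E0 E1 _ f a b)) as n.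
  rewrite (scl_comp (tm_mul E0 a b) (tm_nab E0 _ f (iten a b))) in n.
  rewrite (scl_comp (tm_ten (tm_nab E0 _ f a) (tm_nab E0 _ f b)) (tm_mul E0 (iapp f a) (iapp f b))) in n.
  rewrite (scl_ten (tm_nab E0 _ f a) (tm_nab E0 _ f b)) in n. rewrite n.
  rewrite cat_assoc; rewrite ?mon_tgt, ?tnab_tgt, ?tmul_src, ?tmul_tgt, ?c1; auto.
  rewrite IH, !cat_tgt_comp; rewrite ?tnab_tgt, ?c1', ?c1''; auto.
  rewrite (mon_comp (scl (tnab f a))); rewrite ?tnab_tgt, ?c1', ?c1''; auto.
  rewrite cat_assoc; rewrite ?mon_src, ?mon_tgt, ?tnab_tgt, ?c1', ?c1''; auto.
  rewrite c2', c2'', mult_slet, tmul_src; reflexivity.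
Qed.

Lemma nabla_path_unit o t (p : path L o t) :
  scl (tunt o) ;; nabla_path p (slet T (iunit o)) = scl (tunt t).
Proof.
induction p as [o|o t r f p IH]; rewrite ?nabla_path_cons, ?nabla_path_nil.
- apply cat_idr'. exact (scl_tgt (tm_unt E0 o)).
- rewrite !nabla_slet, tnab_tgt.
  assert (e : slet T (iapp f (iunit o)) = slet T (iunit t)) by apply slet_eq, ie_app_unit.
  destruct (nabla_path_sort p (iunit t)) as [c [c1 c2]].
  rewrite e, <- cat_assoc; rewrite ?tnab_tgt, ?tnab_src, ?c1; auto.
  + pose proof (scl_tmeq (te_nab_unt E0 E1 _ _ f)) as n.
    rewrite (scl_comp (tm_unt E0 o) (tm_nab E0 _ f (iunit o))) in n. rewrite n. exact IH.
  + exact (scl_tgt (tm_unt E0 o)).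
Qed.

(** This makes the chosen liftings well defined. Cartesian equations of the base lift to cartesian
    equations of types, monoid laws to the laws of [m] and [u], the compatibility of monoids with
    generators to the laws of [nabla], and composites in the free category to concatenated paths. *)
Lemma lift_ar_eq r r' : fim_eq r r' -> forall w v, fim_sort r w v ->
  forall A, lay A = w -> lift_ar r A = lift_ar r' A.
Proof.
assert (let_of : forall A o, lay A = [o : ob X] -> exists a : ity L o, A = slet T a)
  by exact lay_letter.
intros Heq; induction Heq; intros w0 v0 Hs A0 e0.
- reflexivity.
- destruct (fim_eq_sort _ Heq) as [w1 [v1 [H1 H2]]].
  destruct (fim_sort_det Hs H2); subst w1 v1. symmetry; exact (IHHeq _ _ H1 A0 e0).
- destruct (fim_eq_sort _ Heq1) as [w1 [v1 [H1 H2]]].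
  destruct (fim_sort_det Hs H1); subst w1 v1.
  rewrite (IHHeq1 _ _ Hs A0 e0). exact (IHHeq2 _ _ H2 A0 e0).
(* Sorts are unique, so the word assumed for the left side is the one displayed by the constructor;
   this rewrites the layers of [A0]. The later cases open in the same way. *)
- destruct (fim_sort_det Hs (fs_comp H H0)) as [q _]; rewrite q in e0; clear q. rewrite !lift_ar_comp.
  rewrite <- (IHHeq1 _ _ H A0 e0).
  destruct (lift_ar_sort A0 H e0) as [_ e1]. rewrite (IHHeq2 _ _ H0 _ e1). reflexivity.
- destruct (fim_eq_sort _ Heq1) as [w1 [v1 [H1 H2]]].
  destruct (fim_eq_sort _ Heq2) as [w2 [v2 [H3 H4]]].
  destruct (fim_sort_det Hs (fs_ten H1 H3)) as [q _]; rewrite q in e0; clear q.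
  destruct (lay_split A0 _ _ e0) as [A [B [-> [e1 e2]]]].
  rewrite (lift_ar_ten _ A B H1 e1), (lift_ar_ten _ A B H2 e1).
  rewrite (IHHeq1 _ _ H1 A e1), (IHHeq2 _ _ H3 B e2). reflexivity.
- destruct (fim_sort_det Hs (fs_comp (fs_comp H H0) H1)) as [q _]; rewrite q in e0; clear q.
  rewrite !lift_ar_comp.
  destruct (lift_ar_sort A0 H e0) as [a1 a2].
  destruct (lift_ar_sort _ H0 a2) as [b1 b2].
  destruct (lift_ar_sort _ H1 b2) as [c1 c2].
  rewrite cat_tgt_comp by congruence. apply cat_assoc; congruence.
- destruct (fim_sort_det Hs (fs_comp (fw_id_sort X w) H)) as [q _]; rewrite q in e0; clear q.
  rewrite lift_ar_comp, lift_ar_id by assumption. rewrite cat_tgt_id.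
  apply cat_idl'. apply (lift_ar_sort A0 H e0).
- destruct (fim_sort_det Hs (fs_comp H (fw_id_sort X v))) as [q _]; rewrite q in e0; clear q.
  destruct (lift_ar_sort A0 H e0) as [a1 a2].
  rewrite lift_ar_comp, lift_ar_id by assumption. apply cat_idr.
- destruct (fim_sort_det Hs (fs_ten (fs_ten H H0) H1)) as [q _]; rewrite q in e0; clear q.
  destruct (lay_split A0 _ _ e0) as [A' [C [-> [e1 e2]]]].
  destruct (lay_split A' _ _ e1) as [A [B [-> [e3 e4]]]].
  rewrite (lift_ar_ten _ _ C (fs_ten H H0) e1), (lift_ar_ten _ A B H e3).
  rewrite mon_assoc_ob, (lift_ar_ten _ A _ H e3), (lift_ar_ten _ B C H0 e4).
  apply mon_assoc_ar.
- destruct (fim_sort_det Hs (fs_ten (fs_eps X) H)) as [q _]; rewrite q in e0; clear q.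
  rewrite <- (mon_unitl_ob A0) at 1. rewrite (lift_ar_ten _ one A0 (fs_eps X)) by exact (lay_sty T []).
  apply mon_unitl_ar.
- destruct (fim_sort_det Hs (fs_ten H (fs_eps X))) as [q _]. rewrite q, app_nil_r in e0; clear q.
  rewrite <- (mon_unitr_ob A0) at 1. rewrite (lift_ar_ten _ A0 one H e0).
  apply mon_unitr_ar.
- destruct (fim_sort_det Hs (fs_ten (fs_comp H H0) (fs_comp H1 H2))) as [q _]; rewrite q in e0; clear q.
  destruct (lay_split A0 _ _ e0) as [A [B [-> [e1 e2]]]].
  destruct (lift_ar_sort A H e1) as [a1 a2], (lift_ar_sort _ H0 a2) as [a3 a4].
  destruct (lift_ar_sort B H1 e2) as [b1 b2], (lift_ar_sort _ H2 b2) as [b3 b4].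
  rewrite (lift_ar_ten _ A B (fs_comp H H0) e1), !lift_ar_comp, (lift_ar_ten _ A B H e1).
  rewrite mon_tgt, (lift_ar_ten _ _ _ H0 a2). apply mon_comp; congruence.
- destruct (fim_sort_det Hs (fs_comp (fs_sym X a b) (fs_sym X b a))) as [q _]; rewrite q in e0; clear q.
  destruct (lay_split A0 [a] [b] e0) as [A [B [-> [e1 e2]]]].
  rewrite lift_ar_comp, lift_ar_sym by assumption. rewrite swap_tgt, lift_ar_sym by assumption.
  rewrite lift_ar_id by assumption. apply swap_inv.
- destruct (fim_sort_det Hs (fs_comp (fs_ten H H0) (fw_sym_sort X v v'))) as [q _]; rewrite q in e0; clear q.
  destruct (lay_split A0 _ _ e0) as [A [B [-> [e1 e2]]]].
  destruct (lift_ar_sort A H e1) as [a1 a2], (lift_ar_sort B H0 e2) as [b1 b2].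
  rewrite !lift_ar_comp, (lift_ar_ten _ A B H e1), mon_tgt, !lift_ar_swap by assumption.
  rewrite swap_tgt, (lift_ar_ten _ B A H0 e2), swap_nat, a1, b1. reflexivity.
- destruct (fim_sort_det Hs (fs_comp (fs_dup X a) (fs_ten (fs_dup X a) (fs_id X a)))) as [q _]; rewrite q in e0; clear q.
  rewrite !lift_ar_comp. rewrite !lift_ar_dup1, diag_tgt.
  rewrite (lift_ar_ten _ A0 A0 (fs_dup X a) e0), (lift_ar_ten _ A0 A0 (fs_id X a) e0).
  apply diag_assoc.
- destruct (fim_sort_det Hs (fs_comp (fs_dup X a) (fs_ten (fs_del X a) (fs_id X a)))) as [q _]; rewrite q in e0; clear q.
  rewrite !lift_ar_comp. rewrite !lift_ar_dup1, diag_tgt.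
  rewrite (lift_ar_ten _ A0 A0 (fs_del X a) e0). apply diag_unitl.
- destruct (fim_sort_det Hs (fs_comp (fs_dup X a) (fs_ten (fs_id X a) (fs_del X a)))) as [q _]; rewrite q in e0; clear q.
  rewrite !lift_ar_comp. rewrite !lift_ar_dup1, diag_tgt.
  rewrite (lift_ar_ten _ A0 A0 (fs_id X a) e0). apply diag_unitr.
- destruct (fim_sort_det Hs (fs_comp H (fw_dup_sort X v))) as [q _]; rewrite q in e0; clear q.
  destruct (lift_ar_sort A0 H e0) as [a1 a2].
  rewrite !lift_ar_comp, !lift_ar_dup by assumption. rewrite diag_tgt.
  rewrite (lift_ar_ten _ A0 A0 H e0), diag_nat, a1. reflexivity.
- destruct (fim_sort_det Hs (fs_comp H (fw_del_sort X v))) as [q _]; rewrite q in e0; clear q.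
  destruct (lift_ar_sort A0 H e0) as [a1 a2].
  rewrite !lift_ar_comp, !lift_ar_del by assumption. rewrite bang_nat, a1. reflexivity.
- destruct (fim_sort_det Hs (fs_comp (fs_ten (fs_mul X a) (fs_id X a)) (fs_mul X a))) as [q _]; rewrite q in e0; clear q.
  destruct (lay_split A0 [a] [a; a] e0) as [A [B' [-> [e1 e2]]]].
  destruct (lay_split B' [a] [a] e2) as [B [C [-> [e3 e4]]]].
  destruct (let_of _ _ e1) as [x ->], (let_of _ _ e3) as [y ->], (let_of _ _ e4) as [z ->].
  rewrite !lift_ar_comp, (lift_ar_ten _ (slet T x) _ (fs_id X a) e1), <- mon_assoc_ob.
  rewrite (lift_ar_ten _ (slet T x ** slet T y) (slet T z) (fs_mul X a)) by (rewrite lay_ten, e1, e3; reflexivity).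
  rewrite !lift_ar_mul, !lift_ar_id1.
  rewrite !mon_tgt, !tmul_tgt, !cat_tgt_id, !lift_ar_mul.
  pose proof (scl_tmeq (te_mul_assoc E0 E1 x y z)) as n.
  rewrite (scl_comp (tm_ten (tm_mul E0 x y) (tm_id E0 z)) (tm_mul E0 (iten x y) z)) in n.
  rewrite (scl_comp (tm_ten (tm_id E0 x) (tm_mul E0 y z)) (tm_mul E0 x (iten y z))) in n.
  rewrite (scl_ten (tm_mul E0 x y) (tm_id E0 z)), (scl_ten (tm_id E0 x) (tm_mul E0 y z)) in n.
  rewrite !scl_id1 in n. exact n.
- destruct (fim_sort_det Hs (fs_comp (fs_ten (fs_unt X a) (fs_id X a)) (fs_mul X a))) as [q _]; rewrite q in e0; clear q.
  destruct (let_of _ _ e0) as [x ->].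
  rewrite lift_ar_comp. rewrite <- (mon_unitl_ob (slet T x)).
  rewrite !(lift_ar_ten _ one _ (fs_unt X a)) by exact (lay_sty T []).
  rewrite !lift_ar_id1, !lift_ar_unt.
  rewrite mon_tgt, (scl_tgt (tm_unt E0 a) : _ = slet T (iunit a)), cat_tgt_id, lift_ar_mul.
  pose proof (scl_tmeq (te_mul_unitl E0 E1 x)) as n.
  rewrite (scl_comp (tm_ten (tm_unt E0 a) (tm_id E0 x)) (tm_mul E0 (iunit a) x)) in n.
  rewrite (scl_ten (tm_unt E0 a) (tm_id E0 x)), !scl_id1 in n.
  rewrite mon_unitl_ob. exact n.
- destruct (fim_sort_det Hs (fs_comp (fs_ten (fs_id X a) (fs_unt X a)) (fs_mul X a))) as [q _]; rewrite q in e0; clear q.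
  destruct (let_of _ _ e0) as [x ->].
  rewrite lift_ar_comp. rewrite <- (mon_unitr_ob (slet T x)).
  rewrite !(lift_ar_ten _ (slet T x) _ (fs_id X a)) by exact e0.
  rewrite !lift_ar_id1, !lift_ar_unt.
  rewrite mon_tgt, (scl_tgt (tm_unt E0 a) : _ = slet T (iunit a)), cat_tgt_id, lift_ar_mul.
  pose proof (scl_tmeq (te_mul_unitr E0 E1 x)) as n.
  rewrite (scl_comp (tm_ten (tm_id E0 x) (tm_unt E0 a)) (tm_mul E0 x (iunit a))) in n.
  rewrite (scl_ten (tm_id E0 x) (tm_unt E0 a)), !scl_id1 in n.
  rewrite mon_unitr_ob. exact n.
- destruct (fim_sort_det Hs (fs_comp (fs_mul X (src f)) (fs_gen X f))) as [q _]; rewrite q in e0; clear q.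
  destruct (lay_split A0 [src f] [src f] e0) as [A [B [-> [e1 e2]]]].
  destruct (let_of _ _ e1) as [x ->], (let_of _ _ e2) as [y ->].
  rewrite !lift_ar_comp, lift_ar_mul, tmul_tgt.
  rewrite (lift_ar_ten _ (slet T x) (slet T y) (fs_gen X f) e1), mon_tgt.
  rewrite !lift_ar_gen.
  destruct (nabla_path_sort (pa_path f) x) as [c [_ c1]], (nabla_path_sort (pa_path f) y) as [d [_ d1]].
  etransitivity; [exact (nabla_path_mult (pa_path f) x y)|]. f_equal.
  (* The two lifted paths end in internal types [c] and [d], at which the chosen multiplication is
     [tmul c d]. *)
  rewrite c1, d1, mult_slet. symmetry.
  etransitivity; [|exact (lift_ar_mul c d)]. apply f_equal. exact (f_equal2 tob c1 d1).
- destruct (fim_sort_det Hs (fs_comp (fs_unt X (src f)) (fs_gen X f))) as [q _]; rewrite q in e0; clear q.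
  rewrite lift_ar_comp, !lift_ar_unt, (scl_tgt (tm_unt E0 (src f))), lift_ar_gen. apply nabla_path_unit.
- reflexivity.
- destruct (fim_sort_det Hs (fs_gen X (f ;; g))) as [q _]; rewrite q in e0; clear q.
  destruct f as [o t p], g as [t' s q]. simpl in H. subst t'.
  rewrite cat_src_comp in e0 by reflexivity. destruct (let_of _ _ e0) as [x ->].
  rewrite lift_ar_comp. rewrite free_comp. apply nabla_path_app.
Qed.

Lemma syn_lift_cl r v A : fim_sort r (lay A) v ->
  lift (syn_opfib T) (fcl r) A = lift_ar r A.
Proof.
destruct (sty_surj A) as [U ->]. rewrite lay_sty. intros H.
destruct (is_lift_ex H U eq_refl) as [V [x [Hx eV]]].
destruct (is_lift_term Hx) as [H1 [H2 H3]].
apply the_eq.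
- exists (FimTerm H), (STerm T H1). split; [exact (fcl_mk H)|]. simpl.
  split; [rewrite <- H3; exact (scl_mk H1)|]. split; [reflexivity|exact Hx].
- intros k [[w' v' r' Hr'] [[U' V' x' Hx'] [e1 [-> [e2 e3]]]]]; simpl in e2, e3.
  destruct (is_lift_term e3) as [_ [K2 K3]].
  assert (e4 : sty U = sty U') by exact e2.
  transitivity (scl x'); [symmetry; exact (scl_mk Hx')|].
  rewrite K3, <- e4. symmetry.
  assert (e5 : fcl r = fcl r') by (rewrite (fcl_mk Hr'); exact e1).
  exact (lift_ar_eq (fcl_inj H Hr' e5) H (sty U) (lay_sty T U)).
Qed.

Lemma lift_ar_proj (Hproj : forall x y, E1 x y -> fim_eq (tm_proj x) (tm_proj y)) r v A :
  fim_sort r (lay A) v -> @s_ar Y Bs (syn_proj T) (lift_ar r A) = fcl r.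
Proof.
destruct (sty_surj A) as [U ->]. rewrite lay_sty. intros H.
destruct (is_lift_ex H U eq_refl) as [V [x [Hx eV]]].
destruct (is_lift_term Hx) as [H1 [H2 <-]].
rewrite (syn_proj_scl Hproj H1). clear H1 H2 H eV v.
(* A lifted path projects to a composite of one-edge generators, which [fe_gen_comp] contracts to
   the single generator of the path. *)
assert (P : forall o t (p : path L o t) a b x, path_lift p a b x -> pcl T x = fcl (@fr_gen X (PathAr p))).
{ intros o t p a b y Hy; induction Hy.
  - unfold pcl; simpl. exact (eq_sym (fcl_eq (fe_gen_id X o) (fs_gen X (idn (o : ob X))) (fs_id X o))).
  - destruct (path_lift_term Hy) as [K _].
    rewrite (pcl_comp (tm_nab E0 _ f A) K), IHHy.
    change (pcl T (tnab f A)) with (fcl (@fr_gen X (edge f))).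
    rewrite <- (fcl_comp (fs_gen X (edge f)) (fs_gen X (PathAr p))).
    pose proof (fe_gen_comp X (edge f) (PathAr p) eq_refl) as G.
    unfold edge in G. rewrite free_comp in G. simpl papp in G.
    exact (eq_sym (fcl_eq G (fs_gen X (PathAr (pcons f p))) (fs_comp (fs_gen X (edge f)) (fs_gen X (PathAr p))))). }
induction Hx.
- exact (P _ _ _ _ _ _ H).
- reflexivity.
- reflexivity.
- destruct (is_lift_term Hx1) as [K1 [K2 _]], (is_lift_term Hx2) as [K3 [K4 _]].
  rewrite (pcl_comp K1 K3), (fcl_comp K2 K4), IHHx1, IHHx2. reflexivity.
- destruct (is_lift_term Hx1) as [K1 [K2 _]], (is_lift_term Hx2) as [K3 [K4 _]].
  rewrite (pcl_ten K1 K3), (fcl_ten K2 K4), IHHx1, IHHx2. reflexivity.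
- reflexivity.
- reflexivity.
- reflexivity.
- reflexivity.
- reflexivity.
Qed.
End Lifting.
Arguments lift_ar_sort {T r w v A}.
Arguments lift_ar_ten {T r1 r2 w v}.
Arguments lift_ar_eq {T r r'} _ {w v}.
Arguments is_lift_term {T r U V x}.
Arguments is_lift_ex {T r w v} _ U.
Arguments syn_lift_cl {T r v A}.
Arguments lift_ar_proj {T} Hproj {r v A}.
Arguments lay_nil {T A}.
Arguments lay_letter {T A o}.
Arguments lay_split {T A w v}.
Arguments slet_inj {T o a b}.
Arguments slet_eq {T o a b}.

(** * Factorization into a lifting and a vertical arrow *)

Section Factorization.
Variable T : theory.
Local Notation L := (th_sig T).
Local Notation E0 := (th_E0 T).
Local Notation E1 := (th_E1 T).
Local Notation term := (term E0).
Local Notation iterm := (iterm E0).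
Local Notation tmeq := (tmeq E0 E1).
Local Notation Y := (syn_mcat T).
Local Notation X := (free_cat L).
Local Notation Bs := (fim X).
Local Notation scl := (scl T).
Local Notation sty := (sty T).
Local Notation lay := (lay (T := T)).
Local Notation lift_ar := (lift_ar (T := T)).
Implicit Types (x y z : tm (th_sig T)) (U V W : ty (th_sig T)) (h k i : ar (syn_mcat T))
  (A B C : ob (syn_mcat T)) (r : fim_raw (free_cat (th_sig T)))
  (w v : list (ob (free_cat (th_sig T)))).

(** Tensors of internal terms; these turn out to be the arrows of the fibres. *)
Inductive vertical : ar Y -> Prop :=
| vert_one : vertical (idn one)
| vert_cons o x (a b : ity L o) h : iterm x a b -> vertical h -> vertical (scl x ## h).

Lemma vertical_ten h k : vertical h -> vertical k -> vertical (h ## k).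
Proof.
intros H K; induction H; [rewrite mon_unitl_ar; exact K|].
rewrite mon_assoc_ar. exact (vert_cons H IHvertical).
Qed.
Lemma vertical_iterm o x (a b : ity L o) : iterm x a b -> vertical (scl x).
Proof. intros H. rewrite <- (mon_unitr_ar (scl x)). exact (vert_cons H vert_one). Qed.
Lemma vertical_id A : vertical (idn A).
Proof.
revert A. apply syn_ind; [exact vert_one|]. intros A B [o [a ->]] H.
rewrite <- mon_id, <- scl_id1. exact (vert_cons (it_id E0 a) H).
Qed.

Lemma scl_isrc o x (a b : ity L o) : iterm x a b -> src (scl x) = slet T a.
Proof. intros H; exact (scl_src (tm_int H)). Qed.
Lemma scl_itgt o x (a b : ity L o) : iterm x a b -> tgt (scl x) = slet T b.
Proof. intros H; exact (scl_tgt (tm_int H)). Qed.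

Lemma vertical_lay h : vertical h -> lay (tgt h) = lay (src h).
Proof.
induction 1; [rewrite cat_src_id, cat_tgt_id; reflexivity|].
rewrite mon_src, mon_tgt, !lay_ten, IHvertical, (scl_isrc H), (scl_itgt H), !lay_slet.
reflexivity.
Qed.

Lemma vertical_nil h : vertical h -> lay (src h) = [] -> h = idn one.
Proof.
intros [|o x a b k H K]; [reflexivity|].
rewrite mon_src, lay_ten, (scl_isrc H), lay_slet. discriminate.
Qed.

Lemma vertical_split h : vertical h -> forall w v, lay (src h) = w ++ v ->
  exists h1 h2, h = h1 ## h2 /\ vertical h1 /\ vertical h2 /\
    lay (src h1) = w /\ lay (src h2) = v.
Proof.
pose proof (lay_one T) as l1.
induction 1; intros w v e.
- rewrite cat_src_id in e. rewrite lay_one in e.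
  symmetry in e; apply app_eq_nil in e. destruct e as [-> ->].
  exists (idn one), (idn one). rewrite mon_unitl_ar, cat_src_id.
  repeat apply conj; auto using vert_one.
- rewrite mon_src, lay_ten, (scl_isrc H), lay_slet in e.
  destruct w as [|t w]; simpl in e.
  + exists (idn one), (scl x ## h). rewrite mon_unitl_ar, cat_src_id.
    split; [reflexivity|]. split; [exact vert_one|]. split; [exact (vert_cons H H0)|].
    split; [exact l1|]. rewrite mon_src, lay_ten, (scl_isrc H), lay_slet. exact e.
  + injection e as e1 e2. destruct (IHvertical w v e2) as [h1 [h2 [-> [H1 [H2 [e3 e4]]]]]].
    exists (scl x ## h1), h2. rewrite mon_assoc_ar.
    split; [reflexivity|]. split; [exact (vert_cons H H1)|]. split; [exact H2|].
    split; [|exact e4]. rewrite mon_src, lay_ten, (scl_isrc H), lay_slet, e3, <- e1. reflexivity.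
Qed.

Lemma vertical_letter h o : vertical h -> lay (src h) = [o : ob X] ->
  exists x (a b : ity L o), iterm x a b /\ h = scl x.
Proof.
intros [|t x a b k H K] e.
- rewrite cat_src_id, lay_one in e. discriminate e.
- rewrite mon_src, lay_ten, (scl_isrc H), lay_slet in e. injection e as e1 e2. subst t.
  apply (vertical_nil K) in e2. subst k. rewrite mon_unitr_ar. exists x, a, b. auto.
Qed.

(** Equal layers force equal lengths, so both decompositions are obtained by cutting the same list
    at the same place. *)
Lemma ten_src_inj A A' B B' : A ** B = A' ** B' -> lay A = lay A' -> A = A' /\ B = B'.
Proof.
intros e e'. assert (el : length (lay A) = length (lay A')) by congruence.
destruct (split_ten A B eq_refl) as [p1 p2].
destruct (split_ten A' B' (eq_sym el)) as [q1 q2]. rewrite e in p1, p2.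
split; congruence.
Qed.

Lemma vertical_comp h : vertical h -> forall k, vertical k -> tgt h = src k -> vertical (h ;; k).
Proof.
induction 1; intros k K e.
- rewrite cat_idl'; [exact K|]. rewrite <- e; apply cat_tgt_id.
- destruct (vertical_split K [o : ob X] (lay (tgt h))) as [k1 [k2 [-> [K1 [K2 [e1 e2]]]]]].
  { rewrite <- e, mon_tgt, lay_ten, (scl_itgt H), lay_slet. reflexivity. }
  rewrite mon_tgt, mon_src in e.
  destruct (ten_src_inj e) as [e3 e4].
  { rewrite e1, (scl_itgt H). apply lay_slet. }
  destruct (vertical_letter K1 e1) as [y [b' [c [Hy ->]]]].
  rewrite <- mon_comp by assumption.
  assert (eb : ieq E0 b' b).
  { apply slet_inj. rewrite <- (scl_isrc Hy), <- (scl_itgt H). symmetry; exact e3. }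
  pose proof (it_conv eb (ie_refl E0 c) Hy) as Hy'.
  rewrite <- (scl_comp (tm_int H) (tm_int Hy')).
  exact (vert_cons (it_comp H Hy') (IHvertical k2 K2 e4)).
Qed.

Lemma path_vertical o t (p : path L o t) : forall x (a b : ity L o), iterm x a b ->
  exists y (c d : ity L t), iterm y c d /\ slet T c = tgt (nabla_path p (slet T a)) /\
    slet T d = tgt (nabla_path p (slet T b)) /\
    scl x ;; nabla_path p (slet T b) = nabla_path p (slet T a) ;; scl y.
Proof.
induction p as [o|o t s f p IH]; intros x a b H; rewrite ?nabla_path_nil, ?nabla_path_cons.
- exists x, a, b. rewrite !cat_tgt_id, cat_idl', cat_idr'; auto.
  + exact (scl_itgt H).
  + exact (scl_isrc H).
- rewrite !nabla_slet, !tnab_tgt.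
  destruct (IH _ _ _ (it_app _ f H)) as [y [c [d [Hy [ec [ed n]]]]]].
  exists y, c, d. split; [exact Hy|].
  destruct (nabla_path_sort T p (iapp f a)) as [c' [c1 c2]].
  destruct (nabla_path_sort T p (iapp f b)) as [d' [d1 d2]].
  rewrite !cat_tgt_comp by (rewrite tnab_tgt; congruence).
  split; [exact ec|]. split; [exact ed|].
  pose proof (scl_tmeq (te_nab_nat E1 _ f H)) as n'.
  rewrite (scl_comp (tm_int H) (tm_nab E0 _ f b)) in n'.
  rewrite (scl_comp (tm_nab E0 _ f a) (tm_int (it_app _ f H))) in n'.
  rewrite <- cat_assoc by (rewrite ?tnab_tgt, ?tnab_src, ?(scl_itgt H); congruence).
  rewrite n', cat_assoc, n, cat_assoc; [reflexivity|..];
    rewrite ?tnab_tgt, ?tnab_src, ?(scl_itgt (it_app _ f H)), ?(scl_isrc (it_app _ f H)), ?(scl_isrc Hy);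
    congruence.
Qed.

(** Naturality of liftings in vertical arrows, one generator at a time. It allows a vertical arrow
    followed by a lifting to be reordered, which is what composing two factorized arrows demands. *)
Lemma vertical_lift r w v : fim_sort r w v -> forall i, vertical i -> lay (src i) = w ->
  exists j, vertical j /\ src j = tgt (lift_ar r (src i)) /\ tgt j = tgt (lift_ar r (tgt i)) /\
    i ;; lift_ar r (tgt i) = lift_ar r (src i) ;; j.
Proof.
induction 1; intros i Hi e.
- destruct (vertical_letter Hi e) as [x [a [b [H ->]]]].
  rewrite !lift_ar_gen, (scl_isrc H), (scl_itgt H).
  destruct (path_vertical (pa_path f) H) as [y [c [d [Hy [ec [ed n]]]]]].
  exists (scl y). split; [exact (vertical_iterm Hy)|].
  rewrite (scl_isrc Hy), (scl_itgt Hy). auto.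
- exists i. rewrite !lift_ar_id1, !cat_tgt_id, cat_idl, cat_idr. auto.
- apply (vertical_nil Hi) in e. subst i. exists (idn one).
  assert (le : forall A, lift_ar (@fr_eps X) A = idn A) by reflexivity.
  rewrite !le, !cat_tgt_id, !cat_src_id. repeat apply conj; auto using vert_one.
- destruct (IHfim_sort1 i Hi e) as [j [Hj [e1 [e2 e3]]]].
  pose proof (lift_ar_sort H e) as [a1 a2].
  assert (e' : lay (tgt i) = w) by (rewrite vertical_lay; assumption).
  pose proof (lift_ar_sort H e') as [b1 b2].
  destruct (IHfim_sort2 j Hj) as [k [Hk [e4 [e5 e6]]]]; [congruence|].
  pose proof (lift_ar_sort H0 a2) as [c1 c2].
  pose proof (lift_ar_sort H0 b2) as [d1 d2].
  exists k. rewrite !lift_ar_comp. rewrite !cat_tgt_comp by congruence.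
  split; [exact Hk|]. split; [congruence|]. split; [congruence|].
  rewrite <- cat_assoc by congruence. rewrite e3.
  rewrite !cat_assoc by congruence. rewrite <- e2, e6, e1. reflexivity.
- destruct (vertical_split Hi w w' e) as [i1 [i2 [-> [H1 [H2 [e1 e2]]]]]].
  destruct (IHfim_sort1 i1 H1 e1) as [j1 [J1 [f1 [f2 f3]]]].
  destruct (IHfim_sort2 i2 H2 e2) as [j2 [J2 [g1 [g2 g3]]]].
  assert (e1' : lay (tgt i1) = w) by (rewrite vertical_lay; assumption).
  assert (e2' : lay (tgt i2) = w') by (rewrite vertical_lay; assumption).
  pose proof (lift_ar_sort H e1) as [a1 a2]. pose proof (lift_ar_sort H e1') as [b1 b2].
  pose proof (lift_ar_sort H0 e2) as [c1 c2]. pose proof (lift_ar_sort H0 e2') as [d1 d2].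
  exists (j1 ## j2). rewrite !mon_src, !mon_tgt.
  rewrite (lift_ar_ten _ _ H e1), (lift_ar_ten _ _ H e1'), !mon_tgt.
  split; [exact (vertical_ten J1 J2)|]. split; [congruence|]. split; [congruence|].
  rewrite <- !mon_comp by congruence. congruence.
- destruct (vertical_split Hi [a] [b] e) as [i1 [i2 [-> [H1 [H2 [e1 e2]]]]]].
  exists (i2 ## i1). rewrite !mon_src, !mon_tgt.
  rewrite !lift_ar_sym by (rewrite ?vertical_lay; assumption).
  rewrite !swap_tgt. split; [exact (vertical_ten H2 H1)|]. repeat apply conj; auto.
  apply swap_nat.
- exists (i ## i). rewrite !lift_ar_dup1, !diag_tgt, mon_src, mon_tgt.
  split; [exact (vertical_ten Hi Hi)|]. repeat apply conj; auto. apply diag_nat.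
(* Deletion discards the vertical arrow, so nothing is left to transport. *)
- exists (idn one). rewrite !lift_ar_del1, !bang_tgt, cat_src_id, cat_tgt_id.
  split; [exact vert_one|]. repeat apply conj; auto.
  rewrite bang_nat, cat_idr'; [reflexivity|apply bang_tgt].
- destruct (vertical_split Hi [a] [a] e) as [i1 [i2 [-> [H1 [H2 [e1 e2]]]]]].
  destruct (vertical_letter H1 e1) as [x [a1 [b1 [Hx ->]]]].
  destruct (vertical_letter H2 e2) as [y [a2 [b2 [Hy ->]]]].
  (* Two letters are merged into one, and their internal terms are joined by the internal tensor;
     the square is naturality of [m]. *)
  exists (scl (titen a x y)). rewrite !mon_src, !mon_tgt.
  rewrite !(scl_isrc Hx), !(scl_isrc Hy), !(scl_itgt Hx), !(scl_itgt Hy), !lift_ar_mul, !tmul_tgt.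
  split; [exact (vertical_iterm (it_ten Hx Hy))|].
  split; [exact (scl_isrc (it_ten Hx Hy))|]. split; [exact (scl_itgt (it_ten Hx Hy))|].
  pose proof (scl_tmeq (te_mul_nat E1 Hx Hy)) as n.
  rewrite (scl_comp (tm_ten (tm_int Hx) (tm_int Hy)) (tm_mul E0 b1 b2)) in n.
  rewrite (scl_comp (tm_mul E0 a1 a2) (tm_int (it_ten Hx Hy))) in n.
  rewrite (scl_ten (tm_int Hx) (tm_int Hy)) in n. exact n.
- apply (vertical_nil Hi) in e. subst i. exists (idn (slet T (iunit a))).
  rewrite !lift_ar_unt, cat_src_id, cat_tgt_id.
  split; [apply vertical_id|]. rewrite (scl_tgt (tm_unt E0 a) : _ = slet T (iunit a)).
  repeat apply conj; auto.
  rewrite cat_idl', cat_idr'; [reflexivity|exact (scl_tgt (tm_unt E0 a))|exact (scl_src (tm_unt E0 a))].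
Qed.

Definition has_factor h r : Prop :=
  exists i, vertical i /\ src i = tgt (lift_ar r (src h)) /\ tgt i = tgt h /\
    h = lift_ar r (src h) ;; i.

Lemma factor_lift h r : h = lift_ar r (src h) -> has_factor h r.
Proof.
intros e. exists (idn (tgt h)). rewrite cat_src_id, cat_tgt_id, <- e, cat_idr.
repeat apply conj; auto. apply vertical_id.
Qed.

Lemma iterm_lift x o (a b : ity L o) : iterm x a b ->
  lift_ar (tm_proj x) (slet T a) = idn (slet T a).
Proof.
intros H. pose proof (iterm_proj_sort H) as K.
rewrite <- (lift_ar_id1 o). refine (lift_ar_eq _ K _ (lay_slet T a)).
apply (fcl_inj K (fs_id X o)). rewrite fcl_id1. exact (pcl_iterm H).
Qed.

Lemma factor x U V : term x U V -> has_factor (scl x) (tm_proj x).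
Proof.
induction 1.
- exists (scl x). rewrite (scl_isrc H), (iterm_lift H), cat_tgt_id, cat_idl' by exact (scl_isrc H).
  split; [exact (vertical_iterm H)|auto].
- destruct IHterm1 as [i [Hi [a1 [a2 a3]]]], IHterm2 as [j [Hj [b1 [b2 b3]]]].
  rewrite (scl_src H) in a1, a3. rewrite (scl_src H0) in b1, b3.
  rewrite (scl_tgt H) in a2. rewrite (scl_tgt H0) in b2.
  pose proof (term_proj_sort H) as K. pose proof (term_proj_sort H0) as K0.
  destruct (lift_ar_sort K (lay_sty T T0)) as [c1 c2].
  destruct (lift_ar_sort K0 (lay_sty T S)) as [d1 d2].
  (* The vertical part of the first term is exchanged with the lifting of the second, so that the
     liftings become adjacent. *)
  destruct (vertical_lift K0 Hi) as [i' [Hi' [e1 [e2 e3]]]]; [congruence|].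
  assert (e4 : lay (src i) = ty_layers S) by congruence.
  destruct (lift_ar_sort K0 e4) as [f1 f2].
  exists (i' ;; j). unfold has_factor. rewrite (scl_src (tm_comp H H0)), (scl_tgt (tm_comp H H0)).
  rewrite a2 in e2, e3. simpl tm_proj. rewrite lift_ar_comp, <- a1.
  assert (e5 : tgt i' = src j) by congruence.
  split; [exact (vertical_comp Hi' Hj e5)|].
  rewrite !cat_src_comp, !cat_tgt_comp by congruence.
  split; [congruence|]. split; [congruence|].
  rewrite (scl_comp H H0), a3, b3 at 1. rewrite cat_assoc by (rewrite ?cat_src_comp; congruence).
  rewrite <- (cat_assoc i) by congruence. rewrite e3.
  rewrite !cat_assoc by (rewrite ?cat_src_comp, ?cat_tgt_comp; congruence). reflexivity.
- apply factor_lift. rewrite (scl_id T [] : scl teps = _), cat_src_id. reflexivity.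
- destruct IHterm1 as [i [Hi [a1 [a2 a3]]]], IHterm2 as [j [Hj [b1 [b2 b3]]]].
  exists (i ## j). rewrite (scl_ten H H0), !mon_src, !mon_tgt. simpl tm_proj.
  pose proof (term_proj_sort H) as K. pose proof (term_proj_sort H0) as K0.
  assert (e1 : lay (src (scl x)) = ty_layers T0) by (rewrite (scl_src H); apply lay_sty).
  rewrite (lift_ar_ten _ _ K e1), mon_tgt, <- mon_comp by congruence.
  split; [exact (vertical_ten Hi Hj)|]. repeat apply conj; congruence.
- apply factor_lift. rewrite (scl_src (tm_sym E0 A B)), <- sty_app. simpl tm_proj.
  rewrite lift_ar_sym by apply lay_sty. symmetry; apply swap_slet.
- apply factor_lift. rewrite (scl_src (tm_nab E0 _ f A)). simpl tm_proj.
  change (sty (sg A)) with (slet T A).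
  rewrite lift_ar_gen. change (pa_path (edge f)) with (pcons f (pnil t)). rewrite nabla_path_cons, nabla_slet, nabla_path_nil, cat_idr.
  reflexivity.
- apply factor_lift. rewrite (scl_src (tm_mul E0 A B)), <- sty_app. simpl tm_proj.
  symmetry; apply lift_ar_mul.
- apply factor_lift. reflexivity.
- apply factor_lift. rewrite (scl_src (tm_dup E0 A)). symmetry; apply diag_slet.
- apply factor_lift. rewrite (scl_src (tm_del E0 A)). symmetry; apply bang_slet.
- exact IHterm.
Qed.

Hypothesis Hproj : forall x y, E1 x y -> fim_eq (tm_proj x) (tm_proj y).
Local Notation p := (syn_proj T).
Local Notation s_ar := (@s_ar Y Bs).
Local Notation s_ob := (@s_ob Y Bs).

Lemma vertical_proj i : vertical i -> s_ar p i = @idn Bs (lay (src i)).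
Proof.
induction 1.
- rewrite (cat_src_id (C := Y)), <- (scl_id T [] : scl teps = @idn Y one).
  rewrite (syn_proj_scl Hproj (tm_eps E0)), lay_one. exact (pcl_id T []).
- rewrite mon_src, lay_ten, (scl_isrc H), lay_slet.
  destruct (scl_surj' h) as [y [U [V [Hy [e1 [e2 e3]]]]]].
  rewrite e1 in IHvertical |- *. rewrite <- (scl_ten (tm_int H) Hy).
  rewrite (syn_proj_scl Hproj (tm_ten (tm_int H) Hy)), (pcl_ten (tm_int H) Hy).
  rewrite (syn_proj_scl Hproj Hy) in IHvertical. rewrite IHvertical, (pcl_iterm H).
  apply (mon_id (C := Bs)).
Qed.

Lemma syn_proj_functor : @is_functor Y Bs p.
Proof.
split.
- intros f. destruct (scl_surj' f) as [x [U [V [H [e1 [e2 e3]]]]]].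
  rewrite e2, e1, (syn_proj_scl Hproj H), (pcl_src H). symmetry; apply lay_sty.
- intros f. destruct (scl_surj' f) as [x [U [V [H [e1 [e2 e3]]]]]].
  rewrite e3, e1, (syn_proj_scl Hproj H), (pcl_tgt H). symmetry; apply lay_sty.
- intros A. pose proof (vertical_proj (vertical_id A)) as e.
  rewrite (cat_src_id (C := Y)) in e. exact e.
- intros f g e. destruct (scl_surj' f) as [x [U [V [H [Ex [e1 e2]]]]]].
  destruct (sty_surj (tgt g)) as [W e3].
  destruct (scl_surj g (eq_trans (eq_sym e) e2) e3) as [y [H' Ey]].
  rewrite Ex, Ey. transitivity (s_ar p (scl (x ;t y))).
  + f_equal. symmetry; exact (scl_comp H H').
  + rewrite (syn_proj_scl Hproj (tm_comp H H')), (syn_proj_scl Hproj H), (syn_proj_scl Hproj H').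
    exact (pcl_comp H H').
Qed.

Lemma syn_proj_monoidal : @strict_monoidal_functor Y Bs p.
Proof.
split; [exact syn_proj_functor|exact (lay_one T)|exact (@lay_ten T)|].
intros f g. destruct (scl_surj' f) as [x [U [V [H [Ex _]]]]].
destruct (scl_surj' g) as [y [U' [V' [H' [Ey _]]]]].
rewrite Ex, Ey. transitivity (s_ar p (scl (x *t y))).
- f_equal. symmetry; exact (scl_ten H H').
- rewrite (syn_proj_scl Hproj (tm_ten H H')), (syn_proj_scl Hproj H), (syn_proj_scl Hproj H').
  exact (pcl_ten H H').
Qed.

(** The factorization of a representing term uses the lifting of its own projection; as liftings
    depend only on the class in the base, any representative [r] may take its place. *)
Lemma factor_proj h r : fim_sort r (lay (src h)) (lay (tgt h)) -> s_ar p h = fcl r ->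
  has_factor h r.
Proof.
intros Hr e. destruct (scl_surj' h) as [x [U [V [H [Ex [e1 e2]]]]]].
destruct (factor H) as [i [Hi [a1 [a2 a3]]]]. rewrite <- Ex in *.
pose proof (term_proj_sort H) as K.
assert (E : lift_ar (tm_proj x) (src h) = lift_ar r (src h)).
{ assert (e3 : lay (src h) = ty_layers U) by (rewrite e1; apply lay_sty).
  refine (lift_ar_eq _ K _ e3). apply (fcl_inj K Hr).
  rewrite <- e, Ex. symmetry; exact (syn_proj_scl Hproj H). }
exists i. rewrite <- E. auto.
Qed.

(** Since every arrow factors as a lifting followed by a vertical arrow, this is all
    that the liftings need in order to be opcartesian. *)
Definition lift_cancel : Prop := forall r v A i j, fim_sort r (lay A) v ->
  vertical i -> vertical j -> src i = tgt (lift_ar r A) -> src j = tgt (lift_ar r A) ->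
  lift_ar r A ;; i = lift_ar r A ;; j -> i = j.

Lemma lift_opcartesian : lift_cancel -> forall r v A, fim_sort r (lay A) v ->
  @opcartesian Y Bs p (lift_ar r A).
Proof.
intros cancel r v A Hr k g e1 e2 e3. pose proof syn_proj_functor as [F1 F2 F3 F4].
destruct (lift_ar_sort Hr eq_refl) as [a1 a2].
rewrite a1 in e1. rewrite (lift_ar_proj Hproj Hr) in e2, e3.
rewrite (fcl_tgt Hr) in e2.
destruct (fcl_surj g) as [r' [Hr' Eg]]. rewrite e2 in Hr'.
assert (ek : lay (tgt k) = tgt g).
{ change (s_ob p (tgt k) = tgt g). rewrite <- F2, e3.
  apply (cat_tgt_comp (C := Bs)). rewrite (fcl_tgt Hr). symmetry; exact e2. }
destruct (lift_ar_sort Hr' a2) as [b1 b2].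
(* With [r'] representing [g], the arrow [k] starts with the lifting of [r ;f r'], which itself
   starts with the lifting of [r]; the rest is the fill-in. *)
destruct (factor_proj k (r := r ;f r')) as [i [Hi [c1 [c2 c3]]]].
- rewrite e1, ek. exact (fs_comp Hr Hr').
- rewrite e3, Eg. symmetry; exact (fcl_comp Hr Hr').
- rewrite e1, lift_ar_comp in c1, c3.
  rewrite cat_tgt_comp in c1 by congruence.
  exists (lift_ar r' (tgt (lift_ar r A)) ;; i). split.
  + rewrite cat_src_comp, cat_tgt_comp by congruence.
    split; [exact b1|]. split; [exact c2|]. split.
    * rewrite F4 by congruence. rewrite (vertical_proj Hi).
      assert (Hr'' : fim_sort r' (lay (tgt (lift_ar r A))) (tgt g)) by (rewrite a2; exact Hr').
      rewrite (lift_ar_proj Hproj Hr''), c1, b2, Eg.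
      rewrite <- Eg. apply (cat_idr' (C := Bs)). reflexivity.
    * rewrite c3, cat_assoc by congruence. reflexivity.
  + intros l [d1 [d2 [d3 d4]]].
    (* A competing fill-in also lies over [g] and begins with the lifting of [r'], so it can differ
       only in its vertical part. *)
    destruct (factor_proj l (r := r')) as [j [Hj [f1 [f2 f3]]]].
    * rewrite d1, a2, d2, ek. exact Hr'.
    * rewrite d3; exact Eg.
    * rewrite d1 in f1, f3. rewrite f3. f_equal.
      (* Both vertical parts complete the lifting of [r ;f r'] to [k], and cancelling that lifting
         identifies them. *)
      apply (cancel (r ;f r') (tgt g) A i j (fs_comp Hr Hr') Hi Hj).
      -- rewrite lift_ar_comp, cat_tgt_comp by congruence. exact c1.
      -- rewrite lift_ar_comp, cat_tgt_comp by congruence. exact f1.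
      -- rewrite lift_ar_comp, <- c3, cat_assoc by congruence. congruence.
Qed.

Lemma coherent_of_cancel : lift_cancel -> coherent T.
Proof.
intros cancel. split; [exact Hproj|]. intros g A e.
destruct (fcl_surj g) as [r [Hr Eg]].
assert (Hr' : fim_sort r (lay A) (tgt g)) by exact (eq_ind_r (fun u => fim_sort r u _) Hr e).
rewrite Eg, (syn_lift_cl Hr'). exact (lift_opcartesian cancel A Hr').
Qed.
End Factorization.
Arguments scl_isrc {T o x a b}.
Arguments scl_itgt {T o x a b}.
Arguments syn_proj_functor {T} Hproj.
Arguments syn_proj_monoidal {T} Hproj.
Arguments factor_proj {T} Hproj h {r}.
Arguments vertical_proj {T} Hproj {i}.
Arguments vertical_split {T h}.
Arguments ten_src_inj {T A A' B B'}.
Arguments coherent_of_cancel {T}.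

(** * Theories with internal equations *)

Section InternalTheories.
Variable T : theory.
Hypothesis Hint : internal_equations T.
Local Notation L := (th_sig T).
Local Notation E0 := (th_E0 T).
Local Notation E1 := (th_E1 T).
Local Notation term := (term E0).
Local Notation iterm := (iterm E0).
Local Notation tmeq := (tmeq E0 E1).
Local Notation Y := (syn_mcat T).
Local Notation X := (free_cat L).
Local Notation ex A := (existT (ity L) _ A).
Local Notation scl := (scl T).
Local Notation sty := (sty T).
Local Notation slet := (slet T).
Local Notation lay := (lay (T := T)).
Local Notation lift_ar := (lift_ar (T := T)).
Implicit Types (x y : tm (th_sig T)) (U V W : ty (th_sig T)) (z h k i : ar (syn_mcat T))
  (r : fim_raw (free_cat (th_sig T)))
  (w v : list (ob (free_cat (th_sig T)))) (l : list (ar (syn_mcat T))).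

Lemma internal_proj x y : E1 x y -> fim_eq (tm_proj x) (tm_proj y).
Proof.
intros e. destruct (Hint _ _ e) as [o [A [B [H K]]]].
apply (fcl_inj (iterm_proj_sort H) (iterm_proj_sort K)).
exact (eq_trans (pcl_iterm H) (eq_sym (pcl_iterm K))).
Qed.

Definition app_ar o t (f : fgen L o t) z : ar Y :=
  the z (fun h => exists x (a b : ity L o), iterm x a b /\ z = scl x /\ h = scl (tapp f x)).
Definition iten_ar o z z' : ar Y :=
  the z (fun h => exists x y (a b c d : ity L o), iterm x a b /\ iterm y c d /\
    z = scl x /\ z' = scl y /\ h = scl (titen o x y)).
Arguments app_ar {o t} f z.

(** The congruence rules for [f[-]] and the internal tensor ask both sides to have the same internal
    sort, while equal terms are given with sorts of their own. *)
Lemma iterm_tmeq_sort x y o (a b c d : ity L o) : iterm x a b -> iterm y c d -> tmeq x y ->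
  iterm y a b.
Proof.
intros H K e. destruct (tmeq_sort (th_parallel T) e) as [U [V [H1 K1]]].
destruct (term_det (tm_int H) H1) as [e1 e2], (term_det (tm_int K) K1) as [e3 e4].
apply it_conv with (3 := K); apply teq_sg_ieq; tr.
Qed.

Lemma app_scl o t (f : fgen L o t) x (a b : ity L o) : iterm x a b ->
  app_ar f (scl x) = scl (tapp f x).
Proof.
intros H. apply the_eq; [exists x, a, b; auto|].
intros h [y [c [d [K [e ->]]]]]. apply (scl_inj (tm_int H) (tm_int K)) in e.
pose proof (iterm_tmeq_sort H K e) as K'.
symmetry. exact (scl_tmeq (te_app _ f H K' e)).
Qed.

Lemma iten_scl o x y (a b c d : ity L o) : iterm x a b -> iterm y c d ->
  iten_ar o (scl x) (scl y) = scl (titen o x y).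
Proof.
intros H H'. apply the_eq; [exists x, y, a, b, c, d; auto|].
intros h [x' [y' [a' [b' [c' [d' [K [K' [e [e' ->]]]]]]]]]].
apply (scl_inj (tm_int H) (tm_int K)) in e. apply (scl_inj (tm_int H') (tm_int K')) in e'.
symmetry. exact (scl_tmeq (te_iten H (iterm_tmeq_sort H K e) H' (iterm_tmeq_sort H' K' e') e e')).
Qed.

(** Generalized elements of an internal type are the classes of internal terms into
    it; [act x] is the action of [x] on lists of them. *)
Definition element (A : {o : layer L & ity L o}) z : Prop :=
  exists x (Z : ity L (projT1 A)), iterm x Z (projT2 A) /\ z = scl x.
Definition elements U l : Prop := Forall2 element U l.

(** On a well-sorted term this is the length of the source, which tells [act] where to cut a list
    for a tensor. *)
Fixpoint width x : nat :=
  match x with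
  | tid _ | tgen _ _ | tapp _ _ | titen _ _ _ | tnab _ _ | tdup _ | tdel _ => 1
  | y ;t _ => width y
  | y *t z => width y + width z
  | teps | tunt _ => 0
  | tsym _ _ | tmul _ _ => 2
  end.

(** The sources of the elements are left free: [tmul] tensors them and [tunt] supplies an identity
    of the unit. A generator [tsym] has two inputs, for which [rev] is the exchange. Values on lists
    of the wrong length carry no meaning. *)
Fixpoint act x l : list (ar Y) :=
  match x with
  | tid _ | tgen _ _ | tapp _ _ | titen _ _ _ => map (fun z => z ;; scl x) l
  | y ;t z => act z (act y l)
  | teps => l
  | y *t z => act y (firstn (width y) l) ++ act z (skipn (width y) l)
  | tsym _ _ => rev l
  | tnab f _ => map (app_ar f) l
  | @tmul _ o _ _ => match l with [z; z'] => [iten_ar o z z'] | _ => l end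
  | tunt o => [idn (slet (iunit o))]
  | tdup _ => l ++ l
  | tdel _ => []
  end.

Lemma element_conv A B z : sieq E0 A B -> element A z -> element B z.
Proof.
intros [o a b e] [x [Z [H ->]]]. exists x, Z. split; [|reflexivity].
exact (it_conv (ie_refl E0 Z) e H).
Qed.

Lemma elements_conv U V l : teq E0 U V -> elements U l -> elements V l.
Proof.
intros e; revert l; induction e as [|A B U V e _ IH]; intros l H; inversion H; subst.
- constructor.
- constructor; [exact (element_conv e H2)|]. apply IH; assumption.
Qed.

Lemma elements_1 A l : elements [A] l -> exists z, l = [z] /\ element A z.
Proof. intros H; inversion H; subst. inversion H4; subst. eauto. Qed.

Lemma elements_2 A B l : elements [A; B] l -> exists z z', l = [z; z'] /\ element A z /\ element B z'.
Proof.
intros H; inversion H; subst. destruct (elements_1 H4) as [z' [-> H']]. eauto 6.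
Qed.

Lemma elements_app U V l : elements (U ++ V) l ->
  exists l1 l2, l = l1 ++ l2 /\ elements U l1 /\ elements V l2.
Proof. intros H; apply Forall2_app_inv_l in H. destruct H as [l1 [l2 [? [? ?]]]]; eauto. Qed.

Lemma width_iterm x o (a b : ity L o) : iterm x a b -> width x = 1.
Proof. induction 1; simpl; auto. Qed.

Lemma width_term x U V : term x U V -> width x = length U.
Proof.
induction 1; simpl; try reflexivity; try assumption.
- exact (width_iterm H).
- rewrite length_app. congruence.
- rewrite IHterm. exact (Forall2_length H).
Qed.

Lemma act_ten x y U V l1 l2 : term x U V -> elements U l1 ->
  act (x *t y) (l1 ++ l2) = act x l1 ++ act y l2.
Proof.
intros H Hl. simpl. rewrite (width_term H), (Forall2_length Hl).
rewrite firstn_app, skipn_app, PeanoNat.Nat.sub_diag, firstn_all, skipn_all, app_nil_r.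
reflexivity.
Qed.

Lemma act_comp x y l : act (x ;t y) l = act y (act x l).
Proof. reflexivity. Qed.

(** An internal composite acts in two stages, and associativity merges them into composition with a
    single arrow. Thus the action of an internal term depends only on its class. *)
Lemma act_iterm x o (a b : ity L o) : iterm x a b -> forall z, element (ex a) z ->
  act x [z] = [z ;; scl x] /\ element (ex b) (z ;; scl x).
Proof.
assert (K : forall x o (a b : ity L o) z, iterm x a b -> element (ex a) z ->
  element (ex b) (z ;; scl x)).
{ intros y o' c d z' H [y' [Z [Hy ->]]]. exists (y' ;t y), Z.
  split; [exact (it_comp Hy H)|]. symmetry; exact (scl_comp (tm_int Hy) (tm_int H)). }
intros H. induction H; intros z Hz.
- split; [reflexivity|]. exact (K _ _ _ _ _ (it_id E0 A) Hz).
- split; [reflexivity|]. exact (K _ _ _ _ _ (it_gen E0 o a b s) Hz).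
- split; [reflexivity|]. exact (K _ _ _ _ _ (it_app _ f H) Hz).
- split; [reflexivity|]. exact (K _ _ _ _ _ (it_ten H H0) Hz).
- split; [|exact (K _ _ _ _ _ (it_comp H H0) Hz)].
  rewrite act_comp. destruct (IHiterm1 z Hz) as [-> H1]. destruct (IHiterm2 _ H1) as [-> H2].
  rewrite (scl_comp (tm_int H) (tm_int H0)). f_equal.
  destruct Hz as [y' [Z [Hy ->]]]. apply cat_assoc.
  + rewrite (scl_itgt Hy), (scl_isrc H). reflexivity.
  + rewrite (scl_itgt H), (scl_isrc H0). reflexivity.
- assert (H3 : element (ex A) z) by exact (element_conv (sieq_intro (ie_sym H)) Hz).
  destruct (IHiterm z H3) as [-> H4]. split; [reflexivity|].
  exact (element_conv (sieq_intro H0) H4).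
Qed.

Lemma act_elements x U V : term x U V -> forall l, elements U l -> elements V (act x l).
Proof.
induction 1; intros l Hl.
- destruct (elements_1 Hl) as [z [-> Hz]]. destruct (act_iterm H Hz) as [-> K].
  constructor; [exact K|constructor].
- exact (IHterm2 _ (IHterm1 _ Hl)).
- exact Hl.
- destruct (elements_app _ _ Hl) as [l1 [l2 [-> [H1 H2]]]].
  rewrite (act_ten _ _ H H1).
  exact (Forall2_app (IHterm1 _ H1) (IHterm2 _ H2)).
- destruct (elements_2 Hl) as [z [z' [-> [H1 H2]]]]. simpl.
  constructor; [assumption|constructor; [assumption|constructor]].
- destruct (elements_1 Hl) as [z [-> [x [Z [H ->]]]]]. simpl. constructor; [|constructor].
  rewrite (app_scl _ f H). exists (tapp f x), (iapp f Z). split; [exact (it_app _ f H)|reflexivity].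
- destruct (elements_2 Hl) as [z [z' [-> [[x [Z [H ->]]] [y [Z' [H' ->]]]]]]]. simpl.
  constructor; [|constructor]. simpl in *. rewrite (iten_scl H H').
  exists (titen o x y), (iten Z Z'). split; [exact (it_ten H H')|reflexivity].
- simpl. constructor; [|constructor]. exists (tid (iunit o)), (iunit o).
  split; [apply it_id|]. symmetry; apply scl_id1.
- exact (Forall2_app Hl Hl).
- constructor.
- apply (elements_conv H0), IHterm. apply (elements_conv (symmetry H)), Hl.
Qed.

Lemma act_id1 o (a : ity L o) l : elements (sg a) l -> act (tid a) l = l.
Proof.
intros Hl. destruct (elements_1 Hl) as [z [-> [x [Z [H ->]]]]].
transitivity [scl x ;; scl (tid a)]; [reflexivity|].
rewrite scl_id1, cat_idr'; [reflexivity|exact (scl_itgt H)].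
Qed.

Lemma act_id U : forall l, elements U l -> act (tid_l U) l = l.
Proof.
induction U as [|[o a] U IH]; intros l Hl; [reflexivity|].
destruct (elements_app (sg a) U Hl) as [l1 [l2 [-> [H1 H2]]]]. simpl tid_l.
rewrite (act_ten _ l2 (tm_id E0 a) H1), act_id1, IH by assumption. reflexivity.
Qed.

Lemma act_sym1 A U : forall z l, element A z -> elements U l -> act (tsym1_l A U) (z :: l) = l ++ [z].
Proof.
destruct A as [o a]. induction U as [|[t b] U IH]; intros z l Hz Hl.
- inversion Hl; subst. apply act_id1. constructor; [assumption|constructor].
- destruct (elements_app (sg b) U Hl) as [l1 [l2 [-> [H1 H2]]]].
  destruct (elements_1 H1) as [z' [-> Hz']].
  simpl tsym1_l.
  assert (E : act ((tsym a b *t tid_l U) ;t (tid b *t tsym1_l (ex a) U)) ([z; z'] ++ l2) =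
    act (tid b *t tsym1_l (ex a) U) (act (tsym a b *t tid_l U) ([z; z'] ++ l2))) by reflexivity.
  refine (eq_trans E _).
  rewrite (act_ten (tid_l U) l2 (tm_sym E0 a b)) by (constructor; [assumption|constructor; [assumption|constructor]]).
  rewrite act_id by assumption. simpl (act (tsym a b) [z; z']).
  change ([z'; z] ++ l2) with ([z'] ++ (z :: l2)).
  rewrite (act_ten _ (z :: l2) (tm_id E0 b) H1), act_id1, IH by assumption. reflexivity.
Qed.

Lemma act_sym U V : forall l l', elements U l -> elements V l' ->
  act (tsym_l U V) (l ++ l') = l' ++ l.
Proof.
induction U as [|[o a] U IH]; intros l l' Hl Hl'.
- inversion Hl; subst. simpl. rewrite app_nil_r. apply act_id, Hl'.
- destruct (elements_app (sg a) U Hl) as [l1 [l2 [-> [H1 H2]]]].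
  destruct (elements_1 H1) as [z [-> Hz]]. simpl tsym_l.
  assert (E : forall x y l, act (x ;t y) l = act y (act x l)) by reflexivity.
  rewrite E, <- app_assoc, (act_ten _ (l2 ++ l') (tm_id E0 a) H1), act_id1, IH by assumption.
  rewrite app_assoc. rewrite (act_ten _ l2 (tsym1_l_sort E0 (ex a) V)) by (constructor; assumption).
  simpl ([z] ++ l'). rewrite act_sym1, act_id by assumption. rewrite <- app_assoc. reflexivity.
Qed.

Lemma act_dup U : forall l, elements U l -> act (tdup_l U) l = l ++ l.
Proof.
induction U as [|[o a] U IH]; intros l Hl.
- inversion Hl; subst. reflexivity.
- destruct (elements_app (sg a) U Hl) as [l1 [l2 [-> [H1 H2]]]].
  destruct (elements_1 H1) as [z [-> Hz]]. simpl tdup_l.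
  assert (E : forall x y l, act (x ;t y) l = act y (act x l)) by reflexivity.
  rewrite E, (act_ten _ l2 (tm_dup E0 a) H1), IH by assumption.
  transitivity (act (tid a *t tsym1_l (ex a) U *t tid_l U) ([z] ++ (z :: l2) ++ l2)); [reflexivity|].
  rewrite (act_ten _ _ (tm_id E0 a) H1), act_id1 by assumption.
  rewrite (act_ten _ l2 (tsym1_l_sort E0 (ex a) U)) by (constructor; assumption).
  rewrite act_sym1, act_id by assumption. rewrite <- !app_assoc. reflexivity.
Qed.

Lemma act_del U : forall l, elements U l -> act (tdel_l U) l = [].
Proof.
induction U as [|[o a] U IH]; intros l Hl.
- inversion Hl; subst. reflexivity.
- destruct (elements_app (sg a) U Hl) as [l1 [l2 [-> [H1 H2]]]]. simpl tdel_l.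
  rewrite (act_ten _ l2 (tm_del E0 a) H1), IH by assumption. reflexivity.
Qed.

Lemma act_internal x y o (a b : ity L o) : iterm x a b -> iterm y a b -> scl x = scl y ->
  forall l, elements (sg a) l -> act x l = act y l.
Proof.
intros H K e l Hl. destruct (elements_1 Hl) as [z [-> Hz]].
destruct (act_iterm H Hz) as [-> _], (act_iterm K Hz) as [-> _]. rewrite e. reflexivity.
Qed.

(** Equations between internal terms act by composition with equal arrows; cartesian ones become
    identities of lists. Associativity and units of [m] become the laws of the internal tensor, its
    naturality becomes interchange, and the laws of [nabla] become functoriality and monoidality of
    [f[-]]. *)
Lemma act_tmeq_typed x y : tmeq x y -> forall U V, term x U V -> forall l, elements U l ->
  act x l = act y l.
Proof.
assert (int : forall x y o (a b : ity L o), iterm x a b -> iterm y a b -> tmeq x y ->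
  forall U V, term x U V -> forall l, elements U l -> act x l = act y l).
{ intros x' y' o a b H K e U V Hx l Hl. destruct (term_det Hx (tm_int H)) as [e1 _].
  exact (act_internal H K (scl_tmeq e) (elements_conv e1 Hl)). }
intros e; induction e; intros U0 V0 Hs l Hl.
- reflexivity.
- destruct (tmeq_sort (th_parallel T) e) as [U [V [H K]]].
  destruct (term_det Hs K) as [e1 _]. symmetry.
  exact (IHe _ _ H l (elements_conv e1 Hl)).
- destruct (tmeq_sort (th_parallel T) e1) as [U [V [H K]]].
  destruct (term_det Hs H) as [e3 _].
  rewrite (IHe1 _ _ Hs l Hl). exact (IHe2 _ _ K l (elements_conv e3 Hl)).
- destruct (term_det Hs (tm_comp H H0)) as [e3 _]. apply (elements_conv e3) in Hl.
  rewrite !act_comp, <- (IHe1 _ _ H l Hl). exact (IHe2 _ _ H0 _ (act_elements H Hl)).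
- destruct (tmeq_sort (th_parallel T) e1) as [U1 [V1 [H1 K1]]].
  destruct (tmeq_sort (th_parallel T) e2) as [U2 [V2 [H2 K2]]].
  destruct (term_det Hs (tm_ten H1 H2)) as [e3 _]. apply (elements_conv e3) in Hl.
  destruct (elements_app _ _ Hl) as [l1 [l2 [-> [Hl1 Hl2]]]].
  rewrite (act_ten _ l2 H1 Hl1), (act_ten _ l2 K1 Hl1), (IHe1 _ _ H1 l1 Hl1), (IHe2 _ _ H2 l2 Hl2).
  reflexivity.
- exact (int _ _ _ _ _ (it_app _ f H) (it_app _ f H0) (te_app _ f H H0 e) _ _ Hs l Hl).
- exact (int _ _ _ _ _ (it_ten H H1) (it_ten H0 H2) (te_iten H H0 H1 H2 e1 e2) _ _ Hs l Hl).
(* The case that rests on internality of the 1-equations: the two sides then act by composition with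
   the same arrow. *)
- destruct (Hint _ _ H) as [o [a [b [Hx Hy]]]].
  exact (int _ _ _ _ _ Hx Hy (te_E1 _ _ _ _ H) _ _ Hs l Hl).
- reflexivity.
- destruct (term_det Hs (tm_comp (tid_l_sort E0 T0) H)) as [e3 _]. apply (elements_conv e3) in Hl.
  rewrite act_comp, act_id by assumption. reflexivity.
- destruct (term_det Hs (tm_comp H (tid_l_sort E0 S))) as [e3 _]. apply (elements_conv e3) in Hl.
  rewrite act_comp. apply act_id, (act_elements H Hl).
- destruct (term_det Hs (tm_ten (tm_ten H H0) H1)) as [e3 _]. apply (elements_conv e3) in Hl.
  destruct (elements_app _ _ Hl) as [l' [l3 [-> [Hl' Hl3]]]].
  destruct (elements_app _ _ Hl') as [l1 [l2 [-> [Hl1 Hl2]]]].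
  rewrite (act_ten _ l3 (tm_ten H H0) Hl'), (act_ten _ l2 H Hl1), <- !app_assoc.
  rewrite (act_ten _ _ H Hl1), (act_ten _ l3 H0 Hl2). reflexivity.
- reflexivity.
- destruct (term_det Hs (tm_ten H (tm_eps E0))) as [e3 _]. apply (elements_conv e3) in Hl.
  destruct (elements_app _ _ Hl) as [l1 [l2 [-> [Hl1 Hl2]]]].
  rewrite (act_ten _ l2 H Hl1). inversion Hl2; subst. simpl. rewrite !app_nil_r. reflexivity.
- destruct (term_det Hs (tm_ten (tm_comp H H0) (tm_comp H1 H2))) as [e3 _]. apply (elements_conv e3) in Hl.
  destruct (elements_app _ _ Hl) as [l1 [l2 [-> [Hl1 Hl2]]]].
  rewrite (act_ten _ l2 (tm_comp H H0) Hl1), !act_comp, (act_ten _ l2 H Hl1).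
  rewrite (act_ten _ _ H0 (act_elements H Hl1)). reflexivity.
- exact (int _ _ _ _ _ (it_ten (it_ten H H0) H1) (iterm_conv' (it_ten H (it_ten H0 H1))
    (ie_sym (ie_assoc E0 _ _ _)) (ie_sym (ie_assoc E0 _ _ _))) (te_iassoc E1 H H0 H1) _ _ Hs l Hl).
- exact (int _ _ _ _ _ (it_ten (it_id E0 (iunit o)) H) (iterm_conv' H
    (ie_sym (ie_unitl E0 _)) (ie_sym (ie_unitl E0 _))) (te_iunitl E1 H) _ _ Hs l Hl).
- exact (int _ _ _ _ _ (it_ten H (it_id E0 (iunit o))) (iterm_conv' H
    (ie_sym (ie_unitr E0 _)) (ie_sym (ie_unitr E0 _))) (te_iunitr E1 H) _ _ Hs l Hl).
- exact (int _ _ _ _ _ (it_ten (it_comp H H0) (it_comp H1 H2))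
    (it_comp (it_ten H H1) (it_ten H0 H2)) (te_iinterchange E1 H H0 H1 H2) _ _ Hs l Hl).
- exact (int _ _ _ _ _ (it_id E0 (iten A B)) (it_ten (it_id E0 A) (it_id E0 B))
    (te_id_ten E0 E1 A B) _ _ Hs l Hl).
- exact (int _ _ _ _ _ (it_app _ f (it_id E0 A)) (it_id E0 (iapp f A)) (te_app_id E0 E1 _ f A)
    _ _ Hs l Hl).
- exact (int _ _ _ _ _ (it_app _ f (it_comp H H0)) (it_comp (it_app _ f H) (it_app _ f H0))
    (te_app_comp E1 _ f H H0) _ _ Hs l Hl).
- exact (int _ _ _ _ _ (it_app _ f (it_ten H H0)) (iterm_conv' (it_ten (it_app _ f H) (it_app _ f H0))
    (ie_sym (ie_app_ten E0 _ f _ _)) (ie_sym (ie_app_ten E0 _ f _ _))) (te_app_ten E1 _ f H H0)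
    _ _ Hs l Hl).
- exact (int _ _ _ _ _ (it_app _ f (it_id E0 (iunit o))) (iterm_conv' (it_id E0 (iunit t))
    (ie_sym (ie_app_unit E0 _ _ f)) (ie_sym (ie_app_unit E0 _ _ f))) (te_app_unit E0 E1 _ _ f) _ _ Hs l Hl).
- destruct (term_det Hs (tm_comp (tsym_l_sort E0 T0 S) (tsym_l_sort E0 S T0))) as [e3 _].
  apply (elements_conv e3) in Hl.
  rewrite act_comp, (act_id Hl).
  destruct (elements_app _ _ Hl) as [l1 [l2 [-> [Hl1 Hl2]]]].
  rewrite !act_sym by assumption. reflexivity.
- destruct (term_det Hs (tm_comp (tm_ten H H0) (tsym_l_sort E0 S S'))) as [e3 _].
  apply (elements_conv e3) in Hl.
  destruct (elements_app _ _ Hl) as [l1 [l2 [-> [Hl1 Hl2]]]].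
  rewrite !act_comp, (act_ten _ l2 H Hl1), (act_sym Hl1 Hl2).
  rewrite (act_sym (act_elements H Hl1) (act_elements H0 Hl2)), (act_ten _ l1 H0 Hl2). reflexivity.
- destruct (term_det Hs (tm_comp (tm_dup E0 A) (tm_ten (tm_dup E0 A) (tm_id E0 A)))) as [e3 _].
  apply (elements_conv e3) in Hl. rewrite !act_comp. simpl (act (tdup A) l).
  rewrite (act_ten _ l (tm_dup E0 A) Hl), (act_ten _ l (tm_id E0 A) Hl), act_id1 by exact Hl.
  simpl. rewrite app_assoc. reflexivity.
- destruct (term_det Hs (tm_comp (tm_dup E0 A) (tm_ten (tm_del E0 A) (tm_id E0 A)))) as [e3 _].
  apply (elements_conv e3) in Hl. rewrite act_comp. simpl (act (tdup A) l).
  rewrite (act_ten _ l (tm_del E0 A) Hl). reflexivity.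
- destruct (term_det Hs (tm_comp (tm_dup E0 A) (tm_ten (tm_id E0 A) (tm_del E0 A)))) as [e3 _].
  apply (elements_conv e3) in Hl. rewrite act_comp. simpl (act (tdup A) l).
  rewrite (act_ten _ l (tm_id E0 A) Hl). simpl (act (tdel A) l). apply app_nil_r.
- destruct (term_det Hs (tm_comp H (tdup_l_sort E0 S))) as [e3 _]. apply (elements_conv e3) in Hl.
  rewrite !act_comp, (act_dup Hl), (act_dup (act_elements H Hl)), (act_ten _ l H Hl). reflexivity.
- destruct (term_det Hs (tm_comp H (tdel_l_sort E0 S))) as [e3 _]. apply (elements_conv e3) in Hl.
  rewrite !act_comp, (act_del Hl), (act_del (act_elements H Hl)). reflexivity.
- destruct (term_det Hs (tm_comp (tm_ten (tm_mul E0 A B) (tm_id E0 C)) (tm_mul E0 (iten A B) C))) as [e3 _].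
  apply (elements_conv e3) in Hl.
  destruct (elements_app (sg A ++ sg B) (sg C) Hl) as [l' [l3 [-> [Hl' Hl3]]]].
  destruct (elements_app (sg A) (sg B) Hl') as [l1 [l2 [-> [Hl1 Hl2]]]].
  rewrite !act_comp, (act_ten _ l3 (tm_mul E0 A B) Hl'), <- app_assoc.
  rewrite (act_ten _ (l2 ++ l3) (tm_id E0 A) Hl1), !act_id1 by assumption.
  destruct (elements_1 Hl1) as [z1 [-> [x1 [Z1 [H1 ->]]]]].
  destruct (elements_1 Hl2) as [z2 [-> [x2 [Z2 [H2 ->]]]]].
  destruct (elements_1 Hl3) as [z3 [-> [x3 [Z3 [H3 ->]]]]].
  simpl in H1, H2, H3.
  transitivity [iten_ar o (iten_ar o (scl x1) (scl x2)) (scl x3)]; [reflexivity|].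
  transitivity [iten_ar o (scl x1) (iten_ar o (scl x2) (scl x3))]; [|reflexivity].
  rewrite (iten_scl H1 H2), (iten_scl H2 H3).
  rewrite (iten_scl (it_ten H1 H2) H3), (iten_scl H1 (it_ten H2 H3)).
  f_equal. exact (scl_tmeq (te_iassoc E1 H1 H2 H3)).
- destruct (term_det Hs (tm_comp (tm_ten (tm_unt E0 o) (tm_id E0 A)) (tm_mul E0 (iunit o) A))) as [e3 _].
  apply (elements_conv e3) in Hl. rewrite act_comp, act_id1 by exact Hl.
  change l with ([] ++ l) at 1. rewrite (act_ten _ l (tm_unt E0 o)) by constructor.
  rewrite act_id1 by exact Hl.
  destruct (elements_1 Hl) as [z1 [-> [x1 [Z1 [H1 ->]]]]]. simpl in H1.
  transitivity [iten_ar o (idn (slet (iunit o))) (scl x1)]; [reflexivity|].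
  rewrite <- scl_id1, (iten_scl (it_id E0 (iunit o)) H1).
  f_equal. exact (scl_tmeq (te_iunitl E1 H1)).
- destruct (term_det Hs (tm_comp (tm_ten (tm_id E0 A) (tm_unt E0 o)) (tm_mul E0 A (iunit o)))) as [e3 _].
  apply (elements_conv e3) in Hl. rewrite act_comp, act_id1 by exact Hl.
  rewrite <- (app_nil_r l) at 1. rewrite (act_ten _ [] (tm_id E0 A) Hl), act_id1 by exact Hl.
  destruct (elements_1 Hl) as [z1 [-> [x1 [Z1 [H1 ->]]]]]. simpl in H1.
  transitivity [iten_ar o (scl x1) (idn (slet (iunit o)))]; [reflexivity|].
  rewrite <- scl_id1, (iten_scl H1 (it_id E0 (iunit o))).
  f_equal. exact (scl_tmeq (te_iunitr E1 H1)).
- destruct (term_det Hs (tm_comp (tm_ten (tm_int H) (tm_int H0)) (tm_mul E0 B D))) as [e3 _].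
  apply (elements_conv e3) in Hl.
  destruct (elements_app (sg A) (sg C) Hl) as [l1 [l2 [-> [Hl1 Hl2]]]].
  rewrite !act_comp, (act_ten _ l2 (tm_int H) Hl1).
  destruct (elements_1 Hl1) as [z1 [-> Hz1]]. destruct (elements_1 Hl2) as [z2 [-> Hz2]].
  destruct (act_iterm H Hz1) as [-> _], (act_iterm H0 Hz2) as [-> _].
  destruct Hz1 as [x1 [Z1 [H1 ->]]], Hz2 as [x2 [Z2 [H2 ->]]]. simpl in H1, H2.
  transitivity [iten_ar o (scl x1 ;; scl x) (scl x2 ;; scl y)]; [reflexivity|].
  transitivity [iten_ar o (scl x1) (scl x2) ;; scl (titen o x y)]; [|reflexivity].
  rewrite <- (scl_comp (tm_int H1) (tm_int H)), <- (scl_comp (tm_int H2) (tm_int H0)).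
  rewrite (iten_scl (it_comp H1 H) (it_comp H2 H0)), (iten_scl H1 H2).
  rewrite (scl_tmeq (te_iinterchange E1 H1 H H2 H0)). f_equal.
  exact (scl_comp (tm_int (it_ten H1 H2)) (tm_int (it_ten H H0))).
- destruct (term_det Hs (tm_comp (tm_int H) (tm_nab E0 _ f B))) as [e3 _].
  apply (elements_conv e3) in Hl. rewrite !act_comp.
  destruct (elements_1 Hl) as [z1 [-> Hz1]]. destruct (act_iterm H Hz1) as [-> _].
  destruct Hz1 as [x1 [Z1 [H1 ->]]]. simpl in H1.
  transitivity [app_ar f (scl x1 ;; scl x)]; [reflexivity|].
  transitivity [app_ar f (scl x1) ;; scl (tapp f x)]; [|reflexivity].
  rewrite <- (scl_comp (tm_int H1) (tm_int H)), (app_scl _ f (it_comp H1 H)), (app_scl _ f H1).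
  rewrite (scl_tmeq (te_app_comp E1 _ f H1 H)). f_equal.
  exact (scl_comp (tm_int (it_app _ f H1)) (tm_int (it_app _ f H))).
- destruct (term_det Hs (tm_comp (tm_mul E0 A B) (tm_nab E0 _ f (iten A B)))) as [e3 _].
  apply (elements_conv e3) in Hl.
  destruct (elements_app (sg A) (sg B) Hl) as [l1 [l2 [-> [Hl1 Hl2]]]].
  rewrite !act_comp, (act_ten _ l2 (tm_nab E0 _ f A) Hl1).
  destruct (elements_1 Hl1) as [z1 [-> [x1 [Z1 [H1 ->]]]]].
  destruct (elements_1 Hl2) as [z2 [-> [x2 [Z2 [H2 ->]]]]]. simpl in H1, H2.
  transitivity [app_ar f (iten_ar o (scl x1) (scl x2))]; [reflexivity|].
  transitivity [iten_ar t (app_ar f (scl x1)) (app_ar f (scl x2))]; [|reflexivity].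
  rewrite (iten_scl H1 H2), (app_scl _ f H1), (app_scl _ f H2), (app_scl _ f (it_ten H1 H2)).
  rewrite (iten_scl (it_app _ f H1) (it_app _ f H2)). f_equal.
  exact (scl_tmeq (te_app_ten E1 _ f H1 H2)).
- destruct (term_det Hs (tm_comp (tm_unt E0 o) (tm_nab E0 _ f (iunit o)))) as [e3 _].
  apply (elements_conv e3) in Hl. inversion Hl; subst.
  transitivity [app_ar f (idn (slet (iunit o)))]; [reflexivity|].
  transitivity [idn (slet (iunit t))]; [|reflexivity].
  rewrite <- !scl_id1, (app_scl _ f (it_id E0 (iunit o))). f_equal.
  exact (scl_tmeq (te_app_unit E0 E1 _ _ f)).
Qed.

Definition ids U : list (ar Y) := map (fun A => idn (slet (projT2 A))) U.

Lemma ids_elements U : elements U (ids U).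
Proof.
induction U as [|[o a] U IH]; constructor; [|exact IH].
exists (tid a), a. split; [apply it_id|]. symmetry; apply scl_id1.
Qed.

Lemma ids_app U V : ids (U ++ V) = ids U ++ ids V.
Proof. apply map_app. Qed.

Lemma act_path_lift o t (p : path L o t) a b x : path_lift p a b x ->
  act x (ids (sg a)) = ids (sg b).
Proof.
induction 1.
- apply act_id1, ids_elements.
- rewrite act_comp, <- IHpath_lift. f_equal.
  transitivity [app_ar f (idn (slet A))]; [reflexivity|].
  transitivity [idn (slet (iapp f A))]; [|reflexivity].
  rewrite <- !scl_id1, (app_scl _ f (it_id E0 A)). f_equal. exact (scl_tmeq (te_app_id E0 E1 _ f A)).
Qed.

(** A lifting has no internal part, so it moves identities around; [f[id] = id] and the
    decomposition of [id] on a tensor cover [nabla] and [m]. *)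
Lemma act_lift r U V x : is_lift r U V x -> act x (ids U) = ids V.
Proof.
induction 1.
- exact (act_path_lift H).
- apply act_id1, ids_elements.
- reflexivity.
- rewrite act_comp, IHis_lift1. exact IHis_lift2.
- destruct (is_lift_term H) as [K _].
  rewrite !ids_app, (act_ten _ _ K (ids_elements U)), IHis_lift1, IHis_lift2. reflexivity.
- reflexivity.
- reflexivity.
- reflexivity.
- transitivity [iten_ar o (idn (slet A)) (idn (slet B))]; [reflexivity|].
  transitivity [idn (slet (iten A B))]; [|reflexivity].
  rewrite <- !scl_id1, (iten_scl (it_id E0 A) (it_id E0 B)). f_equal.
  symmetry; exact (scl_tmeq (te_id_ten E0 E1 A B)).
- reflexivity.
Qed.

Definition big_ten l : ar Y := fold_right (fun z h => z ## h) (idn one) l.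

(** Acting on identities returns the internal terms that make up a vertical arrow, and tensoring
    them rebuilds it. A term realizing [i] is produced with source exactly [V], since [act] is
    defined on raw terms. *)
Lemma vertical_act i : vertical i -> forall V, src i = sty V ->
  exists x V', term x V V' /\ scl x = i /\ i = big_ten (act x (ids V)).
Proof.
induction 1; intros V e.
- rewrite cat_src_id in e. change (@one Y) with (sty []) in e. apply sty_inj in e.
  inversion e; subst. exists teps, []. repeat apply conj; [apply tm_eps|apply (scl_id T [])|reflexivity].
- rewrite mon_src, (scl_isrc H) in e.
  destruct (sty_surj (src h)) as [W eW].
  rewrite eW, <- sty_cons in e. apply sty_inj in e.
  destruct V as [|[t c] V1]; [inversion e|]. apply Forall2_cons_iff in e. destruct e as [H2 H3].
  destruct (IHvertical V1) as [y [V' [K [e1 e2]]]]; [rewrite eW; apply sty_eq; assumption|].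
  destruct (sieq_inv H2) as [et _]. simpl in et. subst t. apply sieq_inj in H2.
  pose proof (it_conv H2 (ie_refl E0 b) H) as H'.
  exists (x *t y), (sg b ++ V'). split; [exact (tm_ten (tm_int H') K)|].
  rewrite (scl_ten (tm_int H') K), e1. split; [reflexivity|].
  transitivity (big_ten (act (x *t y) (ids (sg c) ++ ids V1))); [|reflexivity].
  rewrite (act_ten _ _ (tm_int H') (ids_elements (sg c))).
  assert (Hz : element (ex c) (idn (slet c))).
  { exists (tid c), c. split; [apply it_id|]. symmetry; apply scl_id1. }
  destruct (act_iterm H' Hz) as [E _].
  change (ids (sg c)) with [@idn Y (slet c)]. rewrite E.
  rewrite cat_idl' by exact (scl_isrc H').
  transitivity (scl x ## big_ten (act y (ids V1))); [|reflexivity]. rewrite <- e2. reflexivity.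
Qed.

Lemma internal_cancel : lift_cancel T.
Proof.
intros r v A i j Hr Hi Hj e1 e2 e.
destruct (sty_surj A) as [U ->]. rewrite lay_sty in Hr.
destruct (is_lift_ex Hr U eq_refl) as [V [x [Hx eV]]].
destruct (is_lift_term Hx) as [K1 [K2 K3]]. rewrite <- K3, (scl_tgt K1) in e1, e2.
destruct (vertical_act Hi e1) as [y [V1 [Hy [<- ey]]]].
destruct (vertical_act Hj e2) as [z [V2 [Hz [<- ez]]]].
rewrite ey, ez. f_equal.
rewrite <- (act_lift Hx), <- !act_comp.
(* At the identities of [U] the lifting yields the identities of [V], so the equal composites
   compare [y] and [z] there, that is, they compare the two vertical arrows. *)
apply (fun q => act_tmeq_typed q (tm_comp K1 Hy) (ids_elements U)).
apply (scl_inj (tm_comp K1 Hy) (tm_comp K1 Hz)).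
rewrite (scl_comp K1 Hy), (scl_comp K1 Hz), K3. exact e.
Qed.

Lemma internal_coherent : coherent T.
Proof. exact (coherent_of_cancel internal_proj internal_cancel). Qed.
End InternalTheories.

(** * Split im-opfibrations *)

Section Opcartesian.
Variables (Y B : cat) (HY : is_cat Y) (HB : is_cat B) (p : sfun Y B) (Hp : is_functor p).

Record vertical_iso (u : ar Y) : Prop := {
  vi_proj : s_ar p u = idn (s_ob p (src u));
  vi_inv : exists u', src u' = tgt u /\ tgt u' = src u /\
    u ;; u' = idn (src u) /\ u' ;; u = idn (tgt u) }.

Lemma proj_src (h : ar Y) x : s_ar p h = idn x -> s_ob p (src h) = x.
Proof. intros e. rewrite <- (fun_src Hp), e. apply cat_src_id. Qed.
Lemma proj_tgt (h : ar Y) x : s_ar p h = idn x -> s_ob p (tgt h) = x.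
Proof. intros e. rewrite <- (fun_tgt Hp), e. apply cat_tgt_id. Qed.

Lemma opcartesian_uniq (h k l : ar Y) : opcartesian p h ->
  src k = tgt h -> src l = tgt h -> tgt k = tgt l -> s_ar p k = s_ar p l ->
  h ;; k = h ;; l -> k = l.
Proof.
intros H e1 e2 e3 e4 e5.
destruct (H (h ;; l) (s_ar p l)) as [m [_ U]].
- apply cat_src_comp; congruence.
- rewrite (fun_src Hp), (fun_tgt Hp), e2. reflexivity.
- apply (fun_comp Hp); congruence.
- rewrite <- (U k), <- (U l); repeat apply conj; auto; rewrite ?cat_tgt_comp; congruence.
Qed.

Lemma opcartesian_iso (h u : ar Y) : opcartesian p h -> vertical_iso u -> tgt h = src u ->
  opcartesian p (h ;; u).
Proof.
intros H [Hu [u' [a1 [a2 [a3 a4]]]]] e k g e1 e2 e3.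
assert (p1 : tgt (s_ar p h) = s_ob p (src u)) by (rewrite (fun_tgt Hp), e; reflexivity).
assert (ph : s_ar p (h ;; u) = s_ar p h).
{ rewrite (fun_comp Hp) by assumption. rewrite Hu. apply cat_idr', p1. }
rewrite ph in e2, e3. rewrite cat_src_comp in e1 by assumption.
(* The inverse of a vertical isomorphism is vertical too: its image is inverse to an identity. *)
assert (pu' : s_ar p u' = idn (s_ob p (src u))).
{ transitivity (s_ar p u ;; s_ar p u').
  - rewrite Hu. symmetry; apply cat_idl'.
    rewrite (fun_src Hp), a1, <- (fun_tgt Hp), Hu, cat_tgt_id. reflexivity.
  - rewrite <- (fun_comp Hp) by congruence. rewrite a3. apply (fun_id Hp). }
destruct (H k g e1 e2 e3) as [l [[b1 [b2 [b3 b4]]] U]].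
exists (u' ;; l). split.
- rewrite cat_src_comp, !cat_tgt_comp by congruence. split; [congruence|]. split; [congruence|]. split.
  + rewrite (fun_comp Hp), pu', b3 by congruence. apply cat_idl'. congruence.
  + rewrite cat_assoc by (rewrite ?cat_src_comp; congruence).
    rewrite <- (cat_assoc u u') by congruence. rewrite a3, <- e, <- b1, cat_idl. exact b4.
- intros l' [c1 [c2 [c3 c4]]]. rewrite cat_tgt_comp in c1 by assumption.
  rewrite (U (u ;; l')).
  + rewrite <- cat_assoc by congruence. rewrite a4, <- c1. apply cat_idl.
  + rewrite cat_src_comp, cat_tgt_comp by congruence. split; [congruence|]. split; [congruence|].
    split.
    * rewrite (fun_comp Hp), Hu, c3 by congruence. apply cat_idl'. congruence.
    * rewrite <- cat_assoc by congruence. exact c4.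
Qed.

(** Reduces statements about arbitrary opcartesian arrows to chosen liftings. The comparison arrows
    exist by opcartesianness over an identity and are mutually inverse by uniqueness. *)
Lemma opcartesian_factor (h l : ar Y) : opcartesian p h -> opcartesian p l ->
  src h = src l -> s_ar p h = s_ar p l ->
  exists u, vertical_iso u /\ src u = tgt l /\ tgt u = tgt h /\ l ;; u = h.
Proof.
intros Hh Hl e1 e2.
assert (et : s_ob p (tgt h) = s_ob p (tgt l)) by (rewrite <- !(fun_tgt Hp); congruence).
destruct (Hl h (idn (s_ob p (tgt h)))) as [u [[a1 [a2 [a3 a4]]] _]].
{ exact e1. } { rewrite cat_src_id, (fun_tgt Hp). exact et. }
{ rewrite <- e2, <- (fun_tgt Hp). symmetry; apply cat_idr. }
destruct (Hh l (idn (s_ob p (tgt l)))) as [u' [[b1 [b2 [b3 b4]]] _]].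
{ symmetry; exact e1. } { rewrite cat_src_id, (fun_tgt Hp). symmetry; exact et. }
{ rewrite e2, <- (fun_tgt Hp). symmetry; apply cat_idr. }
exists u. split; [|auto]. split; [rewrite a3, a1, et; reflexivity|].
exists u'. split; [congruence|]. split; [congruence|]. split.
- apply opcartesian_uniq with (h := l); [exact Hl|..].
  + rewrite cat_src_comp; congruence.
  + rewrite cat_src_id; exact a1.
  + rewrite cat_tgt_comp, cat_tgt_id; congruence.
  + rewrite (fun_comp Hp), (fun_id Hp), a3, b3, a1, et by congruence.
    apply cat_idl', cat_src_id.
  + rewrite <- cat_assoc by congruence. rewrite a4, b4, a1. symmetry; apply cat_idr.
- apply opcartesian_uniq with (h := h); [exact Hh|..].
  + rewrite cat_src_comp; congruence.
  + rewrite cat_src_id; exact a2.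
  + rewrite cat_tgt_comp, cat_tgt_id; congruence.
  + rewrite (fun_comp Hp), (fun_id Hp), a3, b3, a2, et by congruence.
    apply cat_idl', cat_src_id.
  + rewrite <- cat_assoc by congruence. rewrite b4, a4, a2. symmetry; apply cat_idr.
Qed.
End Opcartesian.
Arguments proj_src {Y B HB p} Hp h {x}.
Arguments proj_tgt {Y B HB p} Hp h {x}.
Arguments opcartesian_uniq {Y B HY p} Hp {h k l}.
Arguments opcartesian_iso {Y B HY HB p} Hp {h u}.
Arguments opcartesian_factor {Y B HY HB p} Hp {h l}.

Section ImOpfibration.
Variables (Y : mcat) (B : imcat) (HB : is_cartesian B) (p : opfib Y B)
  (Hp : is_split_im_opfib p).

Instance total_cartesian : is_cartesian Y := io_total Hp.
Let Hf : @is_functor Y B p := so_fun (io_split Hp).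
Let Hm : @strict_monoidal_functor Y B p := io_preserves Hp.

Lemma lift_src f y : s_ob p y = src f -> src (lift p f y) = y.
Proof. apply (so_src (io_split Hp)). Qed.
Lemma lift_tgt f y : tgt (lift p f y) = reindex_ob p f y.
Proof. reflexivity. Qed.
Lemma lift_proj f y : s_ob p y = src f -> s_ar p (lift p f y) = f.
Proof. apply (so_proj (io_split Hp)). Qed.
Lemma reindex_proj f y : s_ob p y = src f -> s_ob p (reindex_ob p f y) = tgt f.
Proof.
intros e. unfold reindex_ob. rewrite <- (fun_tgt Hf), (lift_proj f y e). reflexivity.
Qed.

Lemma lift_uniq f y k l : s_ob p y = src f -> src k = reindex_ob p f y ->
  src l = reindex_ob p f y -> tgt k = tgt l -> s_ar p k = s_ar p l ->
  lift p f y ;; k = lift p f y ;; l -> k = l.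
Proof. intros e. exact (opcartesian_uniq Hf (so_opcart (io_split Hp) f y e)). Qed.

Lemma lift_comp f g y : s_ob p y = src f -> tgt f = src g ->
  lift p (f ;; g) y = lift p f y ;; lift p g (reindex_ob p f y).
Proof. apply (so_comp (io_split Hp)). Qed.
Lemma lift_id y x : s_ob p y = x -> lift p (idn x) y = idn y.
Proof. intros <-. apply (so_id (io_split Hp)). Qed.
Lemma lift_ten f g y z : s_ob p y = src f -> s_ob p z = src g ->
  lift p (f ## g) (y ** z) = lift p f y ## lift p g z.
Proof. apply (io_lift_tensor Hp). Qed.

Lemma reindex_ob_comp f g y : s_ob p y = src f -> tgt f = src g ->
  reindex_ob p (f ;; g) y = reindex_ob p g (reindex_ob p f y).
Proof.
intros e1 e2. unfold reindex_ob at 1. rewrite lift_comp by assumption.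
apply cat_tgt_comp. symmetry; apply lift_src. exact (eq_trans (reindex_proj f y e1) e2).
Qed.
Lemma reindex_ob_id y x : s_ob p y = x -> reindex_ob p (idn x) y = y.
Proof. intros e. unfold reindex_ob. rewrite lift_id by exact e. apply cat_tgt_id. Qed.
Lemma reindex_ob_ten f g y z : s_ob p y = src f -> s_ob p z = src g ->
  reindex_ob p (f ## g) (y ** z) = reindex_ob p f y ** reindex_ob p g z.
Proof. intros e1 e2. unfold reindex_ob at 1. rewrite lift_ten by assumption. apply mon_tgt. Qed.

Lemma reindex_spec f h : s_ar p h = idn (src f) ->
  src (reindex_ar p f h) = reindex_ob p f (src h) /\
  tgt (reindex_ar p f h) = reindex_ob p f (tgt h) /\
  s_ar p (reindex_ar p f h) = idn (tgt f) /\
  lift p f (src h) ;; reindex_ar p f h = h ;; lift p f (tgt h).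
Proof.
intros e. pose proof (proj_src Hf h e) as e1. pose proof (proj_tgt Hf h e) as e2.
apply (the_spec h (fun k => src k = reindex_ob p f (src h) /\ tgt k = reindex_ob p f (tgt h) /\
    s_ar p k = idn (tgt f) /\ lift p f (src h) ;; k = h ;; lift p f (tgt h))).
destruct (so_opcart (io_split Hp) f (src h) e1 (h ;; lift p f (tgt h)) (idn (tgt f)))
  as [k [[a1 [a2 [a3 a4]]] _]].
- rewrite cat_src_comp; rewrite ?lift_src; auto.
- rewrite lift_proj by exact e1. apply cat_src_id.
- rewrite (fun_comp Hf) by (rewrite lift_src; auto).
  rewrite e, !lift_proj, cat_idl, cat_idr by assumption. reflexivity.
- exists k. rewrite cat_tgt_comp in a2 by (rewrite lift_src; auto). auto.
Qed.

Lemma reindex_uniq f h k : s_ar p h = idn (src f) ->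
  src k = reindex_ob p f (src h) -> tgt k = reindex_ob p f (tgt h) ->
  s_ar p k = idn (tgt f) -> lift p f (src h) ;; k = h ;; lift p f (tgt h) ->
  reindex_ar p f h = k.
Proof.
intros e e1 e2 e3 e4. destruct (reindex_spec f h e) as [a1 [a2 [a3 a4]]].
apply (lift_uniq f (src h)); try congruence. exact (proj_src Hf h e).
Qed.

Lemma reindex_idn f y : s_ob p y = src f ->
  reindex_ar p f (idn y) = idn (reindex_ob p f y).
Proof.
intros e. apply reindex_uniq; rewrite ?cat_src_id, ?cat_tgt_id; auto.
- rewrite (fun_id Hf). congruence.
- rewrite (fun_id Hf). rewrite reindex_proj by exact e. reflexivity.
- rewrite <- (lift_tgt f y), cat_idr. rewrite <- (lift_src f y e) at 2. symmetry; apply cat_idl.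
Qed.

Lemma reindex_cmp f h k : s_ar p h = idn (src f) -> s_ar p k = idn (src f) -> tgt h = src k ->
  reindex_ar p f (h ;; k) = reindex_ar p f h ;; reindex_ar p f k.
Proof.
intros e1 e2 e3.
destruct (reindex_spec f h e1) as [a1 [a2 [a3 a4]]].
destruct (reindex_spec f k e2) as [b1 [b2 [b3 b4]]].
pose proof (proj_src Hf h e1) as p1. pose proof (proj_src Hf k e2) as p2.
pose proof (proj_tgt Hf k e2) as p3.
assert (l1 := lift_src f _ p1). assert (l2 := lift_src f _ p2). assert (l3 := lift_src f _ p3).
apply reindex_uniq; rewrite ?cat_src_comp, ?cat_tgt_comp by congruence; auto.
- rewrite (fun_comp Hf), e1, e2 by exact e3. apply cat_idl', cat_src_id.
- rewrite (fun_comp Hf), a3, b3 by congruence. apply cat_idl', cat_src_id.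
- rewrite <- cat_assoc by (rewrite ?lift_tgt; congruence). rewrite a4.
  rewrite cat_assoc by (rewrite ?lift_tgt; congruence).
  rewrite e3, b4. symmetry; apply cat_assoc; congruence.
Qed.

(** Pasting the defining squares for [f] and [g] gives the defining square for the composite,
    because chosen liftings compose. *)
Lemma reindex_comp f g h : s_ar p h = idn (src f) -> tgt f = src g ->
  reindex_ar p (f ;; g) h = reindex_ar p g (reindex_ar p f h).
Proof.
intros e1 e2. destruct (reindex_spec f h e1) as [a1 [a2 [a3 a4]]].
assert (e3 : s_ar p (reindex_ar p f h) = idn (src g)) by congruence.
destruct (reindex_spec g _ e3) as [b1 [b2 [b3 b4]]].
pose proof (proj_src Hf h e1) as p1. pose proof (proj_tgt Hf h e1) as p2.
pose proof (proj_src Hf _ e3) as p3. pose proof (proj_tgt Hf _ e3) as p4.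
assert (l1 := lift_src f _ p1). assert (l2 := lift_src f _ p2).
assert (l3 := lift_src g _ p3). assert (l4 := lift_src g _ p4).
apply reindex_uniq; rewrite ?(cat_src_comp f g), ?(cat_tgt_comp f g) by exact e2; auto.
- rewrite reindex_ob_comp by assumption. congruence.
- rewrite reindex_ob_comp by assumption. congruence.
- rewrite !lift_comp by assumption. rewrite <- a1, <- a2.
  rewrite cat_assoc by (rewrite ?lift_tgt; congruence). rewrite b4.
  rewrite <- cat_assoc by (rewrite ?lift_tgt; congruence). rewrite a4.
  apply cat_assoc; rewrite ?lift_tgt; congruence.
Qed.

Lemma reindex_id h x : s_ar p h = idn x -> reindex_ar p (idn x) h = h.
Proof.
intros e. pose proof (proj_src Hf h e) as p1. pose proof (proj_tgt Hf h e) as p2.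
apply reindex_uniq; rewrite ?cat_src_id, ?cat_tgt_id, ?reindex_ob_id, ?lift_id by assumption; auto.
rewrite cat_idl, cat_idr. reflexivity.
Qed.

(** The tensor of the two defining squares is the defining square of the tensor, because chosen
    liftings are closed under tensor. *)
Lemma reindex_ten f g h k : s_ar p h = idn (src f) -> s_ar p k = idn (src g) ->
  reindex_ar p (f ## g) (h ## k) = reindex_ar p f h ## reindex_ar p g k.
Proof.
intros e1 e2.
destruct (reindex_spec f h e1) as [a1 [a2 [a3 a4]]].
destruct (reindex_spec g k e2) as [b1 [b2 [b3 b4]]].
pose proof (proj_src Hf h e1) as p1. pose proof (proj_tgt Hf h e1) as p2.
pose proof (proj_src Hf k e2) as p3. pose proof (proj_tgt Hf k e2) as p4.
assert (l1 := lift_src f _ p1). assert (l2 := lift_src f _ p2).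
assert (l3 := lift_src g _ p3). assert (l4 := lift_src g _ p4).
apply reindex_uniq; rewrite ?mon_src, ?mon_tgt, ?reindex_ob_ten by assumption; try congruence.
- rewrite (smf_ar Hm), e1, e2. apply mon_id.
- rewrite (smf_ar Hm), a3, b3. apply mon_id.
- rewrite !lift_ten by assumption.
  rewrite <- !mon_comp by (rewrite ?lift_tgt; congruence). congruence.
Qed.

(** The target of the lifting lies over the unit, so it is the unit by reflection, and a map to the
    unit is unique. *)
Lemma lift_bang y x : s_ob p y = x -> lift p (bang B x) y = bang Y y.
Proof.
intros e. assert (e' : s_ob p y = src (bang B x)) by (rewrite bang_src; exact e).
apply bang_uniq; [apply lift_src, e'|].
apply (io_reflects_one Hp). pose proof (reindex_proj _ _ e') as e1.
rewrite bang_tgt in e1. exact e1.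
Qed.

(** Reflection of products is given for arrows; its instance at an identity decomposes objects. *)
Lemma proj_split w x y : s_ob p w = x ** y ->
  exists w1 w2, w = w1 ** w2 /\ s_ob p w1 = x /\ s_ob p w2 = y.
Proof.
intros e. destruct (io_reflects Hp (idn w) (idn x) (idn y)) as [h1 [h2 [a1 [a2 a3]]]].
- rewrite (fun_id Hf), e. symmetry; apply mon_id.
- exists (src h1), (src h2). split; [|split].
  + rewrite <- mon_src, <- a1. symmetry; apply cat_src_id.
  + exact (proj_src Hf _ a2).
  + exact (proj_src Hf _ a3).
Qed.

Lemma lift_pr1 y z x x' : s_ob p y = x -> s_ob p z = x' ->
  lift p (pr1 B x x') (y ** z) = pr1 Y y z.
Proof.
intros e1 e2. unfold pr1. rewrite lift_ten by (rewrite ?cat_src_id, ?bang_src; assumption).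
rewrite lift_id, lift_bang by assumption. reflexivity.
Qed.
Lemma lift_pr2 y z x x' : s_ob p y = x -> s_ob p z = x' ->
  lift p (pr2 B x x') (y ** z) = pr2 Y y z.
Proof.
intros e1 e2. unfold pr2. rewrite lift_ten by (rewrite ?cat_src_id, ?bang_src; assumption).
rewrite lift_id, lift_bang by assumption. reflexivity.
Qed.

(** This works because projections lift to projections. *)
Lemma lift_pairing f g y : src f = src g -> s_ob p y = src f ->
  lift p (pairing B f g) y = pairing Y (lift p f y) (lift p g y).
Proof.
intros e e1. assert (e2 : s_ob p y = src g) by congruence.
assert (e3 : s_ob p y = src (pairing B f g)) by (rewrite pairing_src by exact e; exact e1).
set (l := lift p (pairing B f g) y).
assert (et : s_ob p (tgt l) = tgt f ** tgt g).
{ rewrite <- pairing_tgt by exact e. exact (reindex_proj _ _ e3). }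
destruct (proj_split _ _ _ et) as [w1 [w2 [ew [a1 a2]]]].
assert (k1 : l ;; pr1 Y w1 w2 = lift p f y).
{ rewrite <- (lift_pr1 w1 w2 a1 a2). rewrite <- ew.
  change (tgt l) with (reindex_ob p (pairing B f g) y). unfold l.
  rewrite <- (lift_comp (pairing B f g) (pr1 B (tgt f) (tgt g)) y e3)
    by (rewrite pairing_tgt, pr1_src by exact e; reflexivity).
  rewrite pairing_pr1 by auto. reflexivity. }
assert (k2 : l ;; pr2 Y w1 w2 = lift p g y).
{ rewrite <- (lift_pr2 w1 w2 a1 a2). rewrite <- ew.
  change (tgt l) with (reindex_ob p (pairing B f g) y). unfold l.
  rewrite <- (lift_comp (pairing B f g) (pr2 B (tgt f) (tgt g)) y e3)
    by (rewrite pairing_tgt, pr2_src by exact e; reflexivity).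
  rewrite pairing_pr2 by auto. reflexivity. }
rewrite (pr_decomp l w1 w2 ew), k1, k2. reflexivity.
Qed.

Lemma lift_swap y z x x' : s_ob p y = x -> s_ob p z = x' ->
  lift p (swap B x x') (y ** z) = swap Y y z.
Proof.
intros e1 e2. unfold swap. rewrite lift_pairing.
- rewrite lift_pr1, lift_pr2 by assumption. reflexivity.
- rewrite pr1_src, pr2_src. reflexivity.
- rewrite pr2_src, (smf_ob Hm), e1, e2. reflexivity.
Qed.

Lemma lift_diag y x : s_ob p y = x -> lift p (diag B x) y = diag Y y.
Proof.
intros e. unfold diag. rewrite lift_pairing by (rewrite ?cat_src_id; auto).
rewrite lift_id by exact e. reflexivity.
Qed.
End ImOpfibration.

(** * The syntactic model *)

Section SyntacticModel.
Variable T : theory.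
Hypothesis Hc : coherent T.
Local Notation L := (th_sig T).
Local Notation E0 := (th_E0 T).
Local Notation E1 := (th_E1 T).
Local Notation term := (term E0).
Local Notation iterm := (iterm E0).
Local Notation Y := (syn_mcat T).
Local Notation X := (free_cat L).
Local Notation Bs := (fim X).
Local Notation scl := (scl T).
Local Notation slet := (slet T).
Local Notation lay := (lay (T := T)).
Local Notation lift_ar := (lift_ar (T := T)).
Local Notation p := (syn_opfib T : opfib Y Bs).
Local Notation M := (syn_model T).
Let Hproj := coh_proj Hc.

Lemma syn_lift_repr (f : ar Bs) (A : ob Y) : lay A = src f ->
  exists r, fim_sort r (lay A) (tgt f) /\ f = fcl r /\ lift p f A = lift_ar r A.
Proof.
intros e. destruct (fcl_surj f) as [r [Hr Ef]]. rewrite <- e in Hr.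
exists r. split; [exact Hr|]. split; [exact Ef|]. rewrite Ef at 1. exact (syn_lift_cl Hr).
Qed.

Lemma syn_split_opfib : @is_split_opfib Y Bs p.
Proof.
split.
- exact (syn_proj_functor Hproj).
- intros f A e. destruct (syn_lift_repr f A e) as [r [Hr [_ E]]]. rewrite E.
  apply (lift_ar_sort Hr eq_refl).
- intros f A e. destruct (syn_lift_repr f A e) as [r [Hr [Ef E]]]. rewrite E, Ef.
  exact (lift_ar_proj Hproj Hr).
- exact (coh_lift Hc).
- intros A. change (lift p (@idn Bs (lay A)) A = idn A).
  rewrite <- fcl_id. refine (eq_trans (syn_lift_cl (fw_id_sort X (lay A))) _).
  apply lift_ar_id. reflexivity.
- intros f g A e e'. destruct (syn_lift_repr f A e) as [r [Hr [Ef E]]].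
  destruct (lift_ar_sort Hr eq_refl) as [a1 a2].
  rewrite E. destruct (syn_lift_repr g (tgt (lift_ar r A))) as [r' [Hr' [Eg E']]]; [congruence|].
  rewrite E', Ef, Eg. rewrite a2 in Hr'. rewrite <- (fcl_comp Hr Hr').
  exact (syn_lift_cl (fs_comp Hr Hr')).
Qed.

(** An arrow over a tensor factors through the lifting of a tensor, which is itself a tensor; its
    vertical part can then be cut at the same place. *)
Lemma syn_reflects (h : ar Y) (f g : ar Bs) : @s_ar Y Bs p h = f ## g ->
  exists h1 h2 : ar Y, h = h1 ## h2 /\ @s_ar Y Bs p h1 = f /\ @s_ar Y Bs p h2 = g.
Proof.
intros e. pose proof (syn_proj_functor Hproj) as [F1 F2 F3 F4].
destruct (fcl_surj f) as [r [Hr Ef]], (fcl_surj g) as [r' [Hr' Eg]].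
assert (es : lay (src h) = src f ++ src g).
{ change (@s_ob Y Bs p (src h) = src f ++ src g). rewrite <- F1.
  refine (eq_trans (f_equal src e) _). apply (mon_src (C := Bs)). }
assert (et : lay (tgt h) = tgt f ++ tgt g).
{ change (@s_ob Y Bs p (tgt h) = tgt f ++ tgt g). rewrite <- F2.
  refine (eq_trans (f_equal tgt e) _). apply (mon_tgt (C := Bs)). }
destruct (factor_proj Hproj h (r := r *f r')) as [i [Hi [a1 [a2 a3]]]].
- rewrite es, et. exact (fs_ten Hr Hr').
- refine (eq_trans e _). rewrite Ef, Eg. symmetry. exact (fcl_ten Hr Hr').
- destruct (lay_split es) as [A1 [A2 [eA [b1 b2]]]]. rewrite eA in a1, a3.
  rewrite (lift_ar_ten _ _ Hr b1) in a1, a3.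
  destruct (lift_ar_sort Hr b1) as [c1 c2], (lift_ar_sort Hr' b2) as [d1 d2].
  rewrite mon_tgt in a1.
  destruct (vertical_split Hi (tgt f) (tgt g)) as [i1 [i2 [-> [H1 [H2 [e1 e2]]]]]].
  { rewrite a1, lay_ten. congruence. }
  rewrite mon_src in a1. destruct (ten_src_inj a1) as [k1 k2]; [congruence|].
  exists (lift_ar r A1 ;; i1), (lift_ar r' A2 ;; i2).
  rewrite mon_comp by congruence. split; [exact a3|].
  rewrite <- b1 in Hr. rewrite <- b2 in Hr'. split.
  + etransitivity; [apply F4; congruence|]. rewrite (vertical_proj Hproj H1), k1, c2.
    rewrite (lift_ar_proj Hproj Hr), Ef. rewrite <- Ef. apply (cat_idr (C := Bs)).
  + etransitivity; [apply F4; congruence|]. rewrite (vertical_proj Hproj H2), k2, d2.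
    rewrite (lift_ar_proj Hproj Hr'), Eg. rewrite <- Eg. apply (cat_idr (C := Bs)).
Qed.

Lemma vertical_iso_ten (u u' : ar Y) : @vertical_iso Y Bs p u -> @vertical_iso Y Bs p u' ->
  @vertical_iso Y Bs p (u ## u').
Proof.
pose proof (syn_proj_monoidal Hproj) as [F1 F2 F3 F4].
intros [p1 [v [a1 [a2 [a3 a4]]]]] [p2 [v' [b1 [b2 [b3 b4]]]]]. split.
- rewrite mon_src. etransitivity; [apply F4|].
  transitivity (@s_ar Y Bs p u ## @s_ar Y Bs p u'); [reflexivity|]. rewrite p1, p2.
  etransitivity; [apply (mon_id (C := Bs))|]. f_equal. symmetry; apply F3.
- exists (v ## v'). rewrite !mon_src, !mon_tgt. split; [congruence|]. split; [congruence|].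
  rewrite <- !mon_comp by congruence. rewrite a3, b3, a4, b4, !mon_id. auto.
Qed.

Lemma syn_lift_tensor (f g : ar Bs) (A B : ob Y) : lay A = src f -> lay B = src g ->
  lift p (f ## g) (A ** B) = lift p f A ## lift p g B.
Proof.
intros e e'. destruct (syn_lift_repr f A e) as [r [Hr [Ef E]]].
destruct (syn_lift_repr g B e') as [r' [Hr' [Eg E']]].
rewrite E, E', Ef, Eg, <- (fcl_ten Hr Hr').
assert (H : fim_sort (r *f r') (lay (A ** B)) (tgt f ++ tgt g)).
{ rewrite lay_ten. exact (fs_ten Hr Hr'). }
exact (eq_trans (syn_lift_cl H) (lift_ar_ten A B Hr eq_refl)).
Qed.

Lemma syn_im_opfib : @is_split_im_opfib Y Bs p.
Proof.
pose proof (syn_proj_functor Hproj) as HF. pose proof HF as [F1 F2 F3 F4].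
split.
- exact _.
- exact _.
- apply fim_indexed_monoids.
- exact syn_split_opfib.
- exact (syn_proj_monoidal Hproj).
- intros A. split; [exact lay_nil|]. intros ->. exact (lay_one T).
- exact syn_reflects.
(* Every opcartesian arrow is a chosen lifting followed by a vertical isomorphism, and arrows of
   this form are closed under tensor. *)
- assert (K : forall h : ar Y, @opcartesian Y Bs p h -> exists u, @vertical_iso Y Bs p u /\
    src u = tgt (lift p (@s_ar Y Bs p h) (src h)) /\ lift p (@s_ar Y Bs p h) (src h) ;; u = h).
  { intros h Hh.
    assert (e : lay (src h) = src (@s_ar Y Bs p h)) by (symmetry; apply F1).
    destruct (opcartesian_factor HF Hh (so_opcart syn_split_opfib _ _ e))
      as [u [Hu [a1 [a2 a3]]]].
    - symmetry; exact (so_src syn_split_opfib _ _ e).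
    - symmetry; exact (so_proj syn_split_opfib _ _ e).
    - exists u. auto. }
  intros h k Hh Hk. destruct (K h Hh) as [u [Hu [a1 a2]]], (K k Hk) as [v [Hv [b1 b2]]].
  rewrite <- a2, <- b2. rewrite mon_comp by auto.
  assert (e : lay (src h) = src (@s_ar Y Bs p h)) by (symmetry; apply F1).
  assert (e' : lay (src k) = src (@s_ar Y Bs p k)) by (symmetry; apply F1).
  rewrite <- syn_lift_tensor by assumption.
  apply (opcartesian_iso HF).
  + apply (so_opcart syn_split_opfib). refine (eq_trans (lay_ten _ _) _).
    rewrite e, e'. symmetry; apply (mon_src (C := Bs)).
  + exact (vertical_iso_ten Hu Hv).
  + rewrite syn_lift_tensor by assumption. rewrite mon_tgt, mon_src. congruence.
- exact syn_lift_tensor.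
Qed.

Lemma syn_lift_mul o (a b : ity L o) :
  lift p (mul (fo X o)) (slet a ** slet b) = scl (tmul a b).
Proof.
rewrite <- fcl_mul.
assert (H : fim_sort (@fr_mul X o) (lay (slet a ** slet b)) [o : ob X]).
{ rewrite lay_ten, !lay_slet. exact (fs_mul X o). }
exact (eq_trans (syn_lift_cl H) (lift_ar_mul T a b)).
Qed.
Lemma syn_lift_unt (o : layer L) : lift p (unt (fo X o)) one = scl (tunt o).
Proof.
rewrite <- fcl_unt.
assert (H : fim_sort (@fr_unt X o) (lay one) [o : ob X]).
{ rewrite lay_one. exact (fs_unt X o). }
exact (syn_lift_cl H).
Qed.
Lemma syn_lift_gen o t (f : fgen L o t) (a : ity L o) :
  lift p (fim_gen X (edge f)) (slet a) = scl (tnab f a).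
Proof.
rewrite fim_gen_cl.
assert (H : fim_sort (@fr_gen X (edge f)) (lay (slet a)) [t : ob X]).
{ rewrite lay_slet. exact (fs_gen X (edge f)). }
refine (eq_trans (syn_lift_cl H) _). rewrite lift_ar_gen.
change (pa_path (edge f)) with (pcons f (pnil t)).
rewrite nabla_path_cons, nabla_slet, nabla_path_nil. apply cat_idr.
Qed.

Lemma syn_fib_ob o (a b : ity L o) : fib_ob p (fo X o) (slet a) (slet b) = slet (iten a b).
Proof.
unfold fib_ob, reindex_ob. rewrite syn_lift_mul. apply tmul_tgt.
Qed.
Lemma syn_fib_unit (o : layer L) : fib_unit p (fo X o) = slet (iunit o).
Proof.
unfold fib_unit, reindex_ob. rewrite syn_lift_unt. exact (scl_tgt (tm_unt E0 o)).
Qed.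
Lemma syn_reindex_ob o t (f : fgen L o t) (a : ity L o) :
  reindex_ob p (fim_gen X (edge f)) (slet a) = slet (iapp f a).
Proof. unfold reindex_ob. rewrite syn_lift_gen. apply tnab_tgt. Qed.

Lemma iterm_proj_idn x o (a b : ity L o) : iterm x a b -> @s_ar Y Bs p (scl x) = idn (fo X o).
Proof. intros H. refine (eq_trans (syn_proj_scl Hproj (tm_int H)) _). exact (pcl_iterm H). Qed.

Lemma gen_src o t (f : fgen L o t) : src (fim_gen X (edge f)) = fo X o.
Proof. rewrite fim_gen_cl. exact (fcl_src (fs_gen X (edge f))). Qed.
Lemma gen_tgt o t (f : fgen L o t) : tgt (fim_gen X (edge f)) = fo X t.
Proof. rewrite fim_gen_cl. exact (fcl_tgt (fs_gen X (edge f))). Qed.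

(** The naturality equation of [nabla] is the square that characterizes reindexing, so uniqueness of
    the fill-in suffices. *)
Lemma syn_reindex_ar o t (f : fgen L o t) x (a b : ity L o) : iterm x a b ->
  reindex_ar p (fim_gen X (edge f)) (scl x) = scl (tapp f x).
Proof.
intros H. apply (reindex_uniq _ syn_im_opfib); rewrite ?gen_src, ?gen_tgt.
- exact (iterm_proj_idn H).
- rewrite (scl_isrc H), syn_reindex_ob. exact (scl_isrc (it_app _ f H)).
- rewrite (scl_itgt H), syn_reindex_ob. exact (scl_itgt (it_app _ f H)).
- exact (iterm_proj_idn (it_app _ f H)).
- rewrite (scl_isrc H), (scl_itgt H), !syn_lift_gen.
  rewrite <- (scl_comp (tm_int H) (tm_nab E0 _ f b)), <- (scl_comp (tm_nab E0 _ f a) (tm_int (it_app _ f H))).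
  symmetry; exact (scl_tmeq (te_nab_nat E1 _ f H)).
Qed.

Lemma syn_fib_ar o x y (a b c d : ity L o) : iterm x a b -> iterm y c d ->
  fib_ar p (fo X o) (scl x) (scl y) = scl (titen o x y).
Proof.
intros H H'. unfold fib_ar.
pose proof (syn_proj_monoidal Hproj) as [F1 F2 F3 F4].
apply (reindex_uniq _ syn_im_opfib); rewrite ?fim_mul_src, ?fim_mul_tgt.
- refine (eq_trans (F4 _ _) _).
  transitivity (@s_ar Y Bs p (scl x) ## @s_ar Y Bs p (scl y)); [reflexivity|].
  rewrite (iterm_proj_idn H), (iterm_proj_idn H'). apply (mon_id (C := Bs)).
- rewrite mon_src, (scl_isrc H), (scl_isrc H'). unfold reindex_ob. rewrite syn_lift_mul, tmul_tgt.
  exact (scl_isrc (it_ten H H')).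
- rewrite mon_tgt, (scl_itgt H), (scl_itgt H'). unfold reindex_ob. rewrite syn_lift_mul, tmul_tgt.
  exact (scl_itgt (it_ten H H')).
- exact (iterm_proj_idn (it_ten H H')).
- rewrite mon_src, mon_tgt, (scl_isrc H), (scl_isrc H'), (scl_itgt H), (scl_itgt H'), !syn_lift_mul.
  rewrite <- (scl_comp (tm_mul E0 a c) (tm_int (it_ten H H'))), <- (scl_ten (tm_int H) (tm_int H')).
  rewrite <- (scl_comp (tm_ten (tm_int H) (tm_int H')) (tm_mul E0 b d)).
  symmetry; exact (scl_tmeq (te_mul_nat E1 H H')).
Qed.

Lemma syn_int_ity o (A : ity L o) : int_ity M A = slet A.
Proof.
induction A.
- exact (syn_fib_unit o).
- reflexivity.
- refine (eq_trans (f_equal (reindex_ob p (fim_gen X (edge f))) IHA) _). apply syn_reindex_ob.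
- refine (eq_trans (f_equal2 (fib_ob p (fo X o)) IHA1 IHA2) _). apply syn_fib_ob.
Qed.

Lemma syn_int_iterm x o (a b : ity L o) : iterm x a b -> int_tm M x = scl x.
Proof.
induction 1.
- refine (eq_trans (f_equal (@idn Y) (syn_int_ity A)) _). symmetry; apply scl_id1.
- symmetry. exact (scl_mk (tm_int (it_gen E0 o a b s))).
- refine (eq_trans (f_equal (reindex_ar p (fim_gen X (edge f))) IHiterm) _).
  exact (syn_reindex_ar _ f H).
- refine (eq_trans (f_equal2 (fib_ar p (fo X o)) IHiterm1 IHiterm2) _).
  exact (syn_fib_ar H H0).
- refine (eq_trans (f_equal2 (@comp Y) IHiterm1 IHiterm2) _).
  symmetry; exact (scl_comp (tm_int H) (tm_int H0)).
- exact IHiterm.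
Qed.

(** The syntactic model interprets a term as its own class. Validity of the 1-equations is then
    immediate, and a functor that respects interpretations is known on every arrow. *)
Lemma syn_int_tm x U V : term x U V -> int_tm M x = scl x.
Proof.
induction 1.
- exact (syn_int_iterm H).
- refine (eq_trans (f_equal2 (@comp Y) IHterm1 IHterm2) _). symmetry; exact (scl_comp H H0).
- symmetry; exact (scl_id T []).
- refine (eq_trans (f_equal2 (@tar Y) IHterm1 IHterm2) _). symmetry; exact (scl_ten H H0).
- refine (eq_trans (f_equal2 (swap Y) (syn_int_ity A) (syn_int_ity B)) _). apply swap_slet.
- refine (eq_trans (f_equal (lift p (fim_gen X (edge f))) (syn_int_ity A)) _). apply syn_lift_gen.
- refine (eq_trans (f_equal2 (fun u v => lift p (mul (fo X o)) (u ** v)) (syn_int_ity A) (syn_int_ity B)) _).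
  apply syn_lift_mul.
- exact (syn_lift_unt o).
- refine (eq_trans (f_equal (diag Y) (syn_int_ity A)) _). apply diag_slet.
- refine (eq_trans (f_equal (bang Y) (syn_int_ity A)) _). apply bang_slet.
- exact IHterm.
Qed.

Lemma syn_m_word o (a : list (col (msig L o))) : m_word M o a = slet (iword L o a).
Proof.
induction a as [|c a IH]; [exact (syn_fib_unit o)|].
refine (eq_trans (f_equal (fib_ob p (fo X o) (slet (icol o c))) IH) _). apply syn_fib_ob.
Qed.

Lemma syn_is_model : is_model T M.
Proof.
split.
- split.
  + apply free_is_cat.
  + exact syn_im_opfib.
  + reflexivity.
  + reflexivity.
  + intros o a. exact (lay_slet T (icol o a)).
  + intros o a b s. rewrite syn_m_word.
    refine (eq_trans _ (scl_isrc (it_gen E0 o a b s))). f_equal. symmetry. exact (scl_mk _).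
  + intros o a b s. rewrite syn_m_word.
    refine (eq_trans _ (scl_itgt (it_gen E0 o a b s))). f_equal. symmetry. exact (scl_mk _).
  + intros o a b s. refine (eq_trans _ (iterm_proj_idn (it_gen E0 o a b s))).
    apply (f_equal (@s_ar Y Bs p)). symmetry. exact (scl_mk _).
- intros o A B e. rewrite !syn_int_ity. apply slet_eq, ie_E0, e.
- intros x y e. destruct (th_parallel T _ _ e) as [U [V [H K]]].
  rewrite (syn_int_tm H), (syn_int_tm K). exact (scl_tmeq (te_E1 _ _ _ _ e)).
Qed.
End SyntacticModel.

(** * Fibrewise monoidal structure *)

Section Fibrewise.
Variables (Y : mcat) (B : imcat) (HB : is_cartesian B) (p : opfib Y B)
  (Hp : is_split_im_opfib p).
Instance total_cartesian' : is_cartesian Y := io_total Hp.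
Let Hf : @is_functor Y B p := so_fun (io_split Hp).
Let Hm : @strict_monoidal_functor Y B p := io_preserves Hp.
Let mu_src := mul_src (im_monoids (io_base Hp)).
Let mu_tgt := mul_tgt (im_monoids (io_base Hp)).
Let un_src := unt_src (im_monoids (io_base Hp)).
Let un_tgt := unt_tgt (im_monoids (io_base Hp)).
Variable x : ob B.
Notation over y := (s_ob p y = x).
Notation vert h := (s_ar p h = idn x).

Lemma over_mul y z : over y -> over z -> s_ob p (y ** z) = src (mul x).
Proof. intros e e'. rewrite (smf_ob Hm), mu_src. congruence. Qed.
Lemma over_unt : s_ob p one = src (unt x).
Proof. rewrite (smf_one Hm), un_src. reflexivity. Qed.
Lemma vert_mul h k : vert h -> vert k -> s_ar p (h ## k) = idn (src (mul x)).
Proof. intros e e'. rewrite (smf_ar Hm), mu_src, e, e'. apply mon_id. Qed.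
Lemma vert_idn y : over y -> vert (idn y).
Proof. intros <-. apply (fun_id Hf). Qed.

Lemma fib_ob_over y z : over y -> over z -> over (fib_ob p x y z).
Proof.
intros e e'. unfold fib_ob. rewrite (reindex_proj Hp (mul x) _ (over_mul _ _ e e')). apply mu_tgt.
Qed.
Lemma fib_unit_over : over (fib_unit p x).
Proof. unfold fib_unit. rewrite (reindex_proj Hp (unt x) _ over_unt). apply un_tgt. Qed.

Lemma fib_ar_spec h k : vert h -> vert k ->
  src (fib_ar p x h k) = fib_ob p x (src h) (src k) /\
  tgt (fib_ar p x h k) = fib_ob p x (tgt h) (tgt k) /\
  vert (fib_ar p x h k) /\
  lift p (mul x) (src h ** src k) ;; fib_ar p x h k =
  (h ## k) ;; lift p (mul x) (tgt h ** tgt k).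
Proof.
intros e e'. pose proof (reindex_spec _ Hp (mul x) _ (vert_mul _ _ e e')) as S.
rewrite mon_src, mon_tgt, mu_tgt in S. exact S.
Qed.

(** Multiplying two of three factors is itself a reindexing, along [mul x ## idn x], by
    compatibility of liftings with tensors. Iterated fibrewise products thus become reindexings
    along composites. *)
Lemma step1_ob y z : over y -> over z -> forall a, over a ->
  reindex_ob p (mul x ## idn x) ((y ** z) ** a) = fib_ob p x y z ** a.
Proof.
intros e1 e2 a e3. rewrite (reindex_ob_ten Hp) by (rewrite ?cat_src_id; auto using over_mul).
rewrite (reindex_ob_id Hp) by assumption. reflexivity.
Qed.
Lemma step2_ob y z : over y -> over z -> forall a, over a ->
  reindex_ob p (idn x ## mul x) (a ** y ** z) = a ** fib_ob p x y z.
Proof.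
intros e1 e2 a e3. rewrite (reindex_ob_ten Hp) by (rewrite ?cat_src_id; auto using over_mul).
rewrite (reindex_ob_id Hp) by assumption. reflexivity.
Qed.

Lemma mul_id_src : src (mul x ## idn x) = (x ** x) ** x.
Proof. rewrite mon_src, mu_src, cat_src_id. reflexivity. Qed.
Lemma mul_id_tgt : tgt (mul x ## idn x) = src (mul x).
Proof. rewrite mon_tgt, mu_tgt, cat_tgt_id, mu_src. reflexivity. Qed.
Lemma id_mul_src : src (idn x ## mul x) = x ** x ** x.
Proof. rewrite mon_src, mu_src, cat_src_id. reflexivity. Qed.
Lemma id_mul_tgt : tgt (idn x ## mul x) = src (mul x).
Proof. rewrite mon_tgt, mu_tgt, cat_tgt_id, mu_src. reflexivity. Qed.

(** Both sides reindex one triple product along the two sides of associativity of [mul x]; splitness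
    makes this an equality rather than an isomorphism. *)
Lemma fib_ob_assoc a b c : over a -> over b -> over c ->
  fib_ob p x (fib_ob p x a b) c = fib_ob p x a (fib_ob p x b c).
Proof.
intros e1 e2 e3. unfold fib_ob at 1 3.
rewrite <- step1_ob, <- step2_ob by assumption.
rewrite <- !(reindex_ob_comp Hp);
  [|rewrite !(smf_ob Hm), ?mul_id_src, ?id_mul_src; congruence|apply id_mul_tgt
   |rewrite !(smf_ob Hm), ?mul_id_src, ?id_mul_src; congruence|apply mul_id_tgt].
rewrite (mul_assoc (im_monoids (io_base Hp))), mon_assoc_ob. reflexivity.
Qed.

Lemma unt_id_src : src (unt x ## idn x) = x.
Proof. rewrite mon_src, un_src, cat_src_id. apply mon_unitl_ob. Qed.
Lemma unt_id_tgt : tgt (unt x ## idn x) = src (mul x).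
Proof. rewrite mon_tgt, un_tgt, cat_tgt_id, mu_src. reflexivity. Qed.
Lemma id_unt_src : src (idn x ## unt x) = x.
Proof. rewrite mon_src, un_src, cat_src_id. apply mon_unitr_ob. Qed.
Lemma id_unt_tgt : tgt (idn x ## unt x) = src (mul x).
Proof. rewrite mon_tgt, un_tgt, cat_tgt_id, mu_src. reflexivity. Qed.

Lemma unit_step1_ob a : over a -> reindex_ob p (unt x ## idn x) a = fib_unit p x ** a.
Proof.
intros e. rewrite <- (mon_unitl_ob a) at 1.
rewrite (reindex_ob_ten Hp) by (rewrite ?cat_src_id; auto using over_unt).
rewrite (reindex_ob_id Hp) by assumption. reflexivity.
Qed.
Lemma unit_step2_ob a : over a -> reindex_ob p (idn x ## unt x) a = a ** fib_unit p x.
Proof.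
intros e. rewrite <- (mon_unitr_ob a) at 1.
rewrite (reindex_ob_ten Hp) by (rewrite ?cat_src_id; auto using over_unt).
rewrite (reindex_ob_id Hp) by assumption. reflexivity.
Qed.

Lemma fib_ob_unitl a : over a -> fib_ob p x (fib_unit p x) a = a.
Proof.
intros e. unfold fib_ob. rewrite <- unit_step1_ob by assumption.
rewrite <- (reindex_ob_comp Hp) by (rewrite ?unt_id_src; auto using unt_id_tgt).
rewrite (mul_unitl (im_monoids (io_base Hp))). apply (reindex_ob_id Hp), e.
Qed.
Lemma fib_ob_unitr a : over a -> fib_ob p x a (fib_unit p x) = a.
Proof.
intros e. unfold fib_ob. rewrite <- unit_step2_ob by assumption.
rewrite <- (reindex_ob_comp Hp) by (rewrite ?id_unt_src; auto using id_unt_tgt).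
rewrite (mul_unitr (im_monoids (io_base Hp))). apply (reindex_ob_id Hp), e.
Qed.

Lemma step1_ar h k l : vert h -> vert k -> vert l ->
  reindex_ar p (mul x ## idn x) ((h ## k) ## l) = fib_ar p x h k ## l.
Proof.
intros e1 e2 e3. rewrite (reindex_ten _ Hp) by (rewrite ?cat_src_id; auto using vert_mul).
rewrite (reindex_id _ Hp) by assumption. reflexivity.
Qed.
Lemma step2_ar h k l : vert h -> vert k -> vert l ->
  reindex_ar p (idn x ## mul x) (h ## k ## l) = h ## fib_ar p x k l.
Proof.
intros e1 e2 e3. rewrite (reindex_ten _ Hp) by (rewrite ?cat_src_id; auto using vert_mul).
rewrite (reindex_id _ Hp) by assumption. reflexivity.
Qed.

Lemma fib_ar_assoc h k l : vert h -> vert k -> vert l ->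
  fib_ar p x (fib_ar p x h k) l = fib_ar p x h (fib_ar p x k l).
Proof.
intros e1 e2 e3. unfold fib_ar at 1 3.
rewrite <- step1_ar, <- step2_ar by assumption.
rewrite <- !(reindex_comp _ Hp);
  [|rewrite !(smf_ar Hm), id_mul_src, e1, e2, e3, !mon_id; reflexivity|apply id_mul_tgt
   |rewrite !(smf_ar Hm), mul_id_src, e1, e2, e3, !mon_id; reflexivity|apply mul_id_tgt].
rewrite (mul_assoc (im_monoids (io_base Hp))), mon_assoc_ar. reflexivity.
Qed.

Lemma fib_ar_unitl h : vert h -> fib_ar p x (idn (fib_unit p x)) h = h.
Proof.
intros e. unfold fib_ar.
(* The fibrewise unit is a reindexing of [one], so the whole expression reindexes [h] along a
   composite that the unit law identifies with [idn x]. *)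
assert (E : idn (fib_unit p x) ## h = reindex_ar p (unt x ## idn x) (idn one ## h)).
{ rewrite (reindex_ten _ Hp) by (rewrite ?(fun_id Hf), ?cat_src_id, ?over_unt; auto).
  rewrite (reindex_id _ Hp) by assumption.
  rewrite (reindex_idn _ Hp) by exact over_unt. reflexivity. }
rewrite E, mon_unitl_ar, <- (reindex_comp _ Hp) by (rewrite ?unt_id_src; auto using unt_id_tgt).
rewrite (mul_unitl (im_monoids (io_base Hp))). apply (reindex_id _ Hp), e.
Qed.
Lemma fib_ar_unitr h : vert h -> fib_ar p x h (idn (fib_unit p x)) = h.
Proof.
intros e. unfold fib_ar.
assert (E : h ## idn (fib_unit p x) = reindex_ar p (idn x ## unt x) (h ## idn one)).
{ rewrite (reindex_ten _ Hp) by (rewrite ?(fun_id Hf), ?cat_src_id, ?over_unt; auto).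
  rewrite (reindex_id _ Hp) by assumption.
  rewrite (reindex_idn _ Hp) by exact over_unt. reflexivity. }
rewrite E, mon_unitr_ar, <- (reindex_comp _ Hp) by (rewrite ?id_unt_src; auto using id_unt_tgt).
rewrite (mul_unitr (im_monoids (io_base Hp))). apply (reindex_id _ Hp), e.
Qed.

Lemma fib_ar_idn a b : over a -> over b -> fib_ar p x (idn a) (idn b) = idn (fib_ob p x a b).
Proof.
intros e e'. unfold fib_ar. rewrite mon_id. apply (reindex_idn _ Hp), over_mul; assumption.
Qed.

Lemma fib_ar_cmp h h' k k' : vert h -> vert h' -> vert k -> vert k' ->
  tgt h = src h' -> tgt k = src k' ->
  fib_ar p x (h ;; h') (k ;; k') = fib_ar p x h k ;; fib_ar p x h' k'.
Proof.
intros e1 e2 e3 e4 e5 e6. unfold fib_ar. rewrite mon_comp by assumption.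
apply (reindex_cmp _ Hp); auto using vert_mul. rewrite mon_src, mon_tgt. congruence.
Qed.

Lemma lift_mul_assoc a b c : over a -> over b -> over c ->
  (lift p (mul x) (a ** b) ## idn c) ;; lift p (mul x) (fib_ob p x a b ** c) =
  (idn a ## lift p (mul x) (b ** c)) ;; lift p (mul x) (a ** fib_ob p x b c).
Proof.
intros e1 e2 e3.
rewrite <- (lift_id Hp c e3), <- (lift_id Hp a e1).
rewrite <- !(lift_ten Hp) by (rewrite ?cat_src_id; auto using over_mul).
rewrite <- step1_ob, <- step2_ob by assumption.
rewrite <- !(lift_comp Hp);
  [|rewrite !(smf_ob Hm), ?mul_id_src, ?id_mul_src; congruence|apply id_mul_tgt
   |rewrite !(smf_ob Hm), ?mul_id_src, ?id_mul_src; congruence|apply mul_id_tgt].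
rewrite (mul_assoc (im_monoids (io_base Hp))), mon_assoc_ob. reflexivity.
Qed.

Lemma lift_mul_unitl a : over a ->
  (lift p (unt x) one ## idn a) ;; lift p (mul x) (fib_unit p x ** a) = idn a.
Proof.
intros e. rewrite <- (lift_id Hp a e) at 1.
rewrite <- (lift_ten Hp) by (rewrite ?cat_src_id; auto using over_unt).
rewrite mon_unitl_ob, <- unit_step1_ob by assumption.
rewrite <- (lift_comp Hp) by (rewrite ?unt_id_src; auto using unt_id_tgt).
rewrite (mul_unitl (im_monoids (io_base Hp))). apply (lift_id Hp), e.
Qed.
Lemma lift_mul_unitr a : over a ->
  (idn a ## lift p (unt x) one) ;; lift p (mul x) (a ** fib_unit p x) = idn a.
Proof.
intros e. rewrite <- (lift_id Hp a e) at 1.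
rewrite <- (lift_ten Hp) by (rewrite ?cat_src_id; auto using over_unt).
rewrite mon_unitr_ob, <- unit_step2_ob by assumption.
rewrite <- (lift_comp Hp) by (rewrite ?id_unt_src; auto using id_unt_tgt).
rewrite (mul_unitr (im_monoids (io_base Hp))). apply (lift_id Hp), e.
Qed.

(** * Reindexing along a morphism of monoids preserves the fibrewise structure *)

Variables (x' : ob B) (f : ar B) (f_src : src f = x) (f_tgt : tgt f = x')
  (f_mul : mul x ;; f = (f ## f) ;; mul x') (f_unt : unt x ;; f = unt x').

Lemma mul_f_tgt : tgt (mul x) = src f.
Proof. rewrite mu_tgt; auto. Qed.
Lemma ff_tgt : tgt (f ## f) = src (mul x').
Proof. rewrite mon_tgt, mu_src, f_tgt. reflexivity. Qed.
Lemma over_ff a b : over a -> over b -> s_ob p (a ** b) = src (f ## f).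
Proof. intros. rewrite (smf_ob Hm), mon_src. congruence. Qed.
Lemma over_f a : over a -> s_ob p a = src f.
Proof. congruence. Qed.

Lemma lift_mul_comp a b : over a -> over b ->
  lift p (mul x) (a ** b) ;; lift p f (fib_ob p x a b) =
  (lift p f a ## lift p f b) ;; lift p (mul x') (reindex_ob p f a ** reindex_ob p f b).
Proof.
intros e1 e2. unfold fib_ob.
rewrite <- (lift_comp Hp) by auto using over_mul, mul_f_tgt.
rewrite f_mul, (lift_comp Hp) by auto using over_ff, ff_tgt.
rewrite (lift_ten Hp), (reindex_ob_ten Hp) by auto using over_f. reflexivity.
Qed.
Lemma reindex_fib_ob a b : over a -> over b ->
  reindex_ob p f (fib_ob p x a b) = fib_ob p x' (reindex_ob p f a) (reindex_ob p f b).
Proof.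
intros e1 e2. unfold fib_ob.
rewrite <- (reindex_ob_comp Hp) by auto using over_mul, mul_f_tgt.
rewrite f_mul, (reindex_ob_comp Hp) by auto using over_ff, ff_tgt.
rewrite (reindex_ob_ten Hp) by auto using over_f. reflexivity.
Qed.
Lemma lift_unt_comp : lift p (unt x) one ;; lift p f (fib_unit p x) = lift p (unt x') one.
Proof.
unfold fib_unit. rewrite <- (lift_comp Hp) by (rewrite ?un_tgt; auto using over_unt).
rewrite f_unt. reflexivity.
Qed.
Lemma reindex_fib_unit : reindex_ob p f (fib_unit p x) = fib_unit p x'.
Proof.
unfold fib_unit. rewrite <- (reindex_ob_comp Hp) by (rewrite ?un_tgt; auto using over_unt).
rewrite f_unt. reflexivity.
Qed.
Lemma reindex_fib_ar h k : vert h -> vert k ->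
  reindex_ar p f (fib_ar p x h k) = fib_ar p x' (reindex_ar p f h) (reindex_ar p f k).
Proof.
intros e1 e2. unfold fib_ar.
rewrite <- (reindex_comp _ Hp) by auto using vert_mul, mul_f_tgt.
assert (e3 : s_ar p (h ## k) = idn (src (f ## f))).
{ rewrite (smf_ar Hm), mon_src, e1, e2, f_src. apply mon_id. }
rewrite f_mul, (reindex_comp _ Hp) by auto using ff_tgt.
rewrite (reindex_ten _ Hp) by congruence. reflexivity.
Qed.
End Fibrewise.

(** * Soundness *)

Section Soundness.
Variables (T : theory) (M : model (th_sig T)) (HM : is_model T M).
Local Notation L := (th_sig T).
Local Notation E0 := (th_E0 T).
Local Notation E1 := (th_E1 T).
Local Notation term := (term E0).
Local Notation iterm := (iterm E0).
Local Notation tmeq := (tmeq E0 E1).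
Local Notation Y := (m_total M).
Local Notation X := (free_cat L).
Local Notation Bm := (fim (m_base M)).
Local Notation p := (m_opfib M : opfib Y Bm).
Local Notation ex A := (existT (ity L) _ A).
Let Hp : is_split_im_opfib p := om_opfib (mod_opf HM).
Let HB : is_cartesian Bm := fim_cartesian (m_base M).
Instance model_cartesian : is_cartesian Y := io_total Hp.
Let Hf : @is_functor Y Bm p := so_fun (io_split Hp).
Let Hm : @strict_monoidal_functor Y Bm p := io_preserves Hp.

Lemma m_ar_src o t (f : fgen L o t) : src (m_ar M f) = m_ob M o.
Proof.
unfold m_ar. rewrite fim_gen_cl, (fcl_src (fs_gen _ _)).
exact (f_equal (fun a => [a]) (om_fgen_src (mod_opf HM) o t f)).
Qed.
Arguments m_ar_src {o t} f.
Lemma m_ar_tgt o t (f : fgen L o t) : tgt (m_ar M f) = m_ob M t.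
Proof.
unfold m_ar. rewrite fim_gen_cl, (fcl_tgt (fs_gen _ _)).
exact (f_equal (fun a => [a]) (om_fgen_tgt (mod_opf HM) o t f)).
Qed.
Arguments m_ar_tgt {o t} f.
Lemma m_ar_mul o t (f : fgen L o t) :
  mul (m_ob M o) ;; m_ar M f = (m_ar M f ## m_ar M f) ;; mul (m_ob M t).
Proof.
pose proof (fim_gen_mul (m_base M) (m_fgen M f)) as n.
rewrite (om_fgen_src (mod_opf HM)), (om_fgen_tgt (mod_opf HM)) in n. exact n.
Qed.
Arguments m_ar_mul {o t} f.
Lemma m_ar_unt o t (f : fgen L o t) : unt (m_ob M o) ;; m_ar M f = unt (m_ob M t).
Proof. rewrite <- m_ar_src with (f := f), <- m_ar_tgt with (f := f). apply fim_unt_nat. Qed.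

Arguments m_ar_unt {o t} f.
Lemma int_comp x y : int_tm M (x ;t y) = int_tm M x ;; int_tm M y.
Proof. reflexivity. Qed.
Lemma int_ten x y : int_tm M (x *t y) = int_tm M x ## int_tm M y.
Proof. reflexivity. Qed.
Lemma int_id1 o (A : ity L o) : int_tm M (tid A) = idn (int_ity M A).
Proof. reflexivity. Qed.
Lemma int_sym1 o (A : ity L o) t (B : ity L t) :
  int_tm M (tsym A B) = swap Y (int_ity M A) (int_ity M B).
Proof. reflexivity. Qed.

Lemma int_app o t (f : fgen L o t) x : int_tm M (tapp f x) = reindex_ar p (m_ar M f) (int_tm M x).
Proof. reflexivity. Qed.
Lemma int_iten o x y : int_tm M (titen o x y) = fib_ar p (m_ob M o) (int_tm M x) (int_tm M y).
Proof. reflexivity. Qed.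
Lemma int_nab o t (f : fgen L o t) (A : ity L o) : int_tm M (tnab f A) = lift p (m_ar M f) (int_ity M A).
Proof. reflexivity. Qed.
Lemma int_mul o (A B : ity L o) :
  int_tm M (tmul A B) = lift p (mul (m_ob M o)) (int_ity M A ** int_ity M B).
Proof. reflexivity. Qed.
Lemma int_unt o : int_tm M (tunt o) = lift p (unt (m_ob M o)) one.
Proof. reflexivity. Qed.
Lemma int_dup o (A : ity L o) : int_tm M (tdup A) = diag Y (int_ity M A).
Proof. reflexivity. Qed.
Lemma int_del o (A : ity L o) : int_tm M (tdel A) = bang Y (int_ity M A).
Proof. reflexivity. Qed.
Lemma ity_app o t (f : fgen L o t) (A : ity L o) :
  int_ity M (iapp f A) = reindex_ob p (m_ar M f) (int_ity M A).
Proof. reflexivity. Qed.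
Lemma ity_ten o (A B : ity L o) :
  int_ity M (iten A B) = fib_ob p (m_ob M o) (int_ity M A) (int_ity M B).
Proof. reflexivity. Qed.

Lemma int_over o (A : ity L o) : s_ob p (int_ity M A) = m_ob M o.
Proof.
induction A; simpl int_ity.
- apply (fib_unit_over Hp).
- apply (om_col (mod_opf HM)).
- rewrite (reindex_proj Hp); rewrite ?m_ar_src, ?m_ar_tgt; auto.
- apply (fib_ob_over Hp); assumption.
Qed.

Lemma int_ieq o (A B : ity L o) : ieq E0 A B -> int_ity M A = int_ity M B.
Proof.
induction 1; simpl int_ity; try congruence.
- apply (mod_E0 HM), H.
- apply (fib_ob_assoc HB Hp); apply int_over.
- apply (fib_ob_unitl HB Hp), int_over.
- apply (fib_ob_unitr HB Hp), int_over.
- apply (reindex_fib_ob HB Hp (m_ar M f) (m_ar_src f) (m_ar_tgt f) (m_ar_mul f)); apply int_over.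
- apply (reindex_fib_unit Hp (m_ob M t) (m_ar M f) (m_ar_src f) (m_ar_unt f)).
Qed.

Definition int_ty (U : ty L) : ob Y :=
  fold_right (fun A y => int_ity M (projT2 A) ** y) one U.

Lemma int_ty_app U V : int_ty (U ++ V) = int_ty U ** int_ty V.
Proof.
induction U as [|A U IH]; simpl; [symmetry; apply mon_unitl_ob|].
rewrite IH. symmetry; apply mon_assoc_ob.
Qed.
Lemma int_ty_sg o (A : ity L o) : int_ty (sg A) = int_ity M A.
Proof. apply mon_unitr_ob. Qed.
Lemma int_ty_teq U V : teq E0 U V -> int_ty U = int_ty V.
Proof.
induction 1 as [|A B U V e _ IH]; [reflexivity|]. simpl. rewrite IH.
destruct e as [o A B e]. simpl. rewrite (int_ieq e). reflexivity.
Qed.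

Lemma int_word o (a : list (col (msig L o))) : m_word M o a = int_ity M (iword L o a).
Proof.
induction a as [|c a IH]; [reflexivity|].
exact (f_equal (fib_ob M (m_ob M o) (m_col M c)) IH).
Qed.

Lemma int_iterm x o (A B : ity L o) : iterm x A B ->
  src (int_tm M x) = int_ity M A /\ tgt (int_tm M x) = int_ity M B /\
  s_ar p (int_tm M x) = idn (m_ob M o).
Proof.
induction 1; rewrite ?int_id1, ?int_app, ?int_iten, ?int_comp, ?ity_app, ?ity_ten.
- rewrite cat_src_id, cat_tgt_id. split; [reflexivity|]. split; [reflexivity|].
  apply (vert_idn Hp), int_over.
- split; [|split].
  + rewrite <- int_word. apply (om_gen_src (mod_opf HM)).
  + rewrite <- int_word. apply (om_gen_tgt (mod_opf HM)).
  + apply (om_gen (mod_opf HM)).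
- destruct IHiterm as [e1 [e2 e3]]. rewrite <- m_ar_src with (f := f) in e3.
  pose proof (reindex_spec HB Hp (m_ar M f) _ e3) as [a1 [a2 [a3 _]]].
  rewrite m_ar_tgt in a3. rewrite a1, a2, a3, e1, e2. auto.
- destruct IHiterm1 as [e1 [e2 e3]], IHiterm2 as [e4 [e5 e6]].
  pose proof (fib_ar_spec HB Hp _ _ _ e3 e6) as [a1 [a2 [a3 _]]].
  rewrite a1, a2, a3, e1, e2, e4, e5. auto.
- destruct IHiterm1 as [e1 [e2 e3]], IHiterm2 as [e4 [e5 e6]].
  rewrite cat_src_comp, cat_tgt_comp by congruence. split; [exact e1|]. split; [exact e5|].
  rewrite (fun_comp Hf) by congruence. rewrite e3, e6. apply (cat_idl' (C := Bm)).
  apply (cat_src_id (C := Bm)).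
- rewrite <- (int_ieq H), <- (int_ieq H0). exact IHiterm.
Qed.

Lemma int_vert x o (A B : ity L o) : iterm x A B -> s_ar p (int_tm M x) = idn (m_ob M o).
Proof. intros H; apply (int_iterm H). Qed.
Lemma int_isrc x o (A B : ity L o) : iterm x A B -> src (int_tm M x) = int_ity M A.
Proof. intros H; apply (int_iterm H). Qed.
Lemma int_itgt x o (A B : ity L o) : iterm x A B -> tgt (int_tm M x) = int_ity M B.
Proof. intros H; apply (int_iterm H). Qed.

Lemma over_nab o t (f : fgen L o t) (A : ity L o) : s_ob p (int_ity M A) = src (m_ar M f).
Proof. rewrite m_ar_src. apply int_over. Qed.
Arguments over_nab {o t} f A.
Lemma over_mult o (A B : ity L o) :
  s_ob p (int_ity M A ** int_ity M B) = src (mul (m_ob M o)).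
Proof. apply (over_mul Hp); apply int_over. Qed.

Lemma int_nab_src o t (f : fgen L o t) (A : ity L o) : src (int_tm M (tnab f A)) = int_ity M A.
Proof. apply (lift_src Hp), over_nab. Qed.
Arguments int_nab_src {o t} f A.
Lemma int_mul_src o (A B : ity L o) : src (int_tm M (tmul A B)) = int_ity M A ** int_ity M B.
Proof. apply (lift_src Hp), over_mult. Qed.
Lemma int_unt_src (o : layer L) : src (int_tm M (tunt o)) = one.
Proof. apply (lift_src Hp), (over_unt Hp). Qed.

Lemma int_term x U V : term x U V -> src (int_tm M x) = int_ty U /\ tgt (int_tm M x) = int_ty V.
Proof.
induction 1; rewrite ?int_ty_app, ?int_ty_sg.
- destruct (int_iterm H) as [e1 [e2 _]]. auto.
- destruct IHterm1, IHterm2. simpl int_tm. rewrite cat_src_comp, cat_tgt_comp by congruence. auto.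
- simpl int_tm. rewrite cat_src_id, cat_tgt_id. auto.
- destruct IHterm1, IHterm2. simpl int_tm. rewrite mon_src, mon_tgt. split; congruence.
- simpl int_tm. rewrite swap_src, swap_tgt. auto.
- split; [apply int_nab_src|reflexivity].
- split; [apply int_mul_src|reflexivity].
- split; [apply int_unt_src|reflexivity].
- simpl int_tm. rewrite diag_src, diag_tgt. auto.
- simpl int_tm. rewrite bang_src, bang_tgt. auto.
- rewrite <- (int_ty_teq H), <- (int_ty_teq H0). exact IHterm.
Qed.

Lemma int_src x U V : term x U V -> src (int_tm M x) = int_ty U.
Proof. intros H; apply (int_term H). Qed.
Lemma int_tgt x U V : term x U V -> tgt (int_tm M x) = int_ty V.
Proof. intros H; apply (int_term H). Qed.

Lemma int_id_l U : int_tm M (tid_l U) = idn (int_ty U).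
Proof.
induction U as [|A U IH]; [reflexivity|]. simpl tid_l. rewrite int_ten, IH, int_id1. apply mon_id.
Qed.
Lemma int_sym1_l o (A : ity L o) U : int_tm M (tsym1_l (ex A) U) = swap Y (int_ity M A) (int_ty U).
Proof.
induction U as [|[t B] U IH]; simpl tsym1_l.
- rewrite int_id1. symmetry; apply swap_oner.
- rewrite int_comp, !int_ten. simpl projT2. rewrite IH, int_id_l, int_id1, int_sym1.
  symmetry; apply swap_hex.
Qed.
Lemma int_sym_l U V : int_tm M (tsym_l U V) = swap Y (int_ty U) (int_ty V).
Proof.
induction U as [|[o A] U IH]; simpl tsym_l.
- rewrite int_id_l. symmetry; apply swap_onel.
- rewrite int_comp, !int_ten, IH, int_id_l, int_id1, int_sym1_l. symmetry; apply swap_hex'.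
Qed.
Lemma int_dup_l U : int_tm M (tdup_l U) = diag Y (int_ty U).
Proof.
induction U as [|[o A] U IH]; simpl tdup_l.
- symmetry; apply diag_one.
- rewrite int_comp, !int_ten, IH, int_id_l, int_id1, int_sym1_l. symmetry; apply diag_tensor.
Qed.
Lemma int_del_l U : int_tm M (tdel_l U) = bang Y (int_ty U).
Proof.
induction U as [|[o A] U IH]; simpl tdel_l.
- symmetry; apply bang_one.
- rewrite int_ten, IH. symmetry; apply bang_tensor.
Qed.

(** Cartesian equations hold in every cartesian category and those on internal terms are fibrewise
    laws. Each remaining equation identifies two composites of chosen liftings or is a defining
    square of reindexing. *)
Lemma int_tmeq x y : tmeq x y -> int_tm M x = int_tm M y.
Proof.
intros e; induction e.
- reflexivity.
- congruence.
- congruence.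
- rewrite ?int_comp, ?int_ten, ?int_app, ?int_iten; congruence.
- rewrite ?int_comp, ?int_ten, ?int_app, ?int_iten; congruence.
- rewrite ?int_comp, ?int_ten, ?int_app, ?int_iten; congruence.
- rewrite ?int_comp, ?int_ten, ?int_app, ?int_iten; congruence.
- exact (mod_E1 HM _ _ H).
- rewrite !int_comp. apply cat_assoc.
  + rewrite (int_tgt H), (int_src H0); reflexivity.
  + rewrite (int_tgt H0), (int_src H1); reflexivity.
- rewrite int_comp, int_id_l. apply cat_idl', (int_src H).
- rewrite int_comp, int_id_l. apply cat_idr', (int_tgt H).
- apply mon_assoc_ar.
- apply mon_unitl_ar.
- apply mon_unitr_ar.
- rewrite !int_comp, !int_ten, !int_comp. apply mon_comp.
  + rewrite (int_tgt H), (int_src H0); reflexivity.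
  + rewrite (int_tgt H1), (int_src H2); reflexivity.
- exact (fib_ar_assoc HB Hp _ _ _ _ (int_vert H) (int_vert H0) (int_vert H1)).
- exact (fib_ar_unitl HB Hp _ _ (int_vert H)).
- exact (fib_ar_unitr HB Hp _ _ (int_vert H)).
- apply (fib_ar_cmp HB Hp _ _ _ _ _ (int_vert H) (int_vert H0) (int_vert H1) (int_vert H2)).
  + rewrite (int_itgt H), (int_isrc H0); reflexivity.
  + rewrite (int_itgt H1), (int_isrc H2); reflexivity.
- symmetry. exact (fib_ar_idn HB Hp _ _ (int_over A) (int_over B)).
- exact (reindex_idn HB Hp _ _ (over_nab f A)).
- rewrite int_app, !int_comp, !int_app. apply (reindex_cmp HB Hp); rewrite ?m_ar_src.
  + exact (int_vert H).
  + exact (int_vert H0).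
  + rewrite (int_itgt H), (int_isrc H0); reflexivity.
- exact (reindex_fib_ar HB Hp (m_ar M f) (m_ar_src f) (m_ar_tgt f) (m_ar_mul f) _ _
    (int_vert H) (int_vert H0)).
- rewrite int_app, !int_id1, (reindex_idn HB Hp) by apply (over_nab f (iunit o)). f_equal.
  exact (reindex_fib_unit Hp (m_ob M t) (m_ar M f) (m_ar_src f) (m_ar_unt f)).
- rewrite int_comp, !int_sym_l, int_id_l, int_ty_app. apply swap_inv.
- rewrite !int_comp, !int_ten, !int_sym_l.
  rewrite <- (int_src H), <- (int_src H0), <- (int_tgt H), <- (int_tgt H0). apply swap_nat.
- apply diag_assoc.
- apply diag_unitl.
- apply diag_unitr.
- rewrite !int_comp, !int_ten, !int_dup_l, <- (int_src H), <- (int_tgt H). apply diag_nat.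
- rewrite !int_comp, !int_del_l, <- (int_src H), <- (int_tgt H). apply bang_nat.
- exact (lift_mul_assoc HB Hp _ _ _ (int_over A) (int_over B) (int_over C)).
- exact (lift_mul_unitl HB Hp _ (int_over A)).
- exact (lift_mul_unitr HB Hp _ (int_over A)).
(* Naturality of [m], and of [nabla] in the next case, is the square by which the action on vertical
   arrows was defined. *)
- pose proof (fib_ar_spec HB Hp _ _ _ (int_vert H) (int_vert H0)) as [_ [_ [_ n]]].
  rewrite (int_isrc H), (int_isrc H0), (int_itgt H), (int_itgt H0) in n. symmetry; exact n.
- pose proof (int_vert H) as v. rewrite <- m_ar_src with (f := f) in v.
  pose proof (reindex_spec HB Hp (m_ar M f) _ v) as [_ [_ [_ n]]].
  rewrite (int_isrc H), (int_itgt H) in n. symmetry; exact n.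
- exact (lift_mul_comp HB Hp (m_ar M f) (m_ar_src f) (m_ar_tgt f) (m_ar_mul f) _ _
    (int_over A) (int_over B)).
- exact (lift_unt_comp Hp (m_ob M t) (m_ar M f) (m_ar_src f) (m_ar_unt f)).
Qed.

(** * The functor between bases induced by a model *)

Fixpoint path_int o t (q : path L o t) : ar Bm :=
  match q with
  | pnil o => idn (m_ob M o)
  | pcons f q => m_ar M f ;; path_int q
  end.
Lemma path_int_nil o : path_int (pnil o) = idn (m_ob M o).
Proof. reflexivity. Qed.
Lemma path_int_cons o t r (f : fgen L o t) (q : path L t r) :
  path_int (pcons f q) = m_ar M f ;; path_int q.
Proof. reflexivity. Qed.
Definition base_gen (f : ar X) : ar Bm := path_int (pa_path f).
Definition base_ob (o : ob X) : ob Bm := m_ob M o.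

Lemma path_int_sort o t (q : path L o t) :
  src (path_int q) = m_ob M o /\ tgt (path_int q) = m_ob M t.
Proof.
induction q as [o|o t r f q [IH1 IH2]]; rewrite ?path_int_nil, ?path_int_cons.
- split; [apply (cat_src_id (C := Bm))|apply (cat_tgt_id (C := Bm))].
- assert (e : tgt (m_ar M f) = src (path_int q)) by (rewrite IH1; apply m_ar_tgt).
  split.
  + refine (eq_trans (cat_src_comp (C := Bm) _ _ e) _). apply m_ar_src.
  + refine (eq_trans (cat_tgt_comp (C := Bm) _ _ e) _). exact IH2.
Qed.
Lemma base_src f : src (base_gen f) = base_ob (src f).
Proof. apply (path_int_sort (pa_path f)). Qed.
Lemma base_tgt f : tgt (base_gen f) = base_ob (tgt f).
Proof. apply (path_int_sort (pa_path f)). Qed.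
Lemma base_id o : base_gen (idn o) = idn (base_ob o).
Proof. reflexivity. Qed.
Lemma path_int_app o t r (q : path L o t) (q' : path L t r) :
  path_int (papp q q') = path_int q ;; path_int q'.
Proof.
induction q as [o|o t s f q IH].
- symmetry. apply (cat_idl' (C := Bm)). apply path_int_sort.
- rewrite papp_cons. rewrite ?path_int_nil, ?path_int_cons. rewrite IH. symmetry. apply (cat_assoc (C := Bm)).
  + rewrite (proj1 (path_int_sort q)). apply m_ar_tgt.
  + rewrite (proj2 (path_int_sort q)). symmetry; apply path_int_sort.
Qed.
Lemma base_comp f g : tgt f = src g -> base_gen (f ;; g) = base_gen f ;; base_gen g.
Proof.
destruct f as [o t q], g as [t' r q']. intros e; simpl in e; subst t'.
rewrite free_comp. apply path_int_app.
Qed.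
Lemma base_mul f : mul (base_ob (src f)) ;; base_gen f =
  (base_gen f ## base_gen f) ;; mul (base_ob (tgt f)).
Proof.
destruct f as [o t q].
change (mul (m_ob M o) ;; path_int q = (path_int q ## path_int q) ;; mul (m_ob M t)).
induction q as [o|o t r f q IH].
- rewrite ?path_int_nil, ?path_int_cons. rewrite (mon_id (C := Bm)).
  refine (eq_trans (cat_idr' (C := Bm) _ _ _) (eq_sym (cat_idl' (C := Bm) _ _ _))).
  + apply fim_mul_tgt.
  + apply fim_mul_src.
- rewrite ?path_int_nil, ?path_int_cons. pose proof (path_int_sort q) as [q1 q2].
  assert (e : tgt (m_ar M f) = src (path_int q)) by (rewrite q1; apply m_ar_tgt).
  rewrite (mon_comp (C := Bm)) by exact e.
  refine (eq_trans (eq_sym (cat_assoc (C := Bm) _ _ _ _ e)) _).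
  { rewrite m_ar_src. apply fim_mul_tgt. }
  rewrite m_ar_mul.
  refine (eq_trans (cat_assoc (C := Bm) _ _ _ _ _) _).
  { rewrite (mon_tgt (C := Bm)), m_ar_tgt, fim_mul_src. reflexivity. }
  { rewrite q1. apply fim_mul_tgt. }
  rewrite IH. symmetry. apply (cat_assoc (C := Bm)).
  + rewrite (mon_tgt (C := Bm)), (mon_src (C := Bm)), e. reflexivity.
  + rewrite (mon_tgt (C := Bm)), q2, fim_mul_src. reflexivity.
Qed.

Local Notation HI := (fim_indexed_monoids (m_base M)).
Definition base_functor : sfun (fim X) Bm := free_functor X Bm base_ob base_gen.

Lemma base_functor_ok : imon_functor (fim X) Bm base_functor.
Proof.
exact (free_functor_ok X HB HI (@fim_sym_swap (m_base M)) base_ob base_gen base_src base_tgt base_id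
  base_comp base_mul).
Qed.
Lemma base_functor_cl r w v : fim_sort r w v ->
  s_ar base_functor (fcl r) = free_raw Bm base_ob base_gen r.
Proof.
exact (fun H => free_functor_cl HB HI base_ob base_gen base_src base_tgt base_id base_comp base_mul H).
Qed.
(** The data prescribe [Q] on edges, whereas the generators of the free base are whole paths;
    [fe_gen_comp] writes a path as a composite of edges. *)
Lemma base_functor_uniq (Q : sfun (fim X) Bm) : imon_functor (fim X) Bm Q ->
  (forall o, s_ob Q (fo X o) = m_ob M o) ->
  (forall o t (f : fgen L o t), s_ar Q (fim_gen X (edge f)) = m_ar M f) -> Q = base_functor.
Proof.
intros HQ Ho Hg.
apply (free_functor_uniq HB HI base_ob base_gen base_src base_tgt base_id base_comp base_mul HQ Ho).
intros [o t q]. induction q as [o|o t r f q IH].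
- change (PathAr (pnil o)) with (@idn X o).
  rewrite fim_gen_cl.
  rewrite (fcl_eq (fe_gen_id X o) (fs_gen X (idn (o : ob X))) (fs_id X o)), fcl_id1.
  destruct HQ as [[[_ _ F3 _] _ _ _] _]. rewrite F3. rewrite Ho. reflexivity.
- assert (E : fim_gen X (PathAr (pcons f q)) = fim_gen X (edge f) ;; fim_gen X (PathAr q)).
  { rewrite !fim_gen_cl, <- (fcl_comp (fs_gen X (edge f)) (fs_gen X (PathAr q))).
    pose proof (fe_gen_comp X (edge f) (PathAr q) eq_refl) as G.
    unfold edge in G. rewrite free_comp in G. simpl papp in G.
    exact (fcl_eq G (fs_gen X (PathAr (pcons f q))) (fs_comp (fs_gen X (edge f)) (fs_gen X (PathAr q)))). }
  rewrite E. destruct HQ as [[[_ _ _ F4] _ _ _] _]. rewrite F4, Hg, IH; [reflexivity|].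
  rewrite !fim_gen_cl, (fcl_tgt (fs_gen X _)), (fcl_src (fs_gen X _)). reflexivity.
Qed.

Local Notation fraw := (free_raw Bm base_ob base_gen).

Lemma int_iproj x o (A B : ity L o) : iterm x A B -> fraw (tm_proj x) = idn (m_ob M o).
Proof.
induction 1; try reflexivity; try assumption.
simpl. rewrite IHiterm1, IHiterm2. apply (cat_idl' (C := Bm)). apply (cat_src_id (C := Bm)).
Qed.

Lemma int_proj x U V : term x U V -> s_ar p (int_tm M x) = fraw (tm_proj x).
Proof.
induction 1; simpl tm_proj; simpl free_raw.
- rewrite (int_iproj H). exact (int_vert H).
- rewrite int_comp, (fun_comp Hf), IHterm1, IHterm2; [reflexivity|].
  rewrite (int_tgt H), (int_src H0). reflexivity.
- exact (eq_trans (fun_id Hf one) (f_equal (@idn Bm) (smf_one Hm))).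
- rewrite int_ten, (smf_ar Hm), IHterm1, IHterm2. reflexivity.
- rewrite int_sym1, (preserves_swap _ _ Hm), !int_over. reflexivity.
- rewrite int_nab, (lift_proj Hp) by apply over_nab.
  symmetry. apply (cat_idr' (C := Bm)). apply m_ar_tgt.
- rewrite int_mul. apply (lift_proj Hp), over_mult.
- rewrite int_unt. apply (lift_proj Hp), (over_unt Hp).
- rewrite int_dup, (preserves_diag _ _ Hm), int_over. reflexivity.
- rewrite int_del, (preserves_bang _ _ Hm), int_over. reflexivity.
- exact IHterm.
Qed.

Lemma int_ty_over U : s_ob p (int_ty U) = free_ob X Bm base_ob (ty_layers U).
Proof.
induction U as [|[o A] U IH]; [exact (smf_one Hm)|].
simpl. refine (eq_trans (smf_ob Hm _ _) _). simpl projT2. rewrite int_over.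
exact (f_equal (fun u => m_ob M o ++ u) IH).
Qed.

Lemma int_path_lift o t (q : path L o t) A B x : path_lift q A B x ->
  int_tm M x = lift p (path_int q) (int_ity M A).
Proof.
induction 1; rewrite ?path_int_nil, ?path_int_cons.
- symmetry. exact (lift_id Hp _ (int_over A)).
- rewrite (lift_comp Hp); rewrite ?m_ar_src, ?m_ar_tgt; [|apply int_over|symmetry; apply path_int_sort].
  rewrite int_comp, IHpath_lift. reflexivity.
Qed.

Lemma free_sort' r w v : fim_sort r w v ->
  src (fraw r) = free_ob X Bm base_ob w /\ tgt (fraw r) = free_ob X Bm base_ob v.
Proof. intros H. exact (free_sort HB HI base_ob base_gen base_src base_tgt H). Qed.

(** Symmetries, diagonals and deletions are interpreted by the cartesian structure of the model, not
    by liftings; the two agree because the liftings of such maps are forced. The tensor case uses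
    the split compatibility of liftings with products. *)
Lemma int_lift r U V x : is_lift r U V x -> int_tm M x = lift p (fraw r) (int_ty U).
Proof.
induction 1; rewrite ?int_ty_app, ?int_ty_sg.
- exact (int_path_lift H).
- symmetry. exact (lift_id Hp _ (int_over A)).
- symmetry. exact (lift_id Hp _ (smf_one Hm)).
- destruct (is_lift_term H) as [K1 [K2 _]], (is_lift_term H0) as [K3 [K4 _]].
  rewrite int_comp. change (fraw (h ;f k)) with (fraw h ;; fraw k). rewrite (lift_comp Hp).
  + rewrite <- IHis_lift1. f_equal. rewrite IHis_lift2. f_equal.
    unfold reindex_ob. rewrite <- IHis_lift1. symmetry; exact (int_tgt K1).
  + rewrite int_ty_over. symmetry; apply (free_sort' K2).
  + rewrite (proj2 (free_sort' K2)). symmetry; apply (free_sort' K4).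
- destruct (is_lift_term H) as [K1 [K2 _]], (is_lift_term H0) as [K3 [K4 _]].
  rewrite int_ten. change (fraw (h *f k)) with (fraw h ## fraw k). rewrite (lift_ten Hp).
  + rewrite <- IHis_lift1, <- IHis_lift2. reflexivity.
  + rewrite int_ty_over. symmetry; apply (free_sort' K2).
  + rewrite int_ty_over. symmetry; apply (free_sort' K4).
- symmetry. exact (lift_swap HB Hp _ _ (int_over A) (int_over B)).
- symmetry. exact (lift_diag HB Hp _ (int_over A)).
- symmetry. exact (lift_bang HB Hp _ (int_over A)).
- reflexivity.
- reflexivity.
Qed.
End Soundness.

(** * The universal property *)

Section OpfibrationMorphism.
Variables (Y Y' : mcat) (B B' : imcat) (HB : is_cartesian B) (HB' : is_cartesian B')
  (p : opfib Y B) (p' : opfib Y' B') (Hp : is_split_im_opfib p) (Hp' : is_split_im_opfib p')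
  (P : sfun Y Y') (Q : sfun B B') (HP : is_functor P) (HQ : is_functor Q)
  (square_ob : forall y, s_ob p' (s_ob P y) = s_ob Q (s_ob p y))
  (square_ar : forall h, s_ar p' (s_ar P h) = s_ar Q (s_ar p h))
  (pres_lift : forall f y, s_ob p y = src f ->
     s_ar P (lift p f y) = lift p' (s_ar Q f) (s_ob P y)).
Let Hf : @is_functor Y B p := so_fun (io_split Hp).
Let Hf' : @is_functor Y' B' p' := so_fun (io_split Hp').
Instance mor_cart : is_cartesian Y := io_total Hp.
Instance mor_cart' : is_cartesian Y' := io_total Hp'.

Lemma preserves_over f y : s_ob p y = src f -> s_ob p' (s_ob P y) = src (s_ar Q f).
Proof. intros e. rewrite square_ob, e. symmetry; apply (fun_src HQ). Qed.

(** An opcartesian arrow is a chosen lifting followed by a vertical isomorphism, and both kinds of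
    arrow are preserved. *)
Lemma preserves_opcartesian h : opcartesian p h -> opcartesian p' (s_ar P h).
Proof.
intros Hh.
assert (e : s_ob p (src h) = src (s_ar p h)) by (symmetry; apply (fun_src Hf)).
destruct (opcartesian_factor Hf Hh (so_opcart (io_split Hp) _ _ e))
  as [u [[v [u' [a1 [a2 [a3 a4]]]]] [b1 [b2 b3]]]].
- symmetry; apply (lift_src Hp _ _ e).
- symmetry; apply (lift_proj Hp _ _ e).
- rewrite <- b3, (fun_comp HP), (pres_lift _ _ e) by congruence.
  apply (opcartesian_iso Hf').
  + apply (so_opcart (io_split Hp')), preserves_over, e.
  + split.
    * rewrite square_ar, v, (fun_id HQ), (fun_src HP), square_ob. reflexivity.
    * exists (s_ar P u'). rewrite !(fun_src HP), !(fun_tgt HP), <- !(fun_comp HP), a3, a4, !(fun_id HP)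
        by congruence. repeat split; congruence.
  + rewrite (fun_src HP), b1, <- (fun_tgt HP), (pres_lift _ _ e). reflexivity.
Qed.

Lemma preserves_reindex_ob f y : s_ob p y = src f ->
  s_ob P (reindex_ob p f y) = reindex_ob p' (s_ar Q f) (s_ob P y).
Proof. intros e. unfold reindex_ob. rewrite <- (fun_tgt HP), pres_lift by exact e. reflexivity. Qed.

Lemma preserves_reindex_ar f h : s_ar p h = idn (src f) ->
  s_ar P (reindex_ar p f h) = reindex_ar p' (s_ar Q f) (s_ar P h).
Proof.
intros e. pose proof (proj_src Hf h e) as e1. pose proof (proj_tgt Hf h e) as e2.
pose proof (reindex_spec HB Hp f h e) as [a1 [a2 [a3 a4]]].
symmetry. apply (reindex_uniq HB' Hp').
- rewrite square_ar, e, (fun_id HQ), (fun_src HQ). reflexivity.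
- rewrite !(fun_src HP), a1. apply preserves_reindex_ob, e1.
- rewrite !(fun_tgt HP), a2. apply preserves_reindex_ob, e2.
- rewrite square_ar, a3, (fun_id HQ), (fun_tgt HQ). reflexivity.
- rewrite (fun_src HP), (fun_tgt HP), <- !pres_lift, <- !(fun_comp HP), a4 by
    (assumption || rewrite ?a1, ?(lift_src Hp) by assumption; reflexivity).
  reflexivity.
Qed.
End OpfibrationMorphism.

Arguments preserves_over {Y Y' B B' p p' P Q} HQ square_ob.
Arguments preserves_reindex_ob {Y Y' B B' p p' P Q} HP pres_lift.

(** * Morphisms of im-opfibrations commute with interpretation *)

Section PreservesInterpretation.
Variables (T : theory) (M M' : model (th_sig T)) (HM : is_model T M) (HM' : is_model T M').
Local Notation L := (th_sig T).
Local Notation term := (term (th_E0 T)).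
Local Notation iterm := (iterm (th_E0 T)).
Local Notation Y := (m_total M).
Local Notation Y' := (m_total M').
Local Notation Bm := (fim (m_base M)).
Local Notation Bm' := (fim (m_base M')).
Local Notation p := (m_opfib M : opfib Y Bm).
Local Notation p' := (m_opfib M' : opfib Y' Bm').
Variables (P : sfun Y Y') (Q : sfun Bm Bm') (PQ : im_opfib_mor p p' P Q).
Hypotheses (Q_ob : forall o, s_ob Q (m_ob M o) = m_ob M' o)
  (Q_ar : forall o t (f : fgen L o t), s_ar Q (m_ar M f) = m_ar M' f)
  (Q_unt : forall o, s_ar Q (unt (m_ob M o)) = unt (m_ob M' o))
  (P_col : forall o (a : col (msig L o)), s_ob P (m_col M a) = m_col M' a)
  (P_gen : forall o a b (s : gen (msig L o) a b), s_ar P (m_gen M s) = m_gen M' s).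
Let Hp : is_split_im_opfib p := om_opfib (mod_opf HM).
Let Hp' : is_split_im_opfib p' := om_opfib (mod_opf HM').
Let HB : is_cartesian Bm := fim_cartesian (m_base M).
Let HB' : is_cartesian Bm' := fim_cartesian (m_base M').
Let HQ : @is_functor Bm Bm' Q := smf_fun (imf_mon (iom_base PQ)).
Let HP : @is_functor Y Y' P := smf_fun (iom_total PQ).
Let HPm : @strict_monoidal_functor Y Y' P := iom_total PQ.
Instance pres_cart : is_cartesian Y := io_total Hp.
Instance pres_cart' : is_cartesian Y' := io_total Hp'.

Lemma Q_mul o : s_ar Q (mul (m_ob M o)) = mul (m_ob M' o).
Proof. rewrite (imf_mul (iom_base PQ)), Q_ob. reflexivity. Qed.

Lemma pres_ob f y : s_ob p y = src f ->
  s_ob P (reindex_ob p f y) = reindex_ob p' (s_ar Q f) (s_ob P y).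
Proof. exact (preserves_reindex_ob HP (iom_lift PQ) f y). Qed.
Lemma pres_ar f h : s_ar p h = idn (src f) ->
  s_ar P (reindex_ar p f h) = reindex_ar p' (s_ar Q f) (s_ar P h).
Proof.
exact (preserves_reindex_ar HB HB' Hp Hp' HP HQ (iom_square_ar PQ) (iom_lift PQ) f h).
Qed.

Lemma preserves_int_ity o (A : ity L o) : s_ob P (int_ity M A) = int_ity M' A.
Proof.
induction A.
- refine (eq_trans (pres_ob (unt (m_ob M o)) one (over_unt Hp _)) _).
  rewrite Q_unt, (smf_one HPm). reflexivity.
- apply P_col.
- refine (eq_trans (pres_ob (m_ar M f) (int_ity M A) (over_nab HM _ f A)) _).
  rewrite Q_ar, IHA. reflexivity.
- refine (eq_trans (pres_ob (mul (m_ob M o)) _ (over_mult HM A1 A2)) _).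
  rewrite Q_mul, (smf_ob HPm), IHA1, IHA2. reflexivity.
Qed.

Lemma preserves_int_iterm x o (A C : ity L o) : iterm x A C -> s_ar P (int_tm M x) = int_tm M' x.
Proof.
induction 1.
- exact (eq_trans (fun_id HP _) (f_equal (@idn Y') (preserves_int_ity A))).
- apply P_gen.
- rewrite (int_app T), pres_ar, IHiterm, Q_ar; [reflexivity|].
  rewrite (m_ar_src HM). exact (int_vert HM H).
- rewrite (int_iten T). unfold fib_ar. rewrite pres_ar, Q_mul, (smf_ar HPm), IHiterm1, IHiterm2; [reflexivity|].
  rewrite (smf_ar (io_preserves Hp)), (int_vert HM H), (int_vert HM H0), fim_mul_src.
  apply (mon_id (C := Bm)).
- rewrite (int_comp T), (fun_comp HP), IHiterm1, IHiterm2; [reflexivity|].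
  rewrite (int_itgt HM H), (int_isrc HM H0). reflexivity.
- exact IHiterm.
Qed.

Lemma preserves_int_tm x U V : term x U V -> s_ar P (int_tm M x) = int_tm M' x.
Proof.
induction 1.
- exact (preserves_int_iterm H).
- rewrite (int_comp T), (fun_comp HP), IHterm1, IHterm2; [reflexivity|].
  rewrite (int_tgt HM H), (int_src HM H0). reflexivity.
- exact (eq_trans (fun_id HP _) (f_equal (@idn Y') (smf_one HPm))).
- rewrite (int_ten T), (smf_ar HPm), IHterm1, IHterm2. reflexivity.
- rewrite (int_sym1 T), (preserves_swap _ _ HPm), !preserves_int_ity. reflexivity.
- rewrite (int_nab T), (iom_lift PQ _ _ (over_nab HM _ f A)), Q_ar, preserves_int_ity. reflexivity.
- rewrite (int_mul T), (iom_lift PQ _ _ (over_mult HM A B)), Q_mul, (smf_ob HPm), !preserves_int_ity.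
  reflexivity.
- rewrite (int_unt T), (iom_lift PQ _ _ (over_unt Hp _)), Q_unt, (smf_one HPm). reflexivity.
- rewrite (int_dup T), (preserves_diag _ _ HPm), preserves_int_ity. reflexivity.
- rewrite (int_del T), (preserves_bang _ _ HPm), preserves_int_ity. reflexivity.
- exact IHterm.
Qed.

Lemma preserves_int_ty U : s_ob P (int_ty T M U) = int_ty T M' U.
Proof.
induction U as [|[o A] U IH]; [exact (smf_one HPm)|].
exact (eq_trans (smf_ob HPm _ _) (f_equal2 (@tob Y') (preserves_int_ity A) IH)).
Qed.
End PreservesInterpretation.

(** * The morphism from the syntactic model to a given model *)

Section Universal.
Variables (T : theory) (Hc : coherent T) (M : model (th_sig T)) (HM : is_model T M).
Local Notation L := (th_sig T).
Local Notation E0 := (th_E0 T).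
Local Notation term := (term E0).
Local Notation iterm := (iterm E0).
Local Notation S := (syn_mcat T).
Local Notation Y := (m_total M).
Local Notation X := (free_cat L).
Local Notation Bs := (fim X).
Local Notation Bm := (fim (m_base M)).
Local Notation ps := (syn_opfib T : opfib S Bs).
Local Notation p := (m_opfib M : opfib Y Bm).
Local Notation sty := (sty T).
Local Notation slet := (slet T).
Local Notation scl := (scl T).
Local Notation val_ty := (int_ty T M).
Local Notation Q := (base_functor T M).
Let Hp : is_split_im_opfib p := om_opfib (mod_opf HM).
Let Hs : is_split_im_opfib ps := syn_im_opfib Hc.
Let HB : is_cartesian Bm := fim_cartesian (m_base M).
Let HQ : imon_functor Bs Bm Q := base_functor_ok HM.
Instance universal_cart : is_cartesian Y := io_total Hp.

Definition int_functor : sfun S Y :=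
  SFun S Y (fun A : syn_ob T => val_ty (rep A)) (fun h : syn_ar T => int_tm M (st_raw (rep h))).
Local Notation P := int_functor.

Lemma int_functor_sty U : s_ob P (sty U) = val_ty U.
Proof. exact (int_ty_teq HM (sty_rep T U)). Qed.
Lemma int_functor_scl x U V : term x U V -> s_ar P (scl x) = int_tm M x.
Proof.
intros H. rewrite (scl_mk H).
destruct (rep_cls (sterm_equiv T) (STerm T H)) as [_ [_ e]]. exact (int_tmeq HM e).
Qed.

Lemma int_functor_ok : is_functor P.
Proof.
split.
- intros h. destruct (scl_surj' h) as [x [U [V [H [-> [e1 e2]]]]]].
  rewrite e1, int_functor_sty, (int_functor_scl H). exact (int_src HM H).
- intros h. destruct (scl_surj' h) as [x [U [V [H [-> [e1 e2]]]]]].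
  rewrite e2, int_functor_sty, (int_functor_scl H). exact (int_tgt HM H).
- intros A. destruct (sty_surj A) as [U ->].
  rewrite <- scl_id, (int_functor_scl (tid_l_sort E0 U)), int_functor_sty. apply (int_id_l HM).
- intros h k e. destruct (scl_surj' h) as [x [U [V [H [-> [e1 e2]]]]]].
  destruct (scl_surj k (U := V) (V := rep (tgt k))) as [y [H' ->]].
  { congruence. } { symmetry; apply cls_rep. }
  rewrite <- (scl_comp H H'), (int_functor_scl H), (int_functor_scl H'),
    (int_functor_scl (tm_comp H H')). reflexivity.
Qed.

Lemma int_functor_monoidal : @strict_monoidal_functor S Y P.
Proof.
split.
- exact int_functor_ok.
- exact (int_functor_sty []).
- intros A A'. destruct (sty_surj A) as [U ->], (sty_surj A') as [V ->].
  rewrite sty_app, !int_functor_sty. apply (int_ty_app HM).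
- intros h k. destruct (scl_surj' h) as [x [U [V [H [-> _]]]]].
  destruct (scl_surj' k) as [y [U' [V' [H' [-> _]]]]].
  rewrite <- (scl_ten H H'), (int_functor_scl H), (int_functor_scl H'),
    (int_functor_scl (tm_ten H H')). reflexivity.
Qed.

Lemma int_square_ob A : s_ob p (s_ob P A) = s_ob Q (s_ob ps A).
Proof.
destruct (sty_surj A) as [U ->]. rewrite int_functor_sty, (int_ty_over HM).
exact (f_equal (s_ob Q) (eq_sym (lay_sty T U))).
Qed.
Lemma int_square_ar h : s_ar p (s_ar P h) = s_ar Q (s_ar ps h).
Proof.
destruct (scl_surj' h) as [x [U [V [H [-> _]]]]].
rewrite (int_functor_scl H), (int_proj HM H).
refine (eq_sym (eq_trans (f_equal (s_ar Q) (syn_proj_scl (coh_proj Hc) H)) _)).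
exact (base_functor_cl HM (term_proj_sort H)).
Qed.

Lemma int_functor_lift f A : s_ob ps A = src f ->
  s_ar P (lift ps f A) = lift p (s_ar Q f) (s_ob P A).
Proof.
intros e. destruct (syn_lift_repr (T := T) f A e) as [r [Hr [Ef ->]]].
destruct (sty_surj A) as [U ->]. rewrite lay_sty in Hr.
destruct (is_lift_ex Hr U eq_refl) as [V [x [K _]]].
destruct (is_lift_term K) as [K1 [K2 <-]].
rewrite (int_functor_scl K1), (int_lift HM K), int_functor_sty, Ef, (base_functor_cl HM Hr).
reflexivity.
Qed.

Lemma int_functor_mor : im_opfib_mor ps p P Q.
Proof.
split.
- exact int_functor_monoidal.
- exact HQ.
- exact int_square_ob.
- exact int_square_ar.
- apply (preserves_opcartesian (fim_cartesian X) HB Hs Hp int_functor_ok (smf_fun (imf_mon HQ)) int_square_ob int_square_ar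
    int_functor_lift).
- exact int_functor_lift.
Qed.

Lemma base_edge o t (f : fgen L o t) : s_ar Q (fim_gen X (edge f)) = m_ar M f.
Proof.
rewrite fim_gen_cl, (base_functor_cl HM (fs_gen X (edge f))).
apply (cat_idr' (C := Bm)), (m_ar_tgt HM).
Qed.
Lemma base_letter o : s_ob Q (fo X o) = m_ob M o.
Proof. reflexivity. Qed.
(** [imon_functor] records preservation of multiplications; the value at units is read off the
    construction and supplies the hypothesis [Q_unt] of the preceding section. *)
Lemma base_unt (o : layer L) : s_ar Q (unt (fo X o)) = unt (m_ob M o).
Proof. rewrite <- fcl_unt. exact (base_functor_cl HM (fs_unt X o)). Qed.

Lemma int_functor_col o (a : col (msig L o)) : s_ob P (m_col (syn_model T) a) = m_col M a.
Proof. refine (eq_trans (int_functor_sty (sg (icol o a))) _). apply (int_ty_sg HM). Qed.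
Lemma int_functor_gen o a b (s : gen (msig L o) a b) :
  s_ar P (m_gen (syn_model T) s) = m_gen M s.
Proof.
set (K := tm_int (it_gen E0 o a b s)).
refine (eq_trans (f_equal (s_ar P) (eq_sym (scl_mk K))) _). exact (int_functor_scl K).
Qed.

Lemma int_ty_sty U : int_ty T (syn_model T) U = sty U.
Proof.
induction U as [|[o A] U IH]; [reflexivity|].
refine (eq_trans (f_equal2 (@tob S) (syn_int_ity T A) IH) _). symmetry; apply sty_cons.
Qed.

(** Any such morphism commutes with interpretation, and in the syntactic model every object and
    every arrow is the interpretation of a type or term. The base component is settled beforehand by
    freeness. *)
Lemma int_functor_uniq (P' : sfun S Y) (Q' : sfun Bs Bm) : im_opfib_mor ps p P' Q' ->
  (forall o, s_ob Q' (fo X o) = m_ob M o) ->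
  (forall o t (f : fgen L o t), s_ar Q' (fim_gen X (edge f)) = m_ar M f) ->
  (forall o (a : col (msig L o)), s_ob P' (m_col (syn_model T) a) = m_col M a) ->
  (forall o a b (s : gen (msig L o) a b), s_ar P' (m_gen (syn_model T) s) = m_gen M s) ->
  P' = P /\ Q' = Q.
Proof.
intros H h1 h2 h3 h4. pose proof (base_functor_uniq HM (iom_base H) h1 h2). subst Q'.
split; [|reflexivity].
assert (eo : forall U, s_ob P' (sty U) = val_ty U).
{ intros U. rewrite <- int_ty_sty.
  apply (preserves_int_ty (syn_is_model Hc) H h1 h2 base_unt h3). }
assert (ea : forall x U V, term x U V -> s_ar P' (scl x) = int_tm M x).
{ intros x U V K. rewrite <- (syn_int_tm Hc K).
  exact (preserves_int_tm (syn_is_model Hc) HM H h1 h2 base_unt h3 h4 K). }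
destruct P' as [Po Pa]. unfold int_functor. f_equal.
- apply functional_extensionality. intros A. rewrite <- (cls_rep A) at 1. apply eo.
- apply functional_extensionality. intros h. rewrite <- (cls_rep h) at 1.
  destruct (rep h) as [U V x K]. simpl. rewrite <- (ea x U V K), (scl_mk K). reflexivity.
Qed.
End Universal.

(** * Restriction of a model along a morphism of signatures *)

Section Restriction.
Variables (L L' : lsig) (F : lsig_mor L L') (N : model L').

Definition restrict : model L :=
  @Model L (m_base N) (m_total N) (m_opfib N) (fun o => m_layer N (lm_layer F o))
    (fun o t f => m_fgen N (lm_fgen F f)) (fun o c => m_col N (mm_col (lm_msig F o) c))
    (fun o a b s => m_gen N (mm_gen (lm_msig F o) s)).

Lemma restrict_ity o (A : ity L o) : int_ity restrict A = int_ity N (map_ity F A).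
Proof.
induction A.
- reflexivity.
- reflexivity.
- exact (f_equal (reindex_ob N (m_ar N (lm_fgen F f))) IHA).
- exact (f_equal2 (fib_ob N (m_ob N (lm_layer F o))) IHA1 IHA2).
Qed.

Lemma restrict_tm x : int_tm restrict x = int_tm N (map_tm F x).
Proof.
induction x.
- exact (f_equal (@idn (m_total N)) (restrict_ity A)).
- reflexivity.
- exact (f_equal (reindex_ar N (m_ar N (lm_fgen F f))) IHx).
- exact (f_equal2 (fib_ar N (m_ob N (lm_layer F o))) IHx1 IHx2).
- exact (f_equal2 (@comp (m_total N)) IHx1 IHx2).
- reflexivity.
- exact (f_equal2 (@tar (m_total N)) IHx1 IHx2).
- exact (f_equal2 (swap (m_total N)) (restrict_ity A) (restrict_ity B)).
- exact (f_equal (lift N (m_ar N (lm_fgen F f))) (restrict_ity A)).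
- exact (f_equal2 (fun y z => lift N (mul (m_ob N (lm_layer F o))) (y ** z))
    (restrict_ity A) (restrict_ity B)).
- reflexivity.
- exact (f_equal (diag (m_total N)) (restrict_ity A)).
- exact (f_equal (bang (m_total N)) (restrict_ity A)).
Qed.

Lemma restrict_word o (a : list (col (msig L o))) :
  m_word restrict o a = m_word N (lm_layer F o) (map (mm_col (lm_msig F o)) a).
Proof.
induction a as [|c a IH]; [reflexivity|].
exact (f_equal (fib_ob N (m_ob N (lm_layer F o)) (m_col N (mm_col (lm_msig F o) c))) IH).
Qed.
End Restriction.

(** Restriction leaves the opfibration alone and changes the interpretation functions. Since [F]
    sends each equation to an equation of [K], validity in [N] gives validity in the restriction. *)
Lemma restrict_is_model (T K : theory) (F : theory_mor T K) (N : model (th_sig K)) :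
  is_model K N -> is_model T (restrict (proj1_sig F) N).
Proof.
destruct F as [F [F0 F1]]; intros [[B O s t c gs gt g] h0 h1]; simpl. split.
- split; simpl; intros; auto.
  + refine (eq_trans (gs _ _ _ _) _). symmetry; apply restrict_word.
  + refine (eq_trans (gt _ _ _ _) _). symmetry; apply restrict_word.
- intros o A A' e. rewrite !restrict_ity. apply h0, F0, e.
- intros x y e. rewrite !restrict_tm. apply h1, F1, e.
Qed.

(** * The left adjoint and the adjunction *)

Definition syn_object (T : theory) (c : coherent T) : theory_model :=
  TheoryModel (syn_is_model c).

Lemma syn_universal (T : theory) (c : coherent T) (N : theory_model)
  (F : theory_mor T (tm_theory N)) :
  exists H : model_mor (syn_object c) N, mo_theory (proj1_sig H) = F /\
    forall H' : model_mor (syn_object c) N, mo_theory (proj1_sig H') = F -> H' = H.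
Proof.
destruct N as [K N HN]; simpl in F.
pose proof (restrict_is_model F HN) as HM.
set (M := restrict (proj1_sig F) N) in HM.
(* A morphism to [N] above [F] is the same data as a morphism to the restriction [M] that respects
   the interpretation functions; the clauses coincide by conversion. *)
assert (K1 : is_model_mor (ModelMorData (syn_object c) (TheoryModel HN) F
  (int_functor T M) (base_functor T M))).
{ split.
  - exact (int_functor_mor c HM).
  - exact (base_letter T M).
  - exact (base_edge HM).
  - exact (int_functor_col HM).
  - exact (int_functor_gen HM). }
exists (exist _ _ K1). split; [reflexivity|].
intros [[F' P Q] [h1 h2 h3 h4 h5]] e; simpl in *. subst F'.
destruct (int_functor_uniq c HM h1 h2 h3 h4 h5) as [e1 e2].
apply model_mor_ext; simpl; auto.
Qed.

Definition syn_lift_mor (T : theory) (c : coherent T) (N : theory_model)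
  (F : theory_mor T (tm_theory N)) : model_mor (syn_object c) N :=
  proj1_sig (constructive_indefinite_description _ (syn_universal c N F)).

Lemma syn_lift_mor_theory T c N F : mo_theory (proj1_sig (@syn_lift_mor T c N F)) = F.
Proof. exact (proj1 (proj2_sig (constructive_indefinite_description _ (syn_universal c N F)))). Qed.

(** Both morphisms coincide with the one given by [syn_universal] for their common theory component.
    This reduces all later equations between morphisms out of syntactic models to equations between
    theory morphisms. *)
Lemma syn_mor_eq T c N (H H' : model_mor (@syn_object T c) N) :
  mo_theory (proj1_sig H) = mo_theory (proj1_sig H') -> H = H'.
Proof.
intros e. destruct (syn_universal c N (mo_theory (proj1_sig H))) as [H0 [_ U]].
rewrite (U H eq_refl). symmetry; apply U. symmetry; exact e.
Qed.

(** A morphism of theories is sent to its unique extension into the syntactic model of the codomain,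
    so the functor laws hold because they hold for theory components. *)
Definition syn_functor : functor (full_sub OpFTh coherent)
    (full_sub OpFThMod (fun M => coherent (forget M))).
Proof.
refine (@Functor (full_sub OpFTh coherent) (full_sub OpFThMod (fun M => coherent (forget M)))
  (fun T => exist (fun M => coherent (forget M)) (syn_object (proj2_sig T)) (proj2_sig T))
  (fun T K F => syn_lift_mor (proj2_sig T) (syn_object (proj2_sig K)) F) _ _).
- intros T. apply syn_mor_eq. exact (syn_lift_mor_theory _ _ _).
- intros T K J F G. apply syn_mor_eq.
  refine (eq_trans (syn_lift_mor_theory _ _ _) _). simpl. rewrite !syn_lift_mor_theory. reflexivity.
Defined.
Theorem theorem6p10 :
  (forall T : theory, internal_equations T -> coherent T) /\
  exists syn_ok : forall T : theory, coherent T -> is_model T (syn_model T),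
  exists G : functor (full_sub OpFTh coherent)
                     (full_sub OpFThMod (fun M => coherent (forget M))),
    (forall (T : theory) (c : coherent T),
       proj1_sig (G (exist _ T c)) = TheoryModel (syn_ok T c)) /\
    left_adjoint G (full_sub_functor forget coherent).
Proof.
split; [exact internal_coherent|].
exists (fun T c => syn_is_model c), syn_functor. split; [reflexivity|].
(* Transposition keeps only the theory component, hence the unit is the identity; the inverse is the
   unique extension, and [syn_mor_eq] makes the two mutually inverse. *)
exists (fun T M H => mo_theory (proj1_sig H)),
  (fun T M F => syn_lift_mor (proj2_sig T) (proj1_sig M) F).
split; [|split; [|split]].
- intros T M H. apply syn_mor_eq. apply syn_lift_mor_theory.
- intros T M F. apply syn_lift_mor_theory.
- intros T T' M F H. simpl. rewrite syn_lift_mor_theory. reflexivity.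
- reflexivity.
Qed.
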